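(* Let $S$ be a (finite dimensional) complex manifold, and let $E, E'\to S$ be holomorphic Hilbert bundles endowed with hermitian metrics $h$, $h'$ of class $C^2$. Let $R$ and $R'$ denote the curvature operators of the Chern connections defined by $h$ and $h'$. Let $A:E\to E'$ be a holomorphic homomorphism, and let $\|A\|:S\to[0,\infty)$ denote its pointwise operator norm with respect to $h,h'$. Suppose $A$ decreases curvature, i.e. for all $s\in S$, $\xi\in T^{1,0}_sS$ and $v\in E_s$ such that $Av\neq 0$, $$\frac{h'\left(R'(\xi,\bar\xi)Av,Av\right)}{h'(Av,Av)}\le\frac{h\left(R(\xi,\bar\xi)v,v\right)}{h(v,v)}.$$ Then $\log\|A\|$ is plurisubharmonic on $S$, and hence satisfies the maximum principle.
   Context: A holomorphic Banach bundle over a complex manifold $S$ is a holomorphic map $\pi:E\to S$ from a complex Banach manifold $E$, with each fiber $E_s=\pi^{-1}\{s\}$ endowed with the structure of a complex vector space, such that each $s\in S$ has a neighborhood $U\subset S$, a complex Banach space $W$ and a biholomorphism $F:U\times W\to\pi^{-1}U$ (a local trivialization) mapping $\{t\}\times W$ linearly onto $E_t$ for $t\in U$. Smooth Banach bundles and smooth local trivializations are defined analogously, with diffeomorphisms; every holomorphic Banach bundle is a smooth one. It is a Hilbert bundle if the spaces $W$ are Hilbert spaces. A holomorphic homomorphism $A:E\to E'$ is a holomorphic map that maps each $E_s$ linearly (and continuously) into $E'_s$. A hermitian metric of class $C^k$ on a Hilbert bundle $E$ is a function $h:E\oplus E=\coprod_{s}E_s\oplus E_s\to\mathbb C$ such that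 for each local trivialization $F:U\times W\to\pi^{-1}U$ there is a $C^k$ map $P:U\to\mathrm{End}\,W$ (bounded operators with the operator norm), with values in positive invertible self adjoint operators, satisfying $h(F(s,w_1),F(s,w_2))=\langle P(s)w_1,w_2\rangle$, where $\langle\,,\rangle$ is the inner product of $W$. A connection $\nabla$ maps germs of $C^1$ sections of $E$ to germs of $E$-valued one forms so that in a local trivialization $F$, a section $\varphi(t)=F(t,f(t))$, with $f$ a $C^1$ map to $W$, satisfies $\nabla_\xi\varphi=F(s,\xi f+\theta(\xi)f)$ for $\xi\in\mathbb C\otimes T_sU$, with an $\mathrm{End}\,W$-valued one form $\theta$ on $U$. The Chern connection of $h$ is the unique connection that is compatible with the holomorphic structure (in holomorphic local trivializations $\theta$ is of type $(1,0)$) and with the metric: $\xi h(\varphi,\psi)=h(\nabla_\xi\varphi,\psi)+h(\varphi,\nabla_{\bar\xi}\psi)$ for $C^1$ sections $\varphi,\psi$. In a holomorphic local trivialization $\theta=P^{-1}\partial P$. For $\xi\in T^{1,0}_sS$ the curvature operator is $R(\xi,\bar\xi)=\nabla_\xi\nabla_{\bar\xi}-\nabla_{\bar\xi}\nabla_\xi$, computed by extending $\xi$ to a holomorphic vector field near $s$; it is independent of the extension and is a bounded linear operator on $E_s$. The pointwise operator norm is $\|A\|(s)=\inf\{a\in[0,\infty): h'(Av,Av)^{1/2}\le a\,h(v,v)^{1/2}\text{ for all }v\in E_s\}$. Conventions: $\log 0=-\infty$, and plurisubharmonic functions may take the value $-\infty$, possibly identically. The maximum principle for a function $u$ on $S$: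 if $U\subset S$ is a relatively compact subdomain (connected open subset) with $\partial U\ne\emptyset$ and $u\le c$ on $\partial U$ for a constant $c$, then $u\le c$ on $U$. *)

(* Defs.v *)
From HB Require Import structures.
From mathcomp Require Import all_boot all_order all_algebra.
From mathcomp Require Import sesquilinear complex.
From mathcomp Require Import all_classical all_reals all_analysis.
Set Implicit Arguments.
Unset Strict Implicit.
Unset Printing Implicit Defensive.
Import Order.TTheory GRing.Theory Num.Theory.
Import numFieldNormedType.Exports.
Local Open Scope classical_set_scope.
Local Open Scope ring_scope.
Local Open Scope complex_scope.

HB.instance Definition _ (R : realType) :=
  NormedModule.copy R[i] (R[i] : numFieldType)^o.

HB.instance Definition _ (K : numFieldType) (V W : completeNormedModType K) :=
  Pointed.on (V * W)%type.

Lemma prod_cauchy_cvg (K : numFieldType) (V W : completeNormedModType K)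
    (F : set_system (V * W)%type) : ProperFilter F -> cauchy F -> cvg F.
Proof.
move=> FF /cauchy_ballP Fc.
have cvg1 : cvg (fst @ F).
  apply: cauchy_cvg; apply/cauchy_ballP => e e0.
  have [[A B] [FA FB] AB] := Fc e e0.
  exists (fst @` A, fst @` B).
    split; rewrite /fmap /=.
      by apply: filterS FA => x Ax; exists x.
    by apply: filterS FB => x Bx; exists x.
  by move=> [_ _] [/= [a Aa <-] [b Bb <-]]; have /= [] := AB (a, b) (conj Aa Bb).
have cvg2 : cvg (snd @ F).
  apply: cauchy_cvg; apply/cauchy_ballP => e e0.
  have [[A B] [FA FB] AB] := Fc e e0.
  exists (snd @` A, snd @` B).
    split; rewrite /fmap /=.
      by apply: filterS FA => x Ax; exists x.
    by apply: filterS FB => x Bx; exists x.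
  by move=> [_ _] [/= [a Aa <-] [b Bb <-]]; have /= [] := AB (a, b) (conj Aa Bb).
apply/cvg_ex; exists (lim (fst @ F), lim (snd @ F)).
have FE : F = ((fun x => (x.1, x.2)) @ F).
  by apply/funext => A; rewrite /fmap/=; congr F; apply/funext => -[].
by rewrite FE; exact: (cvg_pair cvg1 cvg2).
Qed.

HB.instance Definition _ (K : numFieldType) (V W : completeNormedModType K) :=
  Uniform_isComplete.Build (V * W)%type (@prod_cauchy_cvg K V W).

Section bounded_operators.
Context (R : realType) (W : normedModType R[i]).

Definition bounded_op : {pred (W -> W)} :=
  fun f => `[< linear f /\ continuous f >].

Lemma bounded_op_submod : GRing.submod_closed bounded_op.
Proof.
split.
  rewrite unfold_in; apply/asboolP; split; last exact: cst_continuous.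
  by move=> a u v; rewrite -[LHS]/(0 : W) -[in RHS]/(a *: (0 : W) + 0) scaler0 addr0.
move=> a f g /asboolP[fl fc] /asboolP[gl gc].
rewrite unfold_in; apply/asboolP; split.
  move=> b u v.
  rewrite -[LHS]/(a *: f (b *: u + v) + g (b *: u + v)).
  rewrite -[RHS]/(b *: (a *: f u + g u) + (a *: f v + g v)).
  rewrite fl gl !scalerDr !scalerA mulrC -!addrA.
  by congr (_ + _); rewrite addrCA.
move=> x; apply: cvgD; last exact: gc.
by apply: cvgZr; exact: fc.
Qed.

HB.instance Definition _ :=
  GRing.isSubmodClosed.Build R[i] (W -> W) bounded_op bounded_op_submod.

(* End W, with the operator norm *)
Record Endo :=
  MkEndo { Endo_val :> W -> W; Endo_valP : Endo_val \in bounded_op }.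

HB.instance Definition _ := [isSub for Endo_val].
HB.instance Definition _ := [Choice of Endo by <:].
HB.instance Definition _ := [SubChoice_isSubLmodule of Endo by <:].

Lemma Endo_linear (P : Endo) : linear P.
Proof. by have /asboolP[] := Endo_valP P. Qed.

HB.instance Definition _ (P : Endo) :=
  GRing.isLinear.Build R[i] W W _ (Endo_val P) (Endo_linear P).

Lemma Endo_continuous (P : Endo) : continuous P.
Proof. by have /asboolP[] := Endo_valP P. Qed.

Implicit Types P Q : Endo.

Definition Endo_bounds (P : Endo) : set R :=
  [set a | 0 <= a /\ forall w, `|P w| <= a%:C * `|w|].

Definition Endo_norm (P : Endo) : R[i] := (inf (Endo_bounds P))%:C.

Lemma norm_real (w : W) : exists2 r : R, 0 <= r & `|w| = r%:C.
Proof.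
have /complex_realP[r rE] : `|w| \is Num.real by exact: normr_real.
by exists r => //; rewrite -ler0c -rE.
Qed.

Lemma Endo_bounds_has_inf P : has_inf (Endo_bounds P).
Proof.
split; last by exists 0 => a [].
have /continuous_linear_bounded/linear_boundedP := @Endo_continuous P 0.
move=> /pinfty_ex_gt0[M M0 PM].
have /complex_realP[r rE] : M \is Num.real by exact: gtr0_real.
exists r; split; first by rewrite -ler0c -rE ltW.
by move=> w; rewrite -rE; exact: PM.
Qed.

Lemma Endo_norm_ge0 P : 0 <= Endo_norm P.
Proof.
rewrite /Endo_norm ler0c; apply: lb_le_inf; first by have [] := Endo_bounds_has_inf P.
by move=> a [].
Qed.

Lemma Endo_normP P w : `|P w| <= Endo_norm P * `|w|.
Proof.
have [r r0 wE] := norm_real w; have [p p0 PwE] := norm_real (P w).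
rewrite wE PwE /Endo_norm -rmorphM/= lecR.
have [r_eq0|r_neq0] := eqVneq r 0.
  have w0 : w = 0 by apply: normr0_eq0; rewrite wE r_eq0.
  have Pw0 : P w = 0 by rewrite w0 linear0.
  move: PwE; rewrite Pw0 normr0 => /esym/complexI ->.
  by rewrite r_eq0 mulr0.
have rgt0 : 0 < r by rewrite lt_def r_neq0.
rewrite -ler_pdivrMr//; apply: lb_le_inf; first by have [] := Endo_bounds_has_inf P.
move=> a [a0 /(_ w)]; rewrite PwE wE -rmorphM/= lecR.
by rewrite ler_pdivrMr.
Qed.

Lemma Endo_norm_le P (a : R) : 0 <= a -> (forall w, `|P w| <= a%:C * `|w|) ->
  Endo_norm P <= a%:C.
Proof.
move=> a0 Pa; rewrite /Endo_norm lecR; apply: ge_inf.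
  by case: (Endo_bounds_has_inf P).
by split.
Qed.

Lemma Endo_norm_real P : exists2 r : R, 0 <= r & Endo_norm P = r%:C.
Proof. by exists (inf (Endo_bounds P)) => //; rewrite -ler0c Endo_norm_ge0. Qed.

Lemma Endo_normD P Q : Endo_norm (P + Q) <= Endo_norm P + Endo_norm Q.
Proof.
have [p p0 pE] := Endo_norm_real P; have [q q0 qE] := Endo_norm_real Q.
rewrite pE qE -rmorphD/=; apply: Endo_norm_le; first exact: addr_ge0.
move=> w; rewrite rmorphD/= mulrDl -pE -qE.
by apply: le_trans (ler_normD _ _) _; apply: lerD; exact: Endo_normP.
Qed.

Lemma Endo_normZ_le (l : R[i]) P : Endo_norm (l *: P) <= `|l| * Endo_norm P.
Proof.
have [p p0 pE] := Endo_norm_real P.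
have /complex_realP[k kE] : `|l| \is Num.real by exact: normr_real.
have k0 : 0 <= k by rewrite -ler0c -kE.
rewrite pE kE -rmorphM/=; apply: Endo_norm_le; first exact: mulr_ge0.
move=> w; rewrite rmorphM/= -pE -kE -mulrA.
rewrite [X in `|X|](_ : _ = l *: P w)// normrZ.
by apply: ler_wpM2l => //; exact: Endo_normP.
Qed.

Lemma Endo_normZ (l : R[i]) P : Endo_norm (l *: P) = `|l| * Endo_norm P.
Proof.
apply/eqP; rewrite eq_le Endo_normZ_le/=.
have [->|l0] := eqVneq l 0; first by rewrite normr0 mul0r Endo_norm_ge0.
rewrite -ler_pdivlMl ?normr_gt0// -normfV.
rewrite -[leLHS](_ : Endo_norm (l^-1 *: (l *: P)) = _) ?Endo_normZ_le//.
by rewrite scalerA mulVf// scale1r.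
Qed.

Lemma Endo_norm0_eq0 P : Endo_norm P = 0 -> P = 0.
Proof.
move=> P0; apply/val_inj/funext => w /=; apply: normr0_eq0.
by apply/eqP; rewrite eq_le normr_ge0 andbT; have := Endo_normP P w; rewrite P0 mul0r.
Qed.

HB.instance Definition _ :=
  Lmodule_isNormed.Build R[i] Endo Endo_normD Endo_normZ Endo_norm0_eq0.

End bounded_operators.

Section calculus.
Context (R : realType).
Local Notation C := R[i].

Section real_derivative.
Context (V W : normedModType C).
Implicit Types (f : V -> W) (v x : V).

Definition rquot f v x (t : R) : W := (t%:C)^-1 *: (f (x + t%:C *: v) - f x).

Definition rderivable f v x : Prop := cvg (rquot f v x @ (0 : R)^').

Definition rderive f v x : W := lim (rquot f v x @ (0 : R)^').

(* Real C^k regularity on an open set O, through iterated directional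
   derivatives; this is the usual notion when V is finite dimensional, the only
   case in which it is used. *)
Fixpoint Ck (k : nat) (O : set V) f : Prop :=
  (forall x, O x -> {for x, continuous f}) /\
  match k with
  | 0%N => True
  | k'.+1 => forall v,
      (forall x, O x -> rderivable f v x) /\ Ck k' O (rderive f v)
  end.

End real_derivative.

Definition finite_dim_space (V : normedModType C) : Prop :=
  exists n (b : 'I_n -> V), forall v, exists a : 'I_n -> C,
    v = \sum_i a i *: b i.

Record chart (M : topologicalType) := Chart {
  model : completeNormedModType C;
  cdom : set M;
  cmap : M -> model;
  cinv : model -> M;
  cdom_open : open cdom;
  crange_open : open (cmap @` cdom);
  cmapK : forall x, cdom x -> cinv (cmap x) = x;
  cmap_continuous : forall x, cdom x -> {for x, continuous cmap};
  cinv_continuous : forall y, (cmap @` cdom) y -> {for y, continuous cinv}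
}.

Arguments cinv {M} c _.

Definition crange (M : topologicalType) (c : chart M) : set (model c) :=
  cmap c @` cdom c.
Arguments crange {M} c _.

(* Complex Banach manifolds; each chart has its own model Banach space. The
   preferred chart chart_at s serves to represent tangent vectors at s. *)
Record manifold := Manifold {
  carrier :> topologicalType;
  manifold_hausdorff : hausdorff_space carrier;
  atlas : chart carrier -> Prop;
  chart_at : carrier -> chart carrier;
  chart_at_atlas : forall s, atlas (chart_at s);
  chart_at_dom : forall s, cdom (chart_at s) s;
  atlas_compat : forall c d, atlas c -> atlas d ->
    forall x, cdom c x -> cdom d x ->
    differentiable (cmap d \o cinv c) (cmap c x)
}.

Definition finite_dim (M : manifold) : Prop :=
  forall c, @atlas M c -> finite_dim_space (model c).

Definition holomorphic_on (M N : manifold) (D : set M) (f : M -> N) : Prop :=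
  forall x, D x -> {for x, continuous f} /\
    forall c d, atlas c -> atlas d -> cdom c x -> cdom d (f x) ->
    differentiable (cmap d \o f \o cinv c) (cmap c x).

Definition biholomorphic_on (M N : manifold) (D : set M) (D' : set N)
    (f : M -> N) : Prop :=
  holomorphic_on D f /\ (forall x, D x -> D' (f x)) /\
  exists g : N -> M,
    [/\ holomorphic_on D' g, forall y, D' y -> D (g y),
        forall x, D x -> g (f x) = x & forall y, D' y -> f (g y) = y].

Section product.
Context (M : manifold) (W : completeNormedModType C).

Lemma preimage_fst_open (T U : topologicalType) (A : set T) :
  open A -> open [set p : T * U | A p.1].
Proof.
move=> oA; apply: (@open_comp _ _ fst A) => // p _.
exact: cvg_fst.
Qed.

Section prod_chart.
Variable c : chart M.

Let pdom : set (M * W)%type := [set p | cdom c p.1].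
Let pmap (p : M * W) : model c * W := (cmap c p.1, p.2).
Let pinv (q : model c * W) : M * W := (cinv c q.1, q.2).

Lemma prod_rangeE : pmap @` pdom = [set q | crange c q.1].
Proof.
apply/seteqP; split => [_ [p pd <-]|[y w] /= [x xd <-]].
  by exists p.1.
by exists (x, w).
Qed.

Lemma prod_dom_open : open pdom.
Proof. by apply: preimage_fst_open; exact: cdom_open. Qed.

Lemma prod_range_open : open (pmap @` pdom).
Proof. by rewrite prod_rangeE; apply: preimage_fst_open; exact: crange_open. Qed.

Lemma prod_mapK p : pdom p -> pinv (pmap p) = p.
Proof. by case: p => x w xd; rewrite /pinv /pmap/= cmapK. Qed.

Lemma prod_map_continuous p : pdom p -> {for p, continuous pmap}.
Proof.
move=> pd; apply: cvg_pair; last exact: cvg_snd.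
by apply: continuous_comp; [exact: cvg_fst|exact: cmap_continuous].
Qed.

Lemma prod_inv_continuous q : (pmap @` pdom) q -> {for q, continuous pinv}.
Proof.
rewrite prod_rangeE => qd; apply: cvg_pair; last exact: cvg_snd.
by apply: continuous_comp; [exact: cvg_fst|exact: cinv_continuous].
Qed.

Definition prod_chart : chart (M * W)%type :=
  @Chart (M * W)%type (model c * W)%type pdom pmap pinv
    prod_dom_open prod_range_open prod_mapK
    prod_map_continuous prod_inv_continuous.

End prod_chart.

Definition prod_atlas (d : chart (M * W)%type) : Prop :=
  exists2 c, @atlas M c & d = prod_chart c.

Lemma prod_atlas_compat c d : prod_atlas c -> prod_atlas d ->
  forall x, cdom c x -> cdom d x ->
  differentiable (cmap d \o cinv c) (cmap c x).
Proof.
move=> [{}c ca ->] [{}d da ->] [x w] /= xc xd.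
have fd (V U : normedModType C) (p : V * U) : differentiable fst p.
  by apply: linear_differentiable => q; exact: cvg_fst.
have sd (V U : normedModType C) (p : V * U) : differentiable snd p.
  by apply: linear_differentiable => q; exact: cvg_snd.
apply: (@differentiable_pair _ _ _ _ ((cmap d \o cinv c) \o fst) snd) => //.
by apply: differentiable_comp => //; exact: atlas_compat.
Qed.

Lemma prod_hausdorff : hausdorff_space (M * W)%type.
Proof.
move=> [x v] [y w] xy; congr (_, _).
  apply: (@manifold_hausdorff M) => A B Ax By.
  have [||p [Ap Bp]] := xy [set p | A p.1] [set p | B p.1].
  - by apply: (@cvg_fst _ _ (nbhs x) (nbhs v)).
  - by apply: (@cvg_fst _ _ (nbhs y) (nbhs w)).
  by exists p.1.
apply: (@norm_hausdorff _ W) => A B Av Bw.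
have [||p [Ap Bp]] := xy [set p | A p.2] [set p | B p.2].
- by apply: (@cvg_snd _ _ (nbhs x) (nbhs v)).
- by apply: (@cvg_snd _ _ (nbhs y) (nbhs w)).
by exists p.2.
Qed.

Definition prod_manifold : manifold :=
  @Manifold (M * W)%type prod_hausdorff prod_atlas
    (fun p => prod_chart (chart_at p.1))
    (fun p => ex_intro2 _ _ (chart_at p.1) (chart_at_atlas p.1) erefl)
    (fun p => chart_at_dom p.1) prod_atlas_compat.

End product.

Section tangent.
Context (S : manifold).

(* T_s S, identified with the model space of the preferred chart at s. *)
Definition tangent (s : S) : completeNormedModType C := model (chart_at s).

(* The coordinates of a tangent vector in another chart. *)
Definition tcoord (c : chart S) (s : S) (X : tangent s) : model c :=
  'd (cmap c \o cinv (chart_at s)) (cmap (chart_at s) s) X.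

(* The pair (X, Y) stands for X + iY in the complexified tangent space. *)
Definition ctangent (s : S) : Type :=
  (tangent s * tangent s)%type.

Definition cconj (s : S) (xi : ctangent s) : ctangent s := (xi.1, - xi.2).

(* Multiplication by 'i in the model space is the complex structure J: the
   vectors of type (1,0) are X - iJX, those of type (0,1) are X + iJX. *)
Definition T10 (s : S) : set (ctangent s) :=
  [set xi | xi.2 = - ('i%C *: xi.1)].

Definition T01 (s : S) : set (ctangent s) :=
  [set xi | xi.2 = 'i%C *: xi.1].

Definition mderive (W : normedModType C) (f : S -> W) (s : S)
    (X : tangent s) : W :=
  rderive (f \o cinv (chart_at s)) X (cmap (chart_at s) s).

Definition cderive (W : normedModType C) (f : S -> W) (s : S)
    (xi : ctangent s) : W :=
  mderive f xi.1 + 'i%C *: mderive f xi.2.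

Definition mCk (k : nat) (W : normedModType C) (O : set S) (f : S -> W) :
    Prop :=
  forall c, atlas c -> Ck k (cmap c @` (O `&` cdom c)) (f \o cinv c).

Definition holomorphic_vector_field (O : set S)
    (xi : forall s, ctangent s) : Prop :=
  (forall s, O s -> T10 (xi s)) /\
  forall c, atlas c -> forall s, O s -> cdom c s ->
    differentiable (fun y => tcoord c (xi (cinv c y)).1) (cmap c s).

End tangent.

(* A map from a Banach manifold onto S with a vector space structure on its
   fibres: fib s is the fibre over s, embedded by pt s in the total space. *)
Record fibration (S : manifold) := Fibration {
  total_space : manifold;
  proj : total_space -> S;
  proj_holomorphic : holomorphic_on setT proj;
  fib : S -> lmodType C;
  pt : forall s, fib s -> total_space;
  vec : forall e : total_space, fib (proj e);
  proj_pt : forall s (v : fib s), proj (pt v) = s;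
  pt_inj : forall s, injective (@pt s);
  vecK : forall e, pt (vec e) = e
}.

Definition local_trivialization (S : manifold) (E : fibration S) (U : set S)
    (W : completeNormedModType C) (F : forall s, {linear W -> fib E s}) :
    Prop :=
  open U /\
  @biholomorphic_on (prod_manifold S W) (total_space E)
    [set p | U p.1] [set e | U (proj e)] (fun p => pt (F p.1 p.2)).

Record banach_bundle (S : manifold) := BanachBundle {
  bundle_fibration :> fibration S;
  locally_trivial : forall s : S, exists (U : set S)
    (W : completeNormedModType C)
    (F : forall s, {linear W -> fib bundle_fibration s}),
    U s /\ local_trivialization U F
}.

Record hilbert_space := HilbertSpace {
  hspace :> completeNormedModType C;
  inner : {dot hspace for @Num.conj C};
  inner_norm : forall w : hspace, `|w| ^+ 2 = inner w w
}.

Section bundle.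
Context (S : manifold) (E : banach_bundle S).

Definition hilbert_bundle : Prop :=
  forall s : S, exists (U : set S) (W : hilbert_space)
    (F : forall s, {linear W -> fib E s}),
    U s /\ local_trivialization U F.

Definition positive_invertible (W : hilbert_space) (P : Endo W) : Prop :=
  [/\ forall w, 0 <= inner W (P w) w,
      exists Q : Endo W, cancel P Q /\ cancel Q P
    & forall w1 w2, inner W (P w1) w2 = inner W w1 (P w2)].

Definition fiber_form := forall s, fib E s -> fib E s -> C.

Definition hermitian_metric (k : nat) (h : fiber_form) : Prop :=
  forall (U : set S) (W : hilbert_space) (F : forall s, {linear W -> fib E s}),
  local_trivialization U F ->
  exists P : S -> Endo W, mCk k U P /\
    forall s, U s -> positive_invertible (P s) /\
      forall w1 w2, h s (F s w1) (F s w2) = inner W (P s w1) w2.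

(* A section over O is a global family, of which only the values on O matter. *)
Definition bsection := forall s, fib E s.

Definition Ck_section (k : nat) (O : set S) (phi : bsection) : Prop :=
  forall s, O s -> exists (U : set S) (W : completeNormedModType C)
    (F : forall s, {linear W -> fib E s}) (f : S -> W),
    [/\ U s, local_trivialization U F, mCk k (U `&` O) f
      & forall t, U t -> O t -> phi t = F t (f t)].

(* nabla s xi phi is the derivative at s, along xi, of the germ of phi at s. *)
Definition section_derivative := forall s, ctangent s -> bsection -> fib E s.

(* The value of an Endo W-valued real one form at a complexified vector *)
Definition cform (W : completeNormedModType C)
    (theta : forall s : S, tangent s -> Endo W) (s : S)
    (xi : ctangent s) : Endo W :=
  theta s xi.1 + 'i%C *: theta s xi.2.

Definition connection_form (nabla : section_derivative) (U : set S)
    (W : completeNormedModType C) (F : forall s, {linear W -> fib E s})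
    (theta : forall s : S, tangent s -> Endo W) : Prop :=
  (forall s, U s -> forall (a : R) X Y,
     theta s (a%:C *: X + Y) = a%:C *: theta s X + theta s Y) /\
  forall (O : set S) (f : S -> W) (phi : bsection),
    open O -> O `<=` U -> mCk 1 O f ->
    (forall t, O t -> phi t = F t (f t)) ->
    forall s (xi : ctangent s), O s ->
      nabla s xi phi = F s (cderive f xi + cform theta xi (f s)).

Definition connection (nabla : section_derivative) : Prop :=
  forall (U : set S) (W : completeNormedModType C)
    (F : forall s, {linear W -> fib E s}),
  local_trivialization U F -> exists theta, connection_form nabla U F theta.

Definition holomorphic_compatible (nabla : section_derivative) : Prop :=
  forall (U : set S) (W : completeNormedModType C)
    (F : forall s, {linear W -> fib E s}) theta,
  local_trivialization U F -> connection_form nabla U F theta ->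
  forall s (xi : ctangent s), U s -> T01 xi -> cform theta xi = 0.

Definition metric_compatible (h : fiber_form) (nabla : section_derivative) :
    Prop :=
  forall (O : set S) (phi psi : bsection),
  open O -> Ck_section 1 O phi -> Ck_section 1 O psi ->
  forall s (xi : ctangent s), O s ->
    cderive (fun t => h t (phi t) (psi t)) xi =
    h s (nabla s xi phi) (psi s) + h s (phi s) (nabla s (cconj xi) psi).

Definition chern_connection (h : fiber_form) (nabla : section_derivative) :
    Prop :=
  [/\ connection nabla, holomorphic_compatible nabla
    & metric_compatible h nabla].

(* Rm s xi v stands for R(xi, conj xi) v, with xi of type (1,0). *)
Definition curvature_operator (nabla : section_derivative)
    (Rm : forall s, ctangent s -> fib E s -> fib E s) : Prop :=
  forall (O : set S) (xi : forall s : S, ctangent s) (phi : bsection),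
  open O -> holomorphic_vector_field O xi -> Ck_section 2 O phi ->
  forall s, O s ->
    Rm s (xi s) (phi s) =
      nabla s (xi s) (fun t => nabla t (cconj (xi t)) phi) -
      nabla s (cconj (xi s)) (fun t => nabla t (xi t) phi).

End bundle.

Section homomorphism.
Context (S : manifold) (E E' : banach_bundle S).
Variable A : forall s, {linear fib E s -> fib E' s}.

(* Continuity on the fibres follows from that on the total space. *)
Definition holomorphic_hom : Prop :=
  holomorphic_on setT
    (fun e : total_space E => pt (A (proj e) (vec e)) : total_space E').

Definition hnorm (B : banach_bundle S) (h : fiber_form B) (s : S)
    (v : fib B s) : R :=
  Num.sqrt (complex.Re (h s v v)).

Definition pointwise_norm (h : fiber_form E) (h' : fiber_form E') (s : S) : R :=
  inf [set a | 0 <= a /\ forall v, hnorm h' (A s v) <= a * hnorm h v].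

(* The inequality is that of R[i]; both of its sides are real, the operators
   R(xi, conj xi) being self adjoint. *)
Definition decreases_curvature (h : fiber_form E) (h' : fiber_form E')
    (Rm : forall s, ctangent s -> fib E s -> fib E s)
    (Rm' : forall s, ctangent s -> fib E' s -> fib E' s) : Prop :=
  forall s (xi : ctangent s) v, T10 xi -> A s v != 0 ->
    h' s (Rm' s xi (A s v)) (A s v) / h' s (A s v) (A s v) <=
    h s (Rm s xi v) v / h s v v.

End homomorphism.

Local Open Scope ereal_scope.

Definition usc_on (T : topologicalType) (O : set T) (u : T -> \bar R) : Prop :=
  forall x, O x -> forall a : R, u x < a%:E -> \forall y \near x, u y < a%:E.

Definition circle_mean (u : C -> \bar R) (a : C) (r : R) : \bar R :=
  ((2 * pi)^-1)%:E *
  \int[lebesgue_measure]_(t in `[0%R, (2 * pi)%R])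
    u (a + r%:C * (cos t +i* sin t)%C)%R.

Definition subharmonic_on (O : set C) (u : C -> \bar R) : Prop :=
  [/\ forall z, O z -> u z < +oo, usc_on O u
    & forall (a : C) (r : R), (0 < r)%R ->
      (forall z : C, (`|z - a| <= r%:C)%R -> O z) -> u a <= circle_mean u a r].

Definition plurisubharmonic (S : manifold) (u : S -> \bar R) : Prop :=
  [/\ forall s, u s < +oo, usc_on setT u
    & forall c, atlas c -> forall a b : model c,
      subharmonic_on [set z | crange c (a + z *: b)%R]
        (fun z => u (cinv c (a + z *: b)%R))].

Definition maximum_principle (S : manifold) (u : S -> \bar R) : Prop :=
  forall U : set S, open U -> connected U -> precompact U ->
  closure U `\` U !=set0 ->
  forall a : \bar R, (forall s, (closure U `\` U) s -> u s <= a) ->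
  forall s, U s -> u s <= a.

End calculus.

(* Main.v *)
Require Import Defs.
From HB Require Import structures.
From mathcomp Require Import all_boot all_order all_algebra.
From mathcomp Require Import sesquilinear complex.
From mathcomp Require Import all_classical all_reals all_analysis measurable_realfun.
From mathcomp Require Import ring lra.

(** The logarithm of a continuous function [rho >= 0] is plurisubharmonic as
    soon as, at every point [p] of a chart where [rho p > 0] and for every
    direction [b], the sum of [ln rho] over the points [p + t b], [p - t b],
    [p + i t b], [p - i t b] is at least [4 ln (rho p)] up to a small multiple
    of [t ^+ 2]. Indeed such an inequality passes to truncations from below
    and to averages over rotations, it excludes interior maxima once a small
    multiple of the square of the norm is added, and thereby it yields the
    submean value inequality on circles ([circle_submean],
    [log_plurisubharmonic]); the case of equality in the latter gives the
    maximum principle ([log_maximum_principle]).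

    It remains to prove this four point inequality for the pointwise norm of
    [A]. In a chart and in trivializations, [A] is a holomorphic family [a] of
    operators between two Hilbert spaces, and the metrics are families [P] and
    [P'] of positive operators ([norm_family_at]). Take a vector [w] at which
    the norm of [a p] is nearly attained, and [x = a p w]. For suitable
    vectors [v] and [y] put
      [f z = <a (p + z b) (w + z v), P' (p) (x + z^* y)>].
    By duality the square of the modulus of [f] is at most [rho ^+ 2] times
    the square norm of [w + z v] for [P (p + z b)] times that of
    [P' (p) (x + z^* y)] for the inverse of [P' (p + z b)]. This bounds the
    logarithm of [rho] from below. The function [f] is holomorphic, so the
    product of its values at the four points is [f 0 ^+ 4] up to third order
    ([four_product]). The vectors [v] and [y] are chosen to solve linear
    equations in the first derivatives of [P] and [P'], which makes the second
    order terms of the sums of the square norms equal to the curvature of [E]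
    at [w] and to minus the curvature of [E'] at [x] ([qf_four],
    [qf_inverse_four], [curvature_formula]). Relative to the square norms of
    [w] and [x], the hypothesis on [A] says exactly that together these terms
    have the right sign ([log_comparison], [norm_four_points]).

    The third order estimate for [f] and the differentiability of changes of
    coordinates rest on Cauchy estimates for functions that are only assumed
    to be complex differentiable. They are obtained from local primitives,
    which exist by Goursat's bisection, and from the maximum principle: the
    primitive has a second order expansion everywhere, so the four point
    inequality holds for the real parts of its difference quotients
    ([disc_primitive], [taylor2_maximum], [holomorphic_estimates]). *)

Set Implicit Arguments.
Unset Strict Implicit.
Unset Printing Implicit Defensive.
Import Order.TTheory GRing.Theory Num.Theory.
Import numFieldNormedType.Exports.
Local Open Scope classical_set_scope.
Local Open Scope ring_scope.
Local Open Scope complex_scope.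

(** * Tactics for linear identities and inequalities *)

Section module_identities.
Context {K : comNzRingType} {V : lmodType K}.

Inductive mexp :=
| MVar of nat | MZero | MAdd of mexp & mexp | MOpp of mexp | MScale of K & mexp.

Fixpoint meval (env : seq V) e := match e with
  | MVar i => nth 0 env i
  | MZero => 0
  | MAdd a b => meval env a + meval env b
  | MOpp a => - meval env a
  | MScale c a => c *: meval env a
  end.

Fixpoint mcoef e (i : nat) : K := match e with
  | MVar j => if Nat.eqb i j then 1 else 0
  | MZero => 0
  | MAdd a b => mcoef a i + mcoef b i
  | MOpp a => - mcoef a i
  | MScale c a => c * mcoef a i
  end.

Lemma meval_sum env e :
  meval env e = \sum_(i < size env) mcoef e i *: nth 0 env i.
Proof.
elim: e => [j||a IHa b IHb|a IHa|c a IHa] /=; rewrite ?IHa ?IHb.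
- have [jn|jn] := ltnP j (size env); last first.
    rewrite nth_default// big1// => i _.
    case: (PeanoNat.Nat.eqb_spec i j) => [ij|]; last by rewrite scale0r.
    by move: (ltn_ord i); rewrite ij ltnNge jn.
  rewrite (bigD1 (Ordinal jn))//= PeanoNat.Nat.eqb_refl scale1r big1 ?addr0//.
  move=> i ij; case: (PeanoNat.Nat.eqb_spec i j) => [ji|]; last by rewrite scale0r.
  by case/eqP: ij; apply: val_inj.
- by rewrite big1// => i _; rewrite scale0r.
- by rewrite -big_split/=; apply: eq_bigr => i _; rewrite scalerDl.
- by rewrite -sumrN; apply: eq_bigr => i _; rewrite scaleNr.
- by rewrite scaler_sumr; apply: eq_bigr => i _; rewrite scalerA.
Qed.

Fixpoint same_coefs e1 e2 n := match n with
  | 0%N => True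
  | n'.+1 => mcoef e1 n' = mcoef e2 n' /\ same_coefs e1 e2 n'
  end.

Lemma meval_eq env e1 e2 :
  same_coefs e1 e2 (size env) -> meval env e1 = meval env e2.
Proof.
move=> same; rewrite !meval_sum; apply: eq_bigr => -[i /= im] _; congr (_ *: _).
elim: (size env) same im => [//|n IH] /= [en same].
by rewrite ltnS leq_eqVlt => /predU1P[->//|]; exact: IH.
Qed.
End module_identities.

Ltac mindex x l := lazymatch l with
  | x :: _ => constr:(0%N)
  | _ :: ?l' => let i := mindex x l' in constr:(S i)
  end.
Ltac madd x l := match l with
  | context [x :: _] => l
  | _ => constr:(x :: l)
  end.
Ltac matoms t l := lazymatch t with
  | (?a + ?b)%R => let l' := matoms a l in matoms b l'
  | (- ?a)%R => matoms a l
  | (_ *: ?a)%R => matoms a l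
  | 0%R => l
  | ?x => madd x l
  end.
Ltac mreify K t l := lazymatch t with
  | (?a + ?b)%R => let a' := mreify K a l in let b' := mreify K b l in
      constr:(@MAdd K a' b')
  | (- ?a)%R => let a' := mreify K a l in constr:(@MOpp K a')
  | (?c *: ?a)%R => let a' := mreify K a l in constr:(@MScale K c a')
  | 0%R => constr:(@MZero K)
  | ?x => let i := mindex x l in constr:(@MVar K i)
  end.
(** Closes an equation between linear combinations, its scalar identities
    being left to [ring]. *)
Ltac lmod_over K := lazymatch goal with |- @eq ?V ?s ?t =>
  let l0 := constr:(@nil V) in let l1 := matoms s l0 in let l := matoms t l1 in
  let e1 := mreify K s l in let e2 := mreify K t l in
  apply: (@meval_eq K _ l e1 e2); cbn [same_coefs mcoef size Nat.eqb];
  repeat split; ring end.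
(** [lra] on the comparisons of the context alone: sifting a large context is
    what costs it most. *)
Ltac flra := repeat match goal with
  | x := _ |- _ => clearbody x
  end; repeat match goal with
  | H : ?P |- _ => lazymatch type of P with
    | Prop => lazymatch P with
      | is_true _ => fail
      | _ = _ => fail
      | _ /\ _ => fail
      | _ => clear H
      end
    end
  end; lra.
(** * Real-valued norms and derivatives along the real line *)

Section real_norm.
Context {R : realType}.
Local Notation C := R[i].

(** The norm of a space over [R[i]] has its values in [R[i]]; [rn] is the same
    norm as a real number. *)
Definition rn (W : normedModType C) (w : W) : R := complex.Re `|w|.

Section rn_theory.
Context {W : normedModType C}.
Implicit Types (v w : W) (c : C) (t : R).

Lemma rnE w : `|w| = (rn w)%:C.
Proof. by have [r _ wE] := norm_real w; rewrite /rn wE. Qed.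

Lemma rn_ge0 w : 0 <= rn w.
Proof. by rewrite -ler0c -rnE. Qed.

Lemma rn_le w t : (rn w <= t) = (`|w| <= t%:C).
Proof. by rewrite rnE lecR. Qed.

Lemma rn0 : rn (0 : W) = 0.
Proof. by rewrite /rn normr0. Qed.

Lemma rn_eq0 w : (rn w == 0) = (w == 0).
Proof.
apply/eqP/eqP => [w0|->]; last exact: rn0.
by apply: normr0_eq0; rewrite rnE w0.
Qed.

Lemma rn_gt0 w : (0 < rn w) = (w != 0).
Proof. by rewrite lt_def rn_ge0 andbT rn_eq0. Qed.

Lemma rnN w : rn (- w) = rn w.
Proof. by rewrite /rn normrN. Qed.

Lemma rnBC v w : rn (v - w) = rn (w - v).
Proof. by rewrite -rnN opprB. Qed.

Lemma rnD v w : rn (v + w) <= rn v + rn w.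
Proof. by rewrite rn_le rmorphD/= -!rnE ler_normD. Qed.

Lemma rnB v w : rn (v - w) <= rn v + rn w.
Proof. by rewrite -(rnN w) rnD. Qed.

Lemma rnZ c w : rn (c *: w) = rn (c : C) * rn w.
Proof. by apply: complexI; rewrite rmorphM/= -!rnE normrZ. Qed.

Lemma ler_rnB v w : rn v - rn w <= rn (v - w).
Proof. by have := rnD (v - w) w; rewrite subrK; flra. Qed.

End rn_theory.

Lemma rnM (c d : C) : rn (c * d) = rn c * rn d.
Proof. exact: rnZ. Qed.

Lemma rnR (t : R) : rn t%:C = `|t|.
Proof. by apply: complexI; rewrite -rnE normc_def/= expr0n addr0 sqrtr_sqr. Qed.

Lemma rn1 : rn (1 : C) = 1.
Proof. by rewrite (rnR 1) normr1. Qed.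

Lemma rni : rn ('i%C : C) = 1.
Proof. by apply: complexI; rewrite -rnE normc_def/= expr0n add0r expr1n sqrtr1. Qed.

Lemma rnX (c : C) n : rn (c ^+ n) = rn c ^+ n.
Proof. by elim: n => [|n IH]; rewrite ?expr0 ?rn1// !exprS rnM IH. Qed.

Lemma rnV (c : C) : rn c^-1 = (rn c)^-1.
Proof. by apply: complexI; rewrite -rnE normfV rnE -fmorphV. Qed.

Lemma rn_sqr (c : C) : rn c ^+ 2 = complex.Re c ^+ 2 + complex.Im c ^+ 2.
Proof. by apply: complexI; rewrite rmorphXn/= -rnE -add_Re2_Im2. Qed.

Lemma normr_Re (c : C) : `|complex.Re c| <= rn c.
Proof.
rewrite -ler_sqr ?nnegrE ?rn_ge0// rn_sqr real_normK ?num_real//.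
by rewrite lerDl sqr_ge0.
Qed.

Lemma normr_Im (c : C) : `|complex.Im c| <= rn c.
Proof.
rewrite -ler_sqr ?nnegrE ?rn_ge0// rn_sqr real_normK ?num_real//.
by rewrite lerDr sqr_ge0.
Qed.

Lemma rn_ReIm (c : C) : rn c <= `|complex.Re c| + `|complex.Im c|.
Proof.
rewrite -ler_sqr ?nnegrE ?rn_ge0 ?addr_ge0// rn_sqr sqrrD !real_normK ?num_real//.
have := mulr_ge0 (normr_ge0 (complex.Re c)) (normr_ge0 (complex.Im c)); flra.
Qed.

Lemma nbhs_rnP {V : normedModType C} (x : V) (A : set V) :
  nbhs x A <-> exists2 d : R, 0 < d & forall y, rn (y - x) < d -> A y.
Proof.
split=> [/nbhs_ballP[e /= e0 eA]|[d d0 dA]].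
  have /complex_realP[d dE] : e \is Num.real by exact: gtr0_real.
  exists d => [|y yd]; first by rewrite -ltcR -dE.
  by apply: eA; rewrite -ball_normE /= distrC rnE dE ltcR.
apply/nbhs_ballP; exists d%:C => /=; first by rewrite ltcR.
by move=> y; rewrite -ball_normE /= distrC rnE ltcR; exact: dA.
Qed.

Lemma cvg_rnP {W : normedModType C} (T : Type) (F : set_system T) (FF : Filter F) (f : T -> W) l :
  f @ F --> l <-> forall e : R, 0 < e -> \forall t \near F, rn (f t - l) < e.
Proof.
split=> [fl e e0|fl A /nbhs_rnP[d d0 dA]].
  have : nbhs l [set y | rn (y - l) < e] by apply/nbhs_rnP; exists e.
  by move/fl.
by apply: filterS (fl d d0) => t; exact: dA.
Qed.

Lemma continuous_rnP {V W : normedModType C} (f : V -> W) x : {for x, continuous f} <->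
  forall e : R, 0 < e ->
    exists2 d : R, 0 < d & forall y, rn (y - x) < d -> rn (f y - f x) < e.
Proof.
split=> [/cvg_rnP fx e /fx/nbhs_rnP//|fx].
by apply/cvg_rnP => e /fx e0; apply/nbhs_rnP.
Qed.

End real_norm.

Section real_variable.
Context {R : realType} {W : normedModType R[i]}.
Implicit Types (f g : R -> W) (x t : R) (l : W).

(** The values lie in a space over [R[i]], so the difference quotients are
    formed with the image of the real increment in [R[i]]. *)
Definition isrd f x l := forall e : R, 0 < e -> exists2 d : R, 0 < d &
  forall t, `|t| < d -> rn (f (x + t) - f x - t%:C *: l) <= e * `|t|.

Lemma mean_value_le f (df : R -> W) (a b B : R) : a <= b ->
  (forall x, a <= x <= b -> isrd f x (df x)) ->
  (forall x, a <= x <= b -> rn (df x) <= B) ->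
  rn (f b - f a) <= B * (b - a).
Proof.
move=> ab fd fB.
have B0 : 0 <= B by apply: le_trans (fB a _); rewrite ?rn_ge0 ?lexx.
suff main (e : R) : 0 < e -> rn (f b - f a) <= (B + e) * (b - a).
  apply/ler_addgt0Pr => e e0.
  have p1 : 0 < b - a + 1 by flra.
  have := main _ (divr_gt0 e0 p1); rewrite mulrDl => /le_trans; apply.
  rewrite lerD2l mulrAC ler_pdivrMr//; apply: ler_wpM2l; flra.
move=> e0.
have step x : a <= x <= b -> exists2 d : R, 0 < d &
    forall t, `|t| < d -> rn (f (x + t) - f x) <= (B + e) * `|t|.
  move=> xab; have [d d0 dP] := fd x xab e e0; exists d => // t /dP td.
  have := rnD (f (x + t) - f x - t%:C *: df x) (t%:C *: df x).
  rewrite subrK => /le_trans; apply; rewrite rnZ rnR mulrDl addrC.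
  by apply: lerD => //; rewrite mulrC; apply: ler_wpM2r => //; exact: fB.
pose E := [set t | a <= t <= b /\
  forall s, a <= s <= t -> rn (f s - f a) <= (B + e) * (s - a)].
have Ea : E a.
  split; first by rewrite lexx.
  by move=> s; rewrite -eq_le => /eqP <-; rewrite !subrr rn0 mulr0.
have supE : has_sup E by split; [exists a|exists b => t [/andP[]]].
set c := sup E.
have ac : a <= c by apply: ub_le_sup => //; case: supE.
have cb : c <= b by apply: ge_sup => [|t [/andP[]]//]; exists a.
have cab : a <= c <= b by rewrite ac.
have [d d0 dP] := step c cab.
have Ec s : a <= s < c -> rn (f s - f a) <= (B + e) * (s - a).
  move=> /andP[as_ sc]; have cs : 0 < c - s by rewrite subr_gt0.
  have [t Et] := sup_adherent cs supE; rewrite -/c opprB addrCA subrr addr0 => st.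
  by case: Et => _; apply; rewrite as_ ltW.
have fc : rn (f c - f a) <= (B + e) * (c - a).
  have [<-|ca] := eqVneq a c; first by rewrite !subrr rn0 mulr0.
  have {}ca : a < c by rewrite lt_neqAle ca.
  pose s := Num.max a (c - d / 2).
  have sc : s < c by rewrite gt_max ca/=; flra.
  have as_ : a <= s by rewrite le_max lexx.
  have sd : c - s < d.
    have : c - d / 2 <= s by rewrite le_max lexx orbT.
    flra.
  have := dP (s - c); rewrite ltr0_norm ?subr_lt0// opprB sd => /(_ isT).
  rewrite addrCA subrr addr0 rnBC => h1.
  have h2 := Ec s; rewrite as_ sc in h2; have {}h2 := h2 isT.
  have := rnD (f c - f s) (f s - f a); rewrite addrA subrK => /le_trans; apply.
  apply: le_trans (lerD h1 h2) _; rewrite -mulrDr.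
  by rewrite addrA subrK.
have [<-//|cb'] := eqVneq c b.
have {}cb' : c < b by rewrite lt_neqAle cb'.
pose t := Num.min b (c + d / 2).
have ct : c < t by rewrite lt_min cb'/=; flra.
have tb : t <= b by rewrite ge_min lexx.
have td : t <= c + d / 2 by rewrite ge_min lexx orbT.
have : E t.
  split; first by rewrite tb andbT; flra.
  move=> s /andP[as_ st]; have [sc|cs] := leP s c.
    by move: sc; rewrite le_eqVlt => /orP[/eqP->//|sc]; apply: Ec; rewrite as_.
  have := dP (s - c); rewrite gtr0_norm ?subr_gt0//.
  have -> : s - c < d by flra.
  move=> /(_ isT); rewrite addrCA subrr addr0 => h.
  have := rnD (f s - f c) (f c - f a); rewrite addrA subrK => /le_trans; apply.
  apply: le_trans (lerD h fc) _; rewrite -mulrDr.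
  by rewrite addrA subrK.
move=> Et; have : t <= c by apply: ub_le_sup => //; case: supE.
flra.
Qed.

Lemma isrdD f g x l m : isrd f x l -> isrd g x m -> isrd (fun t => f t + g t) x (l + m).
Proof.
move=> fl gm e e0; have e2 : 0 < e / 2 by flra.
have [d d0 dP] := fl _ e2; have [d' d'0 d'P] := gm _ e2.
exists (Num.min d d'); first by rewrite lt_min d0.
move=> t; rewrite lt_min => /andP[/dP t1 /d'P t2].
have := rnD (f (x + t) - f x - t%:C *: l) (g (x + t) - g x - t%:C *: m).
rewrite [X in rn X <= _ -> _](_ : _ = f (x + t) + g (x + t) - (f x + g x) - t%:C *: (l + m)); last by lmod_over R[i].
flra.
Qed.

Lemma isrdZ c f x l : isrd f x l -> isrd (fun t => c *: f t) x (c *: l).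
Proof.
move=> fl e e0; have c1 : 0 < rn (c : R[i]) + 1 by have := rn_ge0 (c : R[i]); flra.
have [d d0 dP] := fl _ (divr_gt0 e0 c1); exists d => // t /dP td.
rewrite (_ : _ - _ = c *: (f (x + t) - f x - t%:C *: l)); last by lmod_over R[i].
rewrite rnZ; apply: le_trans (_ : (rn (c : R[i]) + 1) * (e / (rn (c : R[i]) + 1) * `|t|) <= _).
  apply: ler_pM; rewrite ?rn_ge0//; flra.
by rewrite !mulrA [_ * e]mulrC mulfK ?gt_eqF.
Qed.

Lemma isrd_cst x l : isrd (fun=> l) x 0.
Proof.
move=> e e0; exists 1 => // t _; rewrite subrr scaler0 subrr rn0.
by rewrite mulr_ge0// ltW.
Qed.

Lemma isrd_scale x l : isrd (fun t => t%:C *: l) x l.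
Proof.
move=> e e0; exists 1 => // t _; rewrite rmorphD/=.
rewrite (_ : _ - _ = 0); last by lmod_over R[i].
by rewrite rn0 mulr_ge0// ltW.
Qed.

Lemma isrd_sqr x l : isrd (fun t => ((t ^+ 2)%:C) *: l) x (((2 * x)%:C) *: l).
Proof.
move=> e e0; have l1 : 0 < rn l + 1 by have := rn_ge0 l; flra.
exists (e / (rn l + 1)); first exact: divr_gt0.
move=> t td; rewrite !(rmorphXn, rmorphD, rmorphM)/=.
rewrite (_ : _ - _ = (t%:C ^+ 2) *: l); last by lmod_over R[i].
rewrite rnZ rnX rnR expr2 mulrAC; apply: ler_wpM2r => //.
move: td; rewrite ltr_pdivlMr// => /ltW; apply: le_trans.
by apply: ler_wpM2l => //; flra.
Qed.

Lemma isrd_eq f g x l : (forall t, f t = g t) -> isrd f x l -> isrd g x l.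
Proof. by move=> /funext->. Qed.

End real_variable.

(** * Goursat's theorem and local primitives *)

Section primitives.
Context {R : realType}.
Local Notation C := R[i].

Lemma is_derive_le (f : R -> R) (x l : R) : is_derive x 1 f l ->
  forall e : R, 0 < e -> exists2 d : R, 0 < d &
    forall t, `|t| < d -> `|f (x + t) - f x - t * l| <= e * `|t|.
Proof.
move=> [fd fl] e e0.
have : (fun h => h^-1 *: (f (h *: (1 : R) + x) - f x)) @ 0^' --> l.
  by rewrite -fl; exact: fd.
move=> /cvgrPdist_le /(_ e e0); rewrite near_withinE => /nbhs_ballP[d /= d0 dP].
exists d => // t td; have [->|t0] := eqVneq t 0.
  by rewrite addr0 subrr mul0r subrr normr0 mulr0.
have := dP t; rewrite /ball/= sub0r normrN => /(_ td t0).
rewrite distrC => h.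
have -> : f (x + t) - f x - t * l = (t^-1 *: (f (t *: (1 : R) + x) - f x) - l) * t.
  rewrite mulrBl /GRing.scale/= mulr1 [t + x]addrC [t^-1 * _]mulrC mulfVK//.
  by rewrite [l * t]mulrC.
by rewrite normrM; exact: ler_wpM2r.
Qed.

Lemma continuous_primitive (k : R -> R) (B : R) : continuous k ->
  exists K : R -> R, forall x : R, `|x| < B -> is_derive x 1 K (k x).
Proof.
move=> kc.
pose F x := \int[lebesgue_measure]_(t in `[- B - 1, x]) k t.
exists F => x xB.
have [xl xr] : - B < x /\ x < B by apply/andP; rewrite -ltr_norml.
have ki : lebesgue_measure.-integrable `[- B - 1, B + 1] (EFin \o k).
  apply: continuous_compact_integrable; first exact: segment_compact.
  by apply: continuous_subspaceT => ?; exact: kc.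
have x1 : x < B + 1 by flra.
have x2 : - B - 1 < x by flra.
have [d1 d2] : derivable F x 1 /\ F^`()%classic x = k x.
  exact: (continuous_FTC1_closed x1 ki x2 (kc x)).
split; first exact: d1.
by rewrite -d2 derive1E.
Qed.

Definition contRC (k : R -> C) x := forall e : R, 0 < e ->
  exists2 d : R, 0 < d & forall t, `|t| < d -> rn (k (x + t) - k x) < e.

Lemma ReB (a b : C) : complex.Re (a - b) = complex.Re a - complex.Re b.
Proof. by case: a; case: b. Qed.
Lemma ImB (a b : C) : complex.Im (a - b) = complex.Im a - complex.Im b.
Proof. by case: a; case: b. Qed.
Lemma ReRM (a : R) (b : C) : complex.Re (a%:C * b) = a * complex.Re b.
Proof. by case: b => c d /=; rewrite mul0r subr0. Qed.
Lemma ImRM (a : R) (b : C) : complex.Im (a%:C * b) = a * complex.Im b.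
Proof. by case: b => c d /=; rewrite mul0r addr0. Qed.

(** The real and the imaginary part have primitives, by the fundamental
    theorem of calculus. *)
Lemma complex_primitive (k : R -> C) (B : R) : (forall x, contRC k x) ->
  exists K : R -> C, forall x, `|x| < B -> isrd K x (k x).
Proof.
move=> kc.
have kRe : continuous (fun x => complex.Re (k x)).
  move=> x; apply/cvgrPdist_lt => e /(kc x)[d d0 dP].
  apply/nbhs_ballP; exists d => //= y; rewrite /ball/= distrC => /dP.
  rewrite addrCA subrr addr0; apply: le_lt_trans.
  by rewrite -ReB rnBC; exact: normr_Re.
have kIm : continuous (fun x => complex.Im (k x)).
  move=> x; apply/cvgrPdist_lt => e /(kc x)[d d0 dP].
  apply/nbhs_ballP; exists d => //= y; rewrite /ball/= distrC => /dP.
  rewrite addrCA subrr addr0; apply: le_lt_trans.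
  by rewrite -ImB rnBC; exact: normr_Im.
have [K1 K1P] := continuous_primitive B kRe.
have [K2 K2P] := continuous_primitive B kIm.
exists (fun x => (K1 x +i* K2 x)%C) => x xB e e0.
have e2 : 0 < e / 2 by flra.
have [d1 d10 d1P] := is_derive_le (K1P x xB) e2.
have [d2 d20 d2P] := is_derive_le (K2P x xB) e2.
exists (Num.min d1 d2); first by rewrite lt_min d10.
move=> t; rewrite lt_min => /andP[/d1P h1 /d2P h2].
apply: le_trans (rn_ReIm _) _.
rewrite !ReB !ImB [_ *: _](_ : _ = t%:C * k x)// ReRM ImRM/=.
move: h1 h2 => /=; flra.
Qed.

End primitives.

Section mean_value_sym.
Context {R : realType} {W : normedModType R[i]}.
Lemma mean_value_sym (f df : R -> W) (x y B : R) :
  (forall t, Num.min x y <= t <= Num.max x y -> isrd f t (df t)) ->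
  (forall t, Num.min x y <= t <= Num.max x y -> rn (df t) <= B) ->
  rn (f y - f x) <= B * `|y - x|.
Proof.
move=> fd fB; have [xy|/ltW yx] := leP x y.
  rewrite ger0_norm ?subr_ge0//; apply: (@mean_value_le _ _ f df) => // t txy.
    by apply: fd; rewrite min_l ?max_r.
  by apply: fB; rewrite min_l ?max_r.
rewrite rnBC distrC ger0_norm ?subr_ge0//.
apply: (@mean_value_le _ _ f df) => // t txy.
  by apply: fd; rewrite min_r ?max_l.
by apply: fB; rewrite min_r ?max_l.
Qed.
End mean_value_sym.

Section goursat.
Context {R : realType}.
Local Notation C := R[i].

Definition cderivative (f : C -> C) z l := forall e : R, 0 < e ->
  exists2 d : R, 0 < d &
    forall h, rn h < d -> rn (f (z + h) - f z - l * h) <= e * rn h.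

Definition cpt (x y : R) : C := (x +i* y)%C.

Lemma cptE x y : cpt x y = x%:C + 'i%C * y%:C.
Proof. exact: (complexE (cpt x y)). Qed.

Lemma cpt_Re_Im (z : C) : cpt (complex.Re z) (complex.Im z) = z.
Proof. by case: z. Qed.

Lemma rn_cpt x y : rn (cpt x y) <= `|x| + `|y|.
Proof. exact: rn_ReIm. Qed.

Lemma cptB x y x' y' : cpt x y - cpt x' y' = cpt (x - x') (y - y').
Proof. by []. Qed.

Variables (f : C -> C) (B r : R) (Phi Psi : R -> R -> C).
Hypothesis fc : forall z, {for z, continuous f}.
Hypothesis rB : r <= B.
Hypothesis PhiP : forall c x, `|x| < B -> isrd (Phi c) x (f (cpt x c)).
Hypothesis PsiP : forall b y, `|y| < B -> isrd (Psi b) y (f (cpt b y)).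
Hypothesis fd : forall x y, `|x| < r -> `|y| < r -> exists l, cderivative f (cpt x y) l.

(** The integral of [f] along the boundary of the rectangle with sides [[a,
    b]] and [[c, d]]: [Phi] and [Psi] are primitives of [f] on the horizontal
    and on the vertical lines. *)
Let mu a b c d : C := (Phi c b - Phi c a) + 'i%C * (Psi b d - Psi b c)
  - (Phi d b - Phi d a) - 'i%C * (Psi a d - Psi a c).

(** An affine function has a primitive on the plane, so its integral along the
    boundary vanishes and only the difference of [f] from it contributes. *)
Lemma mu_estimate (a b c d eta : R) (z0 al la : C) : a <= b -> c <= d ->
  - B < a -> b < B -> - B < c -> d < B ->
  (forall x y, a <= x <= b -> c <= y <= d ->
     rn (f (cpt x y) - (al + la * (cpt x y - z0))) <= eta) ->
  rn (mu a b c d) <= 2 * eta * ((b - a) + (d - c)).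
Proof.
move=> ab cd aB bB cB dB fe.
pose A z := al * z + la / 2 * (z - z0) ^+ 2.
have dA (p u : C) x :
    isrd (fun t => A (p + t%:C * u)) x ((al + la * (p + x%:C * u - z0)) * u).
  apply: (@isrd_eq _ _ (fun t => (t ^+ 2)%:C *: (la / 2 * u ^+ 2 : C) +
      (t%:C *: (al * u + la * (p - z0) * u : C) + A p))).
    move=> t; rewrite /A /GRing.scale/= rmorphXn/=.
    by field.
  rewrite [X in isrd _ _ X](_ : _ = (2 * x)%:C *: (la / 2 * u ^+ 2 : C) +
      ((al * u + la * (p - z0) * u) + 0)).
    by apply/isrdD/isrdD/isrd_cst/isrd_scale/isrd_sqr.
  rewrite /GRing.scale/= rmorphM/= (_ : 2%:C = 2) ?rmorph_nat//.
  by field.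
have hor y : c <= y <= d ->
    rn ((Phi y b - Phi y a) - (A (cpt b y) - A (cpt a y))) <= eta * (b - a).
  move=> ycd.
  have h := @mean_value_le R C (fun t => Phi y t + (-1) *: A (cpt 0 y + t%:C * 1))
    (fun t => f (cpt t y) + (-1) *: ((al + la * (cpt 0 y + t%:C * 1 - z0)) * 1)) a b eta ab.
  have E t : cpt 0 y + t%:C * 1 = cpt t y.
    by rewrite !cptE; ring.
  rewrite !E in h.
  rewrite (_ : _ - _ = Phi y b + -1 *: A (cpt b y) - (Phi y a + -1 *: A (cpt a y))).
    apply: h => t tab.
      apply: isrdD; last exact/isrdZ/dA.
      by apply: PhiP; rewrite ltr_norml; flra.
    by rewrite E mulr1 scaleN1r; exact: fe.
  by rewrite !scaleN1r; ring.
have ver x : a <= x <= b ->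
    rn ('i%C * (Psi x d - Psi x c) - (A (cpt x d) - A (cpt x c))) <= eta * (d - c).
  move=> xab.
  have h := @mean_value_le R C (fun t => 'i%C *: Psi x t + (-1) *: A (cpt x 0 + t%:C * 'i%C))
    (fun t => 'i%C *: f (cpt x t) + (-1) *: ((al + la * (cpt x 0 + t%:C * 'i%C - z0)) * 'i%C))
    c d eta cd.
  have E t : cpt x 0 + t%:C * 'i%C = cpt x t.
    by rewrite !cptE; ring.
  rewrite !E in h.
  rewrite (_ : _ - _ = 'i%C *: Psi x d + -1 *: A (cpt x d) -
      ('i%C *: Psi x c + -1 *: A (cpt x c))).
    apply: h => t tcd.
      apply: isrdD; last exact/isrdZ/dA.
      by apply: isrdZ; apply: PsiP; rewrite ltr_norml; flra.
    rewrite E scaleN1r [_ *: _](_ : _ = f (cpt x t) * 'i%C); last exact: mulrC.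
    by rewrite -mulrBl rnM rni mulr1; exact: fe.
  by rewrite !scaleN1r /GRing.scale/=; ring.
have h1 := hor c; have h2 := hor d; have h3 := ver a; have h4 := ver b.
rewrite !lexx ?ab ?cd in h1 h2 h3 h4.
have {}h1 := h1 isT; have {}h2 := h2 isT; have {}h3 := h3 isT; have {}h4 := h4 isT.
rewrite [X in rn X](_ : _ =
   ((Phi c b - Phi c a - (A (cpt b c) - A (cpt a c)))
   + ('i%C * (Psi b d - Psi b c) - (A (cpt b d) - A (cpt b c))))
   - (Phi d b - Phi d a - (A (cpt b d) - A (cpt a d)))
   - ('i%C * (Psi a d - Psi a c) - (A (cpt a d) - A (cpt a c)))); last by rewrite /mu; ring.
apply: le_trans (rnB _ _) _.
apply: le_trans (lerD (rnB _ _) (lexx _)) _.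
apply: le_trans (lerD (lerD (rnD _ _) (lexx _)) (lexx _)) _.
flra.
Qed.

Let bad eta (q : R * R * R * R) := let: (a, b, c, d) := q in
  [/\ a <= b, c <= d & eta * ((b - a) + (d - c)) ^+ 2 < rn (mu a b c d)].

Let quarter (q q' : R * R * R * R) := let: (a, b, c, d) := q in
  let: (a', b', c', d') := q' in
  [/\ a <= a', b' <= b, c <= c', d' <= d &
      b' - a' = (b - a) / 2 /\ d' - c' = (d - c) / 2].

Let bad_quarter eta q : bad eta q -> exists q', bad eta q' /\ quarter q q'.
Proof.
move: q => [[[a b] c] d] [ab cd].
set m := (a + b) / 2; set n := (c + d) / 2.
set L := (b - a) + (d - c) => big.
have muE : mu a b c d = (mu a m c n + mu m b c n) + (mu a m n d + mu m b n d).
  by rewrite /mu; ring.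
have [h1|h1] := ltP (eta * (L / 2) ^+ 2) (rn (mu a m c n)).
  exists (a, m, c, n); split; split; rewrite /m /n; try flra.
  by apply: le_lt_trans h1; rewrite le_eqVlt; apply/orP; left; apply/eqP; rewrite /L /m /n; field.
have [h2|h2] := ltP (eta * (L / 2) ^+ 2) (rn (mu m b c n)).
  exists (m, b, c, n); split; split; rewrite /m /n; try flra.
  by apply: le_lt_trans h2; rewrite le_eqVlt; apply/orP; left; apply/eqP; rewrite /L /m /n; field.
have [h3|h3] := ltP (eta * (L / 2) ^+ 2) (rn (mu a m n d)).
  exists (a, m, n, d); split; split; rewrite /m /n; try flra.
  by apply: le_lt_trans h3; rewrite le_eqVlt; apply/orP; left; apply/eqP; rewrite /L /m /n; field.
have [h4|h4] := ltP (eta * (L / 2) ^+ 2) (rn (mu m b n d)).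
  exists (m, b, n, d); split; split; rewrite /m /n; try flra.
  by apply: le_lt_trans h4; rewrite le_eqVlt; apply/orP; left; apply/eqP; rewrite /L /m /n; field.
exfalso; move: big; apply/negP; rewrite -leNgt muE.
apply: le_trans (rnD _ _) _; apply: le_trans (lerD (rnD _ _) (rnD _ _)) _.
have -> : eta * L ^+ 2 = 4 * (eta * (L / 2) ^+ 2) by field.
flra.
Qed.

Lemma exists_half_pow (L d : R) : 0 < d -> exists n, L / 2 ^+ n < d.
Proof.
move=> d0; exists (Num.bound `|L / d|).
rewrite ltr_pdivrMr ?exprn_gt0// mulrC -ltr_pdivrMr//.
apply: lt_le_trans (_ : (Num.bound `|L / d|)%:R <= _).
  by apply: le_lt_trans (ler_norm _) _; exact: archi_boundP (normr_ge0 _).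
by rewrite -natrX ler_nat ltnW// ltn_expl.
Qed.

(** By bisection: if the integral were not zero, one of the four quarters of
    the rectangle would carry a quarter of it, and so on. The nested quarters
    shrink to a point, where the differentiability of [f] contradicts the
    lower bound for their integrals. *)
Lemma goursat_rectangle (a b c d : R) : a <= b -> c <= d ->
  - r < a -> b < r -> - r < c -> d < r -> mu a b c d = 0.
Proof.
move=> ab cd ar br cr dr; apply/eqP; rewrite -rn_eq0 eq_le rn_ge0 andbT.
set L := (b - a) + (d - c).
have L0 : 0 <= L by rewrite /L; flra.
suff main (eta : R) : 0 < eta -> rn (mu a b c d) <= eta * L ^+ 2.
  apply/ler_addgt0Pr => e e0; rewrite add0r.
  have p : 0 < L ^+ 2 + 1 by rewrite ltr_wpDl ?sqr_ge0.
  apply: le_trans (main _ (divr_gt0 e0 p)) _.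
  by rewrite mulrAC ler_pdivrMr//; apply: ler_wpM2l; flra.
move=> eta0; rewrite leNgt; apply/negP => big.
have /choice[next nextP] : forall q, exists q', bad eta q -> bad eta q' /\ quarter q q'.
  move=> q; have [bq|nbq] := pselect (bad eta q).
    by have [q' q'P] := bad_quarter bq; exists q'.
  by exists q.
pose q n := iter n next (a, b, c, d).
have qbad n : bad eta (q n).
  by elim: n => [|n /nextP[]//]; split.
pose qa n := (q n).1.1.1; pose qb n := (q n).1.1.2.
pose qc n := (q n).1.2; pose qd n := (q n).2.
have qE n : q n = (qa n, qb n, qc n, qd n).
  by rewrite /qa /qb /qc /qd; case: (q n) => [[[]]].
have badE n : [/\ qa n <= qb n, qc n <= qd n &
    eta * ((qb n - qa n) + (qd n - qc n)) ^+ 2 < rn (mu (qa n) (qb n) (qc n) (qd n))].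
  by have := qbad n; rewrite qE.
have quartE n : [/\ qa n <= qa n.+1, qb n.+1 <= qb n, qc n <= qc n.+1, qd n.+1 <= qd n &
    qb n.+1 - qa n.+1 = (qb n - qa n) / 2 /\ qd n.+1 - qc n.+1 = (qd n - qc n) / 2].
  by have [_] := nextP _ (qbad n); rewrite -[next _]/(q n.+1) (qE n) (qE n.+1).
have len n : (qb n - qa n) + (qd n - qc n) = L / 2 ^+ n.
  elim: n => [|n IH]; first by rewrite expr0 divr1.
  have [_ _ _ _ [-> ->]] := quartE n.
  by rewrite -mulrDl IH exprS invfM [2^-1 * _]mulrC mulrA.
have nest m n : (m <= n)%N -> [/\ qa m <= qa n, qb n <= qb m, qc m <= qc n & qd n <= qd m].
  elim: n => [|n IH]; first by rewrite leqn0 => /eqP ->.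
  rewrite leq_eqVlt => /predU1P[->|]; first by split.
  rewrite ltnS => /IH[h1 h2 h3 h4]; have [k1 k2 k3 k4 _] := quartE n.
  by split; [apply: le_trans h1 _|apply: le_trans h2|apply: le_trans h3 _|apply: le_trans h4].
have cross m n : qa m <= qb n /\ qc m <= qd n.
  have [h1 _ h3 _] := nest m (maxn m n) (leq_maxl _ _).
  have [_ h2 _ h4] := nest n (maxn m n) (leq_maxr _ _).
  have [k1 k2 _] := badE (maxn m n); flra.
pose x := sup (range qa); pose y := sup (range qc).
have sx : has_sup (range qa).
  by split; [exists (qa 0%N), 0%N|exists (qb 0%N) => _ [m _ <-]; have [] := cross m 0%N].
have sy : has_sup (range qc).
  by split; [exists (qc 0%N), 0%N|exists (qd 0%N) => _ [m _ <-]; have [] := cross m 0%N].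
have xn n : qa n <= x <= qb n.
  apply/andP; split; first by apply: ub_le_sup; [case: sx|exists n].
  by apply: ge_sup; [case: sx|move=> _ [m _ <-]; have [] := cross m n].
have yn n : qc n <= y <= qd n.
  apply/andP; split; first by apply: ub_le_sup; [case: sy|exists n].
  by apply: ge_sup; [case: sy|move=> _ [m _ <-]; have [] := cross m n].
have [xab ycd] : a <= x <= b /\ c <= y <= d := conj (xn 0%N) (yn 0%N).
have [||l fl] := @fd x y; [by rewrite ltr_norml; flra..|].
have [e e0 eP] := fl (eta / 4) ltac:(flra).
have [n nP] := exists_half_pow L e0.
set Ln := L / 2 ^+ n in nP.
have Ln0 : 0 <= Ln by rewrite divr_ge0// exprn_ge0.
have [anb cnd big'] := badE n; rewrite len -/Ln in big'.
have [h1 h2 h3 h4] := nest 0%N n isT.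
rewrite -[qa 0%N]/a -[qb 0%N]/b -[qc 0%N]/c -[qd 0%N]/d in h1 h2 h3 h4.
have := @mu_estimate (qa n) (qb n) (qc n) (qd n) (eta / 4 * Ln) (cpt x y) (f (cpt x y)) l.
rewrite len -/Ln.
have rB' := rB.
have k1 : - B < qa n.
  by apply: lt_le_trans h1; flra.
have k2 : qb n < B by apply: le_lt_trans h2 _; flra.
have k3 : - B < qc n by apply: lt_le_trans h3; flra.
have k4 : qd n < B by apply: le_lt_trans h4 _; flra.
move=> /(_ anb cnd k1 k2 k3 k4) h.
suff : rn (mu (qa n) (qb n) (qc n) (qd n)) <= 2 * (eta / 4 * Ln) * Ln.
  rewrite leNgt => /negP; apply; apply: le_lt_trans big'.
  have := mulr_ge0 (ltW eta0) (sqr_ge0 Ln); flra.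
apply: h => u v uab vcd.
have near : rn (cpt u v - cpt x y) <= Ln.
  rewrite cptB; apply: le_trans (rn_cpt _ _) _; rewrite -[leRHS]len.
  have xx := xn n; have yy := yn n.
  by apply: lerD; rewrite ler_norml; flra.
have := eP _ (le_lt_trans near nP).
rewrite addrCA subrr addr0 => hh.
rewrite opprD addrA; apply: le_trans hh _; apply: ler_wpM2l => //; flra.
Qed.

Let mu0 (a b c d : R) : `|a| < r -> `|b| < r -> `|c| < r -> `|d| < r -> mu a b c d = 0.
Proof.
rewrite !ltr_norml => ar br cr dr.
have muN a' b' c' d' : mu a' b' c' d' = - mu b' a' c' d' by rewrite /mu; ring.
have muN' a' b' c' d' : mu a' b' c' d' = - mu a' b' d' c' by rewrite /mu; ring.
wlog ab : a b ar br / a <= b.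
  move=> h; have [ab|ba] := leP a b; first exact: h.
  by rewrite muN h ?oppr0// ltW.
wlog cd : c d cr dr / c <= d.
  move=> h; have [cd|dc] := leP c d; first exact: h.
  by rewrite muN' h ?oppr0// ltW.
by apply: goursat_rectangle; flra.
Qed.

Let F (z : C) := let: x := complex.Re z in let: y := complex.Im z in
  Phi 0 x - Phi 0 0 + 'i%C * (Psi x y - Psi x 0).

(** Because integrals around rectangles vanish, the increment of [F] between
    two nearby points is an integral along a horizontal and a vertical segment
    between them, where [f] is nearly constant. *)
Lemma goursat_primitive z : `|complex.Re z| < r -> `|complex.Im z| < r ->
  cderivative F z (f z).
Proof.
case: z => x y /= xr yr e e0.
have rB' := rB.
have r0 : `|0 : R| < r by rewrite normr0; apply: le_lt_trans xr.
have e2 : 0 < e / 2 by flra.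
have /continuous_rnP/(_ _ e2)[d d0 dP] := fc (z := cpt x y).
pose d' := Num.min d (Num.min (r - `|x|) (r - `|y|)).
exists (d' / 2).
  by rewrite divr_gt0// !lt_min d0 !subr_gt0 xr yr.
case=> h1 h2 hd.
have hx := normr_Re (h1 +i* h2)%C; have hy := normr_Im (h1 +i* h2)%C.
rewrite /= in hx hy; set nh := rn (h1 +i* h2)%C in hd hx hy *.
have dd : d' <= d by rewrite ge_min lexx.
have dx : d' <= r - `|x| by rewrite /d' !ge_min lexx ?orbT.
have dy : d' <= r - `|y| by rewrite /d' !ge_min lexx ?orbT.
have nh0 : 0 <= nh := rn_ge0 _.
have xh : `|x + h1| < r by apply: le_lt_trans (ler_normD _ _) _; flra.
have yh : `|y + h2| < r by apply: le_lt_trans (ler_normD _ _) _; flra.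
have := mu0 xr xh r0 yr; rewrite /mu => mu00.
rewrite (_ : _ - _ =
    ((Phi y (x + h1) + - 1 *: ((x + h1)%:C *: f (cpt x y))) -
     (Phi y x + - 1 *: (x%:C *: f (cpt x y)))) +
    (('i%C *: Psi (x + h1) (y + h2) + - 1 *: ((y + h2)%:C *: ('i%C * f (cpt x y)))) -
     ('i%C *: Psi (x + h1) y + - 1 *: (y%:C *: ('i%C * f (cpt x y)))))); last first.
  rewrite /F /= !scaleN1r /GRing.scale/= (complexE (h1 +i* h2)%C)/= !rmorphD/=.
  rewrite -/(cpt x y); apply/eqP; rewrite -subr_eq0; apply/eqP.
  rewrite -[RHS]mu00; ring.
have h1b t : Num.min x (x + h1) <= t <= Num.max x (x + h1) -> `|t - x| <= `|h1|.
  rewrite ge_min le_max !ler_norml; have := ler_norm h1; have := ler_norm (- h1).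
  rewrite normrN; flra.
have h2b t : Num.min y (y + h2) <= t <= Num.max y (y + h2) -> `|t - y| <= `|h2|.
  rewrite ge_min le_max !ler_norml; have := ler_norm h2; have := ler_norm (- h2).
  rewrite normrN; flra.
apply: le_trans (rnD _ _) _.
have v1 : rn ((Phi y (x + h1) + - 1 *: ((x + h1)%:C *: f (cpt x y))) -
     (Phi y x + - 1 *: (x%:C *: f (cpt x y)))) <= e / 2 * `|x + h1 - x|.
  apply: (@mean_value_sym _ _ (fun t => Phi y t + - 1 *: (t%:C *: f (cpt x y)))
    (fun t => f (cpt t y) + - 1 *: f (cpt x y))) => t /h1b th.
    apply: isrdD; last exact/isrdZ/isrd_scale.
    apply: PhiP; have := ler_normD (t - x) x; rewrite subrK; flra.
  rewrite scaleN1r; apply/ltW/dP; rewrite cptB subrr; apply: le_lt_trans (rn_cpt _ _) _.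
  rewrite normr0; flra.
have v2 : rn (('i%C *: Psi (x + h1) (y + h2) + - 1 *: ((y + h2)%:C *: ('i%C * f (cpt x y)))) -
     ('i%C *: Psi (x + h1) y + - 1 *: (y%:C *: ('i%C * f (cpt x y)))))
     <= e / 2 * `|y + h2 - y|.
  apply: (@mean_value_sym _ _ (fun t => 'i%C *: Psi (x + h1) t + - 1 *: (t%:C *: ('i%C * f (cpt x y))))
    (fun t => 'i%C *: f (cpt (x + h1) t) + - 1 *: ('i%C * f (cpt x y)))) => t /h2b th.
    apply: isrdD; last exact/isrdZ/isrd_scale.
    apply: isrdZ; apply: PsiP; have := ler_normD (t - y) y; rewrite subrK; flra.
  rewrite scaleN1r /GRing.scale/= -mulrBr rnM rni mul1r.
  apply/ltW/dP; rewrite cptB; apply: le_lt_trans (rn_cpt _ _) _.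
  rewrite [x + h1 - x]addrAC subrr add0r; flra.
move: v1 v2; rewrite [x + h1 - x]addrAC subrr add0r [y + h2 - y]addrAC subrr add0r.
nra.
Qed.

End goursat.

Section disc_primitive.
Context {R : realType}.
Local Notation C := R[i].
Implicit Types (f g : C -> C) (z a b : C) (r d : R).

Definition ccont f z : Prop := {for z, continuous f}.

Lemma cderivative_continuous f z l : cderivative f z l -> {for z, continuous f}.
Proof.
move=> fl; apply/continuous_rnP => e e0.
have [d d0 dP] := fl 1 ltr01.
have p : 0 < rn l + 1 by have := rn_ge0 l; flra.
exists (Num.min d (e / (rn l + 1))); first by rewrite lt_min d0 divr_gt0.
move=> y; rewrite lt_min => /andP[/dP].
rewrite addrCA subrr addr0 mul1r ltr_pdivlMr// => h1 h2.
have := rnD (f y - f z - l * (y - z)) (l * (y - z)); rewrite subrK rnM.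
move: h1 h2; flra.
Qed.

(** The square of half side [r] lies in the disc of radius [2 * r]. The
    composition of [f] with the projection onto this square is continuous on
    the whole plane, hence has primitives along all lines. *)
Lemma disc_primitive f r : 0 < r ->
  (forall z, rn z < 2 * r -> exists l, cderivative f z l) ->
  exists F, forall z, rn z < r -> cderivative F z (f z).
Proof.
move=> r0 fd.
pose cl (t : R) := Num.max (- r) (Num.min r t).
have clr t : - r <= cl t <= r.
  by rewrite /cl le_max lexx/= ge_max ge_min lexx andbT; flra.
have clE t : `|t| <= r -> cl t = t.
  by rewrite ler_norml => tr; rewrite /cl min_r ?max_r; flra.
have clL s t : `|cl s - cl t| <= `|s - t|.
  rewrite /cl; have := ler_norm (s - t); have := ler_norm (t - s).
  rewrite (distrC t s) ler_norml /Num.max /Num.min.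
  by repeat case: ifPn; rewrite -?leNgt; flra.
pose ft (z : C) := f (cpt (cl (complex.Re z)) (cl (complex.Im z))).
have sq x y : - r <= x <= r -> - r <= y <= r -> rn (cpt x y : C) < 2 * r.
  move=> xr yr; rewrite -ltr_sqr ?nnegrE ?rn_ge0//; last flra.
  rewrite rn_sqr/=; nra.
have ftc z : {for z, continuous ft}.
  have [l /cderivative_continuous/continuous_rnP fcz] := fd _ (sq _ _ (clr (complex.Re z)) (clr (complex.Im z))).
  apply/continuous_rnP => e /fcz[d d0 dP]; exists (d / 2); first flra.
  move=> y yz; apply: dP; rewrite cptB; apply: le_lt_trans (rn_cpt _ _) _.
  have := clL (complex.Re y) (complex.Re z); have := clL (complex.Im y) (complex.Im z).
  rewrite -ReB -ImB; have := normr_Re (y - z); have := normr_Im (y - z).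
  flra.
have hor c : exists K : R -> C, forall x, `|x| < r -> isrd K x (ft (cpt x c)).
  apply: (@complex_primitive _ (fun x => ft (cpt x c))) => x e e0.
  have /continuous_rnP/(_ e e0)[d d0 dP] := ftc (cpt x c).
  exists d => // t td; apply: dP; rewrite cptB subrr.
  by apply: le_lt_trans (rn_cpt _ _) _; rewrite normr0 addr0 addrAC subrr add0r.
have ver (b : R) : exists K : R -> C, forall y, `|y| < r -> isrd K y (ft (cpt b y)).
  apply: (@complex_primitive _ (fun y => ft (cpt b y))) => x e e0.
  have /continuous_rnP/(_ e e0)[d d0 dP] := ftc (cpt b x).
  exists d => // t td; apply: dP; rewrite cptB subrr.
  by apply: le_lt_trans (rn_cpt _ _) _; rewrite normr0 add0r addrAC subrr add0r.
have [Phi PhiP] := choice hor; have [Psi PsiP] := choice ver.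
have ftE z : rn z < r -> ft z = f z.
  move=> zr; rewrite /ft !clE ?cpt_Re_Im//; apply/ltW/(le_lt_trans _ zr).
    exact: normr_Im.
  exact: normr_Re.
have ftd x y : `|x| < r -> `|y| < r -> exists l, cderivative ft (cpt x y) l.
  move=> xr yr; have [|l fl] := fd (cpt x y); first by move: xr yr; rewrite !ltr_norml => xr yr; apply: sq; flra.
  exists l => e /fl[d d0 dP].
  exists (Num.min d (Num.min (r - `|x|) (r - `|y|))).
    by rewrite !lt_min d0 !subr_gt0 xr.
  move=> h; rewrite !lt_min => /andP[hd /andP[hx hy]].
  rewrite (_ : ft (cpt x y + h) = f (cpt x y + h)); last first.
    rewrite /ft !clE ?cpt_Re_Im//.
      apply: le_trans (_ : `|y + complex.Im h| <= _); first by case: (h).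
      by apply: le_trans (ler_normD _ _) _; have := normr_Im h; flra.
    apply: le_trans (_ : `|x + complex.Re h| <= _); first by case: (h).
    by apply: le_trans (ler_normD _ _) _; have := normr_Re h; flra.
  rewrite (_ : ft (cpt x y) = f (cpt x y)); last by rewrite /ft !clE//= ltW.
  exact: dP.
pose F (z : C) := let: x := complex.Re z in let: y := complex.Im z in
  Phi 0 x - Phi 0 0 + 'i%C * (Psi x y - Psi x 0).
exists F => z zr; rewrite -ftE//.
apply: (goursat_primitive ftc (lexx r) PhiP PsiP ftd).
  by apply: le_lt_trans zr; exact: normr_Re.
by apply: le_lt_trans zr; exact: normr_Im.
Qed.

(** A second order expansion in which the coefficient of the remainder is
    continuous. Primitives of holomorphic functions have such expansions, and
    they are all that the maximum principle below uses. *)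
Definition taylor2 f z a := exists s : C -> C, ccont s 0 /\
  exists2 d : R, 0 < d & forall h, rn h < d -> f (z + h) = f z + a * h + h ^+ 2 * s h.

Lemma continuousMc f g z : ccont f z -> ccont g z ->
  ccont (fun w => f w * g w) z.
Proof. by move=> fc gc; exact: (@cvgM _ _ _ _ _ _ _ _ fc gc). Qed.

Lemma continuousDc f g z : ccont f z -> ccont g z ->
  ccont (fun w => f w + g w) z.
Proof. by move=> fc gc; exact: (@cvgD _ _ _ _ _ _ _ _ _ fc gc). Qed.

Lemma continuousXc f z n : ccont f z ->
  ccont (fun w => f w ^+ n) z.
Proof.
move=> fc; elim: n => [|n IH].
  by rewrite (_ : (fun w => _) = fun=> 1); [exact: cst_continuous|apply/funext => ?; rewrite expr0].
rewrite (_ : (fun w => _) = fun w => f w * f w ^+ n); last by apply/funext => ?; rewrite exprS.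
exact: continuousMc.
Qed.

Lemma continuousVc f z : f z != 0 -> ccont f z ->
  ccont (fun w => (f w)^-1) z.
Proof. by move=> fz fc; exact: (@cvgV _ _ _ _ _ _ fz fc). Qed.

Lemma taylor2M f g z a b : taylor2 f z a -> taylor2 g z b ->
  taylor2 (fun w => f w * g w) z (a * g z + f z * b).
Proof.
move=> [s [sc [d d0 dP]]] [t [tc [e e0 eP]]].
exists (fun h => s h * (g z + b * h + h ^+ 2 * t h) + (a * b + t h * (f z + a * h))); split.
  have idc : ccont (fun h : C => h) 0 by exact: cvg_id.
  have cc c : ccont (fun=> c) 0 by exact: cst_continuous.
  apply: continuousDc.
    apply: (continuousMc sc); apply: continuousDc.
      by apply: continuousDc (cc _) _; exact: continuousMc (cc _) idc.
    by apply: continuousMc tc; exact: continuousXc.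
  apply: continuousDc (cc _) _; apply: (continuousMc tc).
  by apply: continuousDc (cc _) _; exact: continuousMc (cc _) idc.
exists (Num.min d e); first by rewrite lt_min d0.
move=> h; rewrite lt_min => /andP[/dP-> /eP->]; ring.
Qed.

Lemma taylor2X f z a n : taylor2 f z a -> exists b, taylor2 (fun w => f w ^+ n) z b.
Proof.
move=> fa; elim: n => [|n [b IH]].
  exists 0, (fun _ : C => 0); split; first exact: cst_continuous.
  by exists 1 => // h _; rewrite !expr0; ring.
eexists; rewrite (_ : (fun w => _) = fun w => f w * f w ^+ n).
  by apply: taylor2M; [exact: fa|exact: IH].
by apply/funext => ?; rewrite exprS.
Qed.

Lemma taylor2V z : z != 0 -> taylor2 (fun w => w^-1) z (- z ^- 2).
Proof.
move=> z0; exists (fun h => z ^- 2 * (z + h)^-1); split.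
  have idc : ccont (fun h : C => h) 0 by exact: cvg_id.
  have cc c : ccont (fun=> c) 0 by exact: cst_continuous.
  apply: continuousMc (cc _) _; apply: continuousVc; first by rewrite addr0.
  exact: continuousDc (cc _) idc.
exists (rn z); first by rewrite rn_gt0.
move=> h hz; have zh : z + h != 0.
  by apply: contraTneq hz => /addr0_eq <-; rewrite rnN ltxx.
field; by rewrite ?z0 ?zh.
Qed.

Lemma taylor2_affine a b z : taylor2 (fun w => a + b * w) z b.
Proof.
exists (fun _ : C => 0); split; first exact: cst_continuous.
by exists 1 => // h _; ring.
Qed.

Lemma taylor2D f g z a b : taylor2 f z a -> taylor2 g z b ->
  taylor2 (fun w => f w + g w) z (a + b).
Proof.
move=> [s [sc [d d0 dP]]] [t [tc [e e0 eP]]].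
exists (fun h => s h + t h); split; first exact: continuousDc.
exists (Num.min d e); first by rewrite lt_min d0.
move=> h; rewrite lt_min => /andP[/dP-> /eP->]; ring.
Qed.

Lemma taylor2_shift f y z a : taylor2 f (y + z) a -> taylor2 (fun w => f (y + w)) z a.
Proof.
move=> [s [sc [d d0 dP]]]; exists s; split => //; exists d => // h /dP.
by rewrite addrA.
Qed.

Lemma taylor2_continuous f z a : taylor2 f z a -> ccont f z.
Proof.
move=> [s [/continuous_rnP sc [d d0 dP]]].
apply: (@cderivative_continuous _ _ a) => e e0.
have [d' d'0 d'P] := sc 1 ltr01.
have p : 0 < rn (s 0) + 1 by have := rn_ge0 (s 0); flra.
exists (Num.min d (Num.min d' (e / (rn (s 0) + 1)))); first by rewrite !lt_min d0 d'0 divr_gt0.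
move=> h; rewrite !lt_min => /andP[/dP-> /andP[hd' he]].
rewrite (_ : _ - _ = h * s h * h); last by ring.
rewrite rnM; apply: ler_wpM2r; first exact: rn_ge0.
have := d'P h; rewrite subr0 => /(_ hd') sh.
have : rn (s h) <= rn (s 0) + 1 by have := ler_rnB (s h) (s 0); flra.
move: he; rewrite ltr_pdivlMr// rnM => /ltW he s1.
apply: le_trans he; apply: ler_wpM2l => //; exact: rn_ge0.
Qed.

End disc_primitive.

(** * Maximum principle and Cauchy estimates on discs *)

Section maximum_principle_disc.
Context {R : realType}.
Local Notation C := R[i].
Implicit Types (v : C -> R) (f g : C -> C) (z w a b : C) (r d rho B : R).

Definition rcont v z := forall e : R, 0 < e -> exists2 d : R, 0 < d &
  forall w, rn (w - z) < d -> `|v w - v z| < e.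

Lemma rcont_continuous v z : rcont v z -> {for z, continuous v}.
Proof.
move=> vz A /nbhs_ballP[e /= e0 eA]; have [d d0 dP] := vz e e0.
suff : nbhs z (v @^-1` A) by [].
apply/nbhs_rnP; exists d => // w /dP h; apply: eA; by rewrite /ball/= distrC.
Qed.

Lemma rcontD v u z : rcont v z -> rcont u z -> rcont (fun w => v w + u w) z.
Proof.
move=> vz uz e e0; have e2 : 0 < e / 2 by flra.
have [d d0 dP] := vz _ e2; have [d' d'0 d'P] := uz _ e2.
exists (Num.min d d') => [|w]; first by rewrite lt_min d0.
rewrite lt_min => /andP[/dP h1 /d'P h2]; move: h1 h2; rewrite !ltr_norml; flra.
Qed.

Lemma rcontZ (c : R) v z : rcont v z -> rcont (fun w => c * v w) z.
Proof.
move=> vz e e0; have c1 : 0 < `|c| + 1 by have := normr_ge0 c; flra.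
have [d d0 dP] := vz _ (divr_gt0 e0 c1); exists d => // w /dP.
rewrite ltr_pdivlMr// -mulrBr normrM; apply: le_lt_trans.
by rewrite mulrC; apply: ler_wpM2l => //; flra.
Qed.

Lemma rcont_rn2 z : rcont (fun w => rn w ^+ 2) z.
Proof.
move=> e e0; have p : 0 < 2 * rn z + 1 by have := rn_ge0 z; flra.
exists (Num.min 1 (e / (2 * rn z + 1))); first by rewrite lt_min ltr01 divr_gt0.
move=> w; rewrite lt_min => /andP[w1]; rewrite ltr_pdivlMr// => we.
rewrite subr_sqr normrM.
have h1 : `|rn w - rn z| <= rn (w - z).
  by rewrite ler_norml; have := ler_rnB w z; have := ler_rnB z w; rewrite (rnBC z); flra.
have h2 : `|rn w + rn z| <= 2 * rn z + 1.
  by rewrite ger0_norm ?addr_ge0 ?rn_ge0//; have := ler_rnB w z; flra.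
apply: le_lt_trans we; exact: ler_pM.
Qed.

Lemma compact_disc rho : compact [set z : C | rn z <= rho].
Proof.
have sq_compact : compact ((fun p : R * R => cpt p.1 p.2 : C) @` (`[- rho, rho] `*` `[- rho, rho])).
  apply: continuous_compact.
    apply: continuous_subspaceT => -[x y]; apply/cvg_rnP => e e0.
    have e2 : 0 < e / 2 by flra.
    exists (ball x (e / 2), ball y (e / 2)); first by split; exact: nbhsx_ballx.
    move=> [x' y'] [/=]; rewrite /ball/= => h1 h2; rewrite cptB.
    apply: le_lt_trans (rn_cpt _ _) _; rewrite (distrC x') (distrC y'); flra.
  by apply: compact_setX; exact: segment_compact.
apply: (subclosed_compact _ sq_compact).
  rewrite -[X in closed X]setCK; apply: open_closedC.
  rewrite openE => z /= /negP; rewrite -ltNge => zr.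
  apply/nbhs_rnP; exists (rn z - rho); first by rewrite subr_gt0.
  move=> y yz /=; apply/negP; rewrite -ltNge.
  have := ler_rnB z y; rewrite rnBC; flra.
move=> z /= zr; exists (complex.Re z, complex.Im z); last by case: z zr.
split; rewrite /= in_itv/= -ler_norml; apply: le_trans zr.
  exact: normr_Re.
exact: normr_Im.
Qed.

Definition four v z (t : R) : R :=
  v (z + t%:C) + v (z - t%:C) + v (z + 'i%C * t%:C) + v (z - 'i%C * t%:C).

(** The Laplacian of [v] at [z] is nonnegative, in the weak sense that the
    four point average falls short of the value at the centre by a small
    multiple of [t ^+ 2]. *)
Definition four_sub v z := forall e : R, 0 < e -> exists2 d : R, 0 < d &
  forall t : R, 0 < t < d -> 4 * v z - e * t ^+ 2 <= four v z t.

Lemma four_rn2 z (t : R) : four (fun w => rn w ^+ 2) z t = 4 * rn z ^+ 2 + 4 * t ^+ 2.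
Proof.
rewrite /four -[z]cpt_Re_Im !rn_sqr; move: (complex.Re z) (complex.Im z) => x y.
rewrite (_ : 'i%C * t%:C = cpt 0 t); last by rewrite cptE rmorph0 add0r.
by rewrite /=; ring.
Qed.

(** Adding a small multiple of [rn z ^+ 2] to [v] makes the four point
    inequality strict, which excludes an interior maximum. *)
Lemma disc_maximum v rho B : 0 < rho ->
  (forall z, rn z <= rho -> rcont v z) ->
  (forall z, rn z < rho -> four_sub v z) ->
  (forall z, rn z = rho -> v z <= B) ->
  forall z, rn z <= rho -> v z <= B.
Proof.
move=> rho0 vc vs vB z1 z1r; rewrite leNgt; apply/negP => Bz1.
have p : 0 < 2 * (rho ^+ 2 + 1) by have := sqr_ge0 rho; flra.
set e := (v z1 - B) / (2 * (rho ^+ 2 + 1)).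
have e0 : 0 < e by rewrite divr_gt0// subr_gt0.
have eE : e * (2 * (rho ^+ 2 + 1)) = v z1 - B by rewrite /e divfK// gt_eqF.
pose V w := v w + e * rn w ^+ 2.
have [z0 z0r z0max] : exists2 c, c \in [set z : C | rn z <= rho] &
    forall t, t \in [set z : C | rn z <= rho] -> V t <= V c.
  apply: compact_EVT_max; first by exists z1.
    exact: compact_disc.
  move=> z; apply: continuous_in_subspaceT => {}z; rewrite inE /= => zr.
  apply: rcont_continuous; apply: rcontD; first exact: vc.
  exact/rcontZ/rcont_rn2.
move: z0r; rewrite inE /= => z0r.
have z01 : V z1 <= V z0 by apply: z0max; rewrite inE.
have z0lt : rn z0 < rho.
  rewrite lt_neqAle z0r andbT; apply/eqP => z0E.
  have := vB _ z0E; move: z01; rewrite /V z0E.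
  have := mulr_ge0 (ltW e0) (sqr_ge0 (rn z1)).
  have : 0 <= e * rho ^+ 2 by rewrite mulr_ge0 ?sqr_ge0 ?(ltW e0).
  flra.
have [d d0 dP] := vs _ z0lt e e0.
pose t := Num.min (d / 2) (rho - rn z0).
have t0 : 0 < t by rewrite lt_min subr_gt0 z0lt andbT; flra.
have td : 0 < t < d.
  by rewrite t0/=; apply: (@le_lt_trans _ _ (d / 2)); [rewrite ge_min lexx|flra].
have tr : t <= rho - rn z0 by rewrite ge_min lexx orbT.
have Vle w : rn w <= t -> V (z0 + w) <= V z0.
  move=> wt; apply: z0max; rewrite inE /=; have := rnD z0 w; flra.
have rt : rn (t%:C : C) = t by rewrite rnR gtr0_norm.
have rit : rn ('i%C * t%:C : C) = t by rewrite rnM rni rt mul1r.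
have fV : four V z0 t <= 4 * V z0.
  have := Vle t%:C; have := Vle (- t%:C).
  have := Vle ('i%C * t%:C); have := Vle (- ('i%C * t%:C)).
  rewrite !rnN rt rit lexx /four => /(_ isT) h1 /(_ isT) h2 /(_ isT) h3 /(_ isT) h4.
  flra.
have fE : four V z0 t = four v z0 t + e * four (fun w => rn w ^+ 2) z0 t.
  rewrite /four /V; ring.
move: fV; rewrite fE four_rn2 /V; have := dP _ td.
have := mulr_gt0 e0 (exprn_gt0 2 t0); flra.
Qed.

(** The terms of orders one and two cancel over [t, - t, i t, - i t]. *)
Lemma taylor2_four_sub f z a c : taylor2 f z a ->
  four_sub (fun w => complex.Re (c * f w)) z.
Proof.
move=> [s [/continuous_rnP sc [d d0 dP]]] e e0.
have p : 0 < 8 * (rn c + 1) by have := rn_ge0 c; flra.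
have [d' d'0 d'P] := sc _ (divr_gt0 e0 p).
exists (Num.min d d'); first by rewrite lt_min d0.
move=> t /andP[t0]; rewrite lt_min => /andP[td td'].
have rt : rn (t%:C : C) = t by rewrite rnR gtr0_norm.
have rit : rn ('i%C * t%:C : C) = t by rewrite rnM rni rt mul1r.
rewrite /four !dP ?rnN ?rt ?rit//.
set s1 := s t%:C; set s2 := s (- t%:C); set s3 := s _; set s4 := s _.
have sm x : rn x < d' -> rn (s x - s 0) < e / (8 * (rn c + 1)).
  by move=> xd; apply: d'P; rewrite subr0.
have h1 : rn (s1 - s 0) < e / (8 * (rn c + 1)) by apply: sm; rewrite rt.
have h2 : rn (s2 - s 0) < e / (8 * (rn c + 1)) by apply: sm; rewrite rnN rt.
have h3 : rn (s3 - s 0) < e / (8 * (rn c + 1)) by apply: sm; rewrite rit.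
have h4 : rn (s4 - s 0) < e / (8 * (rn c + 1)) by apply: sm; rewrite rnN rit.
set D := (s1 - s 0) + (s2 - s 0) - (s3 - s 0) - (s4 - s 0).
have rD : rn D <= 4 * (e / (8 * (rn c + 1))).
  apply: le_trans (rnB _ _) _; apply: le_trans (lerD (rnB _ _) (lexx _)) _.
  apply: le_trans (lerD (lerD (rnD _ _) (lexx _)) (lexx _)) _; flra.
have ReD (x y : C) : complex.Re (x + y) = complex.Re x + complex.Re y by case: x; case: y.
have Re4 (x : C) : complex.Re (4%:C * x) = 4 * complex.Re x by rewrite ReRM.
rewrite -!ReD.
rewrite [X in _ <= complex.Re X](_ : _ = 4%:C * (c * f z) + (t ^+ 2)%:C * (c * D)); last first.
  have i2 : 'i%C ^+ 2 = -1 :> C by exact: sqr_i.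
  rewrite (_ : 4%:C = 4) ?rmorph_nat// rmorphXn/= /D.
  transitivity (4 * (c * f z) + t%:C ^+ 2 * (c * ((s1 + s2) + 'i%C ^+ 2 * (s3 + s4)))); first ring.
  rewrite i2; ring.
rewrite ReD !ReRM.
have : `|t ^+ 2 * complex.Re (c * D)| <= t ^+ 2 * e.
  rewrite normrM ger0_norm ?sqr_ge0//; apply: ler_wpM2l; first exact: sqr_ge0.
  apply: le_trans (normr_Re _) _; rewrite rnM.
  apply: le_trans (_ : (rn c + 1) * (4 * (e / (8 * (rn c + 1)))) <= _).
    by apply: ler_pM => //; rewrite ?rn_ge0//; flra.
  rewrite (_ : _ * _ = e / 2); first flra.
  by field; have := rn_ge0 c; apply: contraTN => /eqP h; rewrite -ltNge; flra.
rewrite ler_norml; flra.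
Qed.

(** The previous principle is applied to the real part of [c * g], where the
    constant [c] makes the value at a point real and positive. *)
Lemma taylor2_maximum g rho B : 0 < rho ->
  (forall z, rn z <= rho -> ccont g z) ->
  (forall z, rn z < rho -> exists a, taylor2 g z a) ->
  (forall z, rn z = rho -> rn (g z) <= B) ->
  forall z, rn z <= rho -> rn (g z) <= B.
Proof.
move=> rho0 gc gt gB z1 z1r; have [->|g0] := eqVneq (g z1) 0.
  rewrite rn0; apply: le_trans (gB (rho%:C) _); first exact: rn_ge0.
  by rewrite rnR gtr0_norm.
pose c := (g z1)^*%C / (rn (g z1))%:C.
have n0 : rn (g z1) != 0 by rewrite rn_eq0.
have cc : rn c = 1.
  rewrite rnM rnV rnR ger0_norm ?rn_ge0//.
  rewrite (_ : rn (g z1)^*%C = rn (g z1)) ?mulfV//.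
  by apply/eqP; rewrite -(@eqrXn2 _ 2) ?rn_ge0// !rn_sqr; case: (g z1) => ? ? /=; rewrite sqrrN.
have cg : complex.Re (c * g z1) = rn (g z1).
  rewrite /c mulrAC [_^*%C * _]mulrC (_ : g z1 * (g z1)^*%C = (rn (g z1) ^+ 2)%:C).
    by rewrite -fmorphV -rmorphM/= expr2 mulfK.
  by rewrite rn_sqr add_Re2_Im2 normCK.
rewrite -cg; apply: (@disc_maximum (fun w => complex.Re (c * g w)) rho B) => //.
- move=> z /gc/continuous_rnP zc e /zc[d d0 dP]; exists d => // w /dP.
  rewrite -ReB -mulrBr => h; apply: le_lt_trans (normr_Re _) _.
  by rewrite rnM cc mul1r.
- by move=> z /gt[a ga]; apply: taylor2_four_sub ga.
move=> z /gB; apply: le_trans; apply: le_trans (ler_norm _) _.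
by apply: le_trans (normr_Re _) _; rewrite rnM cc mul1r.
Qed.

End maximum_principle_disc.

Section cauchy_estimates.
Context {R : realType}.
Local Notation C := R[i].
Implicit Types (f g q F : C -> C) (z w a b h l : C) (r d rho B M : R).

Lemma ccont_near f g z d : 0 < d -> (forall h, rn h < d -> f (z + h) = g (z + h)) ->
  ccont g z -> ccont f z.
Proof.
move=> d0 fg /continuous_rnP gz; apply/continuous_rnP => e /gz[d' d'0 d'P].
exists (Num.min d d'); first by rewrite lt_min d0.
move=> y; rewrite lt_min => /andP[yd /d'P].
have := fg _ yd; rewrite addrCA subrr addr0 => ->.
by have := fg 0; rewrite rn0 addr0 => ->.
Qed.

Lemma taylor2_near f g z a d : 0 < d -> (forall h, rn h < d -> f (z + h) = g (z + h)) ->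
  taylor2 g z a -> taylor2 f z a.
Proof.
move=> d0 fg [s [sc [e e0 eP]]]; exists s; split => //.
exists (Num.min d e); first by rewrite lt_min d0.
move=> h; rewrite lt_min => /andP[hd he].
by rewrite fg// eP//; have := fg 0; rewrite rn0 addr0 => ->.
Qed.

(** At the origin [w ^+ 2 * q w ^+ n] has a second order expansion because [q]
    is continuous there. The maximum principle for these functions bounds [rn
    (q z)] by [B] times an [n]-th root that tends to [1]. *)
Lemma removable_maximum q rho B : 0 < rho ->
  (forall z, rn z <= rho -> ccont q z) ->
  (forall z, z != 0 -> rn z < rho -> exists a, taylor2 q z a) ->
  (forall z, rn z = rho -> rn (q z) <= B) ->
  forall z, rn z <= rho -> rn (q z) <= B.
Proof.
move=> rho0 qc qt qB.
have B0 : 0 <= B.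
  by apply: le_trans (qB (rho%:C) _); rewrite ?rn_ge0// rnR gtr0_norm.
have main z : z != 0 -> rn z <= rho -> rn (q z) <= B.
  move=> z0 zr; apply/ler_addgt0Pr => e e0.
  have p0 : 0 < B + e by flra.
  rewrite leNgt; apply/negP => qz.
  have nbound n : rn z ^+ 2 * rn (q z) ^+ n <= rho ^+ 2 * (B + e) ^+ n.
    rewrite -!rnX -rnM.
    apply: (@taylor2_maximum _ (fun w => w ^+ 2 * q w ^+ n) rho _ rho0 _ _ _ z zr).
    - move=> w wr; apply: continuousMc; last by apply: continuousXc; exact: qc.
      by apply: continuousXc; exact: cvg_id.
    - move=> w wr; have [->|w0] := eqVneq w 0.
        exists 0, (fun h => q h ^+ n); split.
          by apply: continuousXc; apply: qc; rewrite rn0 ltW.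
        by exists 1 => // h _; rewrite add0r expr0n !mul0r !add0r.
      have [a qa] := qt w w0 wr; have [b qb] := taylor2X n qa.
      have [c wc] := taylor2X 2 (taylor2_affine 0 1 w).
      rewrite (_ : (fun _ => _) = (fun w => (0 + 1 * w) ^+ 2 * q w ^+ n)).
        by eexists; exact: taylor2M wc qb.
      by apply/funext => x; rewrite add0r mul1r.
    move=> w wr; rewrite rnM !rnX wr; apply: ler_wpM2l; first exact: sqr_ge0.
    apply: lerXn2r; rewrite ?nnegrE ?rn_ge0 ?(ltW p0)//.
    by have := qB _ wr; flra.
  have rz0 : 0 < rn z by rewrite rn_gt0.
  set x := rn (q z) / (B + e) - 1.
  have x0 : 0 < x by rewrite subr_gt0 ltr_pdivlMr ?mul1r.
  have xn n : n%:R * x <= rho ^+ 2 / rn z ^+ 2.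
    rewrite ler_pdivlMr ?exprn_gt0//.
    have := nbound n; rewrite -ler_pdivrMr ?exprn_gt0// -mulrA -expr_div_n => h.
    apply: le_trans h; rewrite mulrC; apply: ler_wpM2l; first exact: sqr_ge0.
    rewrite (_ : _ / _ = 1 + x); last by rewrite /x addrCA subrr addr0.
    elim: (n) => [|m IH]; first by rewrite mul0r expr0.
    rewrite exprS -natr1 mulrDl mul1r.
    have x1 : 1 <= (1 + x) ^+ m by rewrite exprn_ege1// lerDl ltW.
    rewrite mulrDl mul1r; apply: lerD => //.
    by rewrite -{1}[x]mulr1; apply: ler_wpM2l => //; exact: ltW.
  have := xn (Num.bound (rho ^+ 2 / rn z ^+ 2 / x)).
  rewrite leNgt => /negP; apply; rewrite -ltr_pdivrMr//; apply: archi_boundP.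
  by rewrite !divr_ge0// ?sqr_ge0// ltW.
move=> z zr; have [z0|] := eqVneq z 0; last by move/main; exact.
rewrite z0; apply/ler_addgt0Pr => e e0.
have /continuous_rnP/(_ e e0)[d d0 dP] : ccont q 0 by apply: qc; rewrite rn0 ltW.
pose t := Num.min (d / 2) rho.
have t0 : 0 < t by rewrite lt_min rho0 andbT; flra.
have rt : rn (t%:C : C) = t by rewrite rnR gtr0_norm.
have tz : t%:C != 0 :> C by rewrite -rn_gt0 rt.
have tr : rn (t%:C : C) <= rho by rewrite rt ge_min lexx orbT.
have td : t <= d / 2 by rewrite ge_min lexx.
have := main _ tz tr; have := dP t%:C; rewrite subr0 rt => /(_ ltac:(flra)).
by have := ler_rnB (q 0) (q t%:C); rewrite rnBC; flra.
Qed.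

(** This is Schwarz's lemma: the difference quotients [(g z - g 0) / z] and
    [(g z - g 0 - a * z) / z ^+ 2] extend continuously to the origin, and the
    maximum principle is applied to them. *)
Lemma taylor2_estimates g r M a : 0 < r ->
  (forall z, rn z < r -> exists b, taylor2 g z b) ->
  (forall z, rn z < r -> rn (g z) <= M) -> taylor2 g 0 a ->
  forall z, rn z <= r / 2 ->
    rn (g z - g 0) <= 4 * M / r * rn z /\
    rn (g z - g 0 - a * z) <= 16 * M / r ^+ 2 * rn z ^+ 2.
Proof.
move=> r0 gt gM g0a.
have r2 : 0 < r / 2 by flra.
have [s [sc [d d0 gE]]] := g0a.
have dP h : rn h < d -> g h = g 0 + a * h + h ^+ 2 * s h by move/gE; rewrite add0r.
have idc : ccont (fun h : C => h) 0 by exact: cvg_id.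
have cc (c : C) : ccont (fun=> c) 0 by exact: cst_continuous.
have M0 z : rn z < r -> rn (g z - g 0) <= 2 * M.
  move=> zr; apply: le_trans (rnB _ _) _.
  have := gM _ zr; have := gM 0; rewrite rn0 => /(_ r0); flra.
have near0 z : z != 0 -> exists2 e : R, 0 < e & forall h, rn h < e -> z + h != 0.
  move=> z0; exists (rn z); first by rewrite rn_gt0.
  by move=> h; apply: contraTneq => /addr0_eq <-; rewrite rnN ltxx.
pose q1 z := if z == 0 then a else (g z - g 0) * z^-1.
have q1t z : z != 0 -> rn z < r -> exists b, taylor2 q1 z b.
  move=> z0 zr; have [b gb] := gt _ zr; have [e e0 eP] := near0 z z0.
  eexists; apply: (taylor2_near e0 (g := fun w => (g w + (- g 0 + 0 * w)) * w^-1)).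
    by move=> h /eP zh; rewrite /q1 (negbTE zh) mul0r addr0.
  exact: taylor2M (taylor2D gb (taylor2_affine _ _ _)) (taylor2V z0).
have q1c z : rn z <= r / 2 -> ccont q1 z.
  move=> zr; have [->|z0] := eqVneq z 0; last first.
    by have [|b /taylor2_continuous] := q1t z z0; first flra.
  apply: (ccont_near d0 (g := fun h => a + h * s h)).
    move=> h hd; rewrite add0r /q1; case: eqVneq => [->|h0]; first by rewrite mul0r addr0.
    by rewrite dP//; field.
  by apply: continuousDc (cc _) _; exact: continuousMc idc sc.
have q1B z : rn z <= r / 2 -> rn (q1 z) <= 4 * M / r.
  apply: (removable_maximum r2 q1c).
    by move=> w w0 wr; apply: q1t => //; flra.
  move=> w wr; have w0 : w != 0 by rewrite -rn_gt0 wr.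
  rewrite /q1 (negbTE w0) rnM rnV wr ler_pdivrMr//.
  rewrite [leRHS](_ : _ = 2 * M); last by field; rewrite gt_eqF.
  by apply: M0; flra.
have E1 z : rn z <= r / 2 -> rn (g z - g 0) <= 4 * M / r * rn z.
  move=> zr; have [->|z0] := eqVneq z 0; first by rewrite subrr rn0 mulr0.
  have := q1B _ zr; rewrite /q1 (negbTE z0) rnM rnV ler_pdivrMr//.
  by rewrite rn_gt0.
have aB : rn a <= 4 * M / r.
  by have := q1B 0; rewrite /q1 eqxx; apply; rewrite rn0 ltW.
pose q2 z := if z == 0 then s 0 else (g z - g 0 - a * z) * (z^-1 * z^-1).
have q2t z : z != 0 -> rn z < r -> exists b, taylor2 q2 z b.
  move=> z0 zr; have [b gb] := gt _ zr; have [e e0 eP] := near0 z z0.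
  eexists; apply: (taylor2_near e0 (g := fun w => (g w + (- g 0 + (- a) * w)) * (w^-1 * w^-1))).
    by move=> h /eP zh; rewrite /q2 (negbTE zh) mulNr addrA.
  apply: taylor2M (taylor2D gb (taylor2_affine _ _ _)) _.
  exact: taylor2M (taylor2V z0) (taylor2V z0).
have q2c z : rn z <= r / 2 -> ccont q2 z.
  move=> zr; have [->|z0] := eqVneq z 0; last first.
    by have [|b /taylor2_continuous] := q2t z z0; first flra.
  apply: (ccont_near d0 (g := s)) => // h hd.
  rewrite add0r /q2; case: eqVneq => [->//|h0].
  by rewrite dP//; field.
have q2B z : rn z <= r / 2 -> rn (q2 z) <= 16 * M / r ^+ 2.
  apply: (removable_maximum r2 q2c).
    by move=> w w0 wr; apply: q2t => //; flra.
  move=> w wr; have w0 : w != 0 by rewrite -rn_gt0 wr.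
  rewrite /q2 (negbTE w0) !rnM !rnV wr -invfM ler_pdivrMr ?mulr_gt0//.
  rewrite [leRHS](_ : _ = 4 * M); last by field; rewrite gt_eqF.
  apply: le_trans (rnB _ _) _; rewrite rnM wr.
  have k1 : rn (g w - g 0) <= 2 * M by apply: M0; flra.
  have k2 : rn a * (r / 2) <= 4 * M / r * (r / 2) by apply: ler_wpM2r => //; flra.
  have k3 : 4 * M / r * (r / 2) = 2 * M by field; rewrite gt_eqF.
  flra.
move=> z zr; split; first exact: E1.
have [->|z0] := eqVneq z 0.
  by rewrite mulr0 subr0 subrr rn0 expr0n mulr0.
have := q2B _ zr; rewrite /q2 (negbTE z0) !rnM !rnV -invfM ler_pdivrMr ?mulr_gt0 ?rn_gt0//.
Qed.

Lemma cderivative_line f p u (x : R) l : cderivative f (p + x%:C * u) l ->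
  isrd (fun t => f (p + t%:C * u)) x (l * u).
Proof.
move=> fl e e0; have u1 : 0 < rn u + 1 by have := rn_ge0 u; flra.
have [d d0 dP] := fl _ (divr_gt0 e0 u1).
exists (d / (rn u + 1)); first exact: divr_gt0.
move=> t; rewrite ltr_pdivlMr// => td.
have hd : rn (t%:C * u) < d.
  by rewrite rnM rnR; apply: le_lt_trans td; apply: ler_wpM2l => //; flra.
have := dP _ hd; rewrite rmorphD/= mulrDl addrA.
rewrite [_ *: _](_ : _ = l * (t%:C * u)); last by rewrite /GRing.scale/=; ring.
move/le_trans; apply; rewrite rnM rnR.
have eE : e = e / (rn u + 1) * (rn u + 1) by rewrite divfK// gt_eqF.
rewrite [leRHS](_ : _ = e / (rn u + 1) * ((rn u + 1) * `|t|)); last by rewrite mulrA -eE.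
apply: ler_wpM2l; first by rewrite divr_ge0// ltW.
by rewrite mulrC; apply: ler_wpM2r => //; flra.
Qed.

Lemma primitive_taylor2 F f z l d : 0 < d ->
  (forall w, rn (w - z) < d -> cderivative F w (f w)) -> cderivative f z l ->
  taylor2 F z (f z).
Proof.
move=> d0 Ff fl.
pose s h := if h == 0 then l / 2 else (F (z + h) - F z - f z * h) / h ^+ 2.
exists s; split; last first.
  exists 1 => // h _; rewrite /s; case: eqVneq => [->|h0].
    by rewrite addr0; ring.
  by field.
apply/continuous_rnP => e e0; have e2 : 0 < e / 2 by flra.
have [d' d'0 d'P] := fl _ e2.
exists (Num.min d d'); first by rewrite lt_min d0.
move=> h; rewrite subr0 lt_min => /andP[hd hd'].
rewrite /s eqxx; case: eqVneq => [_|h0]; first by rewrite subrr rn0.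
have rh : 0 < rn h by rewrite rn_gt0.
pose k (t : R) : C := F (z + t%:C * h) + (t%:C *: (- f z * h : C) + ((t ^+ 2)%:C *: (- (l / 2 * h ^+ 2) : C))).
have kd t : 0 <= t <= 1 -> isrd k t
    (f (z + t%:C * h) * h + ((- f z * h) + ((2 * t)%:C *: (- (l / 2 * h ^+ 2) : C)))).
  move=> t01; apply: isrdD; last by apply: isrdD; [exact: isrd_scale|exact: isrd_sqr].
  apply: cderivative_line; apply: Ff; rewrite addrAC subrr add0r rnM rnR ger0_norm; last flra.
  by apply: le_lt_trans hd; rewrite ger_pMl//; flra.
have kB t : 0 <= t <= 1 -> rn (f (z + t%:C * h) * h +
    ((- f z * h) + ((2 * t)%:C *: (- (l / 2 * h ^+ 2) : C)))) <= e / 2 * rn h ^+ 2.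
  move=> t01.
  have th : rn (t%:C * h) <= rn h by rewrite rnM rnR ger0_norm ?ger_pMl//; flra.
  have := d'P _ (le_lt_trans th hd').
  rewrite (_ : _ + _ = (f (z + t%:C * h) - f z - l * (t%:C * h)) * h).
    rewrite rnM expr2 mulrA => h1; apply: ler_wpM2r; first exact: rn_ge0.
    apply: le_trans h1 _; apply: ler_wpM2l => //; exact: ltW.
  by rewrite /GRing.scale/= rmorphM/= rmorph_nat; field.
have := @mean_value_le _ _ k _ 0 1 (e / 2 * rn h ^+ 2) ler01 kd kB.
rewrite subr0 mulr1 (_ : k 1 - k 0 = ((F (z + h) - F z - f z * h) / h ^+ 2 - l / 2) * h ^+ 2).
  rewrite rnM rnX ler_pM2r ?exprn_gt0//; flra.
rewrite /k /GRing.scale/= expr1n expr0n/= rmorph0 rmorph1 !mul1r !mul0r !addr0.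
by field.
Qed.

Lemma cderivativeE f z l h (e : R) : cderivative f z l -> 0 < e ->
  exists2 d : R, 0 < d & forall k, k != 0 -> rn k < d -> rn ((f (z + k) - f z) / k - l) <= e.
Proof.
move=> fl /fl[d d0 dP]; exists d => // k k0 /dP.
rewrite (_ : f (z + k) - f z - l * k = ((f (z + k) - f z) / k - l) * k); last by field.
by rewrite rnM ler_pM2r// rn_gt0.
Qed.

(** The difference quotients of a primitive of [f] have second order
    expansions and bounds that do not depend on the increment; their limit is
    [f]. *)
Lemma holomorphic_estimates f r M l : 0 < r ->
  (forall z, rn z < 2 * r -> exists m, cderivative f z m) ->
  (forall z, rn z < 2 * r -> rn (f z) <= M) -> cderivative f 0 l ->
  forall z, rn z <= r / 4 ->
    rn (f z - f 0) <= 64 * M / r * rn z /\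
    rn (f z - f 0 - l * z) <= 512 * M / r ^+ 2 * rn z ^+ 2.
Proof.
move=> r0 fd fM f0l.
have [F0 F0P] := disc_primitive r0 fd.
pose F z := F0 z + (- F0 0 + 0 * z).
have M0 : 0 <= M.
  by apply: le_trans (fM 0 _); rewrite ?rn0 ?rn_ge0//; flra.
have FP z : rn z < r -> cderivative F z (f z).
  move=> zr e e0; have [d d0 dP] := F0P z zr e e0; exists d => // h /dP.
  by rewrite (_ : F (z + h) - F z - f z * h = F0 (z + h) - F0 z - f z * h)// /F; ring.
have Ft z : rn z < r -> taylor2 F z (f z).
  move=> zr; have [|m fm] := fd z; first flra.
  apply: (@primitive_taylor2 F f z m (r - rn z)) => //; first by rewrite subr_gt0.
  by move=> w wz; apply: FP; have := ler_rnB w z; flra.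
have FB z : rn z < r -> rn (F z) <= M * r.
  move=> zr; have F00 : F 0 = 0 by rewrite /F; ring.
  rewrite (_ : F z = F (0 + 1%:C * z) - F (0 + 0%:C * z)); last first.
    by rewrite rmorph1 rmorph0 mul1r mul0r !add0r F00 subr0.
  rewrite (_ : M * r = M * r * (1 - 0)); last by ring.
  apply: (@mean_value_le _ _ (fun t : R => F (0 + t%:C * z))
    (fun t => f (0 + t%:C * z) * z) 0 1 (M * r) ler01).
    move=> t t01; apply: cderivative_line; apply: FP.
    rewrite add0r rnM rnR ger0_norm; last flra.
    by apply: le_lt_trans zr; rewrite ler_piMl ?rn_ge0//; flra.
  move=> t t01; rewrite add0r rnM; apply: ler_pM; rewrite ?rn_ge0 ?(ltW zr)//.
  apply: fM; rewrite rnM rnR ger0_norm; last flra.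
  have : t * rn z <= rn z by rewrite ler_piMl ?rn_ge0//; flra.
  flra.
have r2 : 0 < r / 2 by flra.
have q0 h k : k != 0 -> (h / k) * k = h by move=> k0; rewrite divfK.
(* the difference quotients of the primitive are controlled uniformly *)
have quot z h : rn z < r / 2 -> h != 0 -> rn h <= r / 4 ->
    rn ((F (z + h) - F z) / h) <= 8 * M.
  move=> zr h0 hr.
  have [||||h1 _] := @taylor2_estimates (fun w => F (z + w)) (r / 2) (M * r) (f z) r2 _ _ _ h.
  - move=> w wr; exists (f (z + w)); apply: taylor2_shift; apply: Ft.
    by have := rnD z w; flra.
  - by move=> w wr; apply: FB; have := rnD z w; flra.
  - by apply: taylor2_shift; rewrite addr0; apply: Ft; flra.
  - flra.
  rewrite rnM rnV ler_pdivrMr ?rn_gt0//; rewrite addr0 in h1; apply: le_trans h1 _.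
  apply: ler_wpM2r; first exact: rn_ge0.
  by rewrite le_eqVlt; apply/orP; left; apply/eqP; field; rewrite gt_eqF.
have estim z h : rn z <= r / 4 -> h != 0 -> rn h <= r / 4 ->
    rn ((F (z + h) - F z) / h - (F h - F 0) / h) <= 64 * M / r * rn z /\
    rn ((F (z + h) - F z) / h - (F h - F 0) / h - (f h - f 0) / h * z)
      <= 512 * M / r ^+ 2 * rn z ^+ 2.
  move=> zr h0 hr.
  have tq w : rn w < r / 2 ->
      taylor2 (fun w => (F (h + w) + (-1) * F w) * (h^-1 + 0 * w)) w
        ((f (h + w) + (0 * F w + (-1) * f w)) * (h^-1 + 0 * w) + (F (h + w) + (-1) * F w) * 0).
    move=> wr; apply: taylor2M; last exact: taylor2_affine.
    apply: taylor2D; first by apply: taylor2_shift; apply: Ft; have := rnD h w; flra.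
    apply: taylor2M; last by apply: Ft; flra.
    rewrite (_ : (fun _ => _) = fun w => -1 + 0 * w); first exact: taylor2_affine.
    by apply/funext => ?; ring.
  have [||||h1 h2] := @taylor2_estimates (fun w => (F (h + w) + (-1) * F w) * (h^-1 + 0 * w))
     (r / 2) (8 * M) _ r2 _ _ (tq 0 _) z.
  - by move=> w /tq; eexists; eassumption.
  - move=> w wr; rewrite mul0r addr0 mulN1r [h + w]addrC; exact: quot.
  - by rewrite rn0.
  - flra.
  move: h1 h2; rewrite !(mul0r, addr0, mulr0, mulN1r, add0r) [h + z]addrC.
  rewrite (_ : 4 * (8 * M) / (r / 2) = 64 * M / r); last by field; rewrite gt_eqF.
  rewrite (_ : 16 * (8 * M) / (r / 2) ^+ 2 = 512 * M / r ^+ 2); last by field; rewrite gt_eqF.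
  by move=> k1 k2; split.
move=> z zr.
have zr' : rn z < r by flra.
have close (e : R) : 0 < e -> exists h, [/\ h != 0, rn h <= r / 4,
    rn ((F (z + h) - F z) / h - f z) <= e, rn ((F h - F 0) / h - f 0) <= e &
    rn ((f h - f 0) / h - l) <= e].
  move=> e0; have [d1 d10 d1P] := cderivativeE 0 (FP z zr') e0.
  have r00 : rn (0 : C) < r by rewrite rn0.
  have [d2 d20 d2P] := cderivativeE 0 (FP 0 r00) e0.
  have [d3 d30 d3P] := cderivativeE 0 f0l e0.
  pose t := Num.min (r / 4) (Num.min (d1 / 2) (Num.min (d2 / 2) (d3 / 2))).
  have t0 : 0 < t by rewrite !lt_min; apply/and4P; split; flra.
  have t1 : t <= r / 4 by rewrite ge_min lexx.
  have t2 : t <= d1 / 2 by rewrite /t !ge_min lexx ?orbT.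
  have t3 : t <= d2 / 2 by rewrite /t !ge_min lexx ?orbT.
  have t4 : t <= d3 / 2 by rewrite /t !ge_min lexx ?orbT.
  have rt : rn (t%:C : C) = t by rewrite rnR gtr0_norm.
  have tz : t%:C != 0 :> C by rewrite -rn_gt0 rt.
  have := d1P _ tz; have := d2P _ tz; have := d3P _ tz; rewrite !add0r rt.
  by exists t%:C; split=> //; rewrite ?rt//; [apply: H1|apply: H0|apply: H]; flra.
have z0 := rn_ge0 z.
split; apply/ler_addgt0Pr => e e0.
  have [|h [h0 hr h1 h2 h3]] := close (e / 2); first flra.
  have [k1 _] := estim z h zr h0 hr.
  rewrite (_ : f z - f 0 = ((F (z + h) - F z) / h - (F h - F 0) / h)
    - ((F (z + h) - F z) / h - f z) + ((F h - F 0) / h - f 0)); last by ring.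
  apply: le_trans (rnD _ _) _; apply: le_trans (lerD (rnB _ _) (lexx _)) _.
  flra.
have e3 : 0 < e / (2 + rn z) by rewrite divr_gt0//; flra.
have [h [h0 hr h1 h2 h3]] := close _ e3.
have [_ k2] := estim z h zr h0 hr.
rewrite (_ : f z - f 0 - l * z = ((F (z + h) - F z) / h - (F h - F 0) / h - (f h - f 0) / h * z)
    - ((F (z + h) - F z) / h - f z) + ((F h - F 0) / h - f 0) + ((f h - f 0) / h - l) * z);
  last by ring.
apply: le_trans (rnD _ _) _; apply: le_trans (lerD (rnD _ _) (lexx _)) _.
apply: le_trans (lerD (lerD (rnB _ _) (lexx _)) (lexx _)) _.
rewrite rnM.
have h4 : rn ((f h - f 0) / h - l) * rn z <= e / (2 + rn z) * rn z by apply: ler_wpM2r.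
have h5 : e / (2 + rn z) * (2 + rn z) = e by rewrite divfK// gt_eqF//; flra.
move: h1 h2 h3 h4 h5; set D := e / (2 + rn z); flra.
Qed.

End cauchy_estimates.

(** * Holomorphic maps between normed spaces *)

Section frechet.
Context {R : realType} {V W : normedModType R[i]}.
Implicit Types (f : V -> W) (x k : V) (D : V -> W).

Definition fder f x D := forall e : R, 0 < e -> exists2 d : R, 0 < d &
  forall k, rn k < d -> rn (f (x + k) - f x - D k) <= e * rn k.

Lemma differentiable_fder f x : differentiable f x -> fder f x ('d f x).
Proof.
move=> /diff_locallyP[_ /eqaddoP fx] e e0.
have /fx/nbhs_rnP[d d0 dP] : (0 : R[i]) < e%:C by rewrite ltcR.
exists d => // k kd; have := dP k; rewrite subr0 => /(_ kd).
rewrite rn_le rmorphM/= -rnE -[X in `|X|]/(f (k + x) - (f x + 'd f x k)).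
by rewrite opprD addrA [k + x]addrC.
Qed.

Lemma fder_differentiable f x D (M : R) : linear D ->
  (forall k, rn (D k) <= M * rn k) -> fder f x D ->
  differentiable f x /\ forall k, 'd f x k = D k.
Proof.
move=> Dl DM fD.
pose lM := GRing.isLinear.Build _ _ _ _ D Dl.
pose Dm : {linear V -> W} := HB.pack D lM.
have Dc : continuous (Dm : V -> W).
  move=> y; apply/continuous_rnP => e e0.
  have M1 : 0 < `|M| + 1 by have := normr_ge0 M; flra.
  exists (e / (`|M| + 1)); first exact: divr_gt0.
  move=> z; rewrite ltr_pdivlMr// => zy; rewrite -linearB.
  apply: le_lt_trans zy; apply: le_trans (DM _) _; rewrite mulrC.
  by apply: ler_wpM2l; [exact: rn_ge0|have := ler_norm M; flra].
have fE : f \o shift x = cst (f x) + (Dm : V -> W) +o_0 id.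
  apply/eqaddoP => eps eps0.
  have /complex_realP[e eE] : eps \is Num.real by exact: gtr0_real.
  have e0 : 0 < e by rewrite -ltcR -eE.
  have [d d0 dP] := fD e e0; apply/nbhs_rnP; exists d => // k; rewrite subr0 => /dP.
  rewrite rn_le rmorphM/= -rnE -eE -[X in _ -> `|X| <= _]/(f (k + x) - (f x + D k)).
  by rewrite opprD addrA [k + x]addrC.
have dE : 'd f x = Dm :> (V -> W) := diff_unique Dc fE.
split; last by move=> k; rewrite dE.
by apply/diff_locallyP; rewrite dE; split.
Qed.

Lemma fder_near f g x D (d : R) : 0 < d ->
  (forall k, rn k < d -> f (x + k) = g (x + k)) -> fder g x D -> fder f x D.
Proof.
move=> d0 fg gD e /gD[d' d'0 d'P]; exists (Num.min d d'); first by rewrite lt_min d0.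
move=> k; rewrite lt_min => /andP[kd /d'P]; rewrite fg//.
by have := fg 0; rewrite rn0 addr0 => ->.
Qed.

Lemma fder_bound f x D (K d : R) : linear D -> 0 < d -> fder f x D ->
  (forall k, rn k <= d -> rn (f (x + k) - f x) <= K * rn k) ->
  forall k, rn (D k) <= K * rn k.
Proof.
move=> Dl d0 fD fK k; pose lM := GRing.isLinear.Build _ _ _ _ D Dl.
pose Dm : {linear V -> W} := HB.pack D lM.
have [->|k0] := eqVneq k 0; first by rewrite -[D]/(Dm : V -> W) linear0 !rn0 mulr0.
have rk : 0 < rn k by rewrite rn_gt0.
apply/ler_addgt0Pr => e e0.
have [d' d'0 d'P] := fD _ (divr_gt0 e0 rk).
pose t := Num.min d (d' / 2) / rn k.
have m0 : 0 < Num.min d (d' / 2) by rewrite lt_min d0; flra.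
have t0 : 0 < t by rewrite divr_gt0.
have rt : rn (t%:C *: k) = Num.min d (d' / 2) by rewrite rnZ rnR gtr0_norm// divfK// gt_eqF.
have md : Num.min d (d' / 2) <= d by rewrite ge_min lexx.
have md' : Num.min d (d' / 2) <= d' / 2 by rewrite ge_min lexx orbT.
have h1 : rn (f (x + t%:C *: k) - f x) <= K * rn (t%:C *: k) by apply: fK; rewrite rt.
have h2 := d'P (t%:C *: k); rewrite rt in h2; have {}h2 := h2 ltac:(flra).
have h3 : rn (D (t%:C *: k)) <= K * rn (t%:C *: k) + e / rn k * rn (t%:C *: k).
  rewrite rt; rewrite rt in h1.
  have := ler_rnB (D (t%:C *: k)) (f (x + t%:C *: k) - f x).
    rewrite (rnBC (D _)); flra.
move: h3; rewrite -[D]/(Dm : V -> W) linearZ/= !rnZ rnR gtr0_norm// => h3.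
rewrite -(ler_pM2l t0); apply: le_trans h3 _.
by rewrite le_eqVlt; apply/orP; left; apply/eqP; field; rewrite gt_eqF.
Qed.

End frechet.

Section several_variables.
Context {R : realType} {V : normedModType R[i]}.
Local Notation C := R[i].
Implicit Types (tau : V -> C) (x y k X : V) (r M : R).

Fact cauchy_constant_exists : {K : R | 8192 <= K}.
Proof. by exists 8192. Qed.

(** Only the lower bound of this constant is used; it is kept opaque so that
    arithmetic does not expand the numeral. *)
Definition cauchy_constant : R := sval cauchy_constant_exists.

Lemma cauchy_constant_ge : 8192 <= cauchy_constant.
Proof. exact: svalP cauchy_constant_exists. Qed.

Lemma cauchy_constant_gt0 : 0 < cauchy_constant.
Proof. by have := cauchy_constant_ge; flra. Qed.

Lemma fder_line tau (p k : V) (z : C) (D : V -> C) : linear D ->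
  fder tau (p + z *: k) D -> cderivative (fun w => tau (p + w *: k)) z (D k).
Proof.
move=> Dl tD e e0; pose lM := GRing.isLinear.Build _ _ _ _ D Dl.
pose Dm : {linear V -> C} := HB.pack D lM.
have k1 : 0 < rn k + 1 by have := rn_ge0 k; flra.
have [d d0 dP] := tD _ (divr_gt0 e0 k1).
exists (d / (rn k + 1)); first exact: divr_gt0.
move=> h; rewrite ltr_pdivlMr// => hd.
have hk : rn (h *: k) <= rn h * (rn k + 1).
  by rewrite rnZ; apply: ler_wpM2l; [exact: rn_ge0|flra].
have := dP _ (le_lt_trans hk hd).
have -> : D (h *: k) = D k * h by rewrite -[D]/(Dm : V -> C) linearZ/= [LHS]mulrC.
rewrite scalerDl addrA.
move/le_trans; apply; apply: le_trans (_ : e / (rn k + 1) * (rn h * (rn k + 1)) <= _).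
  by apply: ler_wpM2l => //; rewrite divr_ge0// ltW.
by rewrite le_eqVlt; apply/orP; left; apply/eqP; field; rewrite gt_eqF.
Qed.

Variables (tau : V -> C) (x0 : V) (r M : R).
Hypothesis r0 : 0 < r.
Hypothesis taud : forall y, rn (y - x0) < r -> differentiable tau y.
Hypothesis tauM : forall y, rn (y - x0) < r -> rn (tau y) <= M.

(** These are the estimates of one variable on the complex line through [y] in
    the direction [k]. *)
Lemma frechet_estimates y k : rn (y - x0) < r / 2 -> rn k <= r / 16 ->
  rn (tau (y + k) - tau y) <= cauchy_constant * M / r * rn k /\
  rn (tau (y + k) - tau y - 'd tau y k) <= cauchy_constant * M / r ^+ 2 * rn k ^+ 2.
Proof.
move=> yr kr; have r0' := r0.
have M0 : 0 <= M by apply: le_trans (tauM (y := y) _); rewrite ?rn_ge0//; flra.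
have [->|k0] := eqVneq k 0.
  by rewrite addr0 linear0 subrr subr0 !rn0 expr0n !mulr0.
have rk : 0 < rn k by rewrite rn_gt0.
pose rho := r / (4 * rn k).
have rho0 : 0 < rho by rewrite divr_gt0// mulr_gt0.
have rhoE : rho * (4 * rn k) = r by rewrite divfK// mulf_neq0// gt_eqF.
have inr (z : C) : rn z < 2 * rho -> rn (y + z *: k - x0) < r.
  move=> zr; rewrite addrAC; apply: le_lt_trans (rnD _ _) _; rewrite rnZ.
  have : rn z * rn k <= 2 * rho * rn k by apply: ler_wpM2r; flra.
  flra.
have [||||h1 h2] := @holomorphic_estimates _ (fun z => tau (y + z *: k)) rho M ('d tau y k) rho0 _ _ _ 1.
- move=> z /inr/taud/differentiable_fder zd; exists ('d tau (y + z *: k) k).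
  by apply: fder_line zd; exact: linearP.
- by move=> z /inr; exact: tauM.
- apply: fder_line; first exact: linearP.
  by rewrite scale0r addr0; apply/differentiable_fder/taud; flra.
- rewrite rn1; have : rn k * 16 <= r by flra.
  move=> kr'; rewrite /rho -mulrA -invfM ler_pdivlMr ?mulr_gt0//; flra.
move: h1 h2; rewrite scale1r scale0r addr0 mulr1 rn1 expr1n !mulr1 /rho => h1 h2; split.
  apply: le_trans h1 _.
  rewrite (_ : _ / (r / _) = 256 * (M / r * rn k)); last by field; rewrite !gt_eqF.
  rewrite -!mulrA; apply: ler_wpM2r; last by have := cauchy_constant_ge; flra.
  by apply: mulr_ge0 => //; apply: mulr_ge0; rewrite ?invr_ge0 ltW.
apply: le_trans h2 _.
rewrite [leLHS](_ : _ = 8192 * (M / r ^+ 2 * rn k ^+ 2)); last by field; rewrite !gt_eqF.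
rewrite -!mulrA; apply: ler_wpM2r; last exact: cauchy_constant_ge.
by apply: mulr_ge0 => //; apply: mulr_ge0; rewrite ?invr_ge0 sqr_ge0.
Qed.

Lemma frechet_diff_bound y k : rn (y - x0) < r / 2 ->
  rn ('d tau y k) <= cauchy_constant * M / r * rn k.
Proof.
move=> yr; have r0' := r0; have r16 : 0 < r / 16 by flra.
apply: (@fder_bound _ _ _ tau y ('d tau y) _ (r / 16)) => //.
- exact: linearP.
- by apply/differentiable_fder/taud; flra.
by move=> h hr; have [] := frechet_estimates yr hr.
Qed.

End several_variables.

Lemma diff_subE {K : numFieldType} {V W : normedModType K} (f g : V -> W) x k :
  differentiable f x -> differentiable g x ->
  'd (fun y => f y - g y) x k = 'd f x k - 'd g x k.
Proof. by move=> fx gx; rewrite diffB. Qed.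

Lemma differentiable_sub {K : numFieldType} {V W : normedModType K} (f g : V -> W) x :
  differentiable f x -> differentiable g x -> differentiable (fun y => f y - g y) x.
Proof. by move=> fx gx; exact: differentiableB. Qed.

Section derivative_holomorphic.
Context {R : realType} {V : normedModType R[i]}.
Local Notation C := R[i].
Implicit Types (tau : V -> C) (x y k X : V) (r M c : R).
Local Notation cauchy_constant := (@cauchy_constant R).

Lemma real_limit_at0 (u : R -> R) c h0 : 0 < h0 ->
  (forall h h', 0 < h < h0 -> 0 < h' < h0 -> `|u h - u h'| <= c * (h + h')) ->
  exists l, forall h, 0 < h < h0 -> `|u h - l| <= c * h.
Proof.
move=> h00 uc; pose E := [set u h - c * h | h in [set h | 0 < h < h0]].
have bound h h' : 0 < h < h0 -> 0 < h' < h0 -> u h - c * h <= u h' + c * h'.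
  by move=> hh hh'; have := uc _ _ hh hh'; rewrite ler_norml; flra.
have hE : 0 < h0 / 2 < h0 by flra.
have sE : has_sup E.
  split; first by exists (u (h0 / 2) - c * (h0 / 2)), (h0 / 2).
  by exists (u (h0 / 2) + c * (h0 / 2)) => _ [h hh <-]; exact: bound.
exists (sup E) => h hh; rewrite ler_norml; apply/andP; split.
  have : sup E <= u h + c * h by apply: ge_sup; [case: sE|move=> _ [h' hh' <-]; exact: bound].
  flra.
have : u h - c * h <= sup E by apply: ub_le_sup; [case: sE|exists h].
flra.
Qed.

Lemma complex_limit_at0 (u : R -> C) c h0 : 0 < h0 ->
  (forall h h', 0 < h < h0 -> 0 < h' < h0 -> rn (u h - u h') <= c * (h + h')) ->
  exists l, forall h, 0 < h < h0 -> rn (u h - l) <= 2 * c * h.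
Proof.
move=> h00 uc.
have [|a aP] := @real_limit_at0 (fun h => complex.Re (u h)) c h0 h00.
  move=> h h' hh hh'; apply: le_trans (uc h h' hh hh').
  by rewrite -ReB; exact: normr_Re.
have [|b bP] := @real_limit_at0 (fun h => complex.Im (u h)) c h0 h00.
  move=> h h' hh hh'; apply: le_trans (uc h h' hh hh').
  by rewrite -ImB; exact: normr_Im.
exists (cpt a b) => h hh; apply: le_trans (rn_ReIm _) _.
by rewrite ReB ImB; have := aP h hh; have := bP h hh; rewrite /=; flra.
Qed.

Lemma le0_small (A B h0 : R) : 0 < h0 -> 0 <= B ->
  (forall h : R, 0 < h < h0 -> A <= B * h) -> A <= 0.
Proof.
move=> h00 B0 AB; apply/ler_addgt0Pr => /= e e0; rewrite add0r.
have B1 : 0 < B + 1 by flra.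
pose h := Num.min (h0 / 2) (e / (B + 1)).
have hp : 0 < h by rewrite lt_min; apply/andP; split; [flra|exact: divr_gt0].
have hh : h <= h0 / 2 by rewrite ge_min lexx.
have he : h <= e / (B + 1) by rewrite ge_min lexx orbT.
apply: le_trans (AB h _) _; first by rewrite hp /=; flra.
apply: le_trans (_ : (B + 1) * (e / (B + 1)) <= _).
  by apply: ler_pM => //; [exact: ltW|flra].
by rewrite mulrC divfK// gt_eqF.
Qed.

(** The difference quotients of [tau] in the direction [X] converge near [x0],
    uniformly and at the rate of the increment, by the second order estimates.
    By the first order estimates, applied to the differences of these
    quotients, their differentials converge as well, and the limit is the
    differential of the limit. *)
Lemma derivative_differentiable tau x0 r M X : 0 < r ->
  (forall y, rn (y - x0) < r -> differentiable tau y) ->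
  (forall y, rn (y - x0) < r -> rn (tau y) <= M) ->
  differentiable (fun y => 'd tau y X) x0.
Proof.
move=> r0 taud tauM.
have x00 : rn (x0 - x0) < r / 2 by rewrite subrr rn0; flra.
have M0 : 0 <= M by apply: le_trans (tauM x0 _); rewrite ?rn_ge0// subrr rn0.
pose h0 := r / 16 / (rn X + 1).
have X1 : 0 < rn X + 1 by have := rn_ge0 X; flra.
have h00 : 0 < h0 by rewrite !divr_gt0.
have hX (h : R) : 0 < h < h0 -> rn (h%:C *: X) <= r / 16.
  move=> /andP[hp hh]; rewrite rnZ rnR gtr0_norm//.
  have : h * (rn X + 1) < r / 16 by rewrite -ltr_pdivlMr.
  nra.
clearbody h0.
pose G (h : R) y : C := (h%:C)^-1 *: (tau (y + h%:C *: X) - tau y).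
have hN0 (h : R) : 0 < h -> h%:C != 0 :> C.
  by move=> hp; rewrite -rn_gt0 rnR gtr0_norm.
set K1 := cauchy_constant * M / r * rn X; set K2 := cauchy_constant * M / r ^+ 2 * rn X ^+ 2.
have cK0 : 0 <= cauchy_constant := ltW cauchy_constant_gt0.
have ri0 : 0 <= r^-1 by rewrite invr_ge0 ltW.
have r4i0 : 0 <= (r / 4)^-1 by rewrite invr_ge0; flra.
have K10 : 0 <= K1 by rewrite /K1; apply: mulr_ge0; [apply: mulr_ge0 => //; exact: mulr_ge0|exact: rn_ge0].
have K20 : 0 <= K2.
  rewrite /K2 -exprVn; apply: mulr_ge0; last exact: sqr_ge0.
  by apply: mulr_ge0; [exact: mulr_ge0|exact: sqr_ge0].
have rhX (h : R) : 0 < h -> rn (h%:C *: X) = h * rn X.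
  by move=> hp; rewrite rnZ rnR gtr0_norm.
have GB (h : R) y : 0 < h < h0 -> rn (y - x0) < r / 4 -> rn (G h y) <= K1.
  move=> hh yr; have hp : 0 < h by case/andP: hh.
  have [|h1 _] := frechet_estimates r0 taud tauM (y := y) _ (hX h hh); first flra.
  rewrite /G rnZ rnV rnR gtr0_norm// ler_pdivrMl//; apply: le_trans h1 _.
  by rewrite rhX// /K1 le_eqVlt; apply/orP; left; apply/eqP; ring.
have Glim (h : R) y : 0 < h < h0 -> rn (y - x0) < r / 4 -> rn (G h y - 'd tau y X) <= K2 * h.
  move=> hh yr; have hp : 0 < h by case/andP: hh.
  have [|_ h2] := frechet_estimates r0 taud tauM (y := y) _ (hX h hh); first flra.
  rewrite (_ : _ - _ = (h%:C)^-1 *: (tau (y + h%:C *: X) - tau y - 'd tau y (h%:C *: X))).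
    rewrite rnZ rnV rnR gtr0_norm// ler_pdivrMl//; apply: le_trans h2 _.
    by rewrite rhX// /K2 le_eqVlt; apply/orP; left; apply/eqP; ring.
  by rewrite linearZ/= scalerBr scalerA mulVf ?hN0// scale1r.
have Gd (h : R) y : 0 < h < h0 -> rn (y - x0) < r / 4 -> differentiable (G h) y.
  move=> hh yr; have hp : 0 < h by case/andP: hh.
  apply: differentiableZ; apply: differentiableB; last by apply: taud; flra.
  apply: (@differentiable_comp _ _ _ _ (fun y => y + h%:C *: X) tau) => //.
  by apply: taud; rewrite addrAC; have := rnD (y - x0) (h%:C *: X); have := hX h hh; flra.
clearbody G K1 K2.
have r4 : 0 < r / 4 by flra.
have x04 : rn (x0 - x0) < r / 4 / 2 by rewrite subrr rn0; flra.
have x04' : rn (x0 - x0) < r / 4 by rewrite subrr rn0; flra.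
have Lcauchy k (h h' : R) : 0 < h < h0 -> 0 < h' < h0 ->
    rn ('d (G h) x0 k - 'd (G h') x0 k) <= (cauchy_constant * K2 / (r / 4) * rn k) * (h + h').
  move=> hh hh'.
  rewrite -(diff_subE _ (Gd h x0 hh x04') (Gd h' x0 hh' x04')).
  have := @frechet_diff_bound _ _ (fun y => G h y - G h' y) x0 (r / 4) (K2 * (h + h')) r4 _ _ x0 k x04.
  rewrite (_ : cauchy_constant * (K2 * (h + h')) / (r / 4) * rn k = cauchy_constant * K2 / (r / 4) * rn k * (h + h'));
    last by ring.
  apply.
    by move=> y yr; apply: differentiable_sub; exact: Gd.
  move=> y yr; have -> : G h y - G h' y = (G h y - 'd tau y X) - (G h' y - 'd tau y X).
    by lmod_over R[i].
  apply: le_trans (rnB _ _) _; rewrite mulrDr; apply: lerD; exact: Glim.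
have /choice[L LP] : forall k, exists l, forall h, 0 < h < h0 ->
    rn ('d (G h) x0 k - l) <= 2 * (cauchy_constant * K2 / (r / 4) * rn k) * h.
  by move=> k; apply: complex_limit_at0 => // h h'; exact: Lcauchy.
set K3 := 2 * (cauchy_constant * K2 / (r / 4)).
have K30 : 0 <= K3.
  by rewrite /K3; apply: mulr_ge0 => //; apply: mulr_ge0 => //; exact: mulr_ge0.
have {}LP k (h : R) : 0 < h < h0 -> rn ('d (G h) x0 k - L k) <= K3 * rn k * h.
  by move=> hh; apply: le_trans (LP k h hh) _; rewrite /K3 -!mulrA.
clearbody K3.
have Llin : linear L.
  move=> a u v; apply/eqP; rewrite -subr_eq0 -rn_eq0 eq_le rn_ge0 andbT.
  apply: (le0_small (B := K3 * (rn (a *: u + v) + rn (a : C) * rn u + rn v)) h00).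
    by rewrite mulr_ge0// !addr_ge0 ?mulr_ge0 ?rn_ge0.
  move=> h hh.
  have h1 := LP (a *: u + v) h hh; have h2 := LP u h hh; have h3 := LP v h hh.
  rewrite (_ : _ - _ = - ('d (G h) x0 (a *: u + v) - L (a *: u + v)) +
     a *: ('d (G h) x0 u - L u) + ('d (G h) x0 v - L v)); last first.
    have -> : 'd (G h) x0 (a *: u + v) = a *: 'd (G h) x0 u + 'd (G h) x0 v.
      exact: linearP.
    by lmod_over R[i].
  apply: le_trans (rnD _ _) _; apply: le_trans (lerD (rnD _ _) (lexx _)) _.
  rewrite rnN rnZ.
  have : rn (a : C) * rn ('d (G h) x0 u - L u) <= rn (a : C) * (K3 * rn u * h).
    by apply: ler_wpM2l => //; exact: rn_ge0.
  flra.
have hh2 : 0 < h0 / 2 < h0 by flra.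
have Lbound k : rn (L k) <= (cauchy_constant * K1 / (r / 4) + K3 * (h0 / 2)) * rn k.
  have h1 := LP k _ hh2.
  have h2 : rn ('d (G (h0 / 2)) x0 k) <= cauchy_constant * K1 / (r / 4) * rn k.
    apply: (@frechet_diff_bound _ _ _ x0 (r / 4) K1 r4 _ _ x0 k x04).
      by move=> y; exact: Gd.
    by move=> y; exact: GB.
  have := ler_rnB (L k) ('d (G (h0 / 2)) x0 k); rewrite rnBC; flra.
set K4 := cauchy_constant * K1 / (r / 4) ^+ 2.
have K40 : 0 <= K4.
  by rewrite /K4 -exprVn; apply: mulr_ge0; [exact: mulr_ge0|exact: sqr_ge0].
have quad k : rn k <= r / 64 -> rn ('d tau (x0 + k) X - 'd tau x0 X - L k) <= K4 * rn k ^+ 2.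
  move=> kr; rewrite -subr_le0; apply: (le0_small (B := 2 * K2 + K3 * rn k) h00).
    by apply: addr_ge0; apply: mulr_ge0 => //; exact: rn_ge0.
  move=> h hh.
  have k16 : rn k <= r / 4 / 16 by flra.
  have [_] := frechet_estimates r4 (Gd h ^~ hh) (GB h ^~ hh) x04 k16.
  rewrite -/K4 => h1.
  have h2 : rn (G h (x0 + k) - 'd tau (x0 + k) X) <= K2 * h.
    by apply: Glim => //; rewrite addrAC subrr add0r; flra.
  have h3 := Glim h x0 hh x04'; have h4 := LP k h hh.
  rewrite (_ : _ - L k = - (G h (x0 + k) - 'd tau (x0 + k) X) + (G h x0 - 'd tau x0 X)
    + ('d (G h) x0 k - L k) + (G h (x0 + k) - G h x0 - 'd (G h) x0 k)); last by lmod_over R[i].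
  have := rnD (- (G h (x0 + k) - 'd tau (x0 + k) X) + (G h x0 - 'd tau x0 X)
    + ('d (G h) x0 k - L k)) (G h (x0 + k) - G h x0 - 'd (G h) x0 k).
  have := rnD (- (G h (x0 + k) - 'd tau (x0 + k) X) + (G h x0 - 'd tau x0 X))
    ('d (G h) x0 k - L k).
  have := rnD (- (G h (x0 + k) - 'd tau (x0 + k) X)) (G h x0 - 'd tau x0 X).
  rewrite rnN; flra.
have [] := @fder_differentiable _ _ _ (fun y => 'd tau y X) x0 L _ Llin Lbound => //.
move=> e e0; have K41 : 0 < K4 + 1 by flra.
exists (Num.min (r / 64) (e / (K4 + 1))).
  by rewrite lt_min; apply/andP; split; [flra|exact: divr_gt0].
move=> k; rewrite lt_min => /andP[/ltW kr]; rewrite ltr_pdivlMr// => ke.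
apply: le_trans (quad k kr) _; rewrite expr2 mulrA; apply: ler_wpM2r; first exact: rn_ge0.
by have := rn_ge0 k; flra.
Qed.

End derivative_holomorphic.

Lemma compact_combination_min (R : realType) (K : numFieldType) (V : normedModType K) n
    (b : 'I_n -> V) (A : 'I_n -> set K) (a : 'I_n -> K) (f : V -> R) :
  (forall i, compact (A i)) -> (forall i, A i (a i)) -> continuous f ->
  exists c : 'I_n -> K, (forall i, A i (c i)) /\
    forall d : 'I_n -> K, (forall i, A i (d i)) ->
      f (\sum_i c i *: b i) <= f (\sum_i d i *: b i).
Proof.
move=> cA Aa fc.
have sc (s : seq 'I_n) : continuous (fun w : 'rV[K]_n => \sum_(i <- s) w 0 i *: b i).
  move=> v; have FF : Filter (nbhs v) := nbhs_filter v.
  elim: s => [|i s IHs]; rewrite /continuous_at.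
    rewrite big_nil (_ : (fun w : 'rV[K]_n => \sum_(i <- [::]) w 0 i *: b i) = fun=> 0).
      exact: cst_continuous.
    by apply/funext => w; rewrite big_nil.
  rewrite big_cons (_ : (fun w : 'rV[K]_n => \sum_(i <- i :: s) w 0 i *: b i) =
      fun w : 'rV[K]_n => w 0 i *: b i + \sum_(i <- s) w 0 i *: b i).
    apply: (cvgD (F := nbhs v)); last exact: IHs.
    by apply: (cvgZr_tmp (F := nbhs v)); exact: coord_continuous.
  by apply/funext => w; rewrite big_cons.
pose B := [set v : 'rV[K]_n | forall i, A i (v ord0 i)].
have cB : compact B by exact: rV_compact.
have B0 : B !=set0 by exists (\row_i a i) => i; rewrite mxE.
have gc : continuous (fun w : 'rV[K]_n => f (\sum_i w 0 i *: b i)).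
  by move=> v; apply: continuous_comp; [exact: sc|exact: fc].
have [v /[!inE] vB vmin] := compact_EVT_min B0 cB (continuous_subspaceT gc).
exists (fun i => v 0 i); split => [//|d dA].
have := vmin (\row_i d i); rewrite inE.
rewrite (_ : \sum_i (\row_i d i) 0 i *: b i = \sum_i d i *: b i); last first.
  by apply: eq_bigr => i _; rewrite mxE.
by apply => i; rewrite mxE.
Qed.

Section finite_dimension.
Context {R : realType}.
Local Notation C := R[i].
Implicit Types (V W : normedModType C).

Lemma rn_continuous V : continuous (@rn R V).
Proof.
move=> v A /nbhs_ballP[e /= e0 eA].
suff : nbhs v (@rn R V @^-1` A) by [].
apply/nbhs_rnP; exists e => // w wv; apply: eA.
have := ler_rnB v w; have := ler_rnB w v.
by rewrite (rnBC v) /ball/= ltr_norml; flra.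
Qed.

Lemma scale_sum_lift V n (b : 'I_n.+1 -> V) (a : 'I_n.+1 -> C) (i : 'I_n.+1) :
  a i != 0 -> \sum_j a j *: b j = 0 ->
  forall c : 'I_n.+1 -> C, exists d : 'I_n -> C,
    \sum_j c j *: b j = \sum_j d j *: b (lift i j).
Proof.
move=> ai ab0 c; exists (fun j => c (lift i j) - c i / a i * a (lift i j)).
have bsum (e : 'I_n.+1 -> C) :
    \sum_j e j *: b j = e i *: b i + \sum_j e (lift i j) *: b (lift i j).
  by rewrite (bigD1_ord i).
rewrite bsum; move: ab0; rewrite bsum => /eqP; rewrite addr_eq0 => /eqP ab0.
have -> : c i *: b i = (c i / a i) *: (a i *: b i) by rewrite scalerA divfK.
rewrite ab0 scalerN scaler_sumr -sumrN -big_split/=; apply: eq_bigr => j _.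
by rewrite scalerBl scalerA addrC.
Qed.

Lemma independent_span V : finite_dim_space V -> exists n (b : 'I_n -> V),
  (forall v, exists a : 'I_n -> C, v = \sum_i a i *: b i) /\
  forall a : 'I_n -> C, \sum_i a i *: b i = 0 -> forall i, a i = 0.
Proof.
move=> [n [b bspan]]; elim: n b bspan => [|n IH] b bspan.
  by exists 0%N, b; split => // a _ [].
have [indep|] := pselect (forall a : 'I_n.+1 -> C, \sum_i a i *: b i = 0 -> forall i, a i = 0).
  by exists n.+1, b.
move=> /existsNP[a /not_implyP[ab0 /existsNP[i /eqP ai]]].
apply: (IH (fun j => b (lift i j))) => v; have [c ->] := bspan v.
exact: scale_sum_lift ai ab0 c.
Qed.

Lemma compact_circle : compact [set z : C | rn z = 1].
Proof.
apply: (subclosed_compact _ (@compact_disc R 1)) => [|z /= ->//].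
rewrite -[X in closed X]setCK; apply: open_closedC; rewrite openE => z /= /eqP z1.
apply/nbhs_rnP; exists `|rn z - 1|; first by rewrite normr_gt0 subr_eq0.
move=> y yz /= y1; have := ler_rnB z y; have := ler_rnB y z.
rewrite (rnBC z) y1; move: yz; rewrite ltr_normr => /orP[]; flra.
Qed.

(** The coordinates in a basis are continuous: on the combinations with
    coefficients of modulus at most one, one of which has modulus one, the
    norm attains a minimum, which is positive. *)
Lemma finite_dim_coordinates V : finite_dim_space V ->
  exists n (b : 'I_n -> V) (lam : 'I_n -> V -> C) (K : R),
  [/\ forall i, linear (lam i), forall i v, rn (lam i v) <= K * rn v &
      forall v, v = \sum_i lam i v *: b i].
Proof.
move=> /independent_span[n [b [bspan bind]]].
have [a aP] := choice bspan.
exists n, b, (fun i v => a v i).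
have uniq_coef (c d : 'I_n -> C) : \sum_i c i *: b i = \sum_i d i *: b i -> forall i, c i = d i.
  move=> /eqP; rewrite -subr_eq0 -sumrB => /eqP cd0 i; apply/eqP; rewrite -subr_eq0; apply/eqP.
  apply: (bind (fun i => c i - d i)); rewrite -[RHS]cd0.
  by apply: eq_bigr => j _; rewrite scalerBl.
have alin i : linear (fun v => a v i).
  move=> c u v; apply: (uniq_coef (a (c *: u + v)) (fun i => c *: a u i + a v i)).
  rewrite -aP {1}(aP u) {1}(aP v) scaler_sumr -big_split/=.
  by apply: eq_bigr => j _; rewrite scalerDl scalerA.
(* for each index, the combinations whose largest coefficient is that one *)
have lower i : exists2 m : R, 0 < m & forall c : 'I_n -> C,
    (forall j, rn (c j) <= rn (c i)) -> m * rn (c i) <= rn (\sum_j c j *: b j).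
  pose A j := if j == i then [set z : C | rn z = 1] else [set z : C | rn z <= 1].
  have cA j : compact (A j).
    by rewrite /A; case: eqP => _; [exact: compact_circle|exact: compact_disc].
  have A0 j : A j (if j == i then 1 else 0).
    by rewrite /A; case: eqP => _ /=; rewrite ?rn1// rn0 ler01.
  have [v [vA vmin]] := compact_combination_min b cA A0 (@rn_continuous V).
  have fv0 : 0 < rn (\sum_j v j *: b j).
    rewrite rn_gt0; apply/eqP => /bind/(_ i) vi.
    by have := vA i; rewrite /A eqxx /= vi rn0 => /esym/eqP; rewrite oner_eq0.
  exists (rn (\sum_j v j *: b j)) => // c ci; have [->|ci0] := eqVneq (c i) 0; first by rewrite rn0 mulr0 rn_ge0.
  have rc : 0 < rn (c i) by rewrite rn_gt0.
  have := vmin (fun j => (c i)^-1 * c j).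
  rewrite (_ : \sum_j ((c i)^-1 * c j) *: b j = (c i)^-1 *: \sum_j c j *: b j); last first.
    by rewrite scaler_sumr; apply: eq_bigr => j _; rewrite scalerA.
  rewrite [X in _ -> X <= _]mulrC rnZ rnV ler_pdivlMl//; apply => j; rewrite /A.
  case: eqP => [->|_] /=; first by rewrite mulVf// rn1.
  by rewrite rnM rnV ler_pdivrMl// mulr1.
have /choice[m mP] : forall i, exists m : R, 0 < m /\ forall c : 'I_n -> C,
    (forall j, rn (c j) <= rn (c i)) -> m * rn (c i) <= rn (\sum_j c j *: b j).
  by move=> i; have [mi mi0 miP] := lower i; exists mi.
exists (\sum_i (m i)^-1); split => //.
move=> j v; case: n => [|n'] in b bspan bind a aP uniq_coef alin lower m mP j *.
  by case: j.
pose i := [arg max_(i > j) rn (a v i)]%O.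
have imax k : rn (a v k) <= rn (a v i).
  by rewrite /i; case: arg_maxP => // i' _; exact.
apply: le_trans (imax j) _; have [mi0 /(_ _ imax)] := mP i; rewrite -aP => h.
apply: le_trans (_ : (m i)^-1 * rn v <= _); first by rewrite ler_pdivlMl.
apply: ler_wpM2r; first exact: rn_ge0.
rewrite (bigD1 i)//= lerDl; apply: sumr_ge0 => k _; rewrite invr_ge0 ltW//.
by have [] := mP k.
Qed.

Lemma fder_linear V W (lam : V -> W) (K : R) : linear lam ->
  (forall v, rn (lam v) <= K * rn v) -> forall x, differentiable lam x /\ forall k, 'd lam x k = lam k.
Proof.
move=> ll lK x; apply: (fder_differentiable ll lK) => e e0; exists 1 => // k _.
pose lM := GRing.isLinear.Build _ _ _ _ lam ll.
pose lL : {linear V -> W} := HB.pack lam lM.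
have -> : lam (x + k) = lam x + lam k := linearD lL x k.
rewrite [X in rn X](_ : _ = 0); last by lmod_over R[i].
by rewrite rn0; apply: mulr_ge0; [exact: ltW|exact: rn_ge0].
Qed.

Lemma diff_bounded V W (f : V -> W) x : differentiable f x ->
  exists M : R, forall k, rn ('d f x k) <= M * rn k.
Proof.
move=> fx; have fc : {for 0, continuous 'd f x} by exact: diff_continuous.
have [d d0 dP] := (continuous_rnP _ _).1 fc 1 ltr01.
exists (2 / d) => k; have [->|k0] := eqVneq k 0; first by rewrite linear0 !rn0 mulr0.
have rk : 0 < rn k by rewrite rn_gt0.
have t0 : 0 < d / 2 / rn k by rewrite !divr_gt0.
have := dP ((d / 2 / rn k)%:C *: k); rewrite subr0 linear0 subr0 linearZ/= !rnZ rnR gtr0_norm//.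
rewrite divfK ?gt_eqF// => /(_ ltac:(flra)).
rewrite -ltr_pdivlMl// mulr1 => /ltW /le_trans; apply.
by rewrite le_eqVlt; apply/orP; left; apply/eqP; field; rewrite !gt_eqF.
Qed.

Lemma differentiable_near V W (f g : V -> W) x (d : R) : 0 < d ->
  (forall k, rn k < d -> f (x + k) = g (x + k)) -> differentiable g x ->
  differentiable f x /\ forall k, 'd f x k = 'd g x k.
Proof.
move=> d0 fg gx; have [M gM] := diff_bounded gx.
apply: (fder_differentiable (M := M)); [exact: linearP|exact: gM|].
by apply: fder_near d0 fg _; exact: differentiable_fder.
Qed.

(** The finite dimensional target reduces this to scalar functions, through
    coordinates; for these it follows from the Cauchy estimates. *)
Lemma holomorphic_derivative V W (tau : V -> W) (x : V) (X : V) (r : R) :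
  finite_dim_space W -> 0 < r ->
  (forall y, rn (y - x) < r -> differentiable tau y) ->
  differentiable (fun y => 'd tau y X) x.
Proof.
move=> /finite_dim_coordinates[n [b [lam [K [laml lamK lamE]]]]] r0 taud.
have lamd i y := fder_linear (laml i) (lamK i) y.
have comp i y : rn (y - x) < r -> differentiable (lam i \o tau) y /\
    'd (lam i \o tau) y X = lam i ('d tau y X).
  move=> yr; have [ld lE] := lamd i (tau y).
  split; first by apply: differentiable_comp => //; exact: taud.
  by rewrite (diff_comp (taud y yr) ld) -lE.
have di i : differentiable (fun y => 'd (lam i \o tau) y X) x.
  have xr : rn (x - x) < r by rewrite subrr rn0.
  have /differentiable_continuous/continuous_rnP/(_ 1 ltr01)[d d0 dP] := (comp i x xr).1.
  apply: (@derivative_differentiable _ _ _ x (Num.min r d) (rn ((lam i \o tau) x) + 1)).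
  - by rewrite lt_min r0.
  - by move=> y; rewrite lt_min => /andP[/(comp i)[]].
  move=> y; rewrite lt_min => /andP[_ /dP].
  by have := ler_rnB ((lam i \o tau) y) ((lam i \o tau) x); flra.
have sE y : 'd tau y X = \sum_i lam i ('d tau y X) *: b i by exact: lamE.
have gd : differentiable (fun y => \sum_i 'd (lam i \o tau) y X *: b i) x.
  rewrite (_ : (fun y => _) = \sum_(i < n) (fun y => 'd (lam i \o tau) y X *: b i)); last first.
    by apply/funext => y; rewrite fct_sumE.
  by apply: differentiable_sum => i; exact: differentiableZl.
have xr : rn (x - x) < r by rewrite subrr rn0.
apply: (differentiable_near r0 _ gd).1 => k kr.
rewrite {1}sE; apply: eq_bigr => i _; congr (_ *: _).
by rewrite (comp i (x + k) _).2// addrAC subrr add0r.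
Qed.

End finite_dimension.

(** * The submean value inequality on circles *)

Section circle_means.
Context {R : realType}.
Local Notation C := R[i].
Implicit Types (v : C -> R) (G : R -> R) (a z w : C) (r L t s : R).

Definition edir t : C := cpt (cos t) (sin t).

Lemma edirD s t : edir (s + t) = edir s * edir t.
Proof. by rewrite /edir cosD sinD /cpt; simpc; congr (_ +i* _)%C; rewrite addrC. Qed.

Lemma edir2pi t : edir (t + 2 * pi) = edir t.
Proof. by rewrite /edir mulr_natl cosD2pi sinD2pi. Qed.

Lemma rn_edir t : rn (edir t) = 1.
Proof.
apply/eqP; rewrite -(@eqrXn2 _ 2) ?rn_ge0// rn_sqr/= cos2Dsin2 expr1n.
by [].
Qed.

Lemma polar_form w r : 0 < r -> rn w = r -> exists2 t, `|t| <= pi & w = r%:C * edir t.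
Proof.
move=> r0 wr.
have := rn_sqr w; rewrite wr; move: w {wr} => [x y] /= xy.
have x1 : -1 <= x / r <= 1.
  rewrite -ler_norml normrM normfV (gtr0_norm r0) ler_pdivrMr// mul1r.
  rewrite -ler_sqr ?nnegrE ?(ltW r0)// real_normK ?num_real//.
  by rewrite xy lerDl sqr_ge0.
have sE : Num.sqrt (1 - (x / r) ^+ 2) = `|y / r|.
  rewrite -sqrtr_sqr; congr Num.sqrt.
  have -> : 1 = (x ^+ 2 + y ^+ 2) / r ^+ 2 by rewrite -xy mulfV// expf_neq0// gt_eqF.
  by field; rewrite gt_eqF.
have cE : cos (acos (x / r)) = x / r by rewrite acosK// in_itv.
have [a0 api] := (acos_ge0 x1, acos_lepi x1).
have [y0|y0] := leP 0 y.
  exists (acos (x / r)); first by rewrite ger0_norm.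
  rewrite /edir cE sin_acos// sE ger0_norm ?divr_ge0 ?(ltW r0)//.
  by rewrite /cpt; simpc; congr (_ +i* _)%C; field; rewrite gt_eqF.
exists (- acos (x / r)); first by rewrite normrN ger0_norm.
rewrite /edir cosN sinN cE sin_acos// sE.
rewrite ltr0_norm ?pmulr_llt0 ?invr_gt0// opprK.
by rewrite /cpt; simpc; congr (_ +i* _)%C; field; rewrite gt_eqF.
Qed.

Definition contRR G t := forall e : R, 0 < e ->
  exists2 d : R, 0 < d & forall s, `|s - t| < d -> `|G s - G t| < e.

Lemma uniform_continuity G L : (forall t, contRR G t) -> forall e : R, 0 < e ->
  exists2 d : R, 0 < d & forall s t, `|t| <= L -> `|s - t| < d -> `|G s - G t| < e.
Proof.
move=> Gc e e0.
have cov : compact `[- L, L] by exact: segment_compact.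
move/compact_near_coveringP : cov => /(_ R (0^'+) (fun d x => forall s, `|s - x| < d -> `|G s - G x| < e)).
move=> /(_ _)[|].
- move=> x _; have e2 : 0 < e / 2 by flra.
  have [d d0 dP] := Gc x _ e2.
  exists (ball x (d / 2), [set y | 0 < y < d / 2]); first split => /=.
    + by apply: nbhsx_ballx; flra.
    + near=> y; apply/andP; split; near: y; [exact: nbhs_right_gt|apply: nbhs_right_lt; flra].
  move=> [x' d'] /= [+ /andP[_ d'd]] s sx'; rewrite /ball/= => xx'.
  have h1 : `|G x' - G x| < e / 2 by apply: dP; rewrite distrC; flra.
  have h2 : `|G s - G x| < e / 2.
    apply: dP; have := ler_normD (s - x') (x' - x).
    by rewrite addrA subrK (distrC x' x); flra.
  have := ler_normD (G s - G x) (G x - G x'); rewrite addrA subrK (distrC (G x)); flra.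
- move=> d /= d0 dP; exists (d / 2); first by flra.
  move=> s t tL st; apply: (dP (d / 2)) => //=.
  + by rewrite sub0r normrN gtr0_norm; flra.
  + by flra.
  + by rewrite in_itv/= -ler_norml.
Unshelve. all: by end_near. Qed.

Lemma real_mean_value (f df : R -> R) s t : s < t ->
  (forall x : R, s <= x <= t -> is_derive x 1 f (df x)) ->
  exists2 c, s < c < t & f t - f s = df c * (t - s).
Proof.
move=> st fd; have [||c /[!in_itv]/= ct fE] := @MVT R f df s t st.
- by move=> x /[!in_itv]/= /andP[sx xt]; apply: fd; rewrite !ltW.
- apply: derivable_within_continuous => x /[!in_itv]/= /fd[].
  by [].
by exists c.
Qed.

(** Integrals around the circle, through a primitive of the boundary values:
    [G] is periodic and [H] a primitive of it on a long enough interval. *)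
Section riemann_sums.
Variables (G H : R -> R) (B : R).
Hypothesis Gc : forall t, contRR G t.
Hypothesis Gper : forall t, G (t + 2 * pi) = G t.
Hypothesis HG : forall t : R, `|t| < B -> is_derive t 1 H (G t).

Lemma period_integral t : `|t| + 2 * pi < B ->
  H (t + 2 * pi) - H t = H (2 * pi) - H 0.
Proof.
move=> tB; have pi0 := pi_gt0 R.
pose D s := H (s + 2 * pi) - H s.
have Dd (s : R) : `|s| <= `|t| -> is_derive s 1 D (G (s + 2 * pi) - G s).
  move=> st; apply: is_deriveB; last by apply: HG; flra.
  have HG' : is_derive (s + 2 * pi) 1 H (G (s + 2 * pi)).
    apply: HG; have := ler_normD s (2 * pi); rewrite (gtr0_norm (_ : 0 < 2 * pi)); flra.
  have sd : is_derive s 1 (fun x : R => x + 2 * pi) 1.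
    by rewrite -[X in is_derive _ _ _ X]addr0; apply: is_deriveD.
  by have := @is_derive1_comp R H _ s _ _ HG' sd; rewrite mulr1.
suff : D t = D 0 by rewrite /D add0r.
have tt : `|t| <= `|t| by [].
case: (ltgtP t 0) => [t0|t0|->//].
  have [|c ct] := @real_mean_value D (fun s => G (s + 2 * pi) - G s) t 0 t0.
    by move=> x tx; apply: Dd; rewrite (ltr0_norm t0) ler0_norm; flra.
  by rewrite Gper subrr mul0r => /eqP; rewrite subr_eq0 => /eqP.
have [|c ct] := @real_mean_value D (fun s => G (s + 2 * pi) - G s) 0 t t0.
  by move=> x tx; apply: Dd; rewrite (gtr0_norm t0) ger0_norm; flra.
by rewrite Gper subrr mul0r => /eqP; rewrite subr_eq0 => /eqP.
Qed.

Lemma riemann_sum_le t (e : R) (n : nat) : `|t| + 2 * pi < B -> 0 < e ->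
  (forall s s', `|s'| <= B -> `|s - s'| <= 2 * pi / n.+1%:R -> `|G s - G s'| <= e) ->
  `|H (2 * pi) - H 0 - 2 * pi / n.+1%:R * \sum_(k < n.+1) G (t + 2 * pi * k%:R / n.+1%:R)|
    <= 2 * pi * e.
Proof.
move=> tB e0 Ge; have pi0 := pi_gt0 R; rewrite -(period_integral tB).
set h := 2 * pi / n.+1%:R; have h0 : 0 < h by rewrite divr_gt0 ?mulr_gt0 ?ltr0n.
have hn : h * n.+1%:R = 2 * pi by rewrite divfK// pnatr_eq0.
have -> : H (t + 2 * pi) - H t = \sum_(k < n.+1) (H (t + h * k.+1%:R) - H (t + h * k%:R)).
  rewrite -(big_mkord xpredT (fun k => H (t + h * k.+1%:R) - H (t + h * k%:R))).
  by rewrite (telescope_sumr (fun k => H (t + h * k%:R)))// hn mulr0 addr0.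
rewrite mulr_sumr -sumrB; apply: le_trans (ler_norm_sum _ _ _) _.
apply: le_trans (_ : \sum_(k < n.+1) h * e <= _); last first.
  by rewrite sumr_const card_ord -[X in X <= _]mulr_natr mulrAC hn.
apply: ler_sum => k _.
have -> : 2 * pi * k%:R / n.+1%:R = h * k%:R by rewrite /h; ring.
have kn : h * k.+1%:R <= 2 * pi by rewrite -hn ler_pM2l// ler_nat ltn_ord.
have k0 : 0 <= h * k%:R by rewrite mulr_ge0// ltW.
have kS : h * k.+1%:R = h * k%:R + h by rewrite -natr1 mulrDr mulr1.
have tl := ler_norm t; have tl' := ler_norm (- t); rewrite normrN in tl'.
have lt : t + h * k%:R < t + h * k.+1%:R by rewrite kS; flra.
have [|c /andP[c1 c2] ->] := @real_mean_value H G (t + h * k%:R) (t + h * k.+1%:R) lt.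
  by move=> x xt; apply: HG; rewrite ltr_norml; flra.
have -> : G c * (t + h * k.+1%:R - (t + h * k%:R)) - h * G (t + h * k%:R) =
  h * (G c - G (t + h * k%:R)) by rewrite kS; ring.
rewrite normrM (gtr0_norm h0) ler_pM2l//; apply: Ge.
  by rewrite ler_norml; flra.
by rewrite -/h ger0_norm; flra.
Qed.

End riemann_sums.

(** The condition [four_sub] for crosses in all directions. Rotations of the
    plane permute these crosses, so the condition passes to averages over
    rotations. *)
Definition line_sub v z := forall w, rn w = 1 -> forall e : R, 0 < e ->
  exists2 d : R, 0 < d & forall t, 0 < t < d ->
    4 * v z - e * t ^+ 2 <= v (z + t%:C * w) + v (z - t%:C * w)
      + v (z + 'i%C * (t%:C * w)) + v (z - 'i%C * (t%:C * w)).

Lemma four_subD v u z : four_sub v z -> four_sub u z -> four_sub (fun w => v w + u w) z.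
Proof.
move=> vz uz e e0; have e2 : 0 < e / 2 by flra.
have [d d0 dP] := vz _ e2; have [d' d'0 d'P] := uz _ e2.
exists (Num.min d d') => [|t]; first by rewrite lt_min d0.
rewrite lt_min => /andP[t0 /andP[td td']].
have := dP t; have := d'P t; rewrite t0 td td' => /(_ isT) + /(_ isT); rewrite /four; flra.
Qed.

Lemma four_subZ (c : R) v z : 0 <= c -> four_sub v z -> four_sub (fun w => c * v w) z.
Proof.
move=> c0 vz e e0; have c1 : 0 < c + 1 by flra.
have [d d0 dP] := vz _ (divr_gt0 e0 c1); exists d => // t /dP h.
have h1 := ler_wpM2l c0 h.
have h2 : c * (e / (c + 1) * t ^+ 2) <= e * t ^+ 2.
  rewrite mulrA; apply: ler_wpM2r; first exact: sqr_ge0.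
  by rewrite mulrA ler_pdivrMr// mulrC ler_wpM2l ?(ltW e0)//; flra.
rewrite /four -!mulrDr; move: h1; rewrite /four mulrBr; flra.
Qed.

Lemma four_sub_sum n (V : 'I_n -> C -> R) z : (forall i, four_sub (V i) z) ->
  four_sub (fun w => \sum_i V i w) z.
Proof.
elim: n V => [|n IH] V Vz.
  move=> e e0; exists 1 => // t _; rewrite /four !big_ord0.
  have := mulr_ge0 (ltW e0) (sqr_ge0 t); flra.
rewrite (_ : (fun w => _) = fun w => V ord0 w + \sum_i V (lift ord0 i) w).
  by apply: four_subD; [exact: Vz|apply: IH => i; exact: Vz].
by apply/funext => w; rewrite big_ord_recl.
Qed.

Lemma rcont_sum n (V : 'I_n -> C -> R) z : (forall i, rcont (V i) z) ->
  rcont (fun w => \sum_i V i w) z.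
Proof.
elim: n V => [|n IH] V Vz.
  by move=> e e0; exists 1 => // w _; rewrite !big_ord0 subrr normr0.
rewrite (_ : (fun w => _) = fun w => V ord0 w + \sum_i V (lift ord0 i) w).
  by apply: rcontD; [exact: Vz|apply: IH => i; exact: Vz].
by apply/funext => w; rewrite big_ord_recl.
Qed.

Lemma circle_point t r (a : C) : 0 < r -> rn (a + r%:C * edir t - a) = r.
Proof. by move=> r0; rewrite addrAC subrr add0r rnM rn_edir mulr1 rnR gtr0_norm. Qed.

Lemma rcont_circle v a r : 0 < r -> (forall z, rn (z - a) <= r -> rcont v z) ->
  forall t, contRR (fun t => v (a + r%:C * edir t)) t.
Proof.
move=> r0 vc; pose G t := v (a + r%:C * edir t).
have edirc t (e : R) : 0 < e -> exists2 d : R, 0 < d &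
    forall s, `|s - t| < d -> rn (edir s - edir t) < e.
  move=> e0; have e2 : 0 < e / 2 by flra.
  have /cvgrPdist_lt/(_ _ e2)/nbhs_ballP[d /= d0 dP] := @continuous_cos R t.
  have /cvgrPdist_lt/(_ _ e2)/nbhs_ballP[d' /= d'0 d'P] := @continuous_sin R t.
  exists (Num.min d d') => [|s]; first by rewrite lt_min d0.
  rewrite lt_min => /andP[sd sd']; rewrite cptB; apply: le_lt_trans (rn_cpt _ _) _.
  have h1 : `|cos t - cos s| < e / 2 by apply: dP; rewrite /ball/= distrC.
  have h2 : `|sin t - sin s| < e / 2 by apply: d'P; rewrite /ball/= distrC.
  by rewrite (distrC (cos s)) (distrC (sin s)); flra.
have Gc t : contRR G t.
  move=> e e0; have [|d d0 dP] := vc (a + r%:C * edir t) _ e e0; first by rewrite circle_point.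
  have [d' d'0 d'P] := edirc t _ (divr_gt0 d0 r0).
  exists d' => // s /d'P; rewrite ltr_pdivlMr// => h; apply: dP.
  by rewrite opprD addrACA subrr add0r -mulrBr rnM rnR gtr0_norm// mulrC.
by [].
Qed.

Lemma contRR_continuous G : (forall t, contRR G t) -> continuous G.
Proof.
move=> Gc t; apply/cvgrPdist_lt => e /(Gc t)[d d0 dP].
by apply/nbhs_ballP; exists d => //= s; rewrite /ball/= distrC => /dP; rewrite distrC.
Qed.

(** The average of [v] over [n] equidistant rotations is nearly constant on
    the circle, with the circular mean for its value; the maximum principle
    for this average bounds its value at the centre, which is that of [v]. *)
Lemma circle_submean v a r : 0 < r ->
  (forall z, rn (z - a) <= r -> rcont v z) ->
  (forall z, rn (z - a) < r -> line_sub v z) ->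
  exists2 H : R -> R,
    forall t : R, `|t| < 4 * pi -> is_derive t 1 H (v (a + r%:C * edir t)) &
    2 * pi * v a <= H (2 * pi) - H 0.
Proof.
move=> r0 vc vs; pose G t := v (a + r%:C * edir t).
have pi0 := pi_gt0 R.
have Gc := rcont_circle r0 vc; have Gcont := contRR_continuous Gc.
have Gper t : G (t + 2 * pi) = G t by rewrite /G edir2pi.
have [H HG] := continuous_primitive (4 * pi) Gcont.
exists H => //; rewrite -ler_pdivlMl ?mulr_gt0//.
apply/ler_addgt0Pr => /= e e0.
have [d d0 dP] := uniform_continuity (4 * pi) Gc e0.
pose n := Num.bound (2 * pi / d).
have nd : 2 * pi / n.+1%:R < d.
  rewrite ltr_pdivrMr ?ltr0n// -ltr_pdivrMl// [_^-1 * _]mulrC.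
  apply: lt_le_trans (archi_boundP _) _; first by rewrite divr_ge0 ?mulr_ge0// ltW.
  by rewrite ler_nat.
pose om k := edir (2 * pi * k%:R / n.+1%:R).
pose V w := n.+1%:R^-1 * \sum_(k < n.+1) v (a + om k * w).
have rom k : rn (om k) = 1 by exact: rn_edir.
have Va : V 0 = v a.
  rewrite /V (eq_bigr (fun=> v a)) => [|k _]; last by rewrite mulr0 addr0.
  by rewrite sumr_const card_ord -[X in _ * X]mulr_natl mulrA mulVf ?mul1r// pnatr_eq0.
have shift z w k : a + om k * w - (a + om k * z) = om k * (w - z).
  by rewrite opprD addrACA subrr add0r mulrBr.
have shift0 z k : a + om k * z - a = om k * z by rewrite addrAC subrr add0r.
rewrite -Va; apply: (@disc_maximum _ V r) => //; last by rewrite rn0 ltW.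
- move=> z zr; apply: rcontZ; apply: rcont_sum => k eps eps0.
  have [|dd dd0 ddP] := vc (a + om k * z) _ eps eps0; first by rewrite shift0 rnM rom mul1r.
  by exists dd => // w wz; apply: ddP; rewrite shift rnM rom mul1r.
- move=> z zr; apply: four_subZ; first by rewrite invr_ge0.
  apply: four_sub_sum => k eps eps0.
  have [|dd dd0 ddP] := vs (a + om k * z) _ (om k) (rom k) eps eps0.
    by rewrite shift0 rnM rom mul1r.
  exists dd => // t /ddP; rewrite /four.
  rewrite (_ : a + om k * z + t%:C * om k = a + om k * (z + t%:C)); last by ring.
  rewrite (_ : a + om k * z - t%:C * om k = a + om k * (z - t%:C)); last by ring.
  rewrite (_ : a + om k * z + 'i%C * (t%:C * om k) = a + om k * (z + 'i%C * t%:C)); last by ring.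
  by rewrite (_ : a + om k * z - 'i%C * (t%:C * om k) = a + om k * (z - 'i%C * t%:C)); last by ring.
move=> z zr; have [t tpi zE] := polar_form r0 zr.
have tB : `|t| + 2 * pi < 4 * pi by flra.
have := @riemann_sum_le G H (4 * pi) Gper HG t e n tB e0 _.
rewrite (_ : \sum_(k < n.+1) _ = n.+1%:R * V z); last first.
  rewrite /V mulrA mulfV ?mul1r ?pnatr_eq0//; apply: eq_bigr => k _.
  by rewrite /G edirD zE; congr (v _); rewrite /om; ring.
rewrite mulrA divfK ?pnatr_eq0// => h.
have {h} : `|H (2 * pi) - H 0 - 2 * pi * V z| <= 2 * pi * e.
  by apply: h => s s' s'B ss'; apply/ltW/dP => //; exact: le_lt_trans nd.
rewrite ler_norml => /andP[h1 h2].
rewrite -lerBlDr ler_pdivlMl ?mulr_gt0//; rewrite mulrBr; flra.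
Qed.

End circle_means.

(** * Functions with plurisubharmonic logarithm *)

Section logarithm_truncation.
Context {R : realType}.
Implicit Types (rho : R -> R) (x y : R) (N : nat).

(** [lne] of a nonnegative real, truncated from below at [- N]. *)
Definition tln N x : R := ln (Num.max x (expR (- N%:R))).

Lemma max_expR_gt0 N x : 0 < Num.max x (expR (- N%:R)).
Proof. by rewrite lt_max expR_gt0 orbT. Qed.

Lemma tln_ge N x : - N%:R <= tln N x.
Proof.
rewrite /tln -[leLHS]expRK ler_ln ?posrE ?expR_gt0 ?max_expR_gt0//.
by rewrite le_max lexx orbT.
Qed.

Lemma tln_le N x : expR (- N%:R) <= x -> tln N x = ln x.
Proof. by move=> h; rewrite /tln max_l. Qed.

Lemma tlnN N x : x <= expR (- N%:R) -> tln N x = - N%:R.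
Proof. by move=> h; rewrite /tln max_r// expRK. Qed.

Lemma le_tln N x y : x <= y -> tln N x <= tln N y.
Proof.
move=> xy; rewrite /tln ler_ln ?posrE ?max_expR_gt0// ge_max !le_max xy/=.
by rewrite lexx orbT.
Qed.

Lemma ln_le_tln N x : 0 < x -> ln x <= tln N x.
Proof.
move=> x0; rewrite /tln ler_ln ?posrE ?max_expR_gt0//.
by rewrite le_max lexx.
Qed.

Lemma tln_continuous N : continuous (tln N).
Proof.
move=> x; apply: (@continuous_comp _ _ _ (fun x => Num.max x (expR (- N%:R))) (@ln R)).
  apply/cvgrPdist_lt => e e0; apply/nbhs_ballP; exists e => //= y; rewrite /ball/=.
  apply: le_lt_trans; have := ler_norm (x - y); have := ler_norm (y - x).
  rewrite (distrC y x) ler_norml /Num.max; do 2 case: ifPn; rewrite -?leNgt; flra.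
exact: continuous_ln (max_expR_gt0 _ _).
Qed.

(** The truncations decrease to [lne] as [N] grows, so monotone convergence
    applies. *)
Lemma integral_lne_ge rho (c : R) : continuous rho -> (forall t, 0 <= rho t) ->
  (forall N, (c%:E <= \int[lebesgue_measure]_(t in `[0%R, (2 * pi)%R]) (tln N (rho t))%:E)%E) ->
  (c%:E <= \int[lebesgue_measure]_(t in `[0%R, (2 * pi)%R]) lne (rho t)%:E)%E.
Proof.
move=> rhoc rho0 cN; set D : set R := `[0%R, (2 * pi)%R]%classic.
have mD : measurable D by exact: measurable_itv.
pose f t : \bar R := lne (rho t)%:E.
pose g N := EFin \o (fun t : R => tln N (rho t)).
have gc N : continuous (fun t => tln N (rho t)).
  by move=> t; apply: continuous_comp; [exact: rhoc|exact: tln_continuous].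
have gi N : lebesgue_measure.-integrable D (g N).
  apply: continuous_compact_integrable; first exact: segment_compact.
  by apply: continuous_subspaceT => ?; exact: gc.
have gm N := measurable_int _ (gi N).
have posE N : (g N)^\+%E = f^\+%E.
  apply/funext => t; rewrite !funeposE /g /f /=.
  have [h|h] := leP (rho t) (expR (- N%:R)).
    rewrite tlnN// max_r ?lee_fin ?oppr_le0//.
    case: ifPn => [_|]; first by rewrite max_r// leNye.
    rewrite -ltNge => rt; rewrite max_r// lee_fin -ln1 ler_ln ?posrE//.
    by apply: le_trans h _; rewrite -expR0 ler_expR oppr_le0.
  rewrite tln_le ?(ltW h)//; case: ifPn => // rt.
  by have := lt_le_trans h rt; rewrite ltNge expR_ge0.
pose Iq := (\int[lebesgue_measure]_(t in D) f^\+ t)%E.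
have Iq_fin : Iq \is a fin_num.
  rewrite /Iq -(posE 0%N); apply: integrable_pos_fin_num => //; exact: gi.
have pB N : (\int[lebesgue_measure]_(t in D) (g N)^\- t <= Iq - c%:E)%E.
  have := cN N; rewrite -/(g N) integralE posE -/Iq.
  have := integral_ge0 lebesgue_measure (fun t _ => funeneg_ge0 (g N) t) (D := D).
  case: (\int[_]_(_ in _) _)%E => [r| |]; move: Iq_fin; case: Iq => // q _ _.
  by rewrite -!EFinB !lee_fin; flra.
have neg_lim t : (g N)^\-%E t @[N --> \oo] --> f^\-%E t.
  have [rt|rt] := leP (rho t) 0.
    have -> : f^\-%E t = +oo%E by rewrite funenegE /f /= rt /= max_l// leey.
    apply/cvgeyPge => A; exists (Num.bound `|A|) => // N /= AN.
    rewrite funenegE /g /= tlnN; last by apply: le_trans rt _; exact: expR_ge0.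
    rewrite opprK le_max lee_fin; apply/orP; left.
    apply: le_trans (ler_norm A) _; apply: le_trans (ltW (archi_boundP (normr_ge0 A))) _.
    by rewrite ler_nat.
  apply: cvg_near_cst; exists (Num.bound `|ln (rho t)|) => // N /= AN.
  rewrite !funenegE /g /f /= leNgt rt /= tln_le//.
  rewrite -[leRHS]lnK ?posrE// ler_expR lerNl.
  apply: le_trans (ler_norm _) _; rewrite normrN.
  apply: le_trans (ltW (archi_boundP (normr_ge0 _))) _.
  by rewrite ler_nat.
have mono : (\int[lebesgue_measure]_(t in D) (g N)^\-%E t)%E @[N --> \oo] -->
    (\int[lebesgue_measure]_(t in D) f^\-%E t)%E.
  have -> : (\int[lebesgue_measure]_(t in D) f^\-%E t)%E =
      (\int[lebesgue_measure]_(t in D) limn (fun N => (g N)^\-%E t))%E.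
    by apply: eq_integral => t _; apply/esym/cvg_lim => //; exact: neg_lim.
  apply: cvg_monotone_convergence => //.
  - by move=> N; exact: measurable_funeneg.
  - move=> t _ m n mn /=; rewrite !funenegE ge_max !le_max lexx orbT andbT.
    apply/orP; left.
    rewrite /g /= lee_fin lerN2 /tln ler_ln ?posrE ?max_expR_gt0//.
    rewrite ge_max !le_max lexx/=; apply/orP; right.
    by rewrite ler_expR lerN2 ler_nat.
have negB : (\int[lebesgue_measure]_(t in D) f^\-%E t <= Iq - c%:E)%E.
  rewrite -(cvg_lim _ mono)//; apply: lime_le; first exact: cvgP mono.
  by apply: nearW => N; exact: pB.
rewrite integralE; have := integral_ge0 lebesgue_measure (fun t _ => funeneg_ge0 f t) (D := D).
move: negB; set J := (\int[_]_(_ in _) _)%E => JI J0; change (c%:E <= Iq - J)%E.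
move: J0 JI Iq_fin; clear; case: J => [r| |] //; case: Iq => // q _.
by rewrite -!EFinB !lee_fin => + _; flra.
Qed.

End logarithm_truncation.

Arguments cinv {R M} c _.
Arguments crange {R M} c _.

Section logarithms_of_norms.
Context {R : realType}.
Local Notation C := R[i].
Implicit Types (s : C -> R) (z a : C) (r M : R).

(** The infinitesimal form of the subharmonicity of [ln s] at [z], up to an
    error of second order, with four points on each circle. *)
Definition log_four s z := 0 < s z -> forall w, rn w = 1 -> forall e : R, 0 < e ->
  exists2 d : R, 0 < d & forall t, 0 < t < d ->
    [/\ 0 < s (z + t%:C * w), 0 < s (z - t%:C * w),
        0 < s (z + 'i%C * (t%:C * w)), 0 < s (z - 'i%C * (t%:C * w))
      & 4 * ln (s z) - e * t ^+ 2 <= ln (s (z + t%:C * w)) + ln (s (z - t%:C * w))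
          + ln (s (z + 'i%C * (t%:C * w))) + ln (s (z - 'i%C * (t%:C * w)))].

(** Where the truncation is active, the value at the centre is the minimum;
    elsewhere truncation only increases the other four values. *)
Lemma tln_line_sub N s z : log_four s z -> line_sub (fun z => tln N (s z)) z.
Proof.
move=> sz w w1 e e0; have [h|h] := leP (s z) (expR (- N%:R)).
  exists 1 => // t _; rewrite [tln N (s z)]tlnN//.
  have := tln_ge N (s (z + t%:C * w)); have := tln_ge N (s (z - t%:C * w)).
  have := tln_ge N (s (z + 'i%C * (t%:C * w))); have := tln_ge N (s (z - 'i%C * (t%:C * w))).
  have : 0 <= e * t ^+ 2 by rewrite mulr_ge0 ?sqr_ge0// ltW.
  flra.
have [|d d0 dP] := sz _ w w1 e e0; first exact: lt_trans (expR_gt0 _) h.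
exists d => // t /dP[h1 h2 h3 h4 h5]; rewrite [tln N (s z)](tln_le (ltW h)).
have := ln_le_tln N h1; have := ln_le_tln N h2.
have := ln_le_tln N h3; have := ln_le_tln N h4; move: h5; flra.
Qed.

Lemma rcont_tln N s z : rcont s z -> rcont (fun z => tln N (s z)) z.
Proof.
move=> sz e e0.
have /cvgrPdist_lt/(_ _ e0)/nbhs_ballP[d /= d0 dP] := @tln_continuous R N (s z).
have [d' d'0 d'P] := sz d d0; exists d' => // w /d'P h.
by rewrite distrC; apply: dP; rewrite /ball/= distrC.
Qed.

Lemma le_lne_EFin (x y : R) : 0 <= x -> x <= y -> (lne x%:E <= lne y%:E)%E.
Proof.
move=> x0 xy; rewrite lee_lne ?lee_fin// in_itv/= lee_fin leey andbT//.
exact: le_trans xy.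
Qed.

Lemma lne_ltE (x a : R) : (lne x%:E < a%:E)%E = (x < expR a).
Proof.
have [h|h] := leP x 0; first by rewrite le0_lneNy ?ltNyr// (le_lt_trans h) ?expR_gt0.
by rewrite lne_EFin// lte_fin -(ltr_expR (ln x)) lnK.
Qed.

Lemma log_circle_mean s a r : 0 < r -> (forall z, 0 <= s z) ->
  (forall z, rn (z - a) <= r -> rcont s z) ->
  (forall z, rn (z - a) < r -> log_four s z) ->
  (lne (s a)%:E <= circle_mean (fun z => lne (s z)%:E) a r)%E.
Proof.
move=> r0 s0 sc s4; have [sa|sa] := leP (s a) 0; first by rewrite le0_lneNy ?leNye.
have pi0 := pi_gt0 R; have tpi0 : 0 < 2 * pi :> R by flra.
rewrite lne_EFin// /circle_mean lee_pdivlMl// -EFinM.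
have cont := contRR_continuous (rcont_circle r0 sc).
apply: (integral_lne_ge (rho := fun t => s (a + r%:C * edir t))) => // N.
have tc z : rn (z - a) <= r -> rcont (fun z => tln N (s z)) z.
  by move=> /sc; exact: rcont_tln.
have Gc := contRR_continuous (rcont_circle r0 tc).
have [H HG HM] := circle_submean r0 tc (fun z zr => tln_line_sub N (s4 z zr)).
rewrite (@continuous_FTC2 _ _ H)//.
- rewrite -EFinB lee_fin; apply: le_trans HM.
  by rewrite ler_pM2l//; exact: ln_le_tln.
- by apply: continuous_subspaceT => t; exact: Gc.
- have dH t : `|t| < 4 * pi -> derivable H t 1 by move=> /HG[].
  split=> [t /[!in_itv]/= /andP[t0 t1]||].
  + by apply: dH; rewrite ger0_norm; flra.
  + apply: cvg_at_right_filter; apply/differentiable_continuous/derivable1_diffP.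
    by apply: dH; rewrite normr0; flra.
  + apply: cvg_at_left_filter; apply/differentiable_continuous/derivable1_diffP.
    by apply: dH; rewrite ger0_norm; flra.
- move=> t /[!in_itv]/= /andP[t0 t1]; rewrite derive1E.
  by have [_ ->] : is_derive t 1 H (tln N (s (a + r%:C * edir t))) by
    apply: HG; rewrite ger0_norm; flra.
Qed.

(** The circular mean is at least the value at the centre, which is the
    largest one; so the function is constant on the circle. *)
Lemma log_circle_max s a r (M : R) : 0 < r -> 0 < M -> s a = M ->
  (forall z, rn (z - a) <= r -> s z <= M) ->
  (forall z, rn (z - a) <= r -> rcont s z) ->
  (forall z, rn (z - a) < r -> log_four s z) ->
  s (a - r%:C) = M.
Proof.
move=> r0 M0 saM sM sc s4; have pi0 := pi_gt0 R.
pose N := Num.bound `|ln M|; have NM : expR (- N%:R) < M.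
  rewrite -[ltRHS]lnK ?posrE// ltr_expR ltrNl.
  apply: le_lt_trans (archi_boundP (normr_ge0 _)).
  by rewrite -normrN ler_norm.
have tM z : rn (z - a) <= r -> tln N (s z) <= ln M.
  by move=> /sM h; rewrite -(tln_le (ltW NM)); exact: le_tln.
have tc z : rn (z - a) <= r -> rcont (fun z => tln N (s z)) z.
  by move=> /sc; exact: rcont_tln.
have [H HG HM] := circle_submean r0 tc (fun z zr => tln_line_sub N (s4 z zr)).
move: HM; rewrite saM tln_le ?(ltW NM)// => HM.
have Hder (t : R) : `|t| < 4 * pi ->
    is_derive t 1 (fun t : R => H t - t * ln M) (tln N (s (a + r%:C * edir t)) - ln M).
  move=> /HG h; apply: is_derive_eq.
  rewrite scaler0 ?add0r ?addr0.
  by rewrite /GRing.scale /= mulr1.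
have mono (t t' : R) : 0 <= t -> t <= t' -> t' <= 2 * pi -> H t' - t' * ln M <= H t - t * ln M.
  move=> t0; rewrite le_eqVlt => /predU1P[->//|tt'] t'pi.
  have [|x /andP[x1 x2] E] := @real_mean_value R (fun t : R => H t - t * ln M) (fun t => tln N (s (a + r%:C * edir t)) - ln M) t t' tt'.
    by move=> x /andP[x1 x2]; apply: Hder; rewrite ger0_norm; flra.
  rewrite -subr_le0 E; apply: mulr_le0_ge0; last by flra.
  by rewrite subr_le0; apply: tM; rewrite circle_point.
have [|_ d1] := Hder pi; first by rewrite ger0_norm; flra.
have [_ d2] : is_derive (pi : R) 1 (fun t : R => H t - t * ln M) 0.
  apply: (@derive1_at_max _ _ 0 (2 * pi)).
  - by flra.
  - move=> t /[!in_itv]/= /andP[t0 t1].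
    by have [|] := Hder t; first by rewrite ger0_norm; flra.
  - by rewrite in_itv/=; flra.
  - move=> t /[!in_itv]/= /andP[t0 t1].
    have := mono 0 t (lexx _) (ltW t0) (ltW t1).
    rewrite mul0r subr0; have : pi <= 2 * pi :> R by flra.
    by move=> h; have := mono pi (2 * pi) (ltW pi0) h (lexx _); flra.
move: d1; rewrite d2 => /esym/eqP; rewrite subr_eq0.
have -> : edir pi = -1 :> C by rewrite /edir cospi sinpi cptE; rewrite rmorphN1 mulr0 addr0.
rewrite mulrN1 => /eqP; move/ln_inj; rewrite !posrE max_expR_gt0 => /(_ isT M0).
by rewrite /Num.max; case: ifP => // _ E; move: NM; rewrite E ltxx.
Qed.

Variables (S : manifold R) (rho : S -> R).
Hypotheses (rho0 : forall x, 0 <= rho x) (rhoc : continuous rho).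

Definition log_four_points := forall (c : chart R S) (p b : model c),
  atlas c -> crange c p -> 0 < rho (cinv c p) -> forall e : R, 0 < e ->
  exists2 d : R, 0 < d & forall t, 0 < t < d ->
    [/\ 0 < rho (cinv c (p + t%:C *: b)), 0 < rho (cinv c (p - t%:C *: b)),
        0 < rho (cinv c (p + 'i%C *: (t%:C *: b))), 0 < rho (cinv c (p - 'i%C *: (t%:C *: b)))
      & 4 * ln (rho (cinv c p)) - e * t ^+ 2 <=
          ln (rho (cinv c (p + t%:C *: b))) + ln (rho (cinv c (p - t%:C *: b)))
          + ln (rho (cinv c (p + 'i%C *: (t%:C *: b))))
          + ln (rho (cinv c (p - 'i%C *: (t%:C *: b))))].

Hypothesis rho4 : log_four_points.

Let disc (c : chart R S) (p b : model c) z := rho (cinv c (p + z *: b)).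

Let log_four_disc c (p b : model c) z : atlas c -> crange c (p + z *: b) ->
  log_four (disc p b) z.
Proof.
move=> ca pz sz w w1 e e0; have [d d0 dP] := rho4 (w *: b) ca pz sz e0.
exists d => // t /dP; rewrite /disc.
rewrite (_ : p + (z + t%:C * w) *: b = p + z *: b + t%:C *: (w *: b)); last by lmod_over R[i].
rewrite (_ : p + (z - t%:C * w) *: b = p + z *: b - t%:C *: (w *: b)); last by lmod_over R[i].
rewrite (_ : p + (z + 'i%C * (t%:C * w)) *: b = p + z *: b + 'i%C *: (t%:C *: (w *: b))); last by lmod_over R[i].
by rewrite (_ : p + (z - 'i%C * (t%:C * w)) *: b = p + z *: b - 'i%C *: (t%:C *: (w *: b))); last by lmod_over R[i].
Qed.

Let rcont_disc c (p b : model c) z : crange c (p + z *: b) -> rcont (disc p b) z.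
Proof.
move=> pz e e0.
have : nbhs (cinv c (p + z *: b)) [set x | `|rho x - rho (cinv c (p + z *: b))| < e].
  by have /cvgrPdist_lt/(_ _ e0) := rhoc (x := cinv c (p + z *: b)); apply: filterS => x; rewrite distrC.
move=> /(cinv_continuous pz)/nbhs_rnP[d d0 dP].
have b1 : 0 < rn b + 1 by have := rn_ge0 b; flra.
exists (d / (rn b + 1)) => [|w]; first exact: divr_gt0.
rewrite ltr_pdivlMr// => wz; apply: dP.
rewrite (_ : _ - _ = (w - z) *: b); last by lmod_over R[i].
rewrite rnZ; apply: le_lt_trans wz; apply: ler_wpM2l; first exact: rn_ge0.
by flra.
Qed.

Lemma log_plurisubharmonic : plurisubharmonic (fun x : S => lne (rho x)%:E).
Proof.
split.
- by move=> x; have [h|h] := leP (rho x) 0; [rewrite le0_lneNy|rewrite lne_EFin ?ltry].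
- move=> x _ a xa; have {}xa : rho x < expR a.
    by rewrite -lne_ltE.
  have e0 : 0 < expR a - rho x by rewrite subr_gt0.
  have /cvgrPdist_lt/(_ _ e0) := rhoc (x := x).
  by apply: filterS => y; rewrite lne_ltE ltr_norml => /andP[+ _]; flra.
- move=> c ca a b; split.
  + by move=> z _; have [h|h] := leP (rho (cinv c (a + z *: b))) 0;
      [rewrite le0_lneNy|rewrite lne_EFin ?ltry].
  + move=> z /= az x xa; have {}xa : disc a b z < expR x.
      by rewrite -lne_ltE.
    have e0 : 0 < expR x - disc a b z by rewrite subr_gt0.
    have [d d0 dP] := rcont_disc az e0; apply/nbhs_rnP; exists d => // w /dP.
    rewrite -/(disc a b w) ltr_norml => /andP[_ wa].
    by rewrite lne_ltE; flra.
  + move=> z r r0 zr; apply: (log_circle_mean (s := disc a b)) => //.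
    * by move=> w; exact: rho0.
    * by move=> w wz; apply/rcont_disc/zr; rewrite -rn_le.
    * by move=> w wz; apply: log_four_disc => //; apply: zr; rewrite -rn_le ltW.
Qed.

(** The set where [rho] attains its maximum over [U] is open, because of the
    previous lemma applied to discs centred there, and closed in [U]. *)
Lemma log_maximum_principle : maximum_principle (fun x : S => lne (rho x)%:E).
Proof.
move=> U oU cU; rewrite precompactE => kU [y0 [y0U y0N]] a bU s sU.
have clU : U `<=` closure U by exact: subset_closure.
have [|p /set_mem pU pmax] := compact_EVT_max (f := rho) _ kU (continuous_subspaceT rhoc).
  by exists y0.
have {}pmax t : closure U t -> rho t <= rho p by move=> tU; apply: pmax; exact: mem_set.
have top y : (closure U `\` U) y -> rho y = rho p -> (lne (rho s)%:E <= a)%E.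
  move=> yb yp; apply: le_trans (bU y yb).
  by apply: le_lne_EFin => //; rewrite yp; apply: pmax; exact: clU.
have [ps|ps] := leP (rho p) 0.
  apply: (top y0) => //; apply/eqP; rewrite eq_le pmax//=.
  exact: le_trans ps _.
have [pU'|pU'] := pselect (U p); last exact: (top p).
pose B : set S := U `&` [set x | rho x = rho p].
have cB : closed [set x | rho x = rho p].
  rewrite (_ : [set x | _] = rho @^-1` [set rho p]); last by [].
  by apply: closed_comp => [x _|]; [exact: rhoc|exact: closed_eq].
have Bopen x : B x -> nbhs x [set y | rho y = rho p].
  move=> [xU xp]; pose c := chart_at x; have xc := chart_at_dom x : cdom c x.
  have ca : atlas c := chart_at_atlas x.
  pose q := cmap c x; have qc : crange c q by exists x.
  have qK : cinv c q = x by exact: cmapK.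
  have n1 : nbhs q (crange c) by apply: open_nbhs_nbhs; split=> //; exact: crange_open.
  have n2 : nbhs q (cinv c @^-1` U).
    by apply: (cinv_continuous qc); rewrite qK; apply: open_nbhs_nbhs.
  have [d d0 dP] := (nbhs_rnP _ _).1 (filterI n1 n2).
  have ball y : rn (y - q) < d -> rho (cinv c y) = rho p.
    move=> yd; pose b := q - y.
    have bz z : rn (z - 0) <= 1 -> rn (q + z *: b - q) < d.
      rewrite subr0 => z1; rewrite addrAC subrr add0r rnZ.
      apply: le_lt_trans yd; rewrite rnBC -[leRHS]mul1r.
      by apply: ler_wpM2r => //; exact: rn_ge0.
    have := @log_circle_max (disc q b) 0 1 (rho p) ltr01 ps.
    rewrite /disc scale0r addr0 qK sub0r (_ : q + _ = y); last by rewrite /b; lmod_over R[i].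
    apply=> // z z1.
    - by apply/pmax/clU; have [] := dP _ (bz z z1).
    - by apply: rcont_disc; have [] := dP _ (bz z z1).
    - by apply: log_four_disc => //; have [] := dP _ (bz z (ltW z1)).
  have n3 : nbhs x (cdom c) by apply: open_nbhs_nbhs; split=> //; exact: cdom_open.
  have n4 : nbhs x (cmap c @^-1` [set y | rn (y - q) < d]).
    by apply: (cmap_continuous xc); apply/nbhs_rnP; exists d.
  by apply: filterS (filterI n3 n4) => y [yc /ball]; rewrite cmapK.
have BU : B = U.
  apply: cU; first by exists p.
  - exists [set x | rho x = rho p]^°; first exact: open_interior.
    apply/seteqP; split=> x [xU xp]; split=> //; first exact: Bopen.
    by apply: interior_subset xp.
  - by exists [set x | rho x = rho p].
apply: (top y0) => //; have : closure U `<=` [set x | rho x = rho p].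
  by rewrite [X in _ `<=` X](closure_id _).1// -BU; apply: closure_subset => ? [].
by apply.
Qed.

End logarithms_of_norms.

(** * Maps of class C^k on finite dimensional spaces *)

Section directional_derivatives.
Context {R : realType}.
Local Notation C := R[i].
Implicit Types (V W : normedModType C).

(** The relational form of [rderivable] and [rderive]: it can be derived by
    rules, without knowing beforehand that the limit exists. *)
Definition isdd V W (f : V -> W) x v l := isrd (fun t : R => f (x + t%:C *: v)) 0 l.

Lemma isddP V W (f : V -> W) x v l : isdd f x v l <->
  forall e : R, 0 < e -> exists2 d : R, 0 < d &
    forall t : R, `|t| < d -> rn (f (x + t%:C *: v) - f x - t%:C *: l) <= e * `|t|.
Proof.
by split=> h e /h[d d0 dP]; exists d => // t /dP; rewrite add0r scale0r addr0.
Qed.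

Lemma isdd_lipschitz V W (f : V -> W) x v v' l l' (L d : R) : 0 < d ->
  (forall t : R, `|t| < d -> rn (f (x + t%:C *: v) - f (x + t%:C *: v')) <= L * `|t|) ->
  isdd f x v l -> isdd f x v' l' -> rn (l - l') <= L.
Proof.
move=> d0 fL /isddP fl /isddP fl'; have := ler_addgt0Pr => /= h; apply/h => {h} e e0.
have e2 : 0 < e / 2 by flra.
have [d1 d10 d1P] := fl _ e2; have [d2 d20 d2P] := fl' _ e2.
pose t := Num.min d (Num.min d1 d2) / 2.
have m0 : 0 < Num.min d (Num.min d1 d2) by rewrite !lt_min d0 d10.
have t0 : 0 < t by rewrite /t; flra.
have : t < Num.min d (Num.min d1 d2) by rewrite /t; flra.
rewrite !lt_min => /and3P[td td1 td2].
have := fL t; have := d1P t; have := d2P t; rewrite !gtr0_norm// => /(_ td2) h2 /(_ td1) h1 /(_ td) h.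
rewrite -(ler_pM2l t0) -[t in t * rn _](ger0_norm (ltW t0)) -rnR -rnZ.
rewrite (_ : t%:C *: (l - l') = f (x + t%:C *: v) - f (x + t%:C *: v')
   - (f (x + t%:C *: v) - f x - t%:C *: l) + (f (x + t%:C *: v') - f x - t%:C *: l')); last by lmod_over R[i].
apply: le_trans (rnD _ _) _; apply: le_trans (lerD (rnB _ _) (lexx _)) _.
by rewrite mulrDr [t * L]mulrC; flra.
Qed.

Lemma isdd_unique V W (f : V -> W) x v l l' : isdd f x v l -> isdd f x v l' -> l = l'.
Proof.
move=> fl fl'; apply/eqP; rewrite -subr_eq0 -rn_eq0 eq_le rn_ge0 andbT.
apply: (isdd_lipschitz ltr01 _ fl fl') => t _.
by rewrite subrr rn0 mul0r.
Qed.

Lemma rderivable_isdd V W (f : V -> W) v x : rderivable f v x -> isdd f x v (rderive f v x).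
Proof.
move=> fx; apply/isddP => e e0.
have /cvg_rnP/(_ _ e0)/nbhs_ballP[d /= d0 dP] :
  rquot f v x @ (0 : R)^' --> rderive f v x by exact: fx.
exists d => // t td; have [->|t0] := eqVneq t 0.
  by rewrite scale0r addr0 scale0r !subrr rn0 normr0 mulr0.
have tC : t%:C != 0 by rewrite fmorph_eq0.
have -> : f (x + t%:C *: v) - f x - t%:C *: rderive f v x =
    t%:C *: (rquot f v x t - rderive f v x).
  by rewrite scalerBr /rquot scalerA mulfV// scale1r.
rewrite rnZ rnR mulrC; apply: ler_wpM2r => //; apply/ltW/dP => //.
by rewrite /ball/= sub0r normrN.
Qed.

Lemma isdd_rderivable V W (f : V -> W) v x l :
  isdd f x v l -> rderivable f v x /\ rderive f v x = l.
Proof.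
move=> /isddP fl; have fx : rquot f v x @ (0 : R)^' --> l.
  apply/cvg_rnP => e e0; have e2 : 0 < e / 2 by flra.
  have [d d0 dP] := fl _ e2; apply/nbhs_ballP; exists d => // t.
  rewrite /ball/= sub0r normrN => td t0.
  have tC : t%:C != 0 by rewrite fmorph_eq0.
  have h : 0 < `|t| by rewrite normr_gt0.
  rewrite -(ltr_pM2l h) -[in ltLHS]rnR -rnZ scalerBr /rquot scalerA mulfV// scale1r.
  by apply: le_lt_trans (dP t td) _; rewrite mulrC ltr_pM2l//; flra.
split; first by apply: cvgP fx.
by apply: cvg_lim => //; exact: norm_hausdorff.
Qed.

Lemma isdd_isrd V W (f : V -> W) x v (t : R) l :
  isdd f (x + t%:C *: v) v l -> isrd (fun t : R => f (x + t%:C *: v)) t l.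
Proof.
move=> /isddP fl e /fl[d d0 dP]; exists d => // s /dP.
by rewrite rmorphD scalerDl addrA.
Qed.

Lemma isdd_near V W (f g : V -> W) x v l (d : R) : 0 < d ->
  (forall y, rn (y - x) < d -> f y = g y) -> isdd f x v l -> isdd g x v l.
Proof.
move=> d0 fg /isddP fl; apply/isddP => e /fl[d1 d10 d1P].
have v1 : 0 < rn v + 1 by have := rn_ge0 v; flra.
exists (Num.min d1 (d / (rn v + 1))); first by rewrite lt_min d10 divr_gt0.
move=> t; rewrite lt_min ltr_pdivlMr// => /andP[t1 td].
rewrite -!fg ?subrr ?rn0//; first exact: d1P.
rewrite addrAC subrr add0r rnZ rnR; apply: le_lt_trans td.
by apply: ler_wpM2l => //; flra.
Qed.

Lemma differentiable_isdd V W (f : V -> W) x v : differentiable f x -> isdd f x v ('d f x v).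
Proof.
move=> /differentiable_fder fx; apply/isddP => e e0.
have v1 : 0 < rn v + 1 by have := rn_ge0 v; flra.
have [d d0 dP] := fx _ (divr_gt0 e0 v1); exists (d / (rn v + 1)); first exact: divr_gt0.
move=> t; rewrite ltr_pdivlMr// => td.
have h : rn (t%:C *: v) <= `|t| * (rn v + 1).
  by rewrite rnZ rnR; apply: ler_wpM2l => //; flra.
have := dP (t%:C *: v) (le_lt_trans h td); rewrite linearZ/= => h2.
apply: le_trans h2 _; rewrite -mulrA; apply: ler_wpM2l; first exact: ltW.
by rewrite ler_pdivrMl// mulrC.
Qed.

Lemma isddZl W V (f : V -> W) (a : C) x v l : isdd f x v l -> isdd (fun y => a *: f y) x v (a *: l).
Proof. exact: isrdZ. Qed.

Lemma isddD W V (f g : V -> W) x v l m : isdd f x v l -> isdd g x v m ->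
  isdd (fun y => f y + g y) x v (l + m).
Proof. exact: isrdD. Qed.

Definition near_lipschitz V W (f : V -> W) x := exists L d : R, [/\ 0 < L, 0 < d &
  forall y z, rn (y - x) < d -> rn (z - x) < d -> rn (f y - f z) <= L * rn (y - z)].

(** A chain rule fails for directional derivatives alone; that [f] is
    Lipschitz allows replacing the curve [tau] by its tangent. *)
Lemma isdd_comp V' V W (f : V -> W) (tau : V' -> V) p X Y l :
  near_lipschitz f (tau p) -> isdd tau p X Y -> isdd f (tau p) Y l -> isdd (f \o tau) p X l.
Proof.
move=> [L [d [L0 d0 dP]]] /isddP tY /isddP fl; apply/isddP => e e0.
have e2 : 0 < e / 2 by flra.
have [d1 d10 d1P] := tY _ (divr_gt0 e2 L0); have [d2 d20 d2P] := fl _ e2.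
have [d3 d30 d3P] := tY _ ltr01.
have Y1 : 0 < rn Y + 1 by have := rn_ge0 Y; flra.
exists (Num.min (Num.min d1 d2) (Num.min d3 (d / (rn Y + 1)))).
  by rewrite !lt_min d10 d20 d30 divr_gt0.
move=> t; rewrite !lt_min ltr_pdivlMr// => /andP[/andP[t1 t2] /andP[t3 t4]] /=.
have hY : rn (tau p + t%:C *: Y - tau p) < d.
  rewrite addrAC subrr add0r rnZ rnR; apply: le_lt_trans t4.
  by apply: ler_wpM2l => //; flra.
have hX : rn (tau (p + t%:C *: X) - tau p) < d.
  rewrite (_ : _ - _ = tau (p + t%:C *: X) - tau p - t%:C *: Y + t%:C *: Y); last by lmod_over R[i].
  apply: le_lt_trans (rnD _ _) _; rewrite rnZ rnR.
  by have := d3P t t3; move: t4; rewrite mulrDr; flra.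
have E (a b c u : W) : a - b - c = a - u + (u - b - c) by lmod_over R[i].
rewrite (E _ _ _ (f (tau p + t%:C *: Y))).
apply: le_trans (rnD _ _) _; rewrite [e in leRHS]splitr mulrDl; apply: lerD; last exact: d2P.
apply: le_trans (dP _ _ hX hY) _.
rewrite opprD addrA; apply: le_trans (ler_wpM2l (ltW L0) (d1P t t1)) _.
by rewrite mulrA mulrCA mulfV ?mulr1// gt_eqF.
Qed.

End directional_derivatives.

Section Ck_calculus.
Context {R : realType}.
Local Notation C := R[i].
Implicit Types (V W : normedModType C).

Lemma Ck_leS k V W (O : set V) (f : V -> W) : Ck k.+1 O f -> Ck k O f.
Proof.
elim: k f => [|k IHk] f [fc fd]; first by split.
by split=> // v; split; [exact: (fd v).1|apply/IHk/(fd v).2].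
Qed.

Lemma Ck0_continuous V W (O : set V) (f : V -> W) k x : Ck k O f -> O x -> {for x, continuous f}.
Proof. by case: k => [|k] [+ _]; exact. Qed.

Lemma open_rnP V (O : set V) x : open O -> O x -> exists2 d : R, 0 < d & forall y, rn (y - x) < d -> O y.
Proof. by move=> oO Ox; apply/nbhs_rnP/open_nbhs_nbhs. Qed.

Lemma Ck1_isdd V W (O : set V) (f : V -> W) x v : Ck 1 O f -> O x -> isdd f x v (rderive f v x).
Proof. by move=> [_ /(_ v)[fd _]] Ox; apply/rderivable_isdd/fd. Qed.

Lemma Ck1_continuous V W (O : set V) (f : V -> W) x v : Ck 1 O f -> O x ->
  {for x, continuous (rderive f v)}.
Proof. by move=> [_ /(_ v)[_ [fd _]]] Ox; exact: fd. Qed.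

Lemma Ck1_intro V W (O : set V) (f : V -> W) (D : V -> V -> W) : open O ->
  (forall x, O x -> {for x, continuous f}) ->
  (forall x v, O x -> isdd f x v (D v x)) ->
  (forall x v, O x -> {for x, continuous (D v)}) -> Ck 1 O f.
Proof.
move=> oO fc fD Dc; split=> // v; split=> [x Ox|].
  by have [] := isdd_rderivable (fD x v Ox).
have fE x : O x -> rderive f v x = D v x.
  by move=> Ox'; have [] := isdd_rderivable (fD x v Ox').
split=> // x Ox; apply/continuous_rnP => e e0.
have [d d0 dP] := open_rnP oO Ox.
have [d1 d10 d1P] := (continuous_rnP _ _).1 (Dc x v Ox) e e0.
exists (Num.min d d1) => [|y]; first by rewrite lt_min d0.
rewrite lt_min => /andP[/dP Oy /d1P]; by rewrite !fE.
Qed.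

Lemma line_in_ball V (x y v : V) (d t s : R) :
  rn (y - x) < d / 2 -> `|t| * (rn v + 1) < d / 2 -> `|s| <= `|t| -> rn (y + s%:C *: v - x) < d.
Proof.
move=> yx td st; rewrite addrAC; apply: le_lt_trans (rnD _ _) _; rewrite rnZ rnR.
have : `|s| * rn v <= `|t| * (rn v + 1).
  by apply: ler_pM => //; [exact: rn_ge0|flra].
flra.
Qed.

Lemma Ck1_real_step V W (O : set V) (f : V -> W) x v : open O -> Ck 1 O f -> O x ->
  exists B d : R, [/\ 0 < B, 0 < d & forall y (t : R), rn (y - x) < d -> `|t| < d ->
    rn (f (y + t%:C *: v) - f y) <= B * `|t|].
Proof.
move=> oO f1 Ox; have [d d0 dP] := open_rnP oO Ox.
have [d1 d10 d1P] := (continuous_rnP _ _).1 (Ck1_continuous (v := v) f1 Ox) 1 ltr01.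
pose m := Num.min d d1; have m0 : 0 < m by rewrite lt_min d0.
have v1 : 0 < rn v + 1 by have := rn_ge0 v; flra.
exists (rn (rderive f v x) + 1), (Num.min (m / 2) (m / 2 / (rn v + 1))).
have m2 : 0 < m / 2 by flra.
split; [by have := rn_ge0 (rderive f v x); flra|by rewrite lt_min m2 divr_gt0|].
move=> y t; rewrite !lt_min => /andP[yx _] /andP[_]; rewrite ltr_pdivlMr// => tv.
have ins (s : R) : Num.min 0 t <= s <= Num.max 0 t -> rn (y + s%:C *: v - x) < m.
  move=> st; apply: line_in_ball yx tv _; move: st.
  by case: (leP 0 t) => t0 /andP[s0 s1]; [rewrite !ger0_norm|rewrite !ler0_norm]; flra.
have := @mean_value_sym _ _ (fun s : R => f (y + s%:C *: v)) (fun s : R => rderive f v (y + s%:C *: v)) 0 t.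
rewrite scale0r addr0 subr0; apply=> s /ins; rewrite lt_min => /andP[sd sd1].
  by apply: isdd_isrd; apply: Ck1_isdd f1 _; exact: dP.
have := d1P _ sd1; have := ler_rnB (rderive f v (y + s%:C *: v)) (rderive f v x); flra.
Qed.

(** One passes from a point to another one parallel to the real coordinate
    axes, one axis at a time, and uses the mean value inequality on each
    segment. *)
Lemma Ck1_lipschitz V W (O : set V) (f : V -> W) x : finite_dim_space V ->
  open O -> Ck 1 O f -> O x -> near_lipschitz f x.
Proof.
move=> /finite_dim_coordinates[n [b [lam [K [_ lamK lamE]]]]] oO f1 Ox.
have steps : exists L d : R, [/\ 0 < L, 0 < d & forall y (a : 'I_n -> C) (m : R),
    rn (y - x) < d -> 0 <= m < d -> (forall i, rn (a i) <= m) ->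
    rn (f (y + \sum_i a i *: b i) - f y) <= L * m].
  elim: n b {lam lamK lamE} => [|n IHn] b.
    exists 1, 1; split=> // y a m _ /andP[m0 _] _; rewrite big_ord0 addr0 subrr rn0.
    by rewrite mul1r.
  have [L [d [L0 d0 dP]]] := IHn (fun i => b (widen_ord (leqnSn n) i)).
  pose v := b ord_max.
  have [B1 [d1 [B10 d10 d1P]]] := Ck1_real_step v oO f1 Ox.
  have [B2 [d2 [B20 d20 d2P]]] := Ck1_real_step ('i%C *: v) oO f1 Ox.
  pose N := \sum_(i < n) rn (b (widen_ord (leqnSn n) i)) + rn v + 1.
  have N1 : 1 <= N by rewrite lerDr addr_ge0 ?rn_ge0// sumr_ge0// => i _; exact: rn_ge0.
  have N0 : 0 < N by flra.
  pose q := Num.min d (Num.min d1 d2).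
  have q0 : 0 < q by rewrite !lt_min d0 d10.
  exists (L + B1 + B2), (q / (2 * N)); split; first by flra.
    by rewrite divr_gt0// mulr_gt0.
  move=> y a m; have h2N : 0 < 2 * N by flra.
  rewrite !ltr_pdivlMr// => yq /andP[m0 mq] am.
  have m2N : m <= m * (2 * N) by rewrite ler_peMr//; flra.
  have : m < q by flra.
  rewrite !lt_min => /and3P[md md1 md2].
  have yN : rn (y - x) * 2 < q.
    apply: le_lt_trans yq; apply: ler_wpM2l; [exact: rn_ge0|flra].
  pose y1 := y + \sum_(i < n) a (widen_ord (leqnSn n) i) *: b (widen_ord (leqnSn n) i).
  pose y2 := y1 + (complex.Re (a ord_max))%:C *: v.
  have y3E : y + \sum_i a i *: b i = y2 + (complex.Im (a ord_max))%:C *: ('i%C *: v).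
    rewrite big_ord_recr/= -/v /y2 /y1 [in LHS](complexE (a ord_max)).
    by rewrite scalerDl scalerA [_ * 'i%C]mulrC !addrA.
  have sumb : rn (\sum_(i < n) a (widen_ord (leqnSn n) i) *: b (widen_ord (leqnSn n) i)) <=
      m * \sum_(i < n) rn (b (widen_ord (leqnSn n) i)).
    rewrite mulr_sumr; elim/big_ind2: _ => [|u1 r1 u2 r2 h1 h2|i _]; first by rewrite rn0.
      by apply: le_trans (rnD _ _) _; exact: lerD.
    by rewrite rnZ; apply: ler_wpM2r; [exact: rn_ge0|exact: am].
  have Re_a := le_trans (normr_Re _) (am ord_max).
  have Im_a := le_trans (normr_Im _) (am ord_max).
  have mN : m * N * 2 < q by rewrite -mulrA [N * 2]mulrC.
  have y1q : rn (y1 - x) < q.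
    rewrite /y1 addrAC; apply: le_lt_trans (rnD _ _) _.
    have : m * \sum_(i < n) rn (b (widen_ord (leqnSn n) i)) <= m * N.
      by apply: ler_wpM2l => //; rewrite /N; have := rn_ge0 v; flra.
    flra.
  have y2q : rn (y2 - x) < q.
    rewrite /y2 /y1 addrAC (addrAC y); do 2 (apply: le_lt_trans (rnD _ _) _; rewrite -?ltrBrDr).
    rewrite rnZ rnR.
    have : `|complex.Re (a ord_max)| * rn v <= m * rn v by apply: ler_wpM2r => //; exact: rn_ge0.
    have : m * (\sum_(i < n) rn (b (widen_ord (leqnSn n) i)) + rn v) <= m * N.
      by apply: ler_wpM2l => //; rewrite /N; flra.
    by rewrite mulrDr; flra.
  move: y1q y2q; rewrite !lt_min => /and3P[_ y1d1 y1d2] /and3P[_ y2d1 y2d2].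
  have qd : q <= d by rewrite ge_min lexx.
  have yd : rn (y - x) < d by have := rn_ge0 (y - x); flra.
  rewrite y3E (_ : _ - f y = (f (y2 + (complex.Im (a ord_max))%:C *: ('i%C *: v)) - f y2)
      + (f y2 - f y1) + (f y1 - f y)); last by lmod_over R[i].
  apply: le_trans (rnD _ _) _; apply: le_trans (lerD (rnD _ _) (lexx _)) _.
  have := dP y (fun i => a (widen_ord (leqnSn n) i)) m yd.
  rewrite m0 md => /(_ isT) h; have {}h := h (fun i => am _).
  have h1 := d1P y1 _ y1d1 (le_lt_trans Re_a md1).
  have h2 := d2P y2 _ y2d2 (le_lt_trans Im_a md2).
  have := ler_wpM2l (ltW B10) Re_a; have := ler_wpM2l (ltW B20) Im_a.
  rewrite -/y2 in h1; rewrite -/y1 in h; rewrite !mulrDl; flra.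
have [L [d [L0 d0 dP]]] := steps.
pose K1 := Num.max K 1; have K10 : 0 < K1 by rewrite lt_max ltr01 orbT.
exists (L * K1), (Num.min (d / 2) (d / (4 * K1))).
have K4 : 0 < 4 * K1 by flra.
split; [exact: mulr_gt0|by rewrite lt_min !divr_gt0|].
move=> y z; rewrite !lt_min !ltr_pdivlMr// => /andP[y1 y2] /andP[z1 z2].
have yz : rn (y - z) <= rn (y - x) + rn (z - x).
  rewrite (_ : y - z = (y - x) - (z - x)); last by lmod_over R[i].
  exact: rnB.
have := dP z (fun i => lam i (y - z)) (K1 * rn (y - z)).
rewrite /= -(lamE (y - z)) (addrC z (y - z)) subrK mulrA; apply; first by have := rn_ge0 (z - x); flra.
  rewrite mulr_ge0 ?rn_ge0 ?(ltW K10)//=.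
  apply: le_lt_trans (ler_wpM2l (ltW K10) yz) _; rewrite mulrDr.
  by move: y2 z2; rewrite !mulrA ![_ * 4]mulrC !(mulrC _ K1) !mulrA; flra.
move=> i; apply: le_trans (lamK i _) _; apply: ler_wpM2r; first exact: rn_ge0.
by rewrite le_max lexx.
Qed.

(** The Lipschitz constant of [f] also bounds the dependence of the derivative
    on the direction. *)
Lemma Ck1_joint_continuous V W (O : set V) (f : V -> W) x X : finite_dim_space V ->
  open O -> Ck 1 O f -> O x -> forall e : R, 0 < e -> exists2 d : R, 0 < d &
  forall y Y, rn (y - x) < d -> rn (Y - X) < d -> rn (rderive f Y y - rderive f X x) < e.
Proof.
move=> fV oO f1 Ox e e0; have [L [d [L0 d0 dP]]] := Ck1_lipschitz fV oO f1 Ox.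
have [d1 d10 d1P] := open_rnP oO Ox; have e2 : 0 < e / 2 by flra.
have [d2 d20 d2P] := (continuous_rnP _ _).1 (Ck1_continuous (v := X) f1 Ox) _ e2.
exists (Num.min (Num.min (d / 2) (e / 2 / L)) (Num.min d1 d2)).
  by rewrite !lt_min d10 d20 !divr_gt0.
move=> y Y; rewrite !lt_min => /andP[/andP[yd _] /andP[yd1 yd2]].
move=> /andP[/andP[_]]; rewrite (ltr_pdivlMr _ _ L0) => YX _.
rewrite (_ : _ - _ = rderive f Y y - rderive f X y + (rderive f X y - rderive f X x)); last by lmod_over R[i].
apply: le_lt_trans (rnD _ _) _; rewrite [e]splitr; apply: ler_ltD; last exact: d2P.
apply: le_trans (_ : L * rn (Y - X) <= _); last by rewrite mulrC ltW.
pose M := rn X + rn Y + 1; have M0 : 0 < M by have := rn_ge0 X; have := rn_ge0 Y; rewrite /M; flra.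
have Oy := d1P y yd1; have d2M : 0 < d / 2 / M by rewrite !divr_gt0.
apply: (isdd_lipschitz d2M _ (Ck1_isdd Y f1 Oy) (Ck1_isdd X f1 Oy)) => t; rewrite ltr_pdivlMr// => td.
have MX Z : rn Z <= M -> rn (y + t%:C *: Z - x) < d.
  move=> ZM; rewrite addrAC; apply: le_lt_trans (rnD _ _) _; rewrite rnZ rnR.
  by have : `|t| * rn Z <= `|t| * M by [exact: ler_wpM2l]; flra.
apply: le_trans (dP _ _ _ _) _.
- by apply: MX; rewrite /M; have := rn_ge0 X; flra.
- by apply: MX; rewrite /M; have := rn_ge0 Y; flra.
rewrite (_ : y + _ - _ = t%:C *: (Y - X)); last by lmod_over R[i].
by rewrite rnZ rnR -mulrA [`|t| * _]mulrC.
Qed.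

(** The derivative of the composition at [p] is that of [f] in the direction
    ['d tau p v]; since this direction varies, its continuity is the joint
    one, and it uses that ['d tau p v] is continuous in [p]. *)
Lemma Ck1_comp V' V W (O' : set V') (O : set V) (f : V -> W) (tau : V' -> V) :
  finite_dim_space V -> open O -> open O' -> (forall p, O' p -> O (tau p)) ->
  (forall p, O' p -> differentiable tau p) -> Ck 1 O f -> Ck 1 O' (f \o tau).
Proof.
move=> fV oO oO' tO td f1.
apply: (@Ck1_intro _ _ _ _ (fun v p => rderive f ('d tau p v) (tau p))) => // p.
- move=> Op; apply: continuous_comp; first exact: differentiable_continuous (td p Op).
  exact: (Ck0_continuous f1 (tO p Op)).
- move=> v Op; apply: isdd_comp (Ck1_lipschitz fV oO f1 (tO p Op)) (differentiable_isdd v (td p Op)) _.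
  exact: Ck1_isdd f1 (tO p Op).
- move=> v Op; have [d d0 dP] := open_rnP oO' Op.
  have dtc : {for p, continuous (fun y => 'd tau y v)}.
    apply: differentiable_continuous; apply: (holomorphic_derivative _ fV d0) => y yd.
    exact/td/dP.
  have tc := differentiable_continuous (td p Op).
  apply/continuous_rnP => e e0.
  have [d1 d10 d1P] := Ck1_joint_continuous ('d tau p v) fV oO f1 (tO p Op) e0.
  have [d2 d20 d2P] := (continuous_rnP _ _).1 tc _ d10.
  have [d3 d30 d3P] := (continuous_rnP _ _).1 dtc _ d10.
  exists (Num.min d2 d3) => [|y]; first by rewrite lt_min d20.
  by rewrite lt_min => /andP[/d2P h2 /d3P h3]; exact: d1P.
Qed.

Lemma Ck1_ext V W (O : set V) (f g : V -> W) : open O -> (forall x, O x -> f x = g x) ->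
  Ck 1 O f -> Ck 1 O g.
Proof.
move=> oO fg f1; apply: (@Ck1_intro _ _ _ _ (rderive f)) => // x.
- move=> Ox; apply/continuous_rnP => e e0; have [d d0 dP] := open_rnP oO Ox.
  have [d1 d10 d1P] := (continuous_rnP _ _).1 (Ck0_continuous f1 Ox) e e0.
  exists (Num.min d d1) => [|y]; first by rewrite lt_min d0.
  by rewrite lt_min => /andP[/dP Oy /d1P]; rewrite !fg.
- move=> v Ox; have [d d0 dP] := open_rnP oO Ox.
  by apply: isdd_near d0 _ (Ck1_isdd v f1 Ox) => y /dP; exact: fg.
- by move=> v Ox; exact: Ck1_continuous f1 Ox.
Qed.

(** The mean value inequality for the remainder, whose derivative along the
    line is the first order remainder of [rderive f v]. *)
Lemma Ck2_taylor V W (O : set V) (f : V -> W) x v : open O -> Ck 2 O f -> O x ->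
  forall e : R, 0 < e -> exists2 d : R, 0 < d & forall t : R, `|t| < d ->
  rn (f (x + t%:C *: v) - f x - t%:C *: rderive f v x
      - (t ^+ 2 / 2)%:C *: rderive (rderive f v) v x) <= e * t ^+ 2.
Proof.
move=> oO f2 Ox e e0; have [_ /(_ v)[_ f1]] := f2.
have fv := Ck_leS f2; set f11 := rderive (rderive f v) v x; set f10 := rderive f v x.
have [d1 d10 d1P] := (isddP _ _ _ _).1 (Ck1_isdd v f1 Ox) _ e0.
have [d2 d20 d2P] := open_rnP oO Ox.
have v1 : 0 < rn v + 1 by have := rn_ge0 v; flra.
exists (Num.min d1 (d2 / (rn v + 1))); first by rewrite lt_min d10 divr_gt0.
move=> t; rewrite lt_min ltr_pdivlMr// => /andP[td1 td2].
pose g (s : R) := f (x + s%:C *: v) + (- 1) *: (s%:C *: f10)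
  + (- (2^-1 : R)%:C) *: ((s ^+ 2)%:C *: f11).
have -> : f (x + t%:C *: v) - f x - t%:C *: f10 - (t ^+ 2 / 2)%:C *: f11 = g t - g 0.
  by rewrite /g expr0n/= !scale0r !scaler0 !addr0 rmorphM/=; lmod_over R[i].
have bnd s : Num.min 0 t <= s <= Num.max 0 t -> `|s| <= `|t|.
  by case: (leP 0 t) => t0 /andP[s0 s1]; [rewrite !ger0_norm|rewrite !ler0_norm]; flra.
have -> : e * t ^+ 2 = e * `|t| * `|t - 0|.
  by rewrite subr0 -mulrA -expr2 real_normK ?num_real.
apply: (@mean_value_sym _ _ g (fun s : R => rderive f v (x + s%:C *: v) + (- 1) *: f10
   + (- (2^-1 : R)%:C) *: ((2 * s)%:C *: f11))) => s /bnd st.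
  apply: isrdD; last exact/isrdZ/isrd_sqr.
  apply: isrdD; last exact/isrdZ/isrd_scale.
  apply: isdd_isrd; apply: Ck1_isdd fv _; apply: d2P.
  rewrite addrAC subrr add0r rnZ rnR; apply: le_lt_trans td2.
  by apply: ler_pM => //; [exact: rn_ge0|flra].
apply: le_trans (_ : e * `|s| <= _); last by apply: ler_wpM2l => //; exact: ltW.
apply: le_trans (d1P s (le_lt_trans st td1)); rewrite le_eqVlt; apply/orP; left; apply/eqP.
congr rn; rewrite -/f10 -/f11 scalerA mulNr -rmorphM/= mulKf ?pnatr_eq0//.
by rewrite !scaleNr scale1r.
Qed.

End Ck_calculus.

(** * Hilbert spaces and their operators *)

Section inner_products.
Context {R : realType}.
Local Notation C := R[i].
Variable W : hilbert_space R.
Implicit Types (u v w : W) (P Q : Endo W).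

Lemma innerDl u v w : inner W (u + v) w = inner W u w + inner W v w.
Proof. by rewrite linearDl. Qed.

Lemma innerDr u v w : inner W w (u + v) = inner W w u + inner W w v.
Proof. by rewrite linearDr. Qed.

Lemma innerZl (c : C) v w : inner W (c *: v) w = c * inner W v w.
Proof. by rewrite linearZl_LR. Qed.

Lemma innerC v w : inner W v w = (inner W w v)^*%C.
Proof. by rewrite (hermC (inner W)) expr0 mul1r. Qed.

Lemma innerZr (c : C) v w : inner W v (c *: w) = c^*%C * inner W v w.
Proof. by rewrite innerC innerZl rmorphM/= -innerC. Qed.

(** The real inner product underlying the hermitian one. *)
Definition rin v w : R := complex.Re (inner W v w).

Lemma rinC v w : rin v w = rin w v.
Proof. by rewrite /rin innerC; case: (inner W w v). Qed.

Lemma rinDl u v w : rin (u + v) w = rin u w + rin v w.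
Proof. by rewrite /rin innerDl; case: (inner W u w); case: (inner W v w). Qed.

Lemma rinDr u v w : rin w (u + v) = rin w u + rin w v.
Proof. by rewrite !(rinC w) rinDl. Qed.

Lemma rinZl (t : R) v w : rin (t%:C *: v) w = t * rin v w.
Proof. by rewrite /rin innerZl; case: (inner W v w) => a b /=; rewrite mul0r subr0. Qed.

Lemma rinZr (t : R) v w : rin v (t%:C *: w) = t * rin v w.
Proof. by rewrite rinC rinZl rinC. Qed.

Lemma rinNl v w : rin (- v) w = - rin v w.
Proof. by rewrite -[- v](scaleN1r v) -[-1](rmorphN1 (real_complex R)) rinZl mulN1r. Qed.

Lemma rinNr v w : rin v (- w) = - rin v w.
Proof. by rewrite rinC rinNl rinC. Qed.

Lemma rin_ii v w : rin ('i%C *: v) ('i%C *: w) = rin v w.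
Proof.
rewrite /rin innerZl innerZr; case: (inner W v w) => a b /=.
by rewrite !(mul0r, mulr0, mul1r, mulr1, subr0, sub0r, add0r, addr0, oppr0, mulN1r, opprK, mulrN1).
Qed.

Lemma rin_il v w : rin ('i%C *: v) w = - rin v ('i%C *: w).
Proof.
by rewrite -rin_ii scalerA -expr2 sqr_i scaleN1r rinNl.
Qed.

Lemma rin_rn v : rin v v = rn v ^+ 2.
Proof. by rewrite /rin -inner_norm rnE -rmorphXn. Qed.

Lemma inner_rin v : inner W v v = (rin v v)%:C.
Proof. by rewrite rin_rn -inner_norm rnE -rmorphXn. Qed.

Lemma rin_le v w : rin v w <= rn v * rn w.
Proof.
have [->|w0] := eqVneq w 0.
  by have := rinDr 0 0 v; rewrite addr0 rn0 mulr0; flra.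
have rw : 0 < rn w by rewrite rn_gt0.
pose t : R := - (rin v w / rn w ^+ 2); have w2 : 0 < rn w ^+ 2 by rewrite exprn_gt0.
have : 0 <= rin (v + t%:C *: w) (v + t%:C *: w) by rewrite rin_rn sqr_ge0.
rewrite rinDl !rinDr !rinZl !rinZr (rinC w v) !rin_rn.
have -> : rn v ^+ 2 + t * rin v w + (t * rin v w + t * (t * rn w ^+ 2)) =
    rn v ^+ 2 - rin v w ^+ 2 / rn w ^+ 2 by rewrite /t; field; rewrite gt_eqF.
rewrite subr_ge0 ler_pdivrMr// -exprMn => h.
apply: le_trans (ler_norm _) _; rewrite -ler_sqr ?nnegrE ?mulr_ge0 ?rn_ge0//.
by rewrite real_normK ?num_real.
Qed.

Lemma rn_inner v w : rn (inner W v w) <= rn v * rn w.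
Proof.
have [z0|z0] := eqVneq (inner W v w) 0; first by rewrite z0 rn0 mulr_ge0 ?rn_ge0.
set z := inner W v w; have rz : 0 < rn z by rewrite rn_gt0.
have := rin_le (z^*%C *: v) w; rewrite rnZ (_ : rn z^*%C = rn z); last first.
  by apply: complexI; rewrite -!rnE normcJ.
rewrite /rin innerZl -/z (_ : complex.Re _ = rn z ^+ 2); last first.
  by rewrite rn_sqr; case: (z) => a b /=; ring.
by rewrite expr2 -mulrA ler_pM2l.
Qed.

Lemma inner_eq0 v : (forall w, inner W v w = 0) -> v = 0.
Proof.
move=> /(_ v); rewrite inner_rin rin_rn => /complexI/eqP.
by rewrite sqrf_eq0 rn_eq0 => /eqP.
Qed.

Lemma rn_op P v : rn (P v) <= rn P * rn v.
Proof. by rewrite rn_le rmorphM/= -!rnE; exact: Endo_normP. Qed.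

Lemma EndoD P Q v : (P + Q) v = P v + Q v. Proof. by []. Qed.
Lemma EndoB P Q v : (P - Q) v = P v - Q v. Proof. by []. Qed.
Lemma EndoZ (c : C) P v : (c *: P) v = c *: P v. Proof. by []. Qed.

Lemma opD P v w : P (v + w) = P v + P w. Proof. exact: linearD. Qed.
Lemma opB P v w : P (v - w) = P v - P w. Proof. exact: linearB. Qed.
Lemma opN P v : P (- v) = - P v. Proof. exact: linearN. Qed.
Lemma opZ (c : C) P v : P (c *: v) = c *: P v. Proof. exact: linearZ. Qed.

Definition selfadjoint P := forall v w, inner W (P v) w = inner W v (P w).

Lemma selfadjoint_rin P v w : selfadjoint P -> rin (P v) w = rin v (P w).
Proof. by move=> Ps; rewrite /rin Ps. Qed.

Lemma selfadjoint_i P w : selfadjoint P -> rin ('i%C *: P w) w = 0.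
Proof.
move=> Ps; have := rin_il (P w) w.
by rewrite -[P w in RHS]/(P w) selfadjoint_rin// linearZ/= (rinC w); flra.
Qed.

(** The real part of the curvature, when [k] solves [P k = dP w] for the
    (1,0)-derivative [dP]: differentiating this equation expresses the
    derivatives [k1] and [k2] of [k], and the mixed derivatives of [P] drop
    out because they are self adjoint. *)
Lemma curvature_algebra (P P1 P2 P11 P12 P21 P22 : Endo W) (k k1 k2 w : W) :
  selfadjoint P1 -> selfadjoint P2 -> selfadjoint P12 -> selfadjoint P21 ->
  P k = P1 w - 'i%C *: P2 w ->
  P k1 = P11 w - 'i%C *: P21 w - P1 k -> P k2 = P12 w - 'i%C *: P22 w - P2 k ->
  rin (P (- (k1 + 'i%C *: k2))) w = rin (P k) k - rin (P11 w) w - rin (P22 w) w.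
Proof.
move=> s1 s2 s12 s21 Pk Pk1 Pk2; rewrite opN opD opZ Pk1 Pk2 rinNl.
have e5 : rin (P k) k = rin (P1 w) k - rin ('i%C *: P2 w) k by rewrite Pk rinDl rinNl.
have e2 : rin (P1 k) w = rin (P1 w) k by rewrite selfadjoint_rin// rinC.
have e3 : rin ('i%C *: P2 k) w = - rin ('i%C *: P2 w) k.
  by rewrite rin_il selfadjoint_rin// opZ (rinC k).
have e6 : rin ('i%C *: ('i%C *: P22 w)) w = - rin (P22 w) w.
  by rewrite scalerA -expr2 sqr_i scaleN1r rinNl.
rewrite !scalerDr !scalerN !rinDl !rinNl e2 e3 e6 e5.
by rewrite (selfadjoint_i w s12) (selfadjoint_i w s21); ring.
Qed.

End inner_products.

Section directional_derivative_linear.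
Context {R : realType}.
Local Notation C := R[i].
Implicit Types (V W : normedModType C).

Lemma isdd_linear V W W' (f : V -> W) (L : W -> W') x v l (K : R) :
  (forall a b, L (a - b) = L a - L b) -> (forall (t : R) a, L (t%:C *: a) = t%:C *: L a) ->
  (forall a, rn (L a) <= K * rn a) -> isdd f x v l -> isdd (L \o f) x v (L l).
Proof.
move=> LB LZ LK /isddP fl; apply/isddP => e e0.
pose K1 := Num.max K 1; have K10 : 0 < K1 by rewrite lt_max ltr01 orbT.
have [d d0 dP] := fl _ (divr_gt0 e0 K10); exists d => // t /dP h.
rewrite /= -LZ -!LB; apply: le_trans (LK _) _.
apply: le_trans (_ : K1 * rn (f (x + t%:C *: v) - f x - t%:C *: l) <= _).
  by apply: ler_wpM2r; [exact: rn_ge0|rewrite le_max lexx].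
by rewrite -ler_pdivlMl// mulrA [K1^-1 * _]mulrC.
Qed.

Lemma isddN V W (f : V -> W) x v l : isdd f x v l -> isdd f x (- v) (- l).
Proof.
move=> /isddP fl; apply/isddP => e /fl[d d0 dP]; exists d => // t td.
have := dP (- t); rewrite normrN => /(_ td); rewrite rmorphN/= !scaleNr.
by rewrite !scalerN.
Qed.

End directional_derivative_linear.

Section implicit_functions.
Context {R : realType}.
Local Notation C := R[i].
Variables (V : normedModType C) (W : hilbert_space R) (O : set V).
Variables (P : V -> Endo W) (g k : V -> W).
Hypotheses (oO : open O) (P1 : Ck 1 O P).
Hypothesis Pinv : forall x, O x -> exists Q : Endo W, cancel (P x) Q /\ cancel Q (P x).
Hypothesis kP : forall x, O x -> P x (k x) = g x.

Let solve_diff x (Q : Endo W) y : O x -> O y -> cancel (P x) Q ->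
  rn (k y - k x) <= rn Q * (rn (P y - P x) * rn (k y) + rn (g y - g x)).
Proof.
move=> Ox Oy QP; rewrite -[k y - k x]QP; apply: le_trans (rn_op _ _) _.
apply: ler_wpM2l; first exact: rn_ge0.
rewrite linearB/= kP// (_ : _ - _ = - ((P y - P x) (k y)) + (g y - g x)); last first.
  by rewrite EndoB kP//; lmod_over R[i].
by apply: le_trans (rnD _ _) _; rewrite rnN; apply: lerD => //; exact: rn_op.
Qed.

Lemma solve_continuous x : O x -> {for x, continuous g} -> {for x, continuous k}.
Proof.
move=> Ox gc; apply/continuous_rnP => e e0.
have [Q [QP PQ]] := Pinv Ox; pose q := rn Q + 1.
have q0 : 0 < q by have := rn_ge0 Q; rewrite /q; flra.
have k1 : 0 < rn (k x) + 1 by have := rn_ge0 (k x); flra.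
pose m := Num.min (1 / (2 * q)) (e / (4 * q * (rn (k x) + 1))).
have m0 : 0 < m by rewrite lt_min !divr_gt0 ?mulr_gt0.
have [d1 d10 d1P] := (continuous_rnP _ _).1 (Ck0_continuous P1 Ox) _ m0.
have e4 : 0 < e / (4 * q) by rewrite divr_gt0 ?mulr_gt0.
have [d2 d20 d2P] := (continuous_rnP _ _).1 gc _ e4.
have [d3 d30 d3P] := open_rnP oO Ox.
exists (Num.min d1 (Num.min d2 d3)); first by rewrite !lt_min d10 d20.
move=> y; rewrite !lt_min => /and3P[/d1P + /d2P hg /d3P Oy].
rewrite lt_min => /andP[hP1 hP2].
have := solve_diff Ox Oy QP; set D := rn (k y - k x); set p := rn (P y - P x).
have ky : rn (k y) <= rn (k x) + D by have := ler_rnB (k y) (k x); rewrite -/D; flra.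
have p0 : 0 <= p := rn_ge0 _; have D0 : 0 <= D := rn_ge0 _; have Q0 := rn_ge0 Q.
have qp : q * p <= 1 / 2 by move: hP1; rewrite -/p ltr_pdivlMr ?mulr_gt0//; flra.
have qpk : q * p * rn (k x) < e / 4.
  move: hP2; rewrite -/p ltr_pdivlMr ?mulr_gt0// => h.
  have : q * p * rn (k x) <= q * p * (rn (k x) + 1).
    by apply: ler_wpM2l; [rewrite mulr_ge0// ltW|flra].
  have -> : q * p * (rn (k x) + 1) = p * (4 * q * (rn (k x) + 1)) / 4 by field.
  by move: h; flra.
have qg : q * rn (g y - g x) < e / 4.
  by move: hg; rewrite ltr_pdivlMr ?mulr_gt0//; flra.
move=> h; have : D <= q * p * rn (k x) + q * p * D + q * rn (g y - g x).
  apply: le_trans h _; apply: le_trans (_ : q * (p * rn (k y) + rn (g y - g x)) <= _).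
    apply: ler_wpM2r; first by rewrite addr_ge0 ?mulr_ge0 ?rn_ge0.
    by rewrite /q; flra.
  rewrite mulrDr lerD2r -mulrDr -mulrA; apply: ler_wpM2l; first exact: ltW.
  exact: ler_wpM2l.
have : q * p * D <= 1 / 2 * D by apply: ler_wpM2r.
by flra.
Qed.

Lemma solve_isdd x v : O x -> isdd g x v (rderive g v x) -> {for x, continuous k} ->
  exists2 l, isdd k x v l & P x l = rderive g v x - rderive P v x (k x).
Proof.
move=> Ox gd kc; have [Q [QP PQ]] := Pinv Ox.
set dg := rderive g v x; set dP := rderive P v x.
exists (Q (dg - dP (k x))); last by rewrite PQ.
apply/isddP => e e0; pose q := rn Q + 1.
have q0 : 0 < q by have := rn_ge0 Q; rewrite /q; flra.
have k1 : 0 < rn (k x) + 1 by have := rn_ge0 (k x); flra.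
have dP1 : 0 < rn dP + 1 by have := rn_ge0 dP; flra.
have e3 : 0 < e / (3 * q) by rewrite divr_gt0 ?mulr_gt0.
have [d1 d10 d1P] := (isddP _ _ _ _).1 gd _ e3.
have [d2 d20 d2P] := (isddP _ _ _ _).1 (Ck1_isdd v P1 Ox) _ (divr_gt0 e3 k1).
have e4 : 0 < Num.min 1 (e / (3 * q) / (rn dP + 1)) by rewrite lt_min ltr01 divr_gt0.
have [d3 d30 d3P] := (continuous_rnP _ _).1 kc _ e4.
have [d4 d40 d4P] := open_rnP oO Ox.
have v1 : 0 < rn v + 1 by have := rn_ge0 v; flra.
exists (Num.min (Num.min d1 d2) (Num.min (d3 / (rn v + 1)) (d4 / (rn v + 1)))).
  by rewrite !lt_min d10 d20 !divr_gt0.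
move=> t; rewrite !lt_min !(ltr_pdivlMr _ _ v1) => /andP[/andP[/d1P t1 /d2P t2] /andP[t3 t4]].
set y := x + t%:C *: v; have yx : rn (y - x) <= `|t| * (rn v + 1).
  rewrite /y addrAC subrr add0r rnZ rnR; apply: ler_wpM2l => //; flra.
have Oy := d4P y (le_lt_trans yx t4).
have := d3P y (le_lt_trans yx t3); rewrite lt_min => /andP[ky1 ky2].
set D := _ - _ - _; have -> : D = Q (P x D) by rewrite QP.
apply: le_trans (rn_op _ _) _.
have -> : P x D = (g y - g x - t%:C *: dg) - (P y - P x - t%:C *: dP) (k y)
    - t%:C *: dP (k y - k x).
  have -> : (P y - P x - t%:C *: dP) (k y) = P y (k y) - P x (k y) - t%:C *: dP (k y) by [].
  rewrite /D !(opB (P x)) opZ PQ !kP// (opB dP).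
  by lmod_over R[i].
have b1 : rn ((P y - P x - t%:C *: dP) (k y)) <= e / (3 * q) * `|t|.
  apply: le_trans (rn_op _ _) _; apply: le_trans (_ : e / (3 * q) / (rn (k x) + 1) * `|t| * (rn (k x) + 1) <= _).
    apply: ler_pM => //; [exact: rn_ge0|exact: rn_ge0|].
    by have := ler_rnB (k y) (k x); flra.
  by rewrite mulrAC divfK ?gt_eqF.
have b2 : rn (t%:C *: dP (k y - k x)) <= e / (3 * q) * `|t|.
  rewrite rnZ rnR mulrC; apply: ler_wpM2r => //; apply: le_trans (rn_op _ _) _.
  move: ky2; rewrite ltr_pdivlMr// => /ltW; apply: le_trans; rewrite mulrC.
  by apply: ler_wpM2l; [exact: rn_ge0|flra].
apply: le_trans (_ : q * (3 * (e / (3 * q) * `|t|)) <= _).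
  apply: ler_pM; [exact: rn_ge0|exact: rn_ge0|by rewrite /q; flra|].
  apply: le_trans (rnB _ _) _; apply: le_trans (lerD (rnB _ _) (lexx _)) _.
  rewrite [3 * _](_ : _ = e / (3 * q) * `|t| + e / (3 * q) * `|t| + e / (3 * q) * `|t|); last by ring.
  by apply: lerD => //; exact: lerD t1 b1.
rewrite le_eqVlt; apply/orP; left; apply/eqP; field; rewrite gt_eqF//.
Qed.

Lemma apply_continuous (Q : V -> Endo W) (l : V -> W) x :
  {for x, continuous Q} -> {for x, continuous l} -> {for x, continuous (fun y => Q y (l y))}.
Proof.
move=> Qc lc; apply/continuous_rnP => e e0; have e2 : 0 < e / 2 by flra.
have l1 : 0 < rn (l x) + 1 by have := rn_ge0 (l x); flra.
have Q1 : 0 < rn (Q x) + 1 by have := rn_ge0 (Q x); flra.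
have [d d0 dP] := (continuous_rnP _ _).1 Qc _ (divr_gt0 e2 l1).
have m0 : 0 < Num.min 1 (e / 2 / (rn (Q x) + 1)) by rewrite lt_min ltr01 divr_gt0.
have [d' d'0 d'P] := (continuous_rnP _ _).1 lc _ m0.
exists (Num.min d d') => [|y]; first by rewrite lt_min d0.
rewrite !lt_min => /andP[/dP hQ /d'P]; rewrite lt_min => /andP[h1 h2].
have -> : Q y (l y) - Q x (l x) = (Q y - Q x) (l y) + Q x (l y - l x).
  by rewrite EndoB opB; lmod_over R[i].
apply: le_lt_trans (rnD _ _) _; rewrite [e]splitr; apply: ltr_leD.
  apply: le_lt_trans (rn_op _ _) _.
  apply: le_lt_trans (_ : rn (Q y - Q x) * (rn (l x) + 1) < _); last by rewrite -ltr_pdivlMr.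
  by apply: ler_wpM2l; [exact: rn_ge0|have := ler_rnB (l y) (l x); flra].
apply: le_trans (rn_op _ _) _; move: h2; rewrite ltr_pdivlMr// => /ltW; apply: le_trans.
by rewrite mulrC; apply: ler_wpM2l; [exact: rn_ge0|flra].
Qed.

End implicit_functions.

(** Solutions of linear equations depend on the data as regularly as the
    data do, and their derivatives solve the differentiated equation. *)
Lemma solve_Ck1 (R : realType) (V : normedModType R[i]) (W : hilbert_space R) (O : set V)
    (P : V -> Endo W) (g k : V -> W) : open O -> Ck 1 O P ->
  (forall x, O x -> exists Q : Endo W, cancel (P x) Q /\ cancel Q (P x)) ->
  (forall x, O x -> P x (k x) = g x) -> Ck 1 O g ->
  Ck 1 O k /\ forall x v, O x -> P x (rderive k v x) = rderive g v x - rderive P v x (k x).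
Proof.
move=> oO P1 Pinv kP g1.
have kc x : O x -> {for x, continuous k}.
  by move=> Ox; apply: (solve_continuous oO P1 Pinv kP Ox); exact: Ck0_continuous g1 Ox.
have kd x v : O x -> isdd k x v (rderive k v x) /\
    P x (rderive k v x) = rderive g v x - rderive P v x (k x).
  move=> Ox; have [l kl lE] := solve_isdd oO P1 Pinv kP Ox (Ck1_isdd v g1 Ox) (kc x Ox).
  by have [_ ->] := isdd_rderivable kl.
split; last by move=> x v /(kd x v)[].
apply: (Ck1_intro (D := rderive k)) => // x v Ox; first by have [] := kd x v Ox.
apply: (solve_continuous oO P1 Pinv (g := fun y => rderive g v y - rderive P v y (k y))) => //.
  by move=> y /(kd y v)[].
have c2 := apply_continuous (Ck1_continuous (v := v) P1 Ox) (kc x Ox).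
have c1 := Ck1_continuous (v := v) g1 Ox.
apply/continuous_rnP => e e0; have e2 : 0 < e / 2 by flra.
have [d d0 dP] := (continuous_rnP _ _).1 c1 _ e2.
have [d' d'0 d'P] := (continuous_rnP _ _).1 c2 _ e2.
exists (Num.min d d') => [|y]; first by rewrite lt_min d0.
rewrite lt_min => /andP[/dP h1 /d'P h2].
set a := rderive g v y in h1 *; set a' := rderive g v x in h1 *.
rewrite (_ : _ - _ = a - a' - (rderive P v y (k y) - rderive P v x (k x))); last by lmod_over R[i].
by apply: le_lt_trans (rnB _ _) _; flra.
Qed.

(** * Derivatives and vector fields in charts *)

Section charts.
Context {R : realType}.
Local Notation C := R[i].
Variable S : manifold R.
Implicit Types (c d : chart R S) (O : set S).

Lemma crangeK c y : crange c y -> cmap c (cinv c y) = y /\ cdom c (cinv c y).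
Proof. by move=> [x xc <-]; rewrite cmapK. Qed.

Lemma chart_image_open c O : open O -> open (cmap c @` (O `&` cdom c)).
Proof.
move=> oO; rewrite openE => _ [x [Ox xc] <-].
have yc : crange c (cmap c x) by exists x.
have n1 : nbhs (cmap c x) (crange c) by apply: open_nbhs_nbhs; split=> //; exact: crange_open.
have n2 : nbhs (cmap c x) (cinv c @^-1` O).
  by apply: (cinv_continuous yc); rewrite cmapK//; apply: open_nbhs_nbhs.
apply: filterS (filterI n1 n2) => y [yr Oy]; have [yE yd] := crangeK yr.
by exists (cinv c y).
Qed.

Lemma chart_change_image c d O : forall y, (cmap d @` ((O `&` cdom c) `&` cdom d)) y ->
  (cmap c @` (O `&` cdom c)) (cmap c (cinv d y)).
Proof. by move=> _ [x [[Ox xc] xd] <-]; rewrite cmapK//; exists x. Qed.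

Lemma chart_change_differentiable c d y : atlas c -> atlas d ->
  crange d y -> cdom c (cinv d y) -> differentiable (cmap c \o cinv d) y.
Proof.
move=> ca da yd yc; have [yE yd'] := crangeK yd.
by rewrite -yE; exact: atlas_compat.
Qed.

Lemma mCk1_chart c O (W : normedModType C) (f : S -> W) : finite_dim S -> atlas c ->
  open O -> Ck 1 (cmap c @` (O `&` cdom c)) (f \o cinv c) -> mCk 1 (O `&` cdom c) f.
Proof.
move=> fS ca oO f1 d da; have oOc : open (O `&` cdom c) := openI oO (cdom_open c).
apply: (Ck1_ext (f := (f \o cinv c) \o (cmap c \o cinv d))).
- exact: chart_image_open.
- by move=> _ [x [[_ xc] xd] <-] /=; rewrite (cmapK xd) (cmapK xc).
apply: (Ck1_comp (fS c ca) _ _ _ _ f1).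
- exact: chart_image_open.
- exact: chart_image_open.
- exact: chart_change_image.
- move=> _ [x [[_ xc] xd] <-]; apply: chart_change_differentiable => //; first by exists x.
  by rewrite cmapK.
Qed.

(** The tangent vector at [s] whose coordinates in the chart [c] are [b]. *)
Definition tvec c (b : model c) (s : S) : tangent s :=
  'd (cmap (chart_at s) \o cinv c) (cmap c s) b.

Lemma tvec_isdd c s b (W : normedModType C) (f : S -> W) l : atlas c -> cdom c s ->
  near_lipschitz (f \o cinv (chart_at s)) (cmap (chart_at s) s) ->
  isdd (f \o cinv (chart_at s)) (cmap (chart_at s) s) (tvec b s) l ->
  isdd (f \o cinv c) (cmap c s) b l.
Proof.
move=> ca sc fl fd; have sE : cmap (chart_at s) (cinv c (cmap c s)) = cmap (chart_at s) s by rewrite cmapK.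
have td : differentiable (cmap (chart_at s) \o cinv c) (cmap c s).
  exact: atlas_compat (chart_at_atlas s) _ sc (chart_at_dom s).
have n1 : nbhs (cmap c s) (cinv c @^-1` cdom (chart_at s)).
  have sr : crange c (cmap c s) by exists s.
  apply: (cinv_continuous sr); rewrite cmapK//; apply: open_nbhs_nbhs.
  by split; [exact: cdom_open|exact: chart_at_dom].
have [r r0 rP] := (nbhs_rnP _ _).1 n1.
apply: (@isdd_near _ _ _ ((f \o cinv (chart_at s)) \o (cmap (chart_at s) \o cinv c)) _ _ _ _ r) => //.
  by move=> y /rP yd /=; rewrite cmapK.
apply: isdd_comp; [by rewrite /= sE|exact: (differentiable_isdd b td)|by rewrite /= sE].
Qed.

Lemma mderiveE c s b (W : normedModType C) (f : S -> W) O : finite_dim S -> open O -> O s ->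
  mCk 1 O f -> atlas c -> cdom c s ->
  mderive f (tvec b s) = rderive (f \o cinv c) b (cmap c s).
Proof.
move=> fS oO Os f1 ca sc; have f1s := f1 _ (chart_at_atlas s).
have sO : (cmap (chart_at s) @` (O `&` cdom (chart_at s))) (cmap (chart_at s) s).
  by exists s => //; split=> //; exact: chart_at_dom.
have oI := @chart_image_open (chart_at s) O oO.
have fd := Ck1_isdd (tvec b s) f1s sO.
have fl := Ck1_lipschitz (fS _ (chart_at_atlas s)) oI f1s sO.
by have [_ ->] := isdd_rderivable (tvec_isdd ca sc fl fd).
Qed.

Lemma tvecZ c s (a : C) b : cdom c s -> atlas c -> tvec (a *: b) s = a *: tvec (c := c) b s.
Proof. by move=> sc ca; rewrite /tvec linearZ. Qed.

(** The constant field [b] of a chart is a holomorphic vector field: its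
    coordinates in another chart are the derivative, in the direction [b],
    of the change of charts. *)
Lemma tvec_holomorphic c b O : finite_dim S -> atlas c -> open O -> O `<=` cdom c ->
  holomorphic_vector_field O (fun s => (tvec b s, - ('i%C *: tvec (c := c) b s)) : ctangent s).
Proof.
move=> fS ca oO Oc; split=> [//|d da s Os sd] /=; have sc := Oc s Os.
pose q := cmap d s; have qr : crange d q by exists s.
have n1 : nbhs q (crange d) by apply: open_nbhs_nbhs; split=> //; exact: crange_open.
have n2 : nbhs q (cinv d @^-1` cdom c).
  by apply: (cinv_continuous qr); rewrite cmapK//; apply: open_nbhs_nbhs; split=> //; exact: cdom_open.
have [r r0 rP] := (nbhs_rnP _ _).1 (filterI n1 n2).
pose G p := 'd (cmap d \o cinv c) p b.
have eqG y : rn (y - q) < r -> tcoord d (tvec b (cinv d y)) = (G \o (cmap c \o cinv d)) y.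
  move=> /rP[yr yc]; have [yE yd] := crangeK yr; rewrite /tcoord /tvec /G /=.
  set s' := cinv d y; set e := chart_at s'; have se : cdom e s' := chart_at_dom s'.
  have ea : atlas e := chart_at_atlas s'.
  have d1 : differentiable (cmap e \o cinv c) (cmap c s') by exact: atlas_compat.
  have sE : (cmap e \o cinv c) (cmap c s') = cmap e s' by rewrite /= cmapK.
  have d2 : differentiable (cmap d \o cinv e) ((cmap e \o cinv c) (cmap c s')).
    by rewrite sE; exact: atlas_compat.
  have n3 : nbhs (cmap c s') (cinv c @^-1` cdom e).
    have sr : crange c (cmap c s') by exists s'.
    by apply: (cinv_continuous sr); rewrite cmapK//; apply: open_nbhs_nbhs; split=> //; exact: cdom_open.
  have [r' r'0 r'P] := (nbhs_rnP _ _).1 n3.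
  have [||_ ->] := @differentiable_near R _ _ (cmap d \o cinv c) ((cmap d \o cinv e) \o (cmap e \o cinv c)) (cmap c s') r' r'0.
  - move=> k kr /=; rewrite cmapK//; apply: r'P.
    by rewrite addrAC subrr add0r.
  - exact: differentiable_comp.
  by rewrite (diff_comp d1 d2) /= cmapK.
have dG : differentiable (G \o (cmap c \o cinv d)) q.
  apply: differentiable_comp.
    by apply: chart_change_differentiable => //; rewrite /q cmapK.
  have pr : crange c (cmap c s) by exists s.
  have n3 : nbhs (cmap c s) (cinv c @^-1` cdom d).
    by apply: (cinv_continuous pr); rewrite cmapK//; apply: open_nbhs_nbhs; split=> //; exact: cdom_open.
  have n4 : nbhs (cmap c s) (crange c) by apply: open_nbhs_nbhs; split=> //; exact: crange_open.
  have [r' r'0 r'P] := (nbhs_rnP _ _).1 (filterI n3 n4).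
  rewrite /= /q cmapK//; apply: (holomorphic_derivative _ (fS d da) r'0) => y /r'P[y1 y2].
  exact: chart_change_differentiable.
have [|//] := @differentiable_near R _ _ (fun y => tcoord d (tvec b (cinv d y))) (G \o (cmap c \o cinv d)) q r r0 _ dG.
by move=> k kr; apply: eqG; rewrite addrAC subrr add0r.
Qed.

End charts.

(** * The curvature in a trivialization *)

Section regular_constants.
Context {R : realType}.
Local Notation C := R[i].
Implicit Types (V W : normedModType C).

Lemma Ck_cst V W k (O : set V) (w : W) : Ck k O (fun=> w).
Proof.
elim: k w => [|k IHk] w; first by split=> // x _; exact: cst_continuous.
split=> [x _|v]; first exact: cst_continuous.
have d0 x : isdd (fun=> w) x v 0 by exact: isrd_cst.
split=> [x _|]; first by have [] := isdd_rderivable (d0 x).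
have -> : rderive (fun=> w) v = fun=> 0; last exact: IHk.
by apply/funext => x; have [] := isdd_rderivable (d0 x).
Qed.

Lemma mCk_cst (S : manifold R) W k (O : set S) (w : W) : mCk k O (fun=> w).
Proof. by move=> c _; exact: Ck_cst. Qed.

Lemma cderive_cst (S : manifold R) W (w : W) (s : S) (xi : ctangent s) :
  cderive (fun=> w) xi = 0.
Proof.
have d0 (V : normedModType C) (x v : V) : rderive (fun=> w) v x = 0.
  have h : isdd (fun=> w) x v 0 by exact: isrd_cst.
  by have [] := isdd_rderivable h.
by rewrite /cderive /mderive !d0 scaler0 addr0.
Qed.

Lemma linear_continuous_at V W W' (f : V -> W) (L : W -> W') x (K : R) :
  (forall a b, L (a - b) = L a - L b) -> (forall a, rn (L a) <= K * rn a) ->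
  {for x, continuous f} -> {for x, continuous (L \o f)}.
Proof.
move=> LB LK fc; apply/continuous_rnP => e e0.
pose K1 := Num.max K 1; have K10 : 0 < K1 by rewrite lt_max ltr01 orbT.
have [d d0 dP] := (continuous_rnP _ _).1 fc _ (divr_gt0 e0 K10).
exists d => // y /dP; rewrite ltr_pdivlMr// => h; rewrite /= -LB.
apply: le_lt_trans (LK _) _; apply: le_lt_trans h; rewrite mulrC.
by apply: ler_wpM2l; [exact: rn_ge0|rewrite le_max lexx].
Qed.

Lemma rderive_selfadjoint V (W : hilbert_space R) (O : set V) (f : V -> Endo W) v x :
  open O -> (forall y, O y -> selfadjoint (f y)) -> Ck 1 O f -> O x -> selfadjoint (rderive f v x).
Proof.
move=> oO fs f1 Ox w1 w2; have fd := Ck1_isdd v f1 Ox; have [r r0 rP] := open_rnP oO Ox.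
pose L1 (Q : Endo W) : C := inner W (Q w1) w2; pose L2 (Q : Endo W) : C := inner W w1 (Q w2).
have innerNl (a b : W) : inner W (- a) b = - inner W a b by rewrite -scaleN1r innerZl mulN1r.
have innerNr (a b : W) : inner W a (- b) = - inner W a b.
  by rewrite innerC innerNl rmorphN/= -innerC.
have d1 : isdd (L1 \o f) x v (L1 (rderive f v x)).
  apply: (isdd_linear (K := rn w1 * rn w2)) fd.
  - by move=> a a'; rewrite /L1 EndoB innerDl innerNl.
  - by move=> t a; rewrite /L1 EndoZ innerZl.
  - move=> a; apply: le_trans (rn_inner _ _) _; rewrite mulrAC [_ * rn a]mulrC.
    by apply: ler_wpM2r; [exact: rn_ge0|exact: rn_op].
have d2 : isdd (L2 \o f) x v (L2 (rderive f v x)).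
  apply: (isdd_linear (K := rn w1 * rn w2)) fd.
  - by move=> a a'; rewrite /L2 EndoB innerDr innerNr.
  - by move=> t a; rewrite /L2 EndoZ innerZr conjc_real.
  - move=> a; apply: le_trans (rn_inner _ _) _; rewrite -mulrA [rn w2 * _]mulrC.
    by apply: ler_wpM2l; [exact: rn_ge0|exact: rn_op].
apply: (isdd_unique d1); apply: isdd_near r0 _ d2 => y /rP /fs h.
by rewrite /L1 /L2 /= h.
Qed.

End regular_constants.

Section curvature.
Context {R : realType}.
Local Notation C := R[i].
Variables (S : manifold R) (E : banach_bundle S) (h : fiber_form E) (nabla : section_derivative E).
Variable Rm : forall s : S, ctangent s -> fib E s -> fib E s.
Hypotheses (fS : finite_dim S) (chern : chern_connection h nabla) (curv : curvature_operator nabla Rm).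
Variables (U : set S) (W : hilbert_space R) (F : forall s, {linear W -> fib E s}) (P : S -> Endo W).
Hypotheses (tF : local_trivialization U F) (P2 : mCk 2 U P).
Hypothesis Ph : forall s, U s -> positive_invertible (P s) /\
      forall w1 w2, h (F s w1) (F s w2) = inner W (P s w1) w2.
Variables (c : chart R S) (b : model c).
Hypothesis ca : atlas c.

Let O := U `&` cdom c.
Let Om := cmap c @` O.
Let Pc := P \o cinv c.
Let D1 : model c -> Endo W := rderive Pc b.
Let D2 : model c -> Endo W := rderive Pc ('i%C *: b).
Let xi s : ctangent s := (tvec b s, - ('i%C *: tvec b s)).

Let oU : open U. Proof. by case: tF. Qed.
Let oO : open O. Proof. by apply: openI => //; exact: cdom_open. Qed.
Let oOm : open Om. Proof. exact: chart_image_open. Qed.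
Let Pc2 : Ck 2 Om Pc. Proof. exact: P2. Qed.
Let Pc1 : Ck 1 Om Pc. Proof. exact: Ck_leS Pc2. Qed.
Let D11 v : Ck 1 Om (rderive Pc v). Proof. by have [_ /(_ v)[]] := Pc2. Qed.

Let mP1 : mCk 1 U P. Proof. by move=> d da; exact/Ck_leS/P2. Qed.

Lemma Pc_selfadjoint y : Om y -> selfadjoint (Pc y).
Proof. by move=> [s [Us sc] <-]; rewrite /Pc/= cmapK//; have [[]] := Ph Us. Qed.

Let pairing w1 w2 (s : S) : C := h (F s w1) (F s w2).

Let mderive_pairing w1 w2 b' s : O s ->
  mderive (pairing w1 w2) (tvec b' s) = inner W (rderive Pc b' (cmap c s) w1) w2.
Proof.
move=> [Us sc]; set d := chart_at s; have da : atlas d := chart_at_atlas s.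
have sd : cdom d s := chart_at_dom s.
have pO : (cmap d @` (U `&` cdom d)) (cmap d s) by exists s.
have := Ck1_isdd (tvec b' s) (mP1 da) pO; rewrite -[rderive _ _ _]/(mderive P (tvec b' s)).
rewrite (mderiveE b' fS oU Us mP1 ca sc) => Pd.
pose L (Q : Endo W) : C := inner W (Q w1) w2.
have Ld : isdd (L \o (P \o cinv d)) (cmap d s) (tvec b' s) (L (rderive Pc b' (cmap c s))).
  apply: (isdd_linear (K := rn w1 * rn w2)) Pd.
  - by move=> a a'; rewrite /L EndoB innerDl -scaleN1r innerZl mulN1r.
  - by move=> t a; rewrite /L EndoZ innerZl.
  - move=> a; apply: le_trans (rn_inner _ _) _; rewrite mulrAC [_ * rn a]mulrC.
    by apply: ler_wpM2r; [exact: rn_ge0|exact: rn_op].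
have [r r0 rP] := open_rnP (chart_image_open d oU) pO.
have gd : isdd (pairing w1 w2 \o cinv d) (cmap d s) (tvec b' s) (L (rderive Pc b' (cmap c s))).
  apply: isdd_near r0 _ Ld => y /rP [s' [Us' sd'] <-] /=.
  by rewrite cmapK// /pairing (Ph Us').2.
exact: (isdd_rderivable gd).2.
Qed.

Let rderivePcN s v : O s -> rderive Pc (- v) (cmap c s) = - rderive Pc v (cmap c s).
Proof.
move=> Os; have Omp : Om (cmap c s) by exists s.
have := isddN (Ck1_isdd v Pc1 Omp); apply: isdd_unique; exact: Ck1_isdd Pc1 Omp.
Qed.

Section connection_matrix.
Variable theta : forall s : S, tangent s -> Endo W.
Hypothesis thetaP : connection_form nabla U F theta.

Let T01xi s : T01 (cconj (xi s)). Proof. by rewrite /T01 /cconj /xi /= opprK. Qed.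

Let theta01 s : U s -> cform theta (cconj (xi s)) = 0.
Proof. by move=> Us; case: chern => _ hol _; exact: hol tF thetaP _ _ Us (T01xi s). Qed.

Let nabla_cst w s (eta : ctangent s) : U s ->
  nabla eta (fun t => F t w) = F s (cform theta eta w).
Proof.
move=> Us; have -> := thetaP.2 U (fun=> w) (fun t => F t w) oU (@subset_refl _ U) (mCk_cst _ _ _) (fun _ _ => erefl) s eta Us.
by rewrite cderive_cst add0r.
Qed.

Let section_cst k w : Ck_section k U (fun t => F t w).
Proof.
move=> s Us; exists U, W, F, (fun=> w); split=> //.
exact: mCk_cst.
Qed.

(** The sections constant in the trivialization are annihilated by the
    (0,1)-part of the connection, so that compatibility with the metric
    becomes an equation for the (1,0)-part: the connection form is the inverse
    of [P] times its (1,0)-derivative. *)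
Lemma connection_matrix s w : O s ->
  P s (cform theta (xi s) w) = D1 (cmap c s) w - 'i%C *: D2 (cmap c s) w.
Proof.
move=> Os; have [Us sc] := Os.
apply/eqP; rewrite -subr_eq0; apply/eqP/inner_eq0 => w2.
rewrite innerDl -scaleN1r innerZl mulN1r; apply/eqP; rewrite subr_eq0; apply/eqP.
case: chern => _ _ /(_ U (fun t => F t w) (fun t => F t w2) oU (section_cst 1 w) (section_cst 1 w2) s (xi s) Us).
rewrite !nabla_cst// theta01// !(Ph Us).2 (_ : (0 : Endo W) w2 = 0)// => H.
have {}H : cderive (pairing w w2) (xi s) = inner W (P s (cform theta (xi s) w)) w2.
  by rewrite H -(scale0r (0 : W)) innerZr rmorph0 mul0r addr0.
rewrite -H /cderive /=.
have -> : - ('i%C *: tvec b s) = tvec (- ('i%C *: b)) s.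
  by rewrite -!scaleNr tvecZ.
rewrite !mderive_pairing// rderivePcN// -/D1 -/D2 innerDl; congr (_ + _).
rewrite -[- _]scaleN1r EndoZ innerZl mulN1r -[- ('i%C *: _)]scaleN1r scalerA innerZl.
by rewrite scalerN mulN1r mulNr.
Qed.

Let dP y : Endo W := D1 y + (- 'i%C) *: D2 y.

Let dP1 : Ck 1 Om dP.
Proof.
apply: (Ck1_intro (D := fun v y => rderive D1 v y + (- 'i%C) *: rderive D2 v y)) => //.
- move=> y Oy; apply: cvgD; first exact: Ck0_continuous (D11 b) Oy.
  by apply: cvgZr; exact: Ck0_continuous (D11 ('i%C *: b)) Oy.
- move=> y v Oy; apply: isddD; first exact: Ck1_isdd (D11 _) Oy.
  by apply: isddZl; exact: Ck1_isdd (D11 _) Oy.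
- move=> y v Oy; apply: cvgD; first exact: Ck1_continuous (D11 _) Oy.
  by apply: cvgZr; exact: Ck1_continuous (D11 _) Oy.
Qed.

Let dPE v y : Om y -> rderive dP v y = rderive D1 v y + (- 'i%C) *: rderive D2 v y.
Proof.
move=> Oy; apply: (isdd_unique (Ck1_isdd v dP1 Oy)); apply: isddD; first exact: Ck1_isdd (D11 _) Oy.
by apply: isddZl; exact: Ck1_isdd (D11 _) Oy.
Qed.

Section vector.
Variable w : W.
Let g y := dP y w.
Let kap s := cform theta (xi s) w.
Let kapc := kap \o cinv c.

Let isdd_g v y : Om y -> isdd g y v (rderive dP v y w).
Proof.
move=> Oy; apply: (isdd_linear (L := fun Q : Endo W => Q w) (K := rn w)) (Ck1_isdd v dP1 Oy) => //.
by move=> a; rewrite mulrC; exact: rn_op.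
Qed.

Let g1 : Ck 1 Om g.
Proof.
apply: (Ck1_intro (D := fun v y => rderive dP v y w)) => //.
- move=> y Oy; apply: (linear_continuous_at (L := fun Q : Endo W => Q w) (K := rn w)) => //.
    by move=> a; rewrite mulrC; exact: rn_op.
  exact: Ck0_continuous dP1 Oy.
- by move=> y v; exact: isdd_g.
- move=> y v Oy; apply: (linear_continuous_at (L := fun Q : Endo W => Q w) (K := rn w)) => //.
    by move=> a; rewrite mulrC; exact: rn_op.
  exact: Ck1_continuous dP1 Oy.
Qed.

Let kapP y : Om y -> Pc y (kapc y) = g y.
Proof.
move=> [s Os <-]; have [_ sc] := Os; rewrite /Pc /kapc /= cmapK// connection_matrix//.
by rewrite /g /dP EndoD EndoZ scaleNr.
Qed.

Let kap_solve : Ck 1 Om kapc /\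
  forall y v, Om y -> Pc y (rderive kapc v y) = rderive g v y - rderive Pc v y (kapc y).
Proof.
apply: solve_Ck1 => // y [s [Us sc] <-]; rewrite /Pc /= cmapK//.
by have [[]] := Ph Us.
Qed.

Let kap1 : mCk 1 O kap. Proof. by apply: mCk1_chart => //; exact: kap_solve.1. Qed.

(** For the same reason only the (0,1)-derivative of the (1,0)-part of the
    connection contributes to the curvature. *)
Lemma curvature_section s : O s ->
  Rm (xi s) (F s w) = F s (- (rderive kapc b (cmap c s) + 'i%C *: rderive kapc ('i%C *: b) (cmap c s))).
Proof.
move=> Os; have [Us sc] := Os.
have xih : holomorphic_vector_field O xi by apply: tvec_holomorphic => // t [].
have w2 : Ck_section 2 O (fun t => F t w).
  move=> t [Ut _]; exists U, W, F, (fun=> w); split=> //.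
  exact: mCk_cst.
rewrite (curv oO xih w2 Os).
have -> : nabla (xi s) (fun t => nabla (cconj (xi t)) (fun u => F u w)) = 0.
  rewrite (thetaP.2 O (fun=> 0) _ oO _ (mCk_cst _ _ _) _ s (xi s) Os).
  - by rewrite cderive_cst add0r !linear0.
  - by move=> t [].
  - by move=> t [Ut _]; rewrite nabla_cst// theta01.
rewrite (thetaP.2 O kap _ oO _ kap1 _ s (cconj (xi s)) Os).
- rewrite theta01// (_ : (0 : Endo W) _ = 0)// addr0 sub0r linearN; congr (- F s _).
  rewrite /cderive /= opprK -(tvecZ _ _ sc ca).
  by rewrite !(mderiveE _ fS oO Os kap1 ca sc).
- by move=> t [].
- by move=> t [Ut _]; rewrite nabla_cst.
Qed.

(** With [k] the covariant derivative of the constant section [w], the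
    curvature in the direction [b] is the norm of [k] minus the Laplacian of
    [P]. *)
Lemma curvature_formula s : O s -> exists k : W,
  P s k = D1 (cmap c s) w - 'i%C *: D2 (cmap c s) w /\
  complex.Re (h (Rm (xi s) (F s w)) (F s w)) =
    rin (P s k) k - rin (rderive D1 b (cmap c s) w) w
      - rin (rderive D2 ('i%C *: b) (cmap c s) w) w.
Proof.
move=> Os; have [Us sc] := Os; have Op : Om (cmap c s) by exists s.
exists (kap s); split; first exact: connection_matrix.
rewrite curvature_section// (Ph Us).2; set p := cmap c s in Op *.
have PsE : P s = Pc p by rewrite /Pc /p /= cmapK.
have kE : kap s = kapc p by rewrite /kapc /p /= cmapK.
have gE v : rderive g v p = rderive dP v p w.
  by have [_ ->] := isdd_rderivable (isdd_g v Op).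
have Dsa v : selfadjoint (rderive Pc v p) by apply: rderive_selfadjoint Pc1 Op => //; exact: Pc_selfadjoint.
have DDsa v v' : selfadjoint (rderive (rderive Pc v) v' p).
  apply: rderive_selfadjoint (D11 v) Op => // y Oy.
  by apply: rderive_selfadjoint Pc1 Oy => //; exact: Pc_selfadjoint.
have gDE v : rderive g v p = rderive D1 v p w - 'i%C *: rderive D2 v p w.
  by rewrite gE dPE// -scaleNr.
rewrite PsE kE; apply: (curvature_algebra (P1 := D1 p) (P2 := D2 p)
  (P12 := rderive D1 ('i%C *: b) p) (P21 := rderive D2 b p)).
- exact: Dsa.
- exact: Dsa.
- exact: DDsa.
- exact: DDsa.
- by rewrite kapP// /g /dP -scaleNr.
- by rewrite (kap_solve.2 _ _ Op) gDE.
- by rewrite (kap_solve.2 _ _ Op) gDE.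
Qed.

End vector.
End connection_matrix.
End curvature.

(** * Products of a holomorphic function over four points *)

Section four_products.
Context {R : realType}.
Local Notation C := R[i].
Implicit Types (f g : C -> C) (z u l m : C).

Lemma cderivative_fder f z l : cderivative f z l -> fder f z (fun k => l * k).
Proof. by move=> fl e /fl[d d0 dP]; exists d. Qed.

Lemma cderivative_differentiable f z l : cderivative f z l ->
  differentiable f z /\ forall k, 'd f z k = l * k.
Proof.
move=> fl; apply: (fder_differentiable (M := rn l)) (cderivative_fder fl).
  by move=> a k k'; rewrite mulrDr mulrCA.
by move=> k; rewrite rnM.
Qed.

Lemma differentiable_cderivative f z : differentiable f z -> cderivative f z ('d f z 1).
Proof.
move=> /differentiable_fder fd e /fd[d d0 dP]; exists d => // k /dP.
have dE : 'd f z k = k *: 'd f z 1.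
  by rewrite -linearZ; congr ('d f z _); rewrite /GRing.scale /= mulr1.
by rewrite dE [_ *: _]mulrC.
Qed.

Lemma cderivative_unique f z l m : cderivative f z l -> cderivative f z m -> l = m.
Proof.
move=> /cderivative_differentiable[_ fl] /cderivative_differentiable[_ fm].
by rewrite -[l]mulr1 -fl fm mulr1.
Qed.

Lemma cderivative_scale f u z l : rn u = 1 -> cderivative f (u * z) l ->
  cderivative (fun w => f (u * w)) z (u * l).
Proof.
move=> u1 fl e /fl[d d0 dP]; exists d => // k kd.
have := dP (u * k); rewrite rnM u1 mul1r => /(_ kd).
by rewrite mulrDr mulrA [l * u]mulrC.
Qed.

Lemma cderivativeM f g z l m : cderivative f z l -> cderivative g z m ->
  cderivative (fun w => f w * g w) z (l * g z + f z * m).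
Proof.
move=> fl gm e e0; pose B := rn (f z) + rn (g z) + rn l + rn m + 1.
have [fz gz rl rm] := And4 (rn_ge0 (f z)) (rn_ge0 (g z)) (rn_ge0 l) (rn_ge0 m).
have B1 : 1 <= B by rewrite /B; flra.
have B0 : 0 < B by flra.
pose e1 := Num.min 1 (e / (4 * B)).
have e10 : 0 < e1 by rewrite lt_min ltr01 divr_gt0// mulr_gt0.
have [d d0 dP] := fl _ e10; have [d' d'0 d'P] := gm _ e10.
pose d2 := e / (4 * B ^+ 2 * 4).
have d20 : 0 < d2 by rewrite divr_gt0// !mulr_gt0// exprn_gt0.
exists (Num.min d (Num.min d' d2)); first by rewrite !lt_min d0 d'0.
move=> k; rewrite !lt_min => /and3P[/dP hf /d'P hg kd2].
set rf := f (z + k) - f z - l * k in hf; set rg := g (z + k) - g z - m * k in hg.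
have -> : f (z + k) * g (z + k) - f z * g z - (l * g z + f z * m) * k =
    rf * g z + (f z + l * k + rf) * rg + (l * k + rf) * (m * k) by rewrite /rf /rg; ring.
have k0 := rn_ge0 k; set x := rn k in k0 kd2 hf hg *.
have e11 : e1 <= 1 by rewrite ge_min lexx.
have e1B : e1 * (4 * B) <= e by rewrite -ler_pdivlMr ?mulr_gt0// ge_min lexx orbT.
have rf1 : rn rf <= x by apply: le_trans hf _; apply: ler_piMl.
have lk : rn (l * k + rf) <= B * x.
  apply: le_trans (rnD _ _) _; rewrite rnM -/x.
  apply: le_trans (lerD (lexx _) rf1) _; rewrite -[x in _ + x]mul1r -mulrDl.
  by apply: ler_wpM2r => //; rewrite /B; flra.
have x1 : x * (16 * B ^+ 2) < e by move: kd2; rewrite ltr_pdivlMr ?mulr_gt0 ?exprn_gt0//; flra.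
have flk : rn (f z + l * k + rf) <= B + B * x.
  rewrite -addrA; apply: le_trans (rnD _ _) _; apply: lerD lk; rewrite /B; flra.
apply: le_trans (rnD _ _) _; apply: le_trans (lerD (rnD _ _) (lexx _)) _.
rewrite (rnM rf) (rnM _ rg) (rnM _ (m * k)) (rnM m) -/x.
have t1 : rn rf * rn (g z) <= e1 * x * B.
  by apply: ler_pM => //; [exact: rn_ge0|rewrite /B; flra].
have t2 : rn (f z + l * k + rf) * rn rg <= (B + B * x) * (e1 * x).
  by apply: ler_pM => //; exact: rn_ge0.
have t3 : rn (l * k + rf) * (rn m * x) <= B * x * (B * x).
  apply: ler_pM => //; [exact: rn_ge0|by rewrite mulr_ge0|].
  by apply: ler_wpM2r => //; rewrite /B; flra.
have s1 : e1 * x * B <= e / 4 * x.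
  by rewrite mulrAC; apply: ler_wpM2r => //; flra.
have BB : B <= B ^+ 2 by rewrite expr2 ler_peMr// ltW.
have Bx0 : 0 <= B * x by rewrite mulr_ge0// ltW.
have s3 : B * x * (B * x) <= e / 16 * x.
  have -> : B * x * (B * x) = (x * (16 * B ^+ 2)) / 16 * x by field.
  by apply: ler_wpM2r => //; flra.
have s2 : B * x * (e1 * x) <= e / 16 * x.
  apply: le_trans s3; apply: ler_wpM2l => //; apply: ler_wpM2r => //.
  exact: le_trans e11 B1.
have s4 : B * (e1 * x) <= e / 4 * x by rewrite [B * _]mulrC.
have ex : 0 <= e * x by rewrite mulr_ge0// ltW.
apply: le_trans (lerD (lerD t1 t2) t3) _; rewrite mulrDl.
apply: le_trans (lerD (lerD s1 (lerD s4 s2)) s3) _.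
by rewrite -!mulrDl; apply: ler_wpM2r => //; flra.
Qed.

(** The product of the values of [f] at the four points [i ^ j z] is a
    holomorphic function invariant under the rotation by [i]. Its derivative
    therefore has a zero of order at least two, to which the second order
    Cauchy estimate is applied. *)
Lemma four_product (r M : R) : 0 < r -> exists K d : R, 0 < d /\ forall f,
  (forall z, rn z < 2 * r -> exists m, cderivative f z m) ->
  (forall z, rn z < 2 * r -> rn (f z) <= M) ->
  forall t : R, 0 <= t < d ->
  rn (f t%:C * f (- t%:C) * f ('i%C * t%:C) * f (- ('i%C * t%:C)) - f 0 ^+ 4) <= K * t ^+ 3.
Proof.
move=> r0; pose M1 := cauchy_constant * M ^+ 4 / (2 * r) * 1.
exists (512 * M1 / (r / 2) ^+ 2), (r / 8); split=> [|f fd fM]; first by flra.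
pose F (z : C) : C := f z * f (- 1 * z) * f ('i%C * z) * f (- 'i%C * z).
have M0 : 0 <= M by apply: le_trans (fM 0 _); rewrite ?rn_ge0// rn0; flra.
have iI : rn ('i%C : C) = 1 := rni.
have Fd z : rn z < 2 * r -> exists m, cderivative F z m.
  move=> zr; have [m0 h0] := fd z zr.
  have sc u : rn u = 1 -> exists m, cderivative (fun w => f (u * w)) z m.
    move=> u1; have [|m h] := fd (u * z); first by rewrite rnM u1 mul1r.
    by exists (u * m); exact: cderivative_scale.
  have [|m1 h1] := sc (- 1); first by rewrite rnN rn1.
  have [|m2 h2] := sc 'i%C; first by [].
  have [|m3 h3] := sc (- 'i%C); first by rewrite rnN.
  by eexists; exact: cderivativeM (cderivativeM (cderivativeM h0 h1) h2) h3.
have FM z : rn z < 2 * r -> rn (F z) <= M ^+ 4.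
  move=> zr; have h u : rn u = 1 -> rn (f (u * z)) <= M.
    by move=> u1; apply: fM; rewrite rnM u1 mul1r.
  rewrite /F !rnM (_ : M ^+ 4 = M * M * M * M); last by ring.
  apply: ler_pM; rewrite ?mulr_ge0 ?rn_ge0//; last by apply: h; rewrite rnN.
  apply: ler_pM; rewrite ?mulr_ge0 ?rn_ge0//; last exact: h.
  by apply: ler_pM; rewrite ?rn_ge0//; [exact: fM|apply: h; rewrite rnN rn1].
have Fdiff z : rn (z - 0) < 2 * r -> differentiable F z.
  by rewrite subr0 => /Fd[m /cderivative_differentiable[]].
have FM' z : rn (z - 0) < 2 * r -> rn (F z) <= M ^+ 4 by rewrite subr0; exact: FM.
have r20 : 0 < 2 * r by flra.
pose dF (z : C) : C := 'd F z (1 : C).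
have dFE z : rn z < 2 * r -> cderivative F z (dF z).
  by move=> zr; apply: differentiable_cderivative; apply: Fdiff; rewrite subr0.
have dFM z : rn z < r -> rn (dF z) <= M1.
  move=> zr; have := frechet_diff_bound r20 Fdiff FM' (1 : C) (y := z).
  by rewrite subr0 rn1; apply; flra.
have dFd z : rn z < r -> cderivative dF z ('d dF z 1).
  move=> zr; apply: differentiable_cderivative.
  have h w : rn (w - z) < r -> rn (w - 0) < 2 * r.
    rewrite subr0 => wz; rewrite -[w](subrK z); apply: le_lt_trans (rnD _ _) _; flra.
  by apply: (derivative_differentiable (M := M ^+ 4) _ r0) => w /h; [exact: Fdiff|exact: FM'].
clearbody dF M1.
have Fi z : F ('i%C * z) = F z.
  have i2 : 'i%C * ('i%C * z) = - 1 * z by rewrite mulrA -expr2 sqr_i.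
  by rewrite /F i2 !mulNr i2 !mulN1r opprK mul1r; ring.
have dFi z : rn z < 2 * r -> 'i%C * dF ('i%C * z) = dF z.
  move=> zr; have iz : rn ('i%C * z) < 2 * r by rewrite rnM iI mul1r.
  have := cderivative_scale iI (dFE _ iz).
  by rewrite (_ : (fun w => F ('i%C * w)) = F); [move/cderivative_unique; apply; exact: dFE|exact/funext].
have fix0 (a : C) : 'i%C * a = a -> a = 0.
  move=> ia; have : a = - a by rewrite -[RHS]mulN1r -sqr_i expr2 -mulrA !ia.
  by move=> /eqP; rewrite -subr_eq0 opprK -mulr2n -mulr_natl mulf_eq0 pnatr_eq0/= => /eqP.
have r02 : rn (0 : C) < 2 * r by rewrite rn0.
have dF0 : dF 0 = 0 by have := dFi 0 r02; rewrite mulr0 => /fix0.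
have r00 : rn (0 : C) < r by rewrite rn0.
have ddF0 : 'd dF 0 1 = 0.
  have h : cderivative dF 0 ('i%C * ('i%C * 'd dF 0 1)).
    have h1 : cderivative dF ('i%C * 0) ('d dF 0 1) by rewrite mulr0; exact: dFd.
    move=> e e0; have [d d0 dP] := cderivative_scale iI h1 e0.
    exists (Num.min d (2 * r)) => [|k]; first by rewrite lt_min d0.
    rewrite lt_min => /andP[/dP + kr]; rewrite !add0r mulr0 => h3.
    rewrite -(dFi k kr) dF0 subr0.
    rewrite (_ : _ - _ = 'i%C * (dF ('i%C * k) - dF 0 - 'i%C * 'd dF 0 1 * k)).
      by rewrite rnM iI mul1r.
    by rewrite dF0; ring.
  have := cderivative_unique h (dFd 0 r00); rewrite mulrA -expr2 sqr_i mulN1r => E.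
  apply/eqP; have /eqP := E; rewrite eq_sym -subr_eq0 opprK -mulr2n -mulr_natl mulf_eq0.
  by rewrite pnatr_eq0.
have rr : 0 < r / 2 by flra.
have est z : rn z <= r / 8 -> rn (dF z) <= 512 * M1 / (r / 2) ^+ 2 * rn z ^+ 2.
  move=> zr; have r22 : 2 * (r / 2) = r by field.
  have := @holomorphic_estimates _ dF (r / 2) M1 ('d dF 0 1) rr; rewrite r22 => h.
  have [||||_] := h _ _ _ z _.
  - by move=> w wr; exists ('d dF w 1); exact: dFd.
  - by move=> w; exact: dFM.
  - by apply: dFd; rewrite rn0.
  - by flra.
  by rewrite dF0 ddF0 mul0r !subr0.
move=> t /andP[t0 tr].
have := @mean_value_le _ C (fun s : R => F (0 + s%:C * 1)) (fun s : R => dF (0 + s%:C * 1) * 1) 0 t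
  (512 * M1 / (r / 2) ^+ 2 * t ^+ 2) t0.
have -> : 0 + t%:C * 1 = t%:C :> C by rewrite mulr1 add0r.
have -> : 0 + (0 : R)%:C * 1 = 0 :> C by rewrite mulr1 add0r.
rewrite (_ : _ * t ^+ 2 * (t - 0) = 512 * M1 / (r / 2) ^+ 2 * t ^+ 3); last by ring.
rewrite (_ : F 0 = f 0 ^+ 4); last first.
  by rewrite /F !mulr0; ring.
rewrite (_ : F t%:C = f t%:C * f (- t%:C) * f ('i%C * t%:C) * f (- ('i%C * t%:C))); last first.
  by rewrite /F mulN1r mulNr.
apply=> s /andP[s0 st].
  apply: cderivative_line; apply: dFE; rewrite add0r mulr1 rnR ger0_norm//; flra.
rewrite mulr1 add0r mulr1; apply: le_trans (est _ _) _; rewrite rnR ger0_norm//; first by flra.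
apply: ler_wpM2l; last by rewrite ler_sqr.
apply: divr_ge0; last exact: sqr_ge0.
by apply: mulr_ge0; [exact: ler0n|exact: le_trans (rn_ge0 _) (dFM 0 r00)].
Qed.

End four_products.

(** * Sums of quadratic forms over four points *)

Section quadratic_forms.
Context {R : realType}.
Local Notation C := R[i].
Variable W : hilbert_space R.
Implicit Types (u v w x y : W) (P Q : Endo W) (t e M s : R).

Definition qf P w := rin (P w) w.

Lemma qf_line Q w v s : selfadjoint Q ->
  qf Q (w + s%:C *: v) = qf Q w + 2 * s * rin (Q w) v + s ^+ 2 * qf Q v.
Proof.
move=> Qs; rewrite /qf opD opZ !(rinDl, rinDr, rinZl, rinZr).
by rewrite (selfadjoint_rin v w Qs) (rinC v); ring.
Qed.

Lemma qf_i Q w : qf Q ('i%C *: w) = qf Q w.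
Proof. by rewrite /qf opZ rin_ii. Qed.

Lemma qf_le Q w : `|qf Q w| <= rn Q * rn w ^+ 2.
Proof.
have h v : rin (Q v) v <= rn Q * rn v ^+ 2.
  apply: le_trans (rin_le _ _) _; rewrite expr2 mulrA.
  by apply: ler_wpM2r; [exact: rn_ge0|exact: rn_op].
rewrite ler_norml h andbT lerNl -rinNl.
apply: le_trans (rin_le _ _) _; rewrite rnN expr2 mulrA.
by apply: ler_wpM2r; [exact: rn_ge0|exact: rn_op].
Qed.

Lemma qf_remainder P P0 P1 P2 s e w : rn (P - P0 - s%:C *: P1 - (s ^+ 2 / 2)%:C *: P2) <= e * s ^+ 2 ->
  `|qf P w - (qf P0 w + s * qf P1 w + s ^+ 2 / 2 * qf P2 w)| <= e * s ^+ 2 * rn w ^+ 2.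
Proof.
set E : Endo W := _ - _; move=> hE; have -> : qf P w - (qf P0 w + s * qf P1 w + s ^+ 2 / 2 * qf P2 w) = qf E w.
  rewrite /qf; have -> : E w = P w - P0 w - s%:C *: P1 w - (s ^+ 2 / 2)%:C *: P2 w by [].
  by rewrite !(rinDl, rinNl, rinZl); ring.
by apply: le_trans (qf_le _ _) _; apply: ler_wpM2r => //; exact: sqr_ge0.
Qed.

Lemma qf_pair (Pp Pm P0 P1 P2 : Endo W) w v t e M : selfadjoint P0 -> selfadjoint P1 -> selfadjoint P2 ->
  0 < t <= e -> e <= 1 -> 1 <= M -> rn w <= M -> rn v <= M -> rn P2 <= M ->
  rn (Pp - P0 - t%:C *: P1 - (t ^+ 2 / 2)%:C *: P2) <= e * t ^+ 2 ->
  rn (Pm - P0 - (- t)%:C *: P1 - ((- t) ^+ 2 / 2)%:C *: P2) <= e * (- t) ^+ 2 ->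
  `|qf Pp (w + t%:C *: v) + qf Pm (w - t%:C *: v)
    - (2 * qf P0 w + t ^+ 2 * (2 * qf P0 v + 4 * rin (P1 w) v + qf P2 w))| <= 9 * M ^+ 3 * (e * t ^+ 2).
Proof.
move=> s0 s1 s2 /andP[t0 te] e1 M1 wM vM P2M /(qf_remainder (w + t%:C *: v)) + /(qf_remainder (w + (- t)%:C *: v)).
have -> : w - t%:C *: v = w + (- t)%:C *: v by rewrite rmorphN scaleNr.
set qp := qf Pp _; set qm := qf Pm _; set rp := rn _; set rm := rn _.
rewrite !qf_line// !sqrrN => hp hm.
have Mp : 0 < M := lt_le_trans ltr01 M1.
have t1 : t <= 1 := le_trans te e1.
have et : 0 <= e * t ^+ 2 := mulr_ge0 (le_trans (ltW t0) te) (sqr_ge0 t).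
have phi (s : R) : `|s| <= 1 -> rn (w + s%:C *: v) ^+ 2 <= 4 * M ^+ 2.
  move=> s1'; rewrite (_ : 4 * M ^+ 2 = (2 * M) ^+ 2); last by ring.
  rewrite ler_sqr ?nnegrE ?rn_ge0 ?mulr_ge0 ?(ltW Mp)//.
  apply: le_trans (rnD _ _) _; rewrite rnZ rnR mulrDl mul1r; apply: lerD => //.
  by apply: le_trans vM; apply: ler_piMl => //; exact: rn_ge0.
have M23 : 4 * M ^+ 2 <= 4 * M ^+ 3.
  apply: ler_wpM2l => //; rewrite (exprS M 2); apply: ler_peMl => //; exact: sqr_ge0.
have b1 : e * t ^+ 2 * rm ^+ 2 <= e * t ^+ 2 * (4 * M ^+ 3).
  by apply: ler_wpM2l => //; apply: le_trans (phi _ _) M23; rewrite normrN gtr0_norm.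
have b2 : e * t ^+ 2 * rp ^+ 2 <= e * t ^+ 2 * (4 * M ^+ 3).
  by apply: ler_wpM2l => //; apply: le_trans (phi _ _) M23; rewrite gtr0_norm.
have b3 : `|t ^+ 4 * qf P2 v| <= e * t ^+ 2 * M ^+ 3.
  rewrite normrM (ger0_norm (exprn_ge0 4 (ltW t0))).
  apply: ler_pM; [exact: exprn_ge0 (ltW t0)|exact: normr_ge0|..].
    rewrite (_ : t ^+ 4 = t ^+ 2 * t ^+ 2); last by ring.
    apply: ler_wpM2r; first exact: sqr_ge0.
    by rewrite expr2; apply: le_trans te; apply: ler_piMr => //; exact: ltW.
  apply: le_trans (qf_le _ _) _; rewrite exprS; apply: ler_pM => //; [exact: rn_ge0|exact: sqr_ge0|].
  by rewrite ler_sqr ?nnegrE ?rn_ge0// ltW.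
have := le_trans hp b2; have := le_trans hm b1; move: b3; clear.
set A := e * t ^+ 2; set Tp := _ + _ + _; set Tm := qf P0 w + _ + _ + _ + _.
move=> b3 hm hp; rewrite (_ : _ - _ = (qp - Tm) + (qm - Tp) + t ^+ 4 * qf P2 v); last first.
  by rewrite /Tp /Tm; field.
apply: le_trans (ler_normD _ _) _; apply: le_trans (lerD (ler_normD _ _) (lexx _)) _.
rewrite (_ : 9 * M ^+ 3 * A = A * (4 * M ^+ 3) + A * (4 * M ^+ 3) + A * M ^+ 3); last by ring.
by apply: lerD => //; exact: lerD.
Qed.

Lemma inverse_selfadjoint P Q : selfadjoint P -> cancel Q P -> selfadjoint Q.
Proof. by move=> Ps QP u v; rewrite -{1}[v]QP -Ps QP. Qed.

Lemma qf_inverse P Q P0 u : selfadjoint P -> selfadjoint P0 -> cancel P Q -> cancel Q P ->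
  qf Q (P0 u) = 2 * qf P0 u - qf P u + qf Q ((P - P0) u).
Proof.
move=> Ps P0s PQ QP; rewrite /qf EndoB !(opB Q) PQ !(rinDl, rinDr, rinNl, rinNr).
have h v : rin (Q v) (P u) = rin v u by rewrite -(selfadjoint_rin _ _ Ps) QP.
by rewrite !h (rinC u (P u)) (rinC u (P0 u)); ring.
Qed.

(** To first order [(P - P0) (x + s *: y)] is [s *: P1 x], and [Q] is close to
    [Q0]. *)
Lemma qf_dual_error P P0 P1 P2 Q Q0 x y t s e M : `|s| = t -> 0 < t <= e -> e <= 1 -> 1 <= M ->
  rn x <= M -> rn y <= M -> rn P1 <= M -> rn P2 <= M -> rn Q0 <= M -> rn (Q - Q0) <= e ->
  rn (P - P0 - s%:C *: P1 - (s ^+ 2 / 2)%:C *: P2) <= e * s ^+ 2 ->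
  qf Q ((P - P0) (x + s%:C *: y)) <= t ^+ 2 * qf Q0 (P1 x) + 71 * M ^+ 5 * (e * t ^+ 2).
Proof.
move=> sE /andP[t0 te] e1 M1 xM yM P1M P2M Q0M Qe.
have s2 : s ^+ 2 = t ^+ 2 by rewrite -sE real_normK ?num_real.
set E := P - P0 - _ - _ => hE; have Mp : 0 < M := lt_le_trans ltr01 M1.
have t1 : t <= 1 := le_trans te e1; have t20 : 0 <= t ^+ 2 := sqr_ge0 t.
rewrite s2 in hE; have e0 : 0 <= e := le_trans (ltW t0) te.
have hE1 : rn E <= t ^+ 2 by apply: le_trans hE _; apply: ler_piMl.
have xy : rn (x + s%:C *: y) <= 2 * M.
  apply: le_trans (rnD _ _) _; rewrite rnZ rnR sE mulrDl mul1r; apply: lerD => //.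
  by apply: le_trans yM; apply: ler_piMl => //; exact: rn_ge0.
have P12 : rn (E + (s ^+ 2 / 2)%:C *: P2) <= t ^+ 2 * (2 * M).
  apply: le_trans (rnD _ _) _; rewrite mulrDl mul1r mulrDr; apply: lerD.
    by apply: le_trans hE1 _; exact: ler_peMr.
  rewrite rnZ rnR s2 ger0_norm ?divr_ge0//; apply: ler_pM => //; [exact: divr_ge0|exact: rn_ge0|].
  by rewrite ler_pdivrMr// ler_peMr// ler1n.
pose a := s%:C *: P1 x; pose r := (s ^+ 2)%:C *: P1 y + (E + (s ^+ 2 / 2)%:C *: P2) (x + s%:C *: y).
have -> : (P - P0) (x + s%:C *: y) = a + r.
  have -> : P - P0 = s%:C *: P1 + (E + (s ^+ 2 / 2)%:C *: P2) by rewrite /E; lmod_over R[i].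
  by rewrite EndoD EndoZ opD opZ /a /r rmorphXn /=; lmod_over R[i].
have aM : rn a <= t * M ^+ 2.
  rewrite /a rnZ rnR sE; apply: ler_wpM2l; first exact: ltW.
  by apply: le_trans (rn_op _ _) _; rewrite expr2; apply: ler_pM => //; exact: rn_ge0.
have rM : rn r <= t ^+ 2 * (5 * M ^+ 2).
  apply: le_trans (rnD _ _) _.
  rewrite (_ : t ^+ 2 * (5 * M ^+ 2) = t ^+ 2 * (M * M) + t ^+ 2 * (2 * M) * (2 * M)); last by ring.
  apply: lerD.
    rewrite rnZ rnR s2 ger0_norm//; apply: ler_wpM2l => //.
    by apply: le_trans (rn_op _ _) _; apply: ler_pM => //; exact: rn_ge0.
  by apply: le_trans (rn_op _ _) _; apply: ler_pM => //; exact: rn_ge0.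
have QM : rn Q <= 2 * M.
  rewrite -[Q](subrK Q0); apply: le_trans (rnD _ _) _; rewrite mulrDl mul1r.
  by apply: lerD => //; apply: le_trans Qe _; exact: le_trans e1 M1.
have Qr u : rin (Q u) u = rin (Q0 u) u + qf (Q - Q0) u by rewrite /qf EndoB rinDl rinNl addrC subrK.
have prod u v A B : rn u <= A -> rn v <= B -> rin (Q u) v <= 2 * M * A * B.
  move=> uA vB; apply: le_trans (rin_le _ _) _; apply: ler_pM => //; rewrite ?rn_ge0//.
  by apply: le_trans (rn_op _ _) _; apply: ler_pM => //; exact: rn_ge0.
have t3 : t ^+ 3 <= e * t ^+ 2 by rewrite exprS; apply: ler_wpM2r.
have t4 : t ^+ 4 <= e * t ^+ 2.
  by apply: le_trans t3; rewrite (exprS t 3); apply: ler_piMl => //; apply: exprn_ge0; exact: ltW.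
have q0a : rin (Q0 a) a = t ^+ 2 * qf Q0 (P1 x) by rewrite /a opZ rinZl rinZr mulrA -expr2 s2.
have M50 : 0 <= M ^+ 5 by apply: exprn_ge0; exact: ltW.
have b1 : qf (Q - Q0) a <= e * t ^+ 2 * M ^+ 5.
  apply: le_trans (ler_norm _) _; apply: le_trans (qf_le _ _) _; rewrite -mulrA.
  apply: ler_pM => //; [exact: rn_ge0|exact: sqr_ge0|].
  apply: le_trans (_ : (t * M ^+ 2) ^+ 2 <= _).
    by rewrite ler_sqr ?nnegrE ?rn_ge0// mulr_ge0 ?(ltW t0)// sqr_ge0.
  rewrite exprMn -exprM; apply: ler_wpM2l => //; rewrite (exprS M 4); apply: ler_peMl => //.
  by apply: exprn_ge0; exact: ltW.
have b2 : rin (Q a) r <= 10 * M ^+ 5 * (e * t ^+ 2).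
  apply: le_trans (prod _ _ _ _ aM rM) _.
  rewrite (_ : 2 * M * _ * _ = 10 * M ^+ 5 * t ^+ 3); last by ring.
  by apply: ler_wpM2l => //; exact: mulr_ge0.
have b3 : rin (Q r) a <= 10 * M ^+ 5 * (e * t ^+ 2).
  apply: le_trans (prod _ _ _ _ rM aM) _.
  rewrite (_ : 2 * M * _ * _ = 10 * M ^+ 5 * t ^+ 3); last by ring.
  by apply: ler_wpM2l => //; exact: mulr_ge0.
have b4 : rin (Q r) r <= 50 * M ^+ 5 * (e * t ^+ 2).
  apply: le_trans (prod _ _ _ _ rM rM) _.
  rewrite (_ : 2 * M * _ * _ = 50 * M ^+ 5 * t ^+ 4); last by ring.
  by apply: ler_wpM2l => //; exact: mulr_ge0.
clearbody a r; rewrite {1}/qf opD !(rinDl, rinDr) Qr q0a.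
move: b1 b2 b3 b4; clear; set A := e * t ^+ 2.
rewrite (_ : 71 * M ^+ 5 * A = A * M ^+ 5 + 10 * M ^+ 5 * A + 10 * M ^+ 5 * A + 50 * M ^+ 5 * A); last by ring.
by flra.
Qed.

(** The second order expansion at a point of the sum of the values of
    [<P phi, phi>] over four points [i ^ j t], for a vector [phi] depending
    linearly on the point; [phi] is chosen so that the curvature appears. *)
Lemma qf_four (P1p P1m P2p P2m P0 P1 P2 P11 P22 : Endo W) w k t e M :
  selfadjoint P0 -> selfadjoint P1 -> selfadjoint P2 -> selfadjoint P11 -> selfadjoint P22 ->
  0 < t <= e -> e <= 1 -> 1 <= M -> rn w <= M -> rn k <= M -> rn P11 <= M -> rn P22 <= M ->
  P0 k = P1 w - 'i%C *: P2 w ->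
  rn (P1p - P0 - t%:C *: P1 - (t ^+ 2 / 2)%:C *: P11) <= e * t ^+ 2 ->
  rn (P1m - P0 - (- t)%:C *: P1 - ((- t) ^+ 2 / 2)%:C *: P11) <= e * (- t) ^+ 2 ->
  rn (P2p - P0 - t%:C *: P2 - (t ^+ 2 / 2)%:C *: P22) <= e * t ^+ 2 ->
  rn (P2m - P0 - (- t)%:C *: P2 - ((- t) ^+ 2 / 2)%:C *: P22) <= e * (- t) ^+ 2 ->
  forall v, v = (- 2^-1)%:C *: k ->
  qf P1p (w + t%:C *: v) + qf P1m (w - t%:C *: v)
    + qf P2p (w + t%:C *: ('i%C *: v)) + qf P2m (w - t%:C *: ('i%C *: v))
  <= 4 * qf P0 w + t ^+ 2 * (qf P11 w + qf P22 w - rin (P0 k) k) + 18 * M ^+ 3 * (e * t ^+ 2).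
Proof.
move=> s0 s1 s2 s11 s22 te e1 M1 wM kM M11 M22 Pk h1 h2 h3 h4 v vE.
have vM : rn v <= M.
  rewrite vE rnZ rnR normrN normfV ger0_norm// ler_pdivrMl//.
  by apply: le_trans kM _; apply: ler_peMl => //; [exact: le_trans M1|rewrite ler1n].
have ivM : rn ('i%C *: v) <= M by rewrite rnZ rni mul1r.
have := qf_pair s0 s1 s11 te e1 M1 wM vM M11 h1 h2.
have := qf_pair s0 s2 s22 te e1 M1 wM ivM M22 h3 h4.
rewrite !ler_norml qf_i => /andP[_ b2] /andP[_ b1].
have e0 : 4 * qf P0 v = rin (P0 k) k by rewrite /qf vE opZ rinZl rinZr; field.
have e2 : 4 * rin (P1 w) v + 4 * rin (P2 w) ('i%C *: v) = - 2 * rin (P0 k) k.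
  have -> : rin (P2 w) ('i%C *: v) = - rin ('i%C *: P2 w) v by rewrite rin_il opprK.
  by rewrite Pk rinDl rinNl vE !rinZr; field.
move: b1 b2; set A := e * t ^+ 2; set B := M ^+ 3.
set qpp := qf P1p _; set qpm := qf P1m _; set qip := qf P2p _; set qim := qf P2m _.
set n0 := qf P0 w; set n11 := qf P11 w; set n22 := qf P22 w.
set kk := rin (P0 k) k in e0 e2 *; set n0v := qf P0 v in e0 *.
set c1 := rin (P1 w) v in e2 *; set c2 := rin (P2 w) _ in e2 *.
have -> : t ^+ 2 * (n11 + n22 - kk) = t ^+ 2 * (2 * n0v + 4 * c1 + n11) + t ^+ 2 * (2 * n0v + 4 * c2 + n22).
  rewrite -mulrDr; congr (_ * _); move: e0 e2; clear; flra.
by clear; set X := t ^+ 2 * _; set Y := t ^+ 2 * _; flra.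
Qed.

(** The same for the inverse operators, which represent the dual metric. *)
Lemma qf_inverse_four (P1p P1m P2p P2m Q1p Q1m Q2p Q2m P0 Q0 P1 P2 P11 P22 : Endo W) x k t e M :
  selfadjoint P0 -> selfadjoint P1 -> selfadjoint P2 -> selfadjoint P11 -> selfadjoint P22 ->
  selfadjoint P1p -> selfadjoint P1m -> selfadjoint P2p -> selfadjoint P2m ->
  cancel P0 Q0 -> cancel Q0 P0 -> cancel P1p Q1p -> cancel Q1p P1p -> cancel P1m Q1m -> cancel Q1m P1m ->
  cancel P2p Q2p -> cancel Q2p P2p -> cancel P2m Q2m -> cancel Q2m P2m ->
  0 < t <= e -> e <= 1 -> 1 <= M ->
  forall y, y = 2^-1%:C *: Q0 (P1 x + 'i%C *: P2 x) ->
  rn x <= M -> rn y <= M -> rn P1 <= M -> rn P2 <= M -> rn P11 <= M -> rn P22 <= M -> rn Q0 <= M ->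
  rn (Q1p - Q0) <= e -> rn (Q1m - Q0) <= e -> rn (Q2p - Q0) <= e -> rn (Q2m - Q0) <= e ->
  P0 k = P1 x - 'i%C *: P2 x ->
  rn (P1p - P0 - t%:C *: P1 - (t ^+ 2 / 2)%:C *: P11) <= e * t ^+ 2 ->
  rn (P1m - P0 - (- t)%:C *: P1 - ((- t) ^+ 2 / 2)%:C *: P11) <= e * (- t) ^+ 2 ->
  rn (P2p - P0 - t%:C *: P2 - (t ^+ 2 / 2)%:C *: P22) <= e * t ^+ 2 ->
  rn (P2m - P0 - (- t)%:C *: P2 - ((- t) ^+ 2 / 2)%:C *: P22) <= e * (- t) ^+ 2 ->
  qf Q1p (P0 (x + t%:C *: y)) + qf Q1m (P0 (x - t%:C *: y))
    + qf Q2p (P0 (x - t%:C *: ('i%C *: y))) + qf Q2m (P0 (x + t%:C *: ('i%C *: y)))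
  <= 4 * qf P0 x + t ^+ 2 * (rin (P0 k) k - qf P11 x - qf P22 x) + 302 * M ^+ 5 * (e * t ^+ 2).
Proof.
move=> s0 s1 s2 s11 s22 s1p s1m s2p s2m PQ0 QP0 PQ1p QP1p PQ1m QP1m PQ2p QP2p PQ2m QP2m.
move=> te e1 M1 y yE xM yM M1' M2' M11 M22 MQ q1p q1m q2p q2m Pk h1 h2 h3 h4.
have [t0 _] := andP te; have Mp : 0 < M := lt_le_trans ltr01 M1.
have nt : `|- t| = t by rewrite normrN gtr0_norm.
have pt : `|t| = t by rewrite gtr0_norm.
pose y2 := - ('i%C *: y); have y2M : rn y2 <= M by rewrite rnN rnZ rni mul1r.
have m1 : x - t%:C *: y = x + (- t)%:C *: y by rewrite rmorphN scaleNr.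
have m2 : x - t%:C *: ('i%C *: y) = x + t%:C *: y2 by rewrite /y2 scalerN.
have m3 : x + t%:C *: ('i%C *: y) = x + (- t)%:C *: y2 by rewrite /y2 rmorphN scaleNr scalerN opprK.
have m4 : x - t%:C *: y2 = x + (- t)%:C *: y2 by rewrite rmorphN scaleNr.
have := qf_pair s0 s1 s11 te e1 M1 xM yM M11 h1 h2; rewrite m1 ler_norml => /andP[b1 _].
have := qf_pair s0 s2 s22 te e1 M1 xM y2M M22 h3 h4; rewrite m4 ler_norml => /andP[b2 _].
have d1 := qf_dual_error pt te e1 M1 xM yM M1' M11 MQ q1p h1.
have d2 := qf_dual_error nt te e1 M1 xM yM M1' M11 MQ q1m h2.
have d3 := qf_dual_error pt te e1 M1 xM y2M M2' M22 MQ q2p h3.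
have d4 := qf_dual_error nt te e1 M1 xM y2M M2' M22 MQ q2m h4.
rewrite m2 m3 !(qf_inverse _ s1p s0 PQ1p QP1p) (qf_inverse _ s1m s0 PQ1m QP1m).
rewrite (qf_inverse _ s2p s0 PQ2p QP2p) (qf_inverse _ s2m s0 PQ2m QP2m).
have M35 : M ^+ 3 <= M ^+ 5.
  rewrite (_ : M ^+ 5 = M ^+ 2 * M ^+ 3); last by ring.
  by apply: ler_peMl; [apply: exprn_ge0; exact: ltW|rewrite expr_ge1// ltW].
have et : 0 <= e * t ^+ 2 by rewrite mulr_ge0 ?sqr_ge0//; have /andP[? ?] := te; exact: le_trans (ltW t0) _.
have n35 : 9 * M ^+ 3 * (e * t ^+ 2) <= 9 * M ^+ 5 * (e * t ^+ 2).
  by apply: ler_wpM2r => //; apply: ler_wpM2l.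
have Q0s := inverse_selfadjoint s0 QP0.
pose q u v := rin (Q0 u) v.
have qC u v : q u v = q v u by rewrite /q selfadjoint_rin// rinC.
have qi u v : q ('i%C *: u) v = - q u ('i%C *: v) by rewrite /q opZ rin_il.
have qii u v : q ('i%C *: u) ('i%C *: v) = q u v by rewrite /q opZ rin_ii.
have qDl u v z : q (u + v) z = q u z + q v z by rewrite /q opD rinDl.
have qDr u v z : q z (u + v) = q z u + q z v by rewrite /q rinDr.
have qNl u z : q (- u) z = - q u z by rewrite /q opN rinNl.
have qNr u z : q z (- u) = - q z u by rewrite /q rinNr.
pose a := P1 x; pose b := P2 x.
have P0y : P0 y = 2^-1%:C *: (a + 'i%C *: b) by rewrite yE opZ QP0.
have e1' : 4 * qf P0 y = q (a + 'i%C *: b) (a + 'i%C *: b).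
  by rewrite /qf P0y rinZl yE rinZr /q (rinC _ (Q0 _)); field.
have e2' : rin (P1 x) y = 2^-1 * q (a + 'i%C *: b) a by rewrite rinC yE rinZl.
have e3' : rin (P2 x) y2 = 2^-1 * q ('i%C *: b) (a + 'i%C *: b).
  have -> : rin (P2 x) y2 = rin ('i%C *: P2 x) y by rewrite /y2 rinNr rin_il.
  by rewrite rinC yE rinZl -/a -/b -/(q _ _) qC.
have e4' : rin (P0 k) k = q (a - 'i%C *: b) (a - 'i%C *: b).
  have -> : k = Q0 (a - 'i%C *: b) by rewrite -Pk PQ0.
  by rewrite QP0 rinC.
have e5' : qf P0 y2 = qf P0 y by rewrite /y2 /qf opN rinNl rinNr opprK -/(qf _ _) qf_i.
have qb : q ('i%C *: b) ('i%C *: b) = q b b := qii b b.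
have e6 : 2 * qf P0 y + 2 * qf P0 y2 - 4 * rin (P1 x) y - 4 * rin (P2 x) y2
    + 2 * qf Q0 (P1 x) + 2 * qf Q0 (P2 x) = rin (P0 k) k.
  rewrite e5' e2' e3' e4' (_ : qf Q0 (P1 x) = q a a)// (_ : qf Q0 (P2 x) = q b b)//.
  move: e1'; rewrite !(qDl, qDr, qNl, qNr) qb !opprK.
  rewrite (qC ('i%C *: b) a); move: (q a a) (q a ('i%C *: b)) (q b b) (qf P0 y); clear.
  by move=> u1 u2 u3 u4; flra.
rewrite (qf_line x y t s0) (qf_line x y (- t) s0) (qf_line x y2 t s0) (qf_line x y2 (- t) s0) !sqrrN.
move: b1 b2 d1 d2 d3 d4 n35; rewrite -e6; clear.
move: (e * t ^+ 2) (M ^+ 5) (M ^+ 3) (qf P1p _) (qf P1m _) (qf P2p _) (qf P2m _) (qf Q1p _) (qf Q1m _)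
  (qf Q2p _) (qf Q2m _) (qf Q0 _) (qf Q0 _) (rin (P1 x) y) (rin (P2 x) y2) (qf P0 x) (qf P11 x)
  (qf P22 x) (rin (P0 x) y) (rin (P0 x) y2) (qf P0 y) (qf P0 y2).
clear => A B B3 p1 p2 p3 p4 r1 r2 r3 r4 z1 z2 c1 c2 n0 n1 n2 m0 m2 v1 v2.
rewrite !mulrDr; flra.
Qed.

End quadratic_forms.

(** * Positive operators and holomorphic families of operators *)

Section positive_forms.
Context {R : realType}.
Local Notation C := R[i].
Variable W : hilbert_space R.
Implicit Types (u v w : W) (P Q : Endo W) (e d : R).

Lemma positive_qf P w : positive_invertible P -> 0 <= qf P w.
Proof.
move=> [P0 _ _]; have := P0 w; rewrite /qf /rin.
by case: (inner W (P w) w) => a b; rewrite lecE /= => /andP[_].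
Qed.

Lemma positive_selfadjoint P : positive_invertible P -> selfadjoint P.
Proof. by case. Qed.

Lemma qf_cauchy_schwarz P u v : selfadjoint P -> (forall w, 0 <= qf P w) ->
  rin (P u) v ^+ 2 <= qf P u * qf P v.
Proof.
move=> Ps P0; set c := rin (P u) v.
have h s : 0 <= qf P u + 2 * s * c + s ^+ 2 * qf P v by rewrite -qf_line.
have [v0|v0] := eqVneq (qf P v) 0.
  have [->|c0] := eqVneq c 0; first by rewrite expr0n mulr_ge0.
  have := h (- (qf P u + 1) / (2 * c)); rewrite v0 mulr0 addr0.
  rewrite (_ : 2 * _ * c = - (qf P u + 1)); last by field.
  by have := P0 u; flra.
have vp : 0 < qf P v by rewrite lt_def v0 P0.
have := h (- c / qf P v).
rewrite (_ : _ + _ = qf P u - c ^+ 2 / qf P v); last by field.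
by rewrite subr_ge0 ler_pdivrMr.
Qed.

Lemma rinZZ (c : C) u v : rin (c *: u) (c *: v) = rn c ^+ 2 * rin u v.
Proof.
rewrite /rin innerZl innerZr rn_sqr; case: c => x y; case: (inner W u v) => x' y' /=.
by ring.
Qed.

(** The dual metric of [P] is represented by the inverse of [P]. *)
Lemma rn_inner_dual P Q u v : selfadjoint P -> (forall w, 0 <= qf P w) -> cancel Q P ->
  rn (inner W u v) ^+ 2 <= qf P u * qf Q v.
Proof.
move=> Ps P0 QP; set z := inner W u v.
have qQ : qf Q v = qf P (Q v) by rewrite /qf QP rinC.
have [z0|z0] := eqVneq z 0; first by rewrite z0 rn0 expr0n/= qQ mulr_ge0.
have rz : 0 < rn z ^+ 2 by rewrite exprn_gt0// rn_gt0.
have zc : rn z^*%C = rn z by apply: complexI; rewrite -!rnE normcJ.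
have E : rin (P (z^*%C *: u)) (Q v) = rn z ^+ 2.
  rewrite selfadjoint_rin// QP /rin innerZl -/z rn_sqr.
  by case: (z) => a b /=; ring.
have F : qf P (z^*%C *: u) = rn z ^+ 2 * qf P u.
  by rewrite /qf opZ rinZZ zc.
have := qf_cauchy_schwarz (z^*%C *: u) (Q v) Ps P0; rewrite E F -qQ.
by rewrite expr2 -mulrA ler_pM2l.
Qed.

Lemma coercive P Q w : selfadjoint P -> (forall w, 0 <= qf P w) -> cancel Q P ->
  rn w ^+ 2 <= rn Q * qf P w.
Proof.
move=> Ps P0 QP; have [->|w0] := eqVneq w 0.
  by rewrite rn0 expr0n mulr_ge0 ?rn_ge0.
have rw : 0 < rn w by rewrite rn_gt0.
have := qf_cauchy_schwarz w (Q w) Ps P0; rewrite selfadjoint_rin// QP rin_rn => h.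
have {}h : (rn w ^+ 2) ^+ 2 <= qf P w * (rn Q * rn w ^+ 2).
  apply: le_trans h _; apply: ler_wpM2l => //; rewrite {1}/qf QP rinC.
  by apply: le_trans (ler_norm _) (qf_le _ _).
by rewrite -(ler_pM2r (exprn_gt0 2 rw)) -expr2; apply: le_trans h _; rewrite mulrA [qf P w * _]mulrC.
Qed.

Lemma rn_op_le P d : 0 <= d -> (forall w, rn (P w) <= d * rn w) -> rn P <= d.
Proof.
move=> d0 Pd; rewrite rn_le; apply: Endo_norm_le => // w.
by rewrite !rnE -rmorphM lecR.
Qed.

Lemma inverse_near P0 Q0 e : cancel P0 Q0 -> cancel Q0 P0 -> 0 < e -> exists2 d, 0 < d &
  forall P Q, rn (P - P0) < d -> cancel P Q -> cancel Q P -> rn (Q - Q0) <= e.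
Proof.
move=> PQ0 QP0 e0; pose q := rn Q0 + 1; have q0 : 0 < q by have := rn_ge0 Q0; rewrite /q; flra.
exists (Num.min (1 / (2 * q)) (e / (2 * q ^+ 2))).
  by rewrite lt_min !divr_gt0// mulr_gt0// exprn_gt0.
move=> P Q; rewrite lt_min !ltr_pdivlMr ?mulr_gt0 ?exprn_gt0// => /andP[h1 h2] PQ QP.
have diff v : Q v - Q0 v = - Q0 ((P - P0) (Q v)) by rewrite EndoB opB PQ0 QP opprB.
have Qq v : rn (Q v - Q0 v) <= q * rn (P - P0) * rn (Q v).
  rewrite diff rnN; apply: le_trans (rn_op _ _) _; rewrite -mulrA.
  by apply: ler_pM; rewrite ?rn_ge0//; [rewrite /q; flra|exact: rn_op].
apply: rn_op_le => [|v]; first exact: ltW.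
rewrite EndoB; apply: le_trans (Qq v) _.
have Qv : rn (Q v) <= 2 * q * rn v.
  have a1 : q * rn (P - P0) * rn (Q v) <= 1 / 2 * rn (Q v).
    by apply: ler_wpM2r; [exact: rn_ge0|move: h1; flra].
  have a2 : rn (Q0 v) <= q * rn v.
    by apply: le_trans (rn_op _ _) _; apply: ler_wpM2r; [exact: rn_ge0|rewrite /q; flra].
  by have := Qq v; have := ler_rnB (Q v) (Q0 v); flra.
apply: le_trans (_ : q * rn (P - P0) * (2 * q * rn v) <= _).
  by apply: ler_wpM2l => //; rewrite mulr_ge0 ?rn_ge0// ltW.
rewrite (_ : _ * _ = (rn (P - P0) * (2 * q ^+ 2)) * rn v); last by ring.
by apply: ler_wpM2r; [exact: rn_ge0|exact: ltW].
Qed.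

Lemma innerBl u v w : inner W (u - v) w = inner W u w - inner W v w.
Proof. by rewrite linearBl. Qed.

Lemma inner_sub3 u v w eta (c : C) :
  inner W u eta - inner W v eta - inner W w eta * c = inner W (u - v - c *: w) eta.
Proof. by rewrite !innerBl innerZl [c * _]mulrC. Qed.

End positive_forms.

Section operator_families.
Context {R : realType}.
Local Notation C := R[i].
Variables (V : completeNormedModType C) (W W' : hilbert_space R) (O : set V).
Variable a : V -> W -> W'.
Hypotheses (oO : open O) (al : forall y, O y -> linear (a y)).
Hypothesis ad : forall y w, O y -> differentiable (fun q : V * W => a q.1 q.2) (y, w).

Lemma family_linear y : O y -> exists A : {linear W -> W'}, A =1 a y.
Proof.
move=> Oy; pose lM := GRing.isLinear.Build _ _ _ _ (a y) (al Oy).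
by pose A : {linear W -> W'} := HB.pack (a y) lM; exists A.
Qed.

Lemma familyZ y (c : C) w : O y -> a y (c *: w) = c *: a y w.
Proof. by move=> /family_linear[A AE]; rewrite -!AE linearZ. Qed.

Lemma family0 y : O y -> a y 0 = 0.
Proof. by move=> /family_linear[A AE]; rewrite -!AE linear0. Qed.

(** Joint continuity makes the operators of the family locally bounded. *)
Lemma family_bounded p : O p -> exists r M : R, [/\ 0 < r, 1 <= M,
  forall y, rn (y - p) < r -> O y & forall y w, rn (y - p) < r -> rn (a y w) <= M * rn w].
Proof.
move=> Op; have ac : {for (p, 0), continuous (fun q : V * W => a q.1 q.2)}.
  exact: differentiable_continuous (ad 0 Op).
have n0 : nbhs (a p 0) [set w : W' | rn w < 1].
  by rewrite family0//; apply/nbhs_rnP; exists 1 => // y; rewrite subr0.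
have [[A B] [/= /nbhs_rnP[d1 d10 d1P] /nbhs_rnP[d2 d20 d2P]] AB] := ac _ n0.
have [d3 d30 d3P] := open_rnP oO Op.
exists (Num.min d1 d3), (2 / d2 + 1); split.
- by rewrite lt_min d10.
- by rewrite lerDr divr_ge0// ltW.
- by move=> y; rewrite lt_min => /andP[_ /d3P].
move=> y w; rewrite lt_min => /andP[/d1P Ay /d3P Oy].
have [->|w0] := eqVneq w 0; first by rewrite family0// !rn0 mulr0.
have rw : 0 < rn w by rewrite rn_gt0.
pose s : R := d2 / 2 / rn w; have s0 : 0 < s by rewrite !divr_gt0.
have : rn (a y (s%:C *: w)) < 1.
  apply: (AB (y, s%:C *: w)); split=> //=; apply: d2P.
  by rewrite subr0 rnZ rnR gtr0_norm// /s divfK ?gt_eqF//; flra.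
rewrite familyZ// rnZ rnR gtr0_norm// /s => h.
have : rn (a y w) < 2 / d2 * rn w.
  move: h; rewrite mulrAC ltr_pdivrMr// mul1r => h.
  rewrite mulrAC ltr_pdivlMr//; move: h; flra.
by rewrite mulrDl mul1r; flra.
Qed.

Lemma affine_differentiable (U : normedModType C) (p b : U) (z : C) :
  differentiable (fun z : C => p + z *: b) z.
Proof.
have [|||h _] := @fder_differentiable R _ _ (fun z : C => p + z *: b) z (fun k => k *: b) (rn b).
- by move=> c k k'; rewrite scalerDl scalerA.
- by move=> k; rewrite rnZ mulrC.
- move=> e e0; exists 1 => // k _; rewrite (_ : _ - _ - _ = 0); last by lmod_over R[i].
  by rewrite rn0 mulr_ge0 ?rn_ge0// ltW.
- exact: h.
Qed.

Lemma family_cderivative p b w v (eta : W') (z : C) : O (p + z *: b) ->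
  exists m, cderivative (fun z => inner W' (a (p + z *: b) (w + z *: v)) eta) z m.
Proof.
move=> Oz; pose G (z : C) := a (p + z *: b) (w + z *: v).
have Gd : differentiable G z.
  apply: (@differentiable_comp _ _ _ _ (fun z : C => (p + z *: b, w + z *: v)) (fun q : V * W => a q.1 q.2)).
    by apply: differentiable_pair; exact: affine_differentiable.
  exact: ad.
exists (inner W' ('d G z 1) eta) => e e0.
have n1 : 0 < rn eta + 1 by have := rn_ge0 eta; flra.
have [d d0 dP] := differentiable_fder Gd (divr_gt0 e0 n1).
exists d => // k /dP; rewrite -/(G _) -/(G z).
have dE : 'd G z k = k *: 'd G z 1.
  by rewrite -linearZ; congr ('d G z _); rewrite /GRing.scale /= mulr1.
rewrite dE => h.
rewrite inner_sub3.
apply: le_trans (rn_inner _ _) _.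
apply: le_trans (_ : e / (rn eta + 1) * rn k * (rn eta + 1) <= _).
  by apply: ler_pM; rewrite ?rn_ge0//; flra.
by rewrite mulrAC divfK// gt_eqF.
Qed.

(** The dependence on the base point is continuous in operator norm: along
    complex lines the family is holomorphic, with bounded values. *)
Lemma family_continuous p : O p -> forall e : R, 0 < e -> exists2 d : R, 0 < d &
  forall y w, rn (y - p) < d -> rn (a y w - a p w) <= e * rn w.
Proof.
move=> Op e e0; have [r [M [r0 M1 rO rM]]] := family_bounded Op.
have M0 : 0 < M := lt_le_trans ltr01 M1.
exists (Num.min (r / 8) (e * r / (128 * M))).
  by rewrite lt_min !divr_gt0 ?mulr_gt0.
move=> y w; rewrite lt_min ltr_pdivlMr ?mulr_gt0// => /andP[y1 y2].
have [->|yp] := eqVneq y p; first by rewrite subrr rn0 mulr_ge0 ?rn_ge0// ltW.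
pose b := y - p; have rb : 0 < rn b by rewrite rn_gt0 subr_eq0.
set eta := a y w - a p w.
have [eta0|eta0] := eqVneq (rn eta) 0; first by rewrite eta0 mulr_ge0 ?rn_ge0// ltW.
have reta : 0 < rn eta by rewrite lt_def eta0 rn_ge0.
pose f (z : C) := inner W' (a (p + z *: b) (w + z *: 0)) eta.
pose s := r / rn b / 2; have s0 : 0 < s by rewrite !divr_gt0.
have zb (z : C) : rn z < 2 * s -> rn (p + z *: b - p) < r.
  by rewrite /s addrAC subrr add0r rnZ mulrC divfK// ltr_pdivlMr.
have fd z : rn z < 2 * s -> exists m, cderivative f z m.
  by move=> /zb/rO Oz; exact: family_cderivative.
have fM z : rn z < 2 * s -> rn (f z) <= M * rn w * rn eta.
  move=> /zb zr; apply: le_trans (rn_inner _ _) _; apply: ler_wpM2r; first exact: rn_ge0.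
  by rewrite scaler0 addr0; exact: rM.
have [|l fl] := fd 0; first by rewrite rn0 mulr_gt0.
have [|h _] := holomorphic_estimates s0 fd fM fl (z := 1).
  by rewrite rn1 /s !ler_pdivlMr// -/b in y1 *; flra.
move: h; rewrite rn1 mulr1 (_ : f 1 - f 0 = inner W' eta eta); last first.
  rewrite /f !scaler0 !addr0 scale1r scale0r addr0 /b [p + _]addrC subrK.
  by rewrite -innerBl.
rewrite inner_rin rnR rin_rn ger0_norm ?sqr_ge0// => h.
rewrite -(ler_pM2r reta) -expr2; apply: le_trans h _.
rewrite /s (_ : 64 * _ / _ = 128 * M * rn b / r * rn w * rn eta); last first.
  by field; rewrite !gt_eqF.
apply: ler_wpM2r; first exact: ltW.
apply: ler_wpM2r; first exact: rn_ge0.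
by move: y2; rewrite ler_pdivrMr// ltr_pdivlMr ?mulr_gt0// -/b => /ltW; rewrite mulrC.
Qed.

End operator_families.

(** * The four point inequality for the norm of a family *)

Section logarithmic_inequalities.
Context {R : realType}.
Implicit Types (x y u n t e : R).

Lemma ln_le_tangent x y : 0 < x -> 0 < y -> ln x <= ln y + (x - y) / y.
Proof.
move=> x0 y0; have xy : 0 < x / y by exact: divr_gt0.
rewrite -lerBlDl -ln_div ?posrE// mulrBl divff ?gt_eqF//.
have -> : ln (x / y) = ln (1 + (x / y - 1)) by rewrite [1 + _]addrC subrK.
by apply: le_ln1Dx; rewrite ltrBrDl addrN.
Qed.

Lemma ln_four x1 x2 x3 x4 y : 0 < x1 -> 0 < x2 -> 0 < x3 -> 0 < x4 -> 0 < y ->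
  ln x1 + ln x2 + ln x3 + ln x4 <= 4 * ln y + (x1 + x2 + x3 + x4 - 4 * y) / y.
Proof.
move=> h1 h2 h3 h4 y0.
have -> : (x1 + x2 + x3 + x4 - 4 * y) / y = (x1 - y) / y + (x2 - y) / y + (x3 - y) / y + (x4 - y) / y by ring.
have := ln_le_tangent h1 y0; have := ln_le_tangent h2 y0.
have := ln_le_tangent h3 y0; have := ln_le_tangent h4 y0; flra.
Qed.

Lemma ln_1B_ge u : 0 <= u <= 1 / 2 -> - (2 * u) <= ln (1 - u).
Proof.
move=> /andP[u0 u1]; have v0 : 0 < 1 - u by flra.
have := @ln_le_tangent 1 (1 - u) ltr01 v0; rewrite ln1 => h.
have : (1 - (1 - u)) / (1 - u) <= 2 * u.
  rewrite ler_pdivrMr// (_ : 1 - (1 - u) = u); last by ring.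
  rewrite -mulrA mulrCA; apply: ler_peMr => //; flra.
flra.
Qed.

(** The logarithm of the product of the [fj] bounds those of the [sj] from
    below, up to the logarithms of the [Nj] and [Dj]. Concavity replaces the
    latter by the logarithms of their averages, where only the coefficients [c
    / n] and [c' / n'] of second order remain, and these compare favourably. *)
Lemma log_comparison (n n' rho t e c c' A B K s1 s2 s3 s4 N1 N2 N3 N4 D1 D2 D3 D4 f1 f2 f3 f4 : R) :
  0 < n -> 0 < n' -> 0 < rho -> 0 < t <= e -> 0 <= K -> K * t ^+ 3 <= n' ^+ 4 / 2 -> t ^+ 3 <= 1 / 2 ->
  0 < s1 -> 0 < s2 -> 0 < s3 -> 0 < s4 -> 0 <= N1 -> 0 <= N2 -> 0 <= N3 -> 0 <= N4 ->
  0 <= D1 -> 0 <= D2 -> 0 <= D3 -> 0 <= D4 -> 0 <= f1 -> 0 <= f2 -> 0 <= f3 -> 0 <= f4 ->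
  f1 ^+ 2 <= s1 ^+ 2 * N1 * D1 -> f2 ^+ 2 <= s2 ^+ 2 * N2 * D2 ->
  f3 ^+ 2 <= s3 ^+ 2 * N3 * D3 -> f4 ^+ 2 <= s4 ^+ 2 * N4 * D4 ->
  n' ^+ 4 - K * t ^+ 3 <= f1 * f2 * f3 * f4 ->
  N1 + N2 + N3 + N4 <= 4 * n - t ^+ 2 * c + A * (e * t ^+ 2) ->
  D1 + D2 + D3 + D4 <= 4 * n' + t ^+ 2 * c' + B * (e * t ^+ 2) ->
  c' / n' <= c / n -> (1 - t ^+ 3) * rho ^+ 2 * n <= n' ->
  4 * ln rho - (4 + 2 * K / n' ^+ 4 + A / (2 * n) + B / (2 * n')) * (e * t ^+ 2)
    <= ln s1 + ln s2 + ln s3 + ln s4.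
Proof.
move=> n0 n'0 rho0 /andP[t0 te] K0 Kt t3 s10 s20 s30 s40 N10 N20 N30 N40 D10 D20 D30 D40 f10 f20 f30 f40.
move=> h1 h2 h3 h4 fK NA DB cc opt.
have n4 : 0 < n' ^+ 4 by exact: exprn_gt0.
have prod0 : 0 < f1 * f2 * f3 * f4 by apply: lt_le_trans fK; flra.
have fi x y : 0 <= x -> 0 <= y -> 0 < x * y -> 0 < x /\ 0 < y.
  move=> x0 y0 xy; rewrite !lt_def x0 y0 !andbT; split; apply: contraTneq xy => ->.
    by rewrite mul0r ltxx.
  by rewrite mulr0 ltxx.
have [p3 f4p] := fi _ _ (mulr_ge0 (mulr_ge0 f10 f20) f30) f40 prod0.
have [p2 f3p] := fi _ _ (mulr_ge0 f10 f20) f30 p3.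
have [f1p f2p] := fi _ _ f10 f20 p2.
have ln2 (x : R) : 0 < x -> ln (x ^+ 2) = 2 * ln x.
  by move=> x0; rewrite expr2 lnM ?posrE//; ring.
have ln4 (x : R) : 0 < x -> ln (x ^+ 4) = 4 * ln x.
  move=> x0; rewrite (_ : x ^+ 4 = x ^+ 2 * x ^+ 2); last by ring.
  by rewrite lnM ?posrE ?exprn_gt0// ln2//; ring.
have logs (f s N D : R) : 0 < f -> 0 < s -> 0 <= N -> 0 <= D -> f ^+ 2 <= s ^+ 2 * N * D ->
    [/\ 0 < N, 0 < D & 2 * ln f <= 2 * ln s + ln N + ln D].
  move=> f0' s0' N0 D0 h; have ff : 0 < f ^+ 2 by exact: exprn_gt0.
  have ss : 0 < s ^+ 2 by exact: exprn_gt0.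
  have [p Dp] := fi _ _ (mulr_ge0 (ltW ss) N0) D0 (lt_le_trans ff h).
  have [_ Np] := fi _ _ (ltW ss) N0 p; split=> //.
  have : ln (f ^+ 2) <= ln (s ^+ 2 * N * D) by rewrite ler_ln ?posrE// mulr_gt0.
  rewrite [ln (s ^+ 2 * N * D)]lnM ?posrE// [ln (s ^+ 2 * N)]lnM ?posrE// !ln2//; clear; flra.
have [N1p D1p l1] := logs _ _ _ _ f1p s10 N10 D10 h1.
have [N2p D2p l2] := logs _ _ _ _ f2p s20 N20 D20 h2.
have [N3p D3p l3] := logs _ _ _ _ f3p s30 N30 D30 h3.
have [N4p D4p l4] := logs _ _ _ _ f4p s40 N40 D40 h4.
set T := e * t ^+ 2; have t20 : 0 < t ^+ 2 by exact: exprn_gt0.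
have tT : t ^+ 3 <= T by rewrite /T exprS; apply: ler_wpM2r => //; exact: ltW.
have LN := ln_four N1p N2p N3p N4p n0; have LD := ln_four D1p D2p D3p D4p n'0.
have LN' : (N1 + N2 + N3 + N4 - 4 * n) / n <= - (t ^+ 2 * (c / n)) + A * T / n.
  rewrite ler_pdivrMr// [leRHS](_ : _ = A * T - t ^+ 2 * c); last by field; rewrite gt_eqF.
  by move: NA; rewrite -/T; clear; flra.
have LD' : (D1 + D2 + D3 + D4 - 4 * n') / n' <= t ^+ 2 * (c' / n') + B * T / n'.
  rewrite ler_pdivrMr// [leRHS](_ : _ = t ^+ 2 * c' + B * T); last by field; rewrite gt_eqF.
  by move: DB; rewrite -/T; clear; flra.
have cc2 : t ^+ 2 * (c' / n') <= t ^+ 2 * (c / n) by apply: ler_wpM2l => //; exact: ltW.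
pose u := K * t ^+ 3 / n' ^+ 4.
have u0 : 0 <= u <= 1 / 2.
  apply/andP; split; first by rewrite divr_ge0 ?mulr_ge0 ?exprn_ge0// ltW.
  by rewrite ler_pdivrMr//; move: Kt; clear; flra.
have Lf : 4 * ln n' - 2 * u <= ln f1 + ln f2 + ln f3 + ln f4.
  have -> : ln f1 + ln f2 + ln f3 + ln f4 = ln (f1 * f2 * f3 * f4) by rewrite !lnM ?posrE.
  apply: le_trans (_ : ln (n' ^+ 4 * (1 - u)) <= _).
    rewrite lnM ?posrE ?ln4//; last by have /andP[_ +] := u0; clear; flra.
    by have := ln_1B_ge u0; clear; flra.
  rewrite ler_ln ?posrE//; last by rewrite mulr_gt0//; have /andP[_ +] := u0; clear; flra.
  by rewrite mulrBr mulr1 /u mulrCA mulfV ?mulr1 ?gt_eqF.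
have Lo : 2 * ln rho - 2 * t ^+ 3 <= ln n' - ln n.
  have v0 : 0 <= t ^+ 3 <= 1 / 2 by rewrite exprn_ge0// ltW.
  have w0 : 0 < 1 - t ^+ 3 by move: t3; clear; flra.
  have := ln_1B_ge v0; have : ln ((1 - t ^+ 3) * rho ^+ 2 * n) <= ln n'.
    by rewrite ler_ln ?posrE// !mulr_gt0// exprn_gt0.
  have r2 : 0 < rho ^+ 2 by exact: exprn_gt0.
  rewrite [ln (_ * _ * n)]lnM ?posrE ?mulr_gt0// [ln (_ * rho ^+ 2)]lnM ?posrE// ln2//; clear; flra.
have uT : u <= K / n' ^+ 4 * T.
  by rewrite /u mulrAC; apply: ler_wpM2l => //; rewrite divr_ge0// ltW.
have E : (4 + 2 * K / n' ^+ 4 + A / (2 * n) + B / (2 * n')) * T =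
    4 * T + 2 * (K / n' ^+ 4 * T) + A * T / n / 2 + B * T / n' / 2.
  by field; rewrite !gt_eqF.
by rewrite E; move: LN LD LN' LD' l1 l2 l3 l4 Lf Lo uT tT cc2; clear; flra.
Qed.

End logarithmic_inequalities.

Lemma inner_qf (R : realType) (W : hilbert_space R) (P : Endo W) x : selfadjoint P ->
  inner W x (P x) = (qf P x)%:C.
Proof.
move=> Ps; have := innerC x (P x); rewrite -Ps /qf /rin.
by case: (inner W (P x) x) => u l [] /eqP; rewrite -subr_eq0 opprK -mulr2n -mulr_natl mulf_eq0 pnatr_eq0/= => /eqP->.
Qed.

Section norm_functions.
Context {R : realType}.
Local Notation C := R[i].
Variables (V : completeNormedModType C) (W W' : hilbert_space R) (O : set V).
Variables (P : V -> Endo W) (P' : V -> Endo W') (a : V -> W -> W') (rho : V -> R).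
(** Operators [a y] between two Hilbert spaces that depend holomorphically on
    [y], with [rho y] the operator norm of [a y] for the metrics given by [P
    y] and [P' y]; the last three fields say that it is this norm. *)
Record norm_family : Prop := NormFamily {
  nf_open : open O;
  nf_linear : forall y, O y -> linear (a y);
  nf_differentiable : forall y w, O y -> differentiable (fun q : V * W => a q.1 q.2) (y, w);
  nf_domain_C2 : Ck 2 O P;
  nf_target_C2 : Ck 2 O P';
  nf_domain_positive : forall y, O y -> positive_invertible (P y);
  nf_target_positive : forall y, O y -> positive_invertible (P' y);
  nf_ge0 : forall y, O y -> 0 <= rho y;
  nf_le : forall y w, O y -> qf (P' y) (a y w) <= rho y ^+ 2 * qf (P y) w;
  nf_min : forall y (c : R), O y -> 0 <= c ->
    (forall w, qf (P' y) (a y w) <= c ^+ 2 * qf (P y) w) -> rho y <= c }.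

Lemma positive_coercive (Q0 : Endo W) : positive_invertible Q0 ->
  exists2 c : R, 0 < c & forall w, rn w ^+ 2 <= c * qf Q0 w.
Proof.
move=> Qpos; have [_ [Q [PQ QP]] _] := Qpos; exists (rn Q + 1); first by have := rn_ge0 Q; flra.
move=> w; apply: le_trans (coercive w (positive_selfadjoint Qpos) (fun w => positive_qf w Qpos) QP) _.
by apply: ler_wpM2r; [exact: positive_qf|flra].
Qed.

(** By definition [rho y ^+ 2] is the supremum of the quotient of two
    quadratic forms. Both are close to those at [p], relatively to the form of
    [P p], which is coercive. *)
Lemma norm_family_continuous p : norm_family -> O p -> forall e : R, 0 < e -> exists2 d : R, 0 < d &
  forall y, rn (y - p) < d -> `|rho y - rho p| < e.
Proof.
move=> [oO al ad P2 P'2 Ppos P'pos rho0 rho_le rho_min] Op e e0; have [c c0 cP] := positive_coercive (Ppos p Op).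
have [r [M [r0 M1 rO rM]]] := family_bounded oO al ad Op.
have M0 : 0 < M := lt_le_trans ltr01 M1.
pose A := rho p ^+ 2 + 1; have A1 : 1 <= A by rewrite /A lerDr sqr_ge0.
have A0 : 0 < A := lt_le_trans ltr01 A1.
pose e1 := Num.min (1 / 2) (e ^+ 2 / (4 * A)).
have e2 : 0 < e ^+ 2 by exact: exprn_gt0.
have e10 : 0 < e1 by rewrite lt_min !divr_gt0// mulr_gt0.
pose q := rn (P' p) + 1; have q0 : 0 < q by have := rn_ge0 (P' p); rewrite /q; flra.
pose d1 := e1 / c; pose d2 := e1 / (2 * c * M ^+ 2); pose d3 := e1 / (4 * c * q * M).
have d10 : 0 < d1 by exact: divr_gt0.
have d20 : 0 < d2 by rewrite divr_gt0// !mulr_gt0// exprn_gt0.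
have d30 : 0 < d3 by rewrite divr_gt0// !mulr_gt0.
have [s1 s10 s1P] := (continuous_rnP _ _).1 (Ck0_continuous P2 Op) _ d10.
have [s2 s20 s2P] := (continuous_rnP _ _).1 (Ck0_continuous P'2 Op) _ d20.
have [s3 s30 s3P] := family_continuous oO al ad Op d30.
exists (Num.min (Num.min r s1) (Num.min s2 s3)); first by rewrite !lt_min r0 s10 s20.
move=> y; rewrite !lt_min => /andP[/andP[yr /s1P y1] /andP[/s2P y2 y3]].
have Oy := rO y yr.
have cw w : rn w ^+ 2 * e1 / c <= e1 * qf (P p) w.
  rewrite mulrAC mulrC; apply: ler_wpM2l; first exact: ltW.
  by rewrite ler_pdivrMr// mulrC.
have HN w : `|qf (P y) w - qf (P p) w| <= e1 * qf (P p) w.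
  rewrite (_ : _ - _ = qf (P y - P p) w); last by rewrite /qf EndoB rinDl rinNl.
  apply: le_trans (qf_le _ _) _; apply: le_trans _ (cw w).
  rewrite -mulrA [leRHS]mulrC; apply: ler_wpM2r; [exact: sqr_ge0|exact: ltW].
have HN' w : `|qf (P' y) (a y w) - qf (P' p) (a p w)| <= e1 * qf (P p) w.
  set u := a y w; set v := a p w.
  have uM : rn u <= M * rn w by exact: rM.
  have vM : rn v <= M * rn w by apply: rM; rewrite subrr rn0.
  have uv : rn (u - v) <= d3 * rn w by exact: s3P.
  rewrite (_ : _ - _ = qf (P' y - P' p) u + (rin (P' p (u - v)) u + rin (P' p v) (u - v))); last first.
    by rewrite /qf EndoB opB !(rinDl, rinDr, rinNl, rinNr); ring.
  have b1 : `|qf (P' y - P' p) u| <= d2 * M ^+ 2 * rn w ^+ 2.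
    apply: le_trans (qf_le _ _) _; rewrite -mulrA -exprMn; apply: ler_pM; rewrite ?rn_ge0 ?sqr_ge0//.
      exact: ltW.
    by rewrite ler_sqr ?nnegrE ?rn_ge0// mulr_ge0 ?rn_ge0// ltW.
  have rin_abs (x z : W') : `|rin x z| <= rn x * rn z.
    rewrite ler_norml rin_le andbT lerNl -rinNl; apply: le_trans (rin_le _ _) _.
    by rewrite rnN.
  have b2 : `|rin (P' p (u - v)) u| <= q * d3 * M * rn w ^+ 2.
    apply: le_trans (rin_abs _ _) _.
    rewrite (_ : q * d3 * M * rn w ^+ 2 = q * (d3 * rn w) * (M * rn w)); last by ring.
    apply: ler_pM; rewrite ?rn_ge0//; apply: le_trans (rn_op _ _) _.
    by apply: ler_pM; rewrite ?rn_ge0// /q; flra.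
  have b3 : `|rin (P' p v) (u - v)| <= q * d3 * M * rn w ^+ 2.
    apply: le_trans (rin_abs _ _) _.
    rewrite (_ : q * d3 * M * rn w ^+ 2 = q * (M * rn w) * (d3 * rn w)); last by ring.
    apply: ler_pM; rewrite ?rn_ge0//; apply: le_trans (rn_op _ _) _.
    by apply: ler_pM; rewrite ?rn_ge0// /q; flra.
  apply: le_trans (ler_normD _ _) _; apply: le_trans (lerD b1 (ler_normD _ _)) _.
  apply: le_trans (lerD (lexx _) (lerD b2 b3)) _; apply: le_trans _ (cw w).
  rewrite /d2 /d3 le_eqVlt; apply/orP; left; apply/eqP; field.
  by rewrite !gt_eqF.
have e12 : e1 <= 1 / 2 by rewrite ge_min lexx.
have e1A : e1 * (4 * A) <= e ^+ 2 by rewrite -ler_pdivlMr ?mulr_gt0// ge_min lexx orbT.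
have up : rho y ^+ 2 <= rho p ^+ 2 + 2 * e1 * A.
  have N1 : 0 < 1 - e1 by flra.
  pose al2 := (rho p ^+ 2 + e1) / (1 - e1).
  have al20 : 0 <= al2 := divr_ge0 (addr_ge0 (sqr_ge0 _) (ltW e10)) (ltW N1).
  have h : rho y <= Num.sqrt al2.
    apply: rho_min => // w.
    rewrite sqr_sqrtr//; have := HN w; have := HN' w; rewrite !ler_norml => /andP[_ h1] /andP[h2 _].
    have h3 := rho_le p w Op; rewrite /al2 mulrAC ler_pdivlMr//.
    have h4 : (rho p ^+ 2 + e1) * ((1 - e1) * qf (P p) w) <= (rho p ^+ 2 + e1) * qf (P y) w.
      by apply: ler_wpM2l; [rewrite addr_ge0 ?sqr_ge0// ltW|move: h2; flra].
    apply: le_trans h4; rewrite mulrCA mulrC; apply: ler_wpM2l; first exact: ltW.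
    by rewrite mulrDl; move: h1 h3; flra.
  have : rho y ^+ 2 <= al2 by rewrite -(sqr_sqrtr al20) ler_sqr ?nnegrE ?sqrtr_ge0 ?rho0.
  move/le_trans; apply; rewrite /al2 ler_pdivrMr// -/A (_ : rho p ^+ 2 = A - 1); last by rewrite /A; ring.
  rewrite -subr_ge0 (_ : _ - _ = e1 * A * (1 - 2 * e1)); last by ring.
  by rewrite !mulr_ge0 ?(ltW e10) ?(ltW A0)//; flra.
have lo : rho p ^+ 2 <= rho y ^+ 2 + 2 * e1 * A.
  pose al2 := rho y ^+ 2 * (1 + e1) + e1.
  have al20 : 0 <= al2 := addr_ge0 (mulr_ge0 (sqr_ge0 _) (addr_ge0 ler01 (ltW e10))) (ltW e10).
  have h : rho p <= Num.sqrt al2.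
    apply: rho_min => // w.
    rewrite sqr_sqrtr//; have := HN w; have := HN' w; rewrite !ler_norml => /andP[h1 _] /andP[_ h2].
    have h3 := rho_le y w Oy.
    have h4 : rho y ^+ 2 * qf (P y) w <= rho y ^+ 2 * ((1 + e1) * qf (P p) w).
      by apply: ler_wpM2l; [exact: sqr_ge0|move: h2; flra].
    by rewrite /al2 mulrDl -mulrA; move: h1 h3 h4; flra.
  have : rho p ^+ 2 <= al2 by rewrite -(sqr_sqrtr al20) ler_sqr ?nnegrE ?sqrtr_ge0 ?rho0.
  move/le_trans; apply; rewrite /al2.
  have : e1 * rho y ^+ 2 <= e1 * (rho p ^+ 2 + 2 * e1 * A) by apply: ler_wpM2l => //; exact: ltW.
  have : e1 * (2 * e1 * A) <= e1 * A.
    by apply: ler_wpM2l; [exact: ltW|rewrite -[leRHS]mul1r; apply: ler_wpM2r; [exact: ltW|flra]].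
  by rewrite /A !mulrDr; flra.
have close : (rho y - rho p) ^+ 2 < e ^+ 2.
  apply: le_lt_trans (_ : 2 * e1 * A < _); last first.
    by have : 0 < e1 * A by [exact: mulr_gt0]; flra.
  have h1 := rho0 y Oy; have h2 := rho0 p Op.
  have [h|h] := leP (rho y) (rho p).
    apply: le_trans (_ : rho p ^+ 2 - rho y ^+ 2 <= _); last by flra.
    rewrite -subr_ge0 (_ : _ - _ = 2 * rho y * (rho p - rho y)); last by ring.
    by rewrite !mulr_ge0// subr_ge0.
  apply: le_trans (_ : rho y ^+ 2 - rho p ^+ 2 <= _); last by flra.
  rewrite -subr_ge0 (_ : _ - _ = 2 * rho p * (rho y - rho p)); last by ring.
  by rewrite !mulr_ge0// subr_ge0 ltW.
by move: close; rewrite -(real_normK (num_real (rho y - rho p))) ltr_sqr ?nnegrE// ltW.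
Qed.

(** The norm of an operator between infinite dimensional spaces need not be
    attained; the loss [s] will be chosen as [t ^+ 3], which is negligible
    against [t ^+ 2]. *)
Lemma near_optimal p (s : R) : norm_family -> O p -> 0 < rho p -> 0 < s < 1 -> exists2 w, rn w = 1 &
  (1 - s) * rho p ^+ 2 * qf (P p) w <= qf (P' p) (a p w).
Proof.
move=> [oO al ad P2 P'2 Ppos P'pos rho0 rho_le rho_min] Op rp /andP[s0 s1]; apply: contrapT => no.
have no' w : rn w = 1 -> qf (P' p) (a p w) <= (1 - s) * rho p ^+ 2 * qf (P p) w.
  by move=> w1; rewrite leNgt; apply/negP => /ltW h; apply: no; exists w.
have s1' : 0 < 1 - s by flra.
pose c := Num.sqrt (1 - s) * rho p.
have cE : c ^+ 2 = (1 - s) * rho p ^+ 2 by rewrite exprMn sqr_sqrtr// ltW.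
have s1c : 1 - s < 1 by flra.
have : rho p <= c.
  apply: rho_min => // [|w]; first by rewrite mulr_ge0 ?sqrtr_ge0 ?rho0.
  rewrite cE; have [->|w0] := eqVneq w 0.
    by rewrite (family0 al Op) /qf !linear0 /rin !linear0l /= mulr0.
  have rw : 0 < rn w by rewrite rn_gt0.
  pose u := (rn w)^-1%:C *: w.
  have u1 : rn u = 1 by rewrite rnZ rnR gtr0_norm ?invr_gt0// mulVf ?gt_eqF.
  have qZ (X : hilbert_space R) (Q : Endo X) (x : X) (l : R) : qf Q (l%:C *: x) = l ^+ 2 * qf Q x.
    by rewrite /qf opZ rinZl rinZr mulrA -expr2.
  have := no' u u1; rewrite (familyZ al _ _ Op) !qZ mulrCA ler_pM2l// exprn_gt0// invr_gt0//.
rewrite leNgt => /negP; apply; rewrite /c -[ltRHS]mul1r ltr_pM2r//.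
by rewrite -[ltRHS]sqrtr1 ltr_sqrt ?ltr01.
Qed.

(** For [w] nearly optimal at [p] and [x = a p w], the function [f z = <a (p +
    z b) (w + z v), P' p (x + z^* y)>] is holomorphic, and at each of the four
    points its square is at most [rho ^+ 2] times the metric of the first
    vector and the dual metric of the second. With [v] and [y] adapted to the
    derivatives of [P] and [P'], the four values of these two metrics average
    to their values at [p] up to curvature terms, which the hypothesis
    compares, whereas the product of the four values of [f] is [f 0 ^+ 4] up
    to third order. All the constants are uniform in [w], which is chosen
    depending on [t]. *)
Lemma norm_four_points p b : norm_family -> O p -> 0 < rho p ->
  (forall w k k', a p w != 0 ->
    P p k = rderive P b p w - 'i%C *: rderive P ('i%C *: b) p w ->
    P' p k' = rderive P' b p (a p w) - 'i%C *: rderive P' ('i%C *: b) p (a p w) ->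
    (rin (P' p k') k' - qf (rderive (rderive P' b) b p) (a p w)
       - qf (rderive (rderive P' ('i%C *: b)) ('i%C *: b) p) (a p w)) / qf (P' p) (a p w)
    <= (rin (P p k) k - qf (rderive (rderive P b) b p) w
       - qf (rderive (rderive P ('i%C *: b)) ('i%C *: b) p) w) / qf (P p) w) ->
  forall e : R, 0 < e -> exists2 d : R, 0 < d & forall t : R, 0 < t < d ->
    [/\ 0 < rho (p + t%:C *: b), 0 < rho (p - t%:C *: b),
        0 < rho (p + 'i%C *: (t%:C *: b)), 0 < rho (p - 'i%C *: (t%:C *: b))
      & 4 * ln (rho p) - e * t ^+ 2 <= ln (rho (p + t%:C *: b)) + ln (rho (p - t%:C *: b))
          + ln (rho (p + 'i%C *: (t%:C *: b))) + ln (rho (p - 'i%C *: (t%:C *: b)))].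
Proof.
move=> H Op rp; have [oO al ad P2 P'2 Ppos P'pos rho0 rho_le rho_min] := H.
move=> curv e e0.
pose E1 : Endo W := rderive P b p; pose E2 : Endo W := rderive P ('i%C *: b) p.
pose E11 : Endo W := rderive (rderive P b) b p.
pose E22 : Endo W := rderive (rderive P ('i%C *: b)) ('i%C *: b) p.
pose F1 : Endo W' := rderive P' b p; pose F2 : Endo W' := rderive P' ('i%C *: b) p.
pose F11 : Endo W' := rderive (rderive P' b) b p.
pose F22 : Endo W' := rderive (rderive P' ('i%C *: b)) ('i%C *: b) p.
have {}curv w k k' : a p w != 0 -> P p k = E1 w - 'i%C *: E2 w ->
    P' p k' = F1 (a p w) - 'i%C *: F2 (a p w) ->
    (rin (P' p k') k' - qf F11 (a p w) - qf F22 (a p w)) / qf (P' p) (a p w)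
    <= (rin (P p k) k - qf E11 w - qf E22 w) / qf (P p) w := curv w k k'.
have Psa y : O y -> selfadjoint (P y) by move=> /Ppos/positive_selfadjoint.
have P'sa y : O y -> selfadjoint (P' y) by move=> /P'pos/positive_selfadjoint.
have D1sa v y : O y -> selfadjoint (rderive P v y).
  by move=> Oy; apply: rderive_selfadjoint (Ck_leS P2) Oy.
have D1'sa v y : O y -> selfadjoint (rderive P' v y).
  by move=> Oy; apply: rderive_selfadjoint (Ck_leS P'2) Oy.
have D2sa v u : selfadjoint (rderive (rderive P v) u p).
  by have [_ /(_ v)[_ P1]] := P2; apply: rderive_selfadjoint P1 Op => // y; exact: D1sa.
have D2'sa v u : selfadjoint (rderive (rderive P' v) u p).
  by have [_ /(_ v)[_ P1]] := P'2; apply: rderive_selfadjoint P1 Op => // y; exact: D1'sa.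
have [sE1 sE2] : selfadjoint E1 /\ selfadjoint E2 := conj (D1sa b p Op) (D1sa _ p Op).
have [sF1 sF2] : selfadjoint F1 /\ selfadjoint F2 := conj (D1'sa b p Op) (D1'sa _ p Op).
have [sE11 sE22] : selfadjoint E11 /\ selfadjoint E22 := conj (D2sa _ _) (D2sa _ _).
have [sF11 sF22] : selfadjoint F11 /\ selfadjoint F22 := conj (D2'sa _ _) (D2'sa _ _).
have E1P : forall e, 0 < e -> exists2 d : R, 0 < d & forall t : R, `|t| < d ->
  rn (P (p + t%:C *: b) - P p - t%:C *: E1 - (t ^+ 2 / 2)%:C *: E11) <= e * t ^+ 2 :=
  Ck2_taylor b oO P2 Op.
have E2P : forall e, 0 < e -> exists2 d : R, 0 < d & forall t : R, `|t| < d ->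
  rn (P (p + t%:C *: ('i%C *: b)) - P p - t%:C *: E2 - (t ^+ 2 / 2)%:C *: E22) <= e * t ^+ 2 :=
  Ck2_taylor ('i%C *: b) oO P2 Op.
have F1P : forall e, 0 < e -> exists2 d : R, 0 < d & forall t : R, `|t| < d ->
  rn (P' (p + t%:C *: b) - P' p - t%:C *: F1 - (t ^+ 2 / 2)%:C *: F11) <= e * t ^+ 2 :=
  Ck2_taylor b oO P'2 Op.
have F2P : forall e, 0 < e -> exists2 d : R, 0 < d & forall t : R, `|t| < d ->
  rn (P' (p + t%:C *: ('i%C *: b)) - P' p - t%:C *: F2 - (t ^+ 2 / 2)%:C *: F22) <= e * t ^+ 2 :=
  Ck2_taylor ('i%C *: b) oO P'2 Op.
clearbody E1 E2 E11 E22 F1 F2 F11 F22.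
have [_ [Q [PQ QP]] _] := Ppos p Op; have [_ [Q' [PQ' QP']] _] := P'pos p Op.
have [c c0 cP] := positive_coercive (Ppos p Op).
have [r [Ma [r0 Ma1 rO rM]]] := family_bounded oO al ad Op.
have Ma0 : 0 < Ma := lt_le_trans ltr01 Ma1.
have b1 : 0 < rn b + 1 by have := rn_ge0 b; flra.
pose r1 := r / (2 * (rn b + 1)); have r10 : 0 < r1 by rewrite divr_gt0// mulr_gt0.
have r1b (z : C) : rn z < 2 * r1 -> rn (p + z *: b - p) < r.
  move=> zr; rewrite addrAC subrr add0r rnZ.
  apply: le_lt_trans (_ : rn z * (rn b + 1) < _).
    by apply: ler_wpM2l; [exact: rn_ge0|flra].
  by rewrite -ltr_pdivlMr//; move: zr; rewrite /r1 (_ : 2 * _ = r / (rn b + 1))//; field; rewrite gt_eqF.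
pose kb := rn Q * (rn E1 + rn E2); pose yb := rn Q' * ((rn F1 + rn F2) * Ma).
have kb0 : 0 <= kb by rewrite mulr_ge0 ?addr_ge0 ?rn_ge0.
have yb0 : 0 <= yb by rewrite !mulr_ge0 ?addr_ge0 ?rn_ge0// ltW.
pose M := 1 + kb + Ma + yb + rn E11 + rn E22 + rn F1 + rn F2 + rn F11 + rn F22 + rn Q'.
have [g1 g2 g3 g4] := And4 (rn_ge0 E11) (rn_ge0 E22) (rn_ge0 F1) (rn_ge0 F2).
have [g5 g6 g7] := And3 (rn_ge0 F11) (rn_ge0 F22) (rn_ge0 Q').
have [M1 kM MaM yM] : [/\ 1 <= M, kb <= M, Ma <= M & yb <= M].
  rewrite /M; move: kb0 yb0 Ma1 g1 g2 g3 g4 g5 g6 g7.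
  move: (kb) (yb) (rn E11) (rn E22) (rn F1) (rn F2) (rn F11) (rn F22) (rn Q').
  by clear -rho a P P' O => k1 k2 l1 l2 l3 l4 l5 l6 l7 *; split; flra.
have [E11M E22M F1M F2M] : [/\ rn E11 <= M, rn E22 <= M, rn F1 <= M & rn F2 <= M].
  rewrite /M; move: kb0 yb0 Ma1 g1 g2 g3 g4 g5 g6 g7.
  move: (kb) (yb) (rn E11) (rn E22) (rn F1) (rn F2) (rn F11) (rn F22) (rn Q').
  by clear -rho a P P' O => k1 k2 l1 l2 l3 l4 l5 l6 l7 *; split; flra.
have [F11M F22M QM] : [/\ rn F11 <= M, rn F22 <= M & rn Q' <= M].
  rewrite /M; move: kb0 yb0 Ma1 g1 g2 g3 g4 g5 g6 g7.
  move: (kb) (yb) (rn E11) (rn E22) (rn F1) (rn F2) (rn F11) (rn F22) (rn Q').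
  by clear -rho a P P' O => k1 k2 l1 l2 l3 l4 l5 l6 l7 *; split; flra.
clearbody M.
have M0 : 0 < M := lt_le_trans ltr01 M1.
(* a lower bound for the form of [P' p] at the images of nearly optimal unit
   vectors; it makes the constants below uniform *)
pose m' := rho p ^+ 2 / (2 * c).
have m'0 : 0 < m' by rewrite divr_gt0 ?exprn_gt0// mulr_gt0.
pose Mf := Ma * (1 + 2 * r1 * M) * (rn (P' p) * (M + 2 * r1 * M)).
have [K0 [d0 [d00 FK]]] := four_product Mf r10.
pose K := Num.max K0 0; have Kge : 0 <= K by rewrite le_max lexx orbT.
have K0K : K0 <= K by rewrite le_max lexx.
pose A := 18 * M ^+ 3; pose B := 302 * M ^+ 5.
have A0 : 0 <= A by rewrite mulr_ge0 ?exprn_ge0 ?ler0n// ltW.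
have B0 : 0 <= B by rewrite mulr_ge0 ?exprn_ge0 ?ler0n// ltW.
(* a bound for the coefficient of the error in [log_comparison] *)
pose Z := 4 + 2 * K / m' ^+ 4 + A * c / 2 + B / (2 * m').
have Z0 : 0 < Z.
  have z1 : 0 <= 2 * K / m' ^+ 4 := divr_ge0 (mulr_ge0 (ler0n _ 2) Kge) (exprn_ge0 _ (ltW m'0)).
  have z2 : 0 <= A * c / 2 := divr_ge0 (mulr_ge0 A0 (ltW c0)) (ler0n _ 2).
  have z3 : 0 <= B / (2 * m') := divr_ge0 B0 (mulr_ge0 (ler0n _ 2) (ltW m'0)).
  have z0 : (0 : R) < 4 := ltr0Sn _ 3.
  exact: ltr_wpDr z3 (ltr_wpDr z2 (ltr_wpDr z1 z0)).
pose e1 := Num.min 1 (e / Z); have e10 : 0 < e1 by rewrite lt_min ltr01 divr_gt0.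
have e11 : e1 <= 1 by rewrite ge_min lexx.
have e1Z : e1 * Z <= e by rewrite -ler_pdivlMr// ge_min lexx orbT.
clearbody e1.
have [t1 t10 T1] := E1P _ e10.
have [t2 t20 T2] := E2P _ e10.
have [t3 t30 T3] := F1P _ e10.
have [t4 t40 T4] := F2P _ e10.
have [s1 s10 S1] := inverse_near PQ' QP' e10.
have [s2 s20 S2] := (continuous_rnP _ _).1 (Ck0_continuous P'2 Op) _ s10.
have [s3 s30 S3] := norm_family_continuous H Op rp.
pose s4 := Num.min r (Num.min s2 s3).
have s40 : 0 < s4 by rewrite !lt_min r0 s20.
pose u0 := Num.min (1 / 2) (m' ^+ 4 / (2 * (K + 1))).
have K10 : 0 < K + 1 by move: Kge; clear -rho a P P' O; flra.
have u00 : 0 < u0 by rewrite lt_min !divr_gt0 ?exprn_gt0// mulr_gt0.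
exists (Num.min (Num.min (Num.min d0 e1) (Num.min u0 (s4 / (rn b + 1))))
   (Num.min (Num.min t1 t2) (Num.min t3 (Num.min t4 r1)))).
  have u1 : 0 < m' ^+ 4 / (2 * (K + 1)) := divr_gt0 (exprn_gt0 _ m'0) (mulr_gt0 (ltr0Sn _ 1) K10).
  have u2 : 0 < s4 / (rn b + 1) := divr_gt0 s40 b1.
  have u3 : (0 : R) < 1 / 2 := divr_gt0 ltr01 (ltr0Sn _ 1).
  by rewrite /u0 !lt_min d00 e10 t10 t20 t30 t40 r10 u1 u2 u3.
move=> t /andP[t0]; rewrite /u0 !lt_min => /andP[/andP[/andP[td0 te1]]].
move=> /andP[/andP[th tm] ts] /and4P[/andP[tt1 tt2] tt3 tt4 tr1].
have tb x : rn x <= rn b -> forall l : R, `|l| <= t -> rn (p + l%:C *: x - p) < s4.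
  move=> xb l lt; rewrite addrAC subrr add0r rnZ rnR.
  apply: le_lt_trans (_ : t * (rn b + 1) < _); last by rewrite -ltr_pdivlMr.
  by apply: ler_pM => //; [exact: rn_ge0|move: xb; clear -rho a P P' O; flra].
have ib : rn ('i%C *: b) <= rn b by rewrite rnZ rni mul1r.
have nt : `|- t| = t by rewrite normrN gtr0_norm.
have pt : `|t| = t by rewrite gtr0_norm.
have Y2 : p - t%:C *: b = p + (- t)%:C *: b by rewrite rmorphN scaleNr.
have Y3 : p + 'i%C *: (t%:C *: b) = p + t%:C *: ('i%C *: b) by rewrite !scalerA mulrC.
have Y4 : p - 'i%C *: (t%:C *: b) = p + (- t)%:C *: ('i%C *: b).
  by rewrite rmorphN scaleNr !scalerA mulrC.
have nearby x (l : R) : rn x <= rn b -> `|l| <= t -> let y := p + l%:C *: x in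
    [/\ O y, 0 < rho y & exists2 Q1 : Endo W', cancel (P' y) Q1 /\ cancel Q1 (P' y) & rn (Q1 - Q') <= e1].
  move=> xb lt y; have := tb x xb l lt; rewrite !lt_min -/y => /and3P[yr /S2 yP /S3 yrho].
  have Oy := rO y yr; split=> //.
    by move: yrho; rewrite ltr_norml => /andP[+ _]; clear -rho a P P' O; flra.
  have [_ [Q1 [PQ1 QP1]] _] := P'pos y Oy; exists Q1 => //.
  exact: S1 yP PQ1 QP1.
rewrite Y2 Y3 Y4.
have ltt : `|t| <= t by rewrite pt. have ltnt : `|- t| <= t by rewrite nt.
have [ O1 R1 [Q1 [PQ1 QP1] q1]] := nearby b t (lexx _) ltt.
have [ O2 R2 [Q2 [PQ2 QP2] q2]] := nearby b (- t) (lexx _) ltnt.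
have [ O3 R3 [Q3 [PQ3 QP3] q3]] := nearby ('i%C *: b) t ib ltt.
have [ O4 R4 [Q4 [PQ4 QP4] q4]] := nearby ('i%C *: b) (- t) ib ltnt.
split=> //.
have t3p : 0 < t ^+ 3 by exact: exprn_gt0.
have th1 : t < 1 by move: th; clear -rho a P P' O; flra.
have t3t : t ^+ 3 <= t.
  by rewrite exprS; apply: ler_piMr; [exact: ltW|rewrite expr_le1 ?ltW].
have t3lt : 0 < t ^+ 3 < 1 by rewrite t3p; exact: le_lt_trans th1.
have [w w1 opt] := near_optimal H Op rp t3lt.
set n := qf (P p) w in opt; set x := a p w in opt; set n' := qf (P' p) x in opt.
have n0 : 1 <= c * n by have := cP w; rewrite w1 expr1n.
have np : 0 < n by rewrite -(pmulr_rgt0 _ c0); exact: lt_le_trans n0.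
have r2 : 0 < rho p ^+ 2 by exact: exprn_gt0.
have m'n : m' <= n'.
  apply: le_trans opt; rewrite /m' ler_pdivrMr ?mulr_gt0//.
  rewrite (_ : _ * (2 * c) = rho p ^+ 2 * (2 * (1 - t ^+ 3)) * (c * n)); last by ring.
  have h : rho p ^+ 2 <= rho p ^+ 2 * (2 * (1 - t ^+ 3)).
    by apply: ler_peMr; [exact: ltW|move: t3t th; clear -rho a P P' O; flra].
  by apply: (le_trans h); apply: ler_peMr n0; exact: le_trans (ltW r2) h.
have n'p : 0 < n' := lt_le_trans m'0 m'n.
have x0 : x != 0.
  by apply: contraTneq n'p => x0; rewrite /n' x0 /qf linear0 /rin linear0l ltxx.
have rw1 (X : Endo W) : rn (X w) <= rn X by have := rn_op X w; rewrite w1 mulr1.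
have wM : rn w <= M by rewrite w1.
have xM : rn x <= M.
  apply: le_trans (_ : Ma * rn w <= _); first by apply: rM; rewrite subrr rn0.
  by rewrite w1 mulr1.
(* [k] and [k'] are the vectors of the curvature formula; [v] completes the
   square in [qf_four], and [y] in [qf_inverse_four] *)
pose k := Q (E1 w - 'i%C *: E2 w); pose k' := Q' (F1 x - 'i%C *: F2 x).
have Pk : P p k = E1 w - 'i%C *: E2 w by rewrite QP.
have Pk' : P' p k' = F1 x - 'i%C *: F2 x by rewrite QP'.
have kkM : rn k <= M.
  apply: le_trans kM; apply: le_trans (rn_op _ _) _; apply: ler_wpM2l; first exact: rn_ge0.
  apply: le_trans (rnB _ _) _; rewrite rnZ rni mul1r.
  exact: lerD (rw1 E1) (rw1 E2).
pose v := (- 2^-1)%:C *: k; pose y := 2^-1%:C *: Q' (F1 x + 'i%C *: F2 x).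
have half : rn ((2^-1 : R)%:C : C) <= 1.
  by rewrite rnR normfV ger0_norm ?ler0n// invf_le1 ?ltr0n// ler1n.
have vM : rn v <= M.
  rewrite /v rmorphN scaleNr rnN rnZ; apply: le_trans kkM; apply: ler_piMl => //; exact: rn_ge0.
have yMM : rn y <= M.
  apply: le_trans yM; rewrite /y rnZ; apply: le_trans (_ : rn (Q' (F1 x + 'i%C *: F2 x)) <= _).
    by apply: ler_piMl => //; exact: rn_ge0.
  apply: le_trans (rn_op _ _) _; apply: ler_wpM2l; first exact: rn_ge0.
  apply: le_trans (rnD _ _) _; rewrite rnZ rni mul1r mulrDl.
  have xMa : rn x <= Ma.
    by apply: le_trans (_ : Ma * rn w <= _); [apply: rM; rewrite subrr rn0|rewrite w1 mulr1].
  have opMa (X : Endo W') : rn (X x) <= rn X * Ma.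
    by apply: le_trans (rn_op _ _) _; apply: ler_wpM2l xMa; exact: rn_ge0.
  exact: lerD (opMa F1) (opMa F2).
have te : 0 < t <= e1 by rewrite t0 ltW.
have nn1 : `|t| < t1 by rewrite pt. have nn2 : `|t| < t2 by rewrite pt.
have nn3 : `|t| < t3 by rewrite pt. have nn4 : `|t| < t4 by rewrite pt.
have mm1 : `|- t| < t1 by rewrite nt. have mm2 : `|- t| < t2 by rewrite nt.
have mm3 : `|- t| < t3 by rewrite nt. have mm4 : `|- t| < t4 by rewrite nt.
have SN := qf_four (Psa p Op) sE1 sE2 sE11 sE22 te e11 M1
  wM kkM E11M E22M Pk (T1 _ nn1) (T1 _ mm1) (T2 _ nn2) (T2 _ mm2) (erefl v).
have SD := qf_inverse_four (P'sa p Op) sF1 sF2 sF11 sF22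
  (P'sa _ O1) (P'sa _ O2) (P'sa _ O3) (P'sa _ O4) PQ' QP' PQ1 QP1 PQ2 QP2 PQ3 QP3 PQ4 QP4 te e11 M1
  (erefl y) xM yMM F1M F2M F11M F22M QM q1 q2 q3 q4 Pk' (T3 _ nn3) (T3 _ mm3) (T4 _ nn4) (T4 _ mm4).
have cc := curv w k k' x0 Pk Pk'.
(* conjugate linearity in the second argument of the inner product turns
   [z^*] into [z], so that [f] is holomorphic *)
pose f (z : C) : C := inner W' (a (p + z *: b) (w + z *: v)) (P' p (x + z^*%C *: y)).
have fE z : f z = inner W' (a (p + z *: b) (w + z *: v)) (P' p x)
    + z * inner W' (a (p + z *: b) (w + z *: v)) (P' p y).
  by rewrite /f opD opZ innerDr innerZr conjcK.
have fd z : rn z < 2 * r1 -> exists l, cderivative f z l.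
  move=> /r1b/rO Oz; have [l1 h1] := family_cderivative ad w v (P' p x) Oz.
  have [l2 h2] := family_cderivative ad w v (P' p y) Oz.
  have hz : cderivative (fun z : C => z) z 1.
    move=> eps eps0; exists 1 => // l _; have -> : (z + l) - z - 1 * l = 0 by ring.
    by rewrite rn0 mulr_ge0 ?rn_ge0// ltW.
  have h3 := cderivativeM hz h2.
  exists (l1 + (1 * inner W' (a (p + z *: b) (w + z *: v)) (P' p y) + z * l2)).
  move=> eps eps0; have eps2 : 0 < eps / 2 by move: eps0; clear -rho a P P' O; flra.
  have [d1 d10 d1P] := h1 _ eps2; have [d2 d20 d2P] := h3 _ eps2.
  exists (Num.min d1 d2) => [|l]; first by rewrite lt_min d10.
  rewrite lt_min => /andP[/d1P a1 /d2P a2]; rewrite !fE [eps]splitr [leRHS]mulrDl.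
  set G1 := inner W' (a (p + (z + l) *: b) (w + (z + l) *: v)) (P' p x) in a1 *.
  set G2 := (z + l) * _ in a2 *; set G3 := inner W' _ (P' p x) in a1 *; set G4 := z * inner _ _ _ in a2 *.
  rewrite (_ : _ - _ - _ = (G1 - G3 - l1 * l) + (G2 - G4
     - (1 * inner W' (a (p + z *: b) (w + z *: v)) (P' p y) + z * l2) * l)); last by ring.
  by apply: le_trans (rnD _ _) _; exact: lerD.
have conj_rn (z : C) : rn z^*%C = rn z by apply: complexI; rewrite -!rnE normcJ.
have fM z : rn z < 2 * r1 -> rn (f z) <= Mf.
  move=> zr; apply: le_trans (rn_inner _ _) _; rewrite /Mf.
  apply: ler_pM; [exact: rn_ge0|exact: rn_ge0|..].
    apply: le_trans (rM _ _ (r1b z zr)) _; apply: ler_wpM2l; first exact: ltW.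
    apply: le_trans (rnD _ _) _; rewrite w1 rnZ lerD2l.
    by apply: ler_pM; rewrite ?rn_ge0// ltW.
  apply: le_trans (rn_op _ _) _; apply: ler_wpM2l; first exact: rn_ge0.
  apply: le_trans (rnD _ _) _; rewrite rnZ conj_rn; apply: lerD => //.
  by apply: ler_pM; rewrite ?rn_ge0// ltW.
have f0 : f 0 = n'%:C.
  by rewrite /f !scale0r rmorph0 scale0r !addr0 -/x inner_qf//; exact: P'sa.
have FE (z : C) (l : R) (b0 : V) : z *: b = l%:C *: b0 -> forall v0 y0, z *: v = v0 -> z^*%C *: y = y0 ->
    f z = inner W' (a (p + l%:C *: b0) (w + v0)) (P' p (x + y0)).
  by move=> zb v0 y0 zv zy; rewrite /f zb zv zy.
have cR (l : R) : (l%:C : C)^*%C = l%:C by rewrite /= oppr0.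
have cN (l : R) : (- l%:C : C)^*%C = - l%:C by apply/eqP; rewrite eq_complex /= !oppr0 !eqxx.
have cI (l : R) : ('i%C * l%:C : C)^*%C = - ('i%C * l%:C).
  by apply/eqP; rewrite eq_complex /=; apply/andP; split; apply/eqP; ring.
have cJ (l : R) : (- ('i%C * l%:C) : C)^*%C = 'i%C * l%:C.
  by apply/eqP; rewrite eq_complex /=; apply/andP; split; apply/eqP; ring.
have iZ (X : lmodType C) (l : R) (u : X) : ('i%C * l%:C) *: u = l%:C *: ('i%C *: u) by rewrite mulrC scalerA.
have h1 : f t%:C = inner W' (a (p + t%:C *: b) (w + t%:C *: v)) (P' p (x + t%:C *: y)).
  by apply: FE => //; rewrite cR.
have h2 : f (- t%:C) = inner W' (a (p + (- t)%:C *: b) (w - t%:C *: v)) (P' p (x - t%:C *: y)).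
  by apply: FE; rewrite ?cN ?scaleNr// rmorphN scaleNr.
have h3 : f ('i%C * t%:C) = inner W' (a (p + t%:C *: ('i%C *: b)) (w + t%:C *: ('i%C *: v)))
    (P' p (x - t%:C *: ('i%C *: y))).
  by apply: FE; rewrite ?cI ?scaleNr iZ.
have h4 : f (- ('i%C * t%:C)) = inner W' (a (p + (- t)%:C *: ('i%C *: b)) (w - t%:C *: ('i%C *: v)))
    (P' p (x + t%:C *: ('i%C *: y))).
  by apply: FE; rewrite ?cJ ?scaleNr iZ// rmorphN scaleNr.
have dual y0 (Q0 : Endo W') (phi : W) (eta : W') : O y0 -> cancel Q0 (P' y0) ->
    rn (inner W' (a y0 phi) eta) ^+ 2 <= rho y0 ^+ 2 * qf (P y0) phi * qf Q0 eta.
  move=> Oy0 PQ0; have P0 := fun w => positive_qf w (P'pos y0 Oy0).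
  apply: le_trans (rn_inner_dual _ _ (P'sa y0 Oy0) P0 PQ0) _.
  by apply: ler_wpM2r; [rewrite /qf rinC -{1}[eta]PQ0; exact: P0|exact: rho_le].
have Nge y0 (phi : W) : O y0 -> 0 <= qf (P y0) phi by move=> /Ppos; exact: positive_qf.
have Dge y0 (Q0 : Endo W') (eta : W') : O y0 -> cancel Q0 (P' y0) -> 0 <= qf Q0 eta.
  by move=> Oy0 PQ0; rewrite /qf rinC -{1}[eta]PQ0; exact: positive_qf (P'pos y0 Oy0).
have t0d : 0 <= t < d0 by rewrite td0 ltW.
have fK := FK f fd fM t t0d.
have K3 : K0 * t ^+ 3 <= K * t ^+ 3 by apply: ler_wpM2r K0K; exact: ltW.
have fp : n' ^+ 4 - K * t ^+ 3 <= rn (f t%:C) * rn (f (- t%:C)) * rn (f ('i%C * t%:C)) * rn (f (- ('i%C * t%:C))).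
  rewrite -!rnM; have nE : rn (f 0 ^+ 4) = n' ^+ 4.
    rewrite f0 (_ : n'%:C ^+ 4 = n'%:C * n'%:C * n'%:C * n'%:C); last by ring.
    by rewrite !rnM rnR gtr0_norm//; ring.
  have := ler_rnB (f 0 ^+ 4) (f t%:C * f (- t%:C) * f ('i%C * t%:C) * f (- ('i%C * t%:C))).
  by rewrite nE rnBC; move: fK K3; clear -rho a P P' O; flra.
rewrite h1 h2 h3 h4 in fp.
have n'4 : m' ^+ 4 <= n' ^+ 4 by rewrite lerXn2r ?nnegrE ?(ltW m'0) ?(ltW n'p).
have Kt : K * t ^+ 3 <= n' ^+ 4 / 2.
  apply: le_trans (_ : (K + 1) * t <= _).
    by apply: ler_pM => //; [exact: ltW|rewrite lerDl].
  move: tm; rewrite ltr_pdivlMr ?mulr_gt0//; move: n'4; rewrite mulrCA [t * _]mulrC; clear -rho a P P' O; flra.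
have t32 : t ^+ 3 <= 1 / 2 by move: t3t th; clear -rho a P P' O; flra.
have SN' := le_trans SN (_ : _ <= 4 * n - t ^+ 2 * (rin (P p k) k - qf E11 w - qf E22 w) + A * (e1 * t ^+ 2)).
have N4 : 4 * qf (P p) w + t ^+ 2 * (qf E11 w + qf E22 w - rin (P p k) k) + 18 * M ^+ 3 * (e1 * t ^+ 2)
    <= 4 * n - t ^+ 2 * (rin (P p k) k - qf E11 w - qf E22 w) + A * (e1 * t ^+ 2).
  have sgn (l1 l2 l3 : R) : l1 + l2 - l3 = - (l3 - l1 - l2) by ring.
  rewrite sgn mulrN; exact: lexx.
have {SN'}SN' := SN' N4.
have L := log_comparison np n'p rp te Kge Kt t32 R1 R2 R3 R4
  (Nge _ _ O1) (Nge _ _ O2) (Nge _ _ O3) (Nge _ _ O4)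
  (Dge _ _ _ O1 QP1) (Dge _ _ _ O2 QP2) (Dge _ _ _ O3 QP3) (Dge _ _ _ O4 QP4)
  (rn_ge0 _) (rn_ge0 _) (rn_ge0 _) (rn_ge0 _)
  (dual _ _ _ _ O1 QP1) (dual _ _ _ _ O2 QP2) (dual _ _ _ _ O3 QP3) (dual _ _ _ _ O4 QP4)
  fp SN' SD cc opt.
apply: le_trans L; rewrite lerD2l lerN2.
have t20' : 0 <= t ^+ 2 by exact: sqr_ge0.
apply: le_trans (_ : Z * (e1 * t ^+ 2) <= _); last by rewrite mulrCA mulrA; apply: ler_wpM2r.
apply: ler_wpM2r; first by rewrite mulr_ge0// ltW.
rewrite /Z; apply: lerD.
  apply: lerD; first rewrite lerD2l.
    apply: ler_wpM2l; first by rewrite mulr_ge0.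
    by rewrite lef_pV2 ?posrE ?exprn_gt0.
  rewrite -[A * c / 2]mulrA; apply: (ler_wpM2l A0).
  by rewrite invfM mulrC; apply: ler_wpM2r; rewrite ?invr_ge0// -div1r ler_pdivrMr.
have n2 : (0 : R) < 2 := ltr0Sn _ 1.
have mn2 : 2 * m' <= 2 * n' := ler_wpM2l (ltW n2) m'n.
have mV : (2 * n')^-1 <= (2 * m')^-1.
  by rewrite lef_pV2 // posrE; [exact: (mulr_gt0 n2 n'p)|exact: (mulr_gt0 n2 m'0)].
exact: (ler_wpM2l B0 mV).
Qed.

End norm_functions.
(** * Homomorphisms in trivializations *)

Lemma Ck_subset (R : realType) (V W : normedModType R[i]) k (O O' : set V) (f : V -> W) :
  O' `<=` O -> Ck k O f -> Ck k O' f.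
Proof.
move=> sub; elim: k f => [|k IHk] f [fc fd]; first by split=> // x /sub/fc.
split=> [x /sub/fc//|v]; have [f1 f2] := fd v.
by split=> [x /sub/f1//|]; exact: IHk.
Qed.

Section holomorphic_maps.
Context {R : realType}.

(** An intermediate chart factors the composition, in charts, as a composition
    of differentiable maps near the point. *)
Lemma holomorphic_on_comp (M N L : manifold R) (D : set M) (D' : set N) (f : M -> N) (g : N -> L) :
  (forall x, D x -> D' (f x)) -> holomorphic_on D f -> holomorphic_on D' g ->
  holomorphic_on D (g \o f).
Proof.
move=> DD fh gh x Dx; have [fc fd] := fh x Dx; have [gc gd] := gh _ (DD x Dx).
split; first exact: continuous_comp fc gc.
move=> c e ca ea xc gxe; set d := chart_at (f x); have da : atlas d := chart_at_atlas (f x).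
have fxd : cdom d (f x) := chart_at_dom (f x).
have xr : crange c (cmap c x) by exists x.
have n1 : nbhs (cmap c x) (cinv c @^-1` (f @^-1` cdom d)).
  apply: (cinv_continuous xr); rewrite cmapK//; apply: fc.
  by apply: open_nbhs_nbhs; split=> //; exact: cdom_open.
have [r r0 rP] := (nbhs_rnP _ _).1 n1.
have h1 := fd c d ca da xc fxd; have h2 := gd d e da ea fxd gxe.
have h2' : differentiable (cmap e \o g \o cinv d) ((cmap d \o f \o cinv c) (cmap c x)).
  by rewrite /= cmapK.
have [|//] := @differentiable_near R _ _ (cmap e \o (g \o f) \o cinv c)
  ((cmap e \o g \o cinv d) \o (cmap d \o f \o cinv c)) (cmap c x) r r0 _ (differentiable_comp h1 h2').
by move=> k kr /=; rewrite cmapK//; apply: rP; rewrite addrAC subrr add0r.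
Qed.

Lemma holomorphic_on_subset (M N : manifold R) (D D' : set M) (f : M -> N) :
  D' `<=` D -> holomorphic_on D f -> holomorphic_on D' f.
Proof. by move=> sub fh x /sub/fh. Qed.

End holomorphic_maps.

Section trivializations.
Context {R : realType} (S : manifold R) (E : fibration S).
Variables (U : set S) (W : completeNormedModType R[i]) (F : forall s, {linear W -> fib E s}).
Hypothesis tF : local_trivialization U F.

(** The inverse of the trivialization takes the point [pt v] to a pair with
    first component [s]. *)
Lemma trivialization_surjective s (v : fib E s) : U s -> exists w, v = F s w.
Proof.
move=> Us; have [_ [_ [_ [g [_ gU _ Kg]]]]] := tF.
have := Kg (pt v); rewrite /= proj_pt => /(_ Us); case: (g (pt v)) => s' w /= h.
have ss : s' = s by rewrite -(proj_pt (F s' w)) h proj_pt.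
by subst s'; exists w; apply: pt_inj.
Qed.

Lemma trivialization_injective s w w' : U s -> F s w = F s w' -> w = w'.
Proof.
move=> Us ww; have [_ [_ [_ [g [_ _ gK _]]]]] := tF.
have := gK (s, w) Us; have := gK (s, w') Us; rewrite /= ww => -> [].
by move=> ->.
Qed.

End trivializations.

Section homomorphism_in_trivializations.
Context {R : realType} (S : manifold R) (E E' : banach_bundle S).
Local Notation C := R[i].
Variable A : forall s : S, {linear fib E s -> fib E' s}.
Hypothesis Ahol : holomorphic_hom A.
Variables (U U' : set S) (W W' : hilbert_space R).
Variables (F : forall s, {linear W -> fib E s}) (F' : forall s, {linear W' -> fib E' s}).
Hypotheses (tF : local_trivialization U F) (tF' : local_trivialization U' F').

Lemma hom_pt (s : S) (v : fib E s) : pt (A (Defs.proj (pt v)) (vec (pt v))) = pt (A s v).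
Proof.
suff h s' (v' : fib E s') : pt v' = pt v -> pt (A s' v') = pt (A s v) by apply: h; rewrite vecK.
move=> vv; have ss : s' = s by rewrite -(proj_pt v') vv proj_pt.
by subst s'; rewrite (pt_inj vv).
Qed.

(** [A] between the two trivializations: the second component of the
    composition of [F], the map of total spaces induced by [A], and the
    inverse of [F'], all three of which are holomorphic. *)
Lemma local_representation : exists H : S * W -> W',
  (forall s w, U s -> U' s -> A s (F s w) = F' s (H (s, w))) /\
  forall c (s : S) w, atlas c -> cdom c s -> U s -> U' s ->
    differentiable (fun q : model c * W => H (cinv c q.1, q.2)) (cmap c s, w).
Proof.
have [_ [Fhol _]] := tF; have [_ [F'hol [_ [g [ghol gU gK Kg]]]]] := tF'.
pose G (p : prod_manifold S W) : prod_manifold S W' := g (pt (A p.1 (F p.1 p.2))).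
have GE s w : U' s -> pt (F' (G (s, w)).1 (G (s, w)).2) = pt (A s (F s w)) /\ (G (s, w)).1 = s.
  move=> Us; have := Kg (pt (A s (F s w))); rewrite /= proj_pt => /(_ Us) h; split=> //.
  by move: (congr1 (@Defs.proj _ _ _) h); rewrite !proj_pt.
exists (fun p => (G p).2); split=> [s w Us U's|c s w ca sc Us U's].
  have [] := GE s w U's; case: (G (s, w)) => s' w' /= + ss; subst s'.
  by move/pt_inj.
have Ghol : holomorphic_on [set p : prod_manifold S W | U p.1 /\ U' p.1] G.
  pose f1 (p : prod_manifold S W) : total_space E := pt (F p.1 p.2).
  pose f2 (e : total_space E) : total_space E' := pt (A (Defs.proj e) (vec e)).
  have -> : G = g \o (f2 \o f1) by apply/funext => p; rewrite /G /f1 /f2 /= hom_pt.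
  apply: (holomorphic_on_comp (D' := [set e | U' (Defs.proj e)])) ghol.
    by move=> [s1 w1] [/= _ U1]; rewrite /f2 /f1 hom_pt proj_pt.
  apply: (holomorphic_on_comp (D' := setT)) => //.
  by apply: holomorphic_on_subset Fhol => p [].
have [_ Gd] := Ghol (s, w) (conj Us U's).
have := Gd (prod_chart W c) (prod_chart W' c) (ex_intro2 _ _ c ca erefl) (ex_intro2 _ _ c ca erefl) sc.
rewrite {1}/cdom /= (GE s w U's).2 => /(_ sc) h.
have sd (p : model c * W') : differentiable snd p.
  by apply: linear_differentiable => q; exact: cvg_snd.
exact: differentiable_comp h (sd _).
Qed.

Variables (h : fiber_form E) (h' : fiber_form E') (P : S -> Endo W) (P' : S -> Endo W').
Hypotheses (P2 : mCk 2 U P) (P'2 : mCk 2 U' P').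
Hypothesis Ph : forall s, U s -> positive_invertible (P s) /\
  forall w1 w2, h (F s w1) (F s w2) = inner W (P s w1) w2.
Hypothesis Ph' : forall s, U' s -> positive_invertible (P' s) /\
  forall w1 w2, h' (F' s w1) (F' s w2) = inner W' (P' s w1) w2.

Let rho s := pointwise_norm A h h' s.

Lemma hnorm_qf s w : U s -> hnorm h (F s w) = Num.sqrt (qf (P s) w).
Proof. by move=> Us; rewrite /hnorm (Ph Us).2. Qed.

Lemma hnorm_qf' s w : U' s -> hnorm h' (F' s w) = Num.sqrt (qf (P' s) w).
Proof. by move=> Us; rewrite /hnorm (Ph' Us).2. Qed.

Variable H : S * W -> W'.
Hypothesis HE : forall s w, U s -> U' s -> A s (F s w) = F' s (H (s, w)).
Hypothesis Hd : forall c (s : S) w, atlas c -> cdom c s -> U s -> U' s ->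
    differentiable (fun q : model c * W => H (cinv c q.1, q.2)) (cmap c s, w).

(** The trivialization is onto the fibre, so a bound for all [v] is one for
    all [F s w]. *)
Lemma norm_boundP s (a : R) : U s -> U' s -> 0 <= a ->
  (forall v, hnorm h' (A s v) <= a * hnorm h v) <->
  (forall w, qf (P' s) (H (s, w)) <= a ^+ 2 * qf (P s) w).
Proof.
move=> Us U's a0; have key w : (hnorm h' (A s (F s w)) <= a * hnorm h (F s w)) =
    (qf (P' s) (H (s, w)) <= a ^+ 2 * qf (P s) w).
  rewrite HE// hnorm_qf// hnorm_qf'//.
  have q0 := positive_qf w (Ph Us).1; have q'0 := positive_qf (H (s, w)) (Ph' U's).1.
  rewrite -[RHS]ler_sqrt ?mulr_ge0 ?sqr_ge0// sqrtrM ?sqr_ge0// sqrtr_sqr ger0_norm//.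
split=> hle w; first by rewrite -key.
by have [w' ->] := trivialization_surjective tF w Us; rewrite key.
Qed.

(** The set whose infimum is the pointwise norm is nonempty since the
    operators [H (s, _)] are bounded and [P s] is coercive; the infimum is
    then attained. *)
Lemma norm_family_chart c : atlas c ->
  norm_family (cmap c @` ((U `&` U') `&` cdom c)) (P \o cinv c) (P' \o cinv c)
    (fun y w => H (cinv c y, w)) (rho \o cinv c).
Proof.
move=> ca; set O := cmap c @` _.
have Oin y : O y -> [/\ U (cinv c y), U' (cinv c y), cdom c (cinv c y) & cmap c (cinv c y) = y].
  by move=> [s [[Us U's] sc] <-]; rewrite cmapK.
have oO : open O.
  by apply: chart_image_open; apply: openI; [have [] := tF|have [] := tF'].
have al y : O y -> linear (fun w => H (cinv c y, w)).
  move=> /Oin[Us U's _ _] l w w'; apply: (trivialization_injective tF' U's).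
  by rewrite -HE// !linearP !HE// linearP.
have ad y w : O y -> differentiable (fun q : model c * W => H (cinv c q.1, q.2)) (y, w).
  by move=> /Oin[Us U's sc yE]; have := Hd w ca sc Us U's; rewrite yE.
have P2' : Ck 2 O (P \o cinv c).
  by apply: Ck_subset (P2 ca) => _ [s [[Us _] sc] <-]; exists s.
have P'2' : Ck 2 O (P' \o cinv c).
  by apply: Ck_subset (P'2 ca) => _ [s [[_ Us] sc] <-]; exists s.
have has y : O y -> exists a : R, 0 <= a /\ forall v, hnorm h' (A (cinv c y) v) <= a * hnorm h v.
  move=> Oy; have [Us U's _ _] := Oin y Oy; have [k k0 kP] := positive_coercive (Ph Us).1.
  have [r [M [r0 M1 _ rM]]] := family_bounded oO al ad Oy; have M0 : 0 <= M := le_trans ler01 M1.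
  pose q := rn (P' (cinv c y)); have q0 : 0 <= q by exact: rn_ge0.
  have b0 : 0 <= q * M ^+ 2 * k by rewrite !mulr_ge0 ?sqr_ge0// ltW.
  exists (Num.sqrt (q * M ^+ 2 * k)); split; first exact: sqrtr_ge0.
  apply: (norm_boundP Us U's (sqrtr_ge0 _)).2 => w.
  rewrite sqr_sqrtr//; apply: le_trans (ler_norm _) _; apply: le_trans (qf_le _ _) _.
  rewrite -[q * M ^+ 2 * k * _]mulrA -[q * M ^+ 2 * _]mulrA; apply: ler_wpM2l => //.
  apply: le_trans (_ : (M * rn w) ^+ 2 <= _).
    rewrite ler_sqr ?nnegrE ?rn_ge0 ?mulr_ge0 ?rn_ge0//.
    by apply: rM; rewrite subrr rn0.
  by rewrite exprMn; apply: ler_wpM2l => //; exact: sqr_ge0.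
have rho_ge0 y : O y -> 0 <= (rho \o cinv c) y.
  move=> Oy; have [a ha] := has y Oy.
  by apply: lb_le_inf; [exists a|move=> a' []].
split=> //.
- by move=> y /Oin[/Ph[]].
- by move=> y /Oin[_ /Ph'[]].
- move=> y w Oy; have [Us U's _ _] := Oin y Oy; have r0 := rho_ge0 y Oy.
  apply: (norm_boundP Us U's r0).1 => v; set s := cinv c y in v Us U's *.
  have [a0 [a00 ha0]] := has y Oy.
  have v0 : 0 <= hnorm h v by exact: sqrtr_ge0.
  have [vz|vn] := eqVneq (hnorm h v) 0; first by have := ha0 v; rewrite vz !mulr0.
  have vp : 0 < hnorm h v by rewrite lt_def vn.
  rewrite -ler_pdivrMr//; apply: lb_le_inf; first by exists a0.
  by move=> a [_ /(_ v)]; rewrite ler_pdivrMr.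
- move=> y k Oy k0 hk; have [Us U's _ _] := Oin y Oy; apply: ge_inf; first by exists 0 => a [].
  by split=> //; exact: (norm_boundP Us U's k0).2.
Qed.

End homomorphism_in_trivializations.

(** * The pointwise norm of a curvature decreasing homomorphism *)

Section main_estimates.
Context {R : realType} (S : manifold R) (E E' : banach_bundle S).
Local Notation C := R[i].
Variables (h : fiber_form E) (h' : fiber_form E').
Variables (nabla : section_derivative E) (nabla' : section_derivative E').
Variables (Rm : forall s : S, ctangent s -> fib E s -> fib E s).
Variables (Rm' : forall s : S, ctangent s -> fib E' s -> fib E' s).
Variable A : forall s : S, {linear fib E s -> fib E' s}.
Hypotheses (fS : finite_dim S) (EH : hilbert_bundle E) (E'H : hilbert_bundle E').
Hypotheses (hh : hermitian_metric 2 h) (hh' : hermitian_metric 2 h').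
Hypotheses (chern : chern_connection h nabla) (chern' : chern_connection h' nabla').
Hypotheses (curv : curvature_operator nabla Rm) (curv' : curvature_operator nabla' Rm').
Hypotheses (Ahol : holomorphic_hom A) (Acurv : decreases_curvature A h h' Rm Rm').
Let rho s := pointwise_norm A h h' s.

(** Around every point of a chart the pointwise norm is that of a family of
    operators between two fixed Hilbert spaces, to which the curvature
    inequality is transported. *)
Lemma norm_family_at c (s : S) : atlas c -> cdom c s ->
  exists (O : set (model c)) (W W' : hilbert_space R) (P : model c -> Endo W) (P' : model c -> Endo W')
    (a : model c -> W -> W'),
    [/\ O (cmap c s), norm_family O P P' a (rho \o cinv c)
      & forall b w k k', let p := cmap c s in a p w != 0 ->
    P p k = rderive P b p w - 'i%C *: rderive P ('i%C *: b) p w ->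
    P' p k' = rderive P' b p (a p w) - 'i%C *: rderive P' ('i%C *: b) p (a p w) ->
    (rin (P' p k') k' - qf (rderive (rderive P' b) b p) (a p w)
       - qf (rderive (rderive P' ('i%C *: b)) ('i%C *: b) p) (a p w)) / qf (P' p) (a p w)
    <= (rin (P p k) k - qf (rderive (rderive P b) b p) w
       - qf (rderive (rderive P ('i%C *: b)) ('i%C *: b) p) w) / qf (P p) w].
Proof.
move=> ca sc; have [U [W [F [Us tF]]]] := EH s; have [U' [W' [F' [U's tF']]]] := E'H s.
have [P [P2 Ph]] := hh tF; have [P' [P'2 Ph']] := hh' tF'.
have [H [HE Hd]] := local_representation Ahol tF tF'.
have nf := norm_family_chart tF tF' P2 P'2 Ph Ph' HE Hd ca.
exists (cmap c @` ((U `&` U') `&` cdom c)), W, W', (P \o cinv c), (P' \o cinv c), (fun y w => H (cinv c y, w)).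
split=> //; first by exists s.
move=> b w k k' p; have pE : cinv c p = s by rewrite /p cmapK.
rewrite /= pE => x0 Pk P'k'; set x := H (s, w) in x0 P'k' *.
have [[con _ _] [con' _ _]] := (chern, chern').
have [theta thetaP] := con U W F tF; have [theta' thetaP'] := con' U' W' F' tF'.
have [k1 [Pk1 Rk]] := curvature_formula fS chern curv tF P2 Ph b ca thetaP w (conj Us sc).
have [k1' [Pk1' Rk']] := curvature_formula fS chern' curv' tF' P'2 Ph' b ca thetaP' x (conj U's sc).
have [_ [Q [PQ _]] _] := (Ph s Us).1; have [_ [Q' [PQ' _]] _] := (Ph' s U's).1.
have kE : k1 = k by apply: (can_inj PQ); rewrite Pk1 Pk.
have kE' : k1' = k' by apply: (can_inj PQ'); rewrite Pk1' P'k'.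
rewrite kE in Rk; rewrite kE' in Rk'.
have AF0 : A s (F s w) != 0.
  apply: contraNneq x0; rewrite HE// -/x => F0; apply/eqP/(trivialization_injective tF' U's).
  by rewrite F0 linear0.
have := @Acurv s (tvec b s, - ('i%C *: tvec b s)) (F s w) erefl AF0.
have hE : h (F s w) (F s w) = (qf (P s) w)%:C.
  by rewrite (Ph s Us).2 -inner_qf; [have [_ _ ->] := (Ph s Us).1|exact: positive_selfadjoint (Ph s Us).1].
have hE' : h' (F' s x) (F' s x) = (qf (P' s) x)%:C.
  by rewrite (Ph' s U's).2 -inner_qf; [have [_ _ ->] := (Ph' s U's).1|exact: positive_selfadjoint (Ph' s U's).1].
rewrite HE// -/x hE hE' lecE => /andP[_].
have ReV (z : C) (r : R) : complex.Re (z / r%:C) = complex.Re z / r.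
  by rewrite -fmorphV; case: z => z1 z2 /=; rewrite mulr0 subr0.
by rewrite !ReV Rk Rk'.
Qed.

Lemma pointwise_norm_ge0 s : 0 <= rho s.
Proof.
have [ O [W [W' [P [P' [a [Os [_ _ _ _ _ _ _ rho0 _ _] _]]]]]]] := norm_family_at (chart_at_atlas s) (chart_at_dom s).
by have := rho0 _ Os; rewrite /= cmapK//; exact: chart_at_dom.
Qed.

Lemma pointwise_norm_continuous : continuous rho.
Proof.
move=> s; set c := chart_at s; have sc : cdom c s := chart_at_dom s.
have [ O [W [W' [P [P' [a [Os nf _]]]]]]] := norm_family_at (chart_at_atlas s) sc.
apply/cvgrPdist_lt => e e0; have [d d0 dP] := norm_family_continuous nf Os e0.
have n1 : nbhs s (cdom c) by apply: open_nbhs_nbhs; split=> //; exact: cdom_open.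
have n2 : nbhs s (cmap c @^-1` [set y | rn (y - cmap c s) < d]).
  by apply: (cmap_continuous sc); apply/nbhs_rnP; exists d.
apply: filterS (filterI n1 n2) => t [tc /dP].
by rewrite /= !cmapK// distrC.
Qed.

Lemma pointwise_norm_four_points : log_four_points rho.
Proof.
move=> c p b ca pc rp e e0; have [pE sc] := crangeK pc.
have [ O [W [W' [P [P' [a [Os nf cv]]]]]]] := norm_family_at ca sc.
rewrite pE in Os cv.
exact: (norm_four_points nf Os rp (cv b)) e0.
Qed.

End main_estimates.

Theorem theorem1p1 (R : realType) (S : manifold R) (E E' : banach_bundle S)
    (h : fiber_form E) (h' : fiber_form E')
    (nabla : section_derivative E) (nabla' : section_derivative E')
    (Rm : forall s : S, ctangent s -> fib E s -> fib E s)
    (Rm' : forall s : S, ctangent s -> fib E' s -> fib E' s)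
    (A : forall s : S, {linear fib E s -> fib E' s}%R) :
  finite_dim S ->
  hilbert_bundle E -> hilbert_bundle E' ->
  hermitian_metric 2 h -> hermitian_metric 2 h' ->
  chern_connection h nabla -> chern_connection h' nabla' ->
  curvature_operator nabla Rm -> curvature_operator nabla' Rm' ->
  holomorphic_hom A ->
  decreases_curvature A h h' Rm Rm' ->
  plurisubharmonic (fun s : S => lne (pointwise_norm A h h' s)%:E) /\
  maximum_principle (fun s : S => lne (pointwise_norm A h h' s)%:E).
Proof.
move=> fS EH E'H hh hh' ch ch' cv cv' Ahol Acurv.
have rho0 := pointwise_norm_ge0 fS EH E'H hh hh' ch ch' cv cv' Ahol Acurv.
have rhoc := pointwise_norm_continuous fS EH E'H hh hh' ch ch' cv cv' Ahol Acurv.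
have rho4 := pointwise_norm_four_points fS EH E'H hh hh' ch ch' cv cv' Ahol Acurv.
by split; [exact: log_plurisubharmonic|exact: log_maximum_principle].
Qed.
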